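(* Let $g$ belong to the range of $T\colon L\log L\to L^1$. Then all solutions $f\in L\log L$ of the airfoil equation $T(f)=g$ (a.e. on $(-1,1)$) are of the form $$f(x)=\frac{-1}{\sqrt{1-x^2}}\,T\big(\sqrt{1-t^2}\,g(t)\big)(x)+\frac{c}{\sqrt{1-x^2}},\qquad\text{a.e. }|x|<1,$$ with $c\in\mathbb C$ arbitrary (that is, a function $f$ belongs to $L\log L$ and satisfies $T(f)=g$ if and only if it has this form for some $c\in\mathbb C$). In particular, this holds for every $g\in L(\log L)^2$.
   Context: All functions are complex-valued, Lebesgue measurable on $(-1,1)$, identified when equal a.e.; $L^1=L^1(-1,1)$. The decreasing rearrangement of $f$ is $f^*(t)=\inf\{\lambda\ge 0: |\{x\in(-1,1):|f(x)|>\lambda\}|\le t\}$, $0<t<2$. For $\alpha\ge1$, $L(\log L)^\alpha=L(\log L)^\alpha(-1,1)$ is the space of all measurable $f$ with $\|f\|_{L(\log L)^\alpha}:=\int_0^2 f^*(t)\log^\alpha\big(\tfrac{2e}{t}\big)\,dt<\infty$, and $L\log L=L(\log L)^1$; these are contained in $L^1$. For $f\in L^1$ the finite Hilbert transform is $$T(f)(t)=\lim_{\varepsilon\to0^+}\frac1\pi\Big(\int_{-1}^{t-\varepsilon}+\int_{t+\varepsilon}^1\Big)\frac{f(x)}{x-t}\,dx ,$$ which exists for a.e. $t\in(-1,1)$ and is measurable; $T$ maps $L\log L$ boundedly into $L^1$. *)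

(* Defs.v *)
From HB Require Import structures.
From mathcomp Require Export all_boot all_order all_algebra.
From mathcomp Require Export complex.
From mathcomp Require Export all_classical all_reals all_analysis.

Set Implicit Arguments.
Unset Strict Implicit.
Unset Printing Implicit Defensive.
Import Order.TTheory GRing.Theory Num.Theory.
Import numFieldNormedType.Exports.

Local Open Scope classical_set_scope.
Local Open Scope ring_scope.
Local Open Scope complex_scope.

(* The real line with the sigma-algebra of all Lebesgue (not only Borel)
   measurable sets: the type on which [completed_lebesgue_measure] lives. *)
Definition lebesgueR (R : realType) : measurableType _ :=
  caratheodory_type (((wlength (R:=R) idfun)^*)%mu).

Notation leb := completed_lebesgue_measure.

(* The values of a function [R -> R[i]] outside this interval never matter. *)
Definition I11 {R : realType} : set (lebesgueR R) := `]-1, 1[%classic.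

Definition measurable_on11 {R : realType} (f : R -> R[i]) : Prop :=
  measurable_fun I11 (fun x : lebesgueR R => complex.Re (f x)) /\
  measurable_fun I11 (fun x : lebesgueR R => complex.Im (f x)).

Definition rearrangement {R : realType} (f : R -> R[i]) (t : R) : R :=
  inf [set l : R | 0 <= l /\
    (leb [set x : lebesgueR R | I11 x /\ (l < Normc.normc (f x))%R]
      <= t%:E)%E].

Definition LlogL_norm {R : realType} (a : R) (f : R -> R[i]) : \bar R :=
  (\int[leb]_(t in (`]0%R, 2%R[%classic : set (lebesgueR R)))
    (rearrangement f t * (ln (2 * expR 1 / t) `^ a))%:E)%E.

Definition LlogL {R : realType} (a : R) (f : R -> R[i]) : Prop :=
  measurable_on11 f /\ (LlogL_norm a f < +oo)%E.

Definition cintegral {R : realType} (D : set (lebesgueR R)) (f : R -> R[i])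
    : R[i] :=
  (\int[leb]_(x in D) complex.Re (f x)) +i* (\int[leb]_(x in D) complex.Im (f x)).

(* [R[i]^o] is [R[i]] with its usual topology, given by the modulus. At points
   where the limit does not exist (a null set if f is integrable), [lim] returns
   an arbitrary value. *)
Definition fht {R : realType} (f : R -> R[i]) (t : R) : R[i] :=
  lim ((((pi : R)^-1)%:C *
        (cintegral `]-1, t - e[%classic (fun x => f x / (x - t)%:C) +
         cintegral `]t + e, 1[%classic (fun x => f x / (x - t)%:C)) : R[i]^o)
       @[e --> (0 : R)^'+]).

Definition fht_range {R : realType} (g : R -> R[i]) : Prop :=
  exists2 f : R -> R[i], LlogL 1 f & fht f = g %[ae leb in I11].

(* Main.v *)
(* Let w x = sqrt (1 - x^2) and let T be the principal value transform without
   the factor 1/pi. For a polynomial p, T (p / w) = pi q and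
   T (w q) = - pi p + c with q a polynomial (Chebyshev polynomials of both
   kinds), whence T (w (T f)) = - pi^2 w f + pi (integral of f) for f = p / w.
   This extends to L log L by density of these f, once T is controlled: the
   Cauchy transform F of f >= 0 is holomorphic with positive real part, and
   integrating F^2 / (F + l) over a rectangle gives
   l |{|T f| > l}| <= C (integral of f^2 / (|f| + l)). Cotlar's inequality then
   bounds the maximal truncation, so that T f exists a.e., and summing over the
   levels l = 2^k bounds T from L log L to L^1 and from L (log L)^2 to L log L.
   For g in L (log L)^2, T (w g) / w differs from T g by an integral operator
   with kernel at most 2 / (w x (w x + w t)), hence lies in L log L, and
   T (T (w g) / w) = - pi^2 g, again by density of polynomials. Finally the
   kernel of T in L log L contains 1 / w, and the inversion formula shows that
   it contains nothing else. *)
From HB Require Import structures.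
Require Import Defs.
From mathcomp Require Import measurable_realfun ring lra.

Set Implicit Arguments.
Unset Strict Implicit.
Unset Printing Implicit Defensive.
Import Order.TTheory GRing.Theory Num.Theory.
Import numFieldNormedType.Exports.

Local Open Scope classical_set_scope.
Local Open Scope ring_scope.


Notation mu := (@lebesgue_measure _).

(** The space L log L is handled through the modular [Phi c e] instead of a norm. The bound for T f
    in L^1 is 2 e plus a multiple of the integral of [Phi 1 e] of f; because of the additive term,
    every density argument shrinks the scale e together with the error, and polynomials must be
    dense for the modular itself. The weak type bound has to keep f^2 / (|f| + l): with |f| in its
    place each dyadic level would contribute the full integral of |f| and the sum would diverge,
    whereas these quantities telescope. The function z^2 / (z + l) is chosen because it has exactly
    this size, O(|z|^2 / l) for small z and O(|z|) for large z, while its real part at z = u - i v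
    is negative of order l, up to a multiple of [kap l u], as soon as |v| exceeds l. Constants are
    generous throughout. The analysis is done for real Borel functions, truncated integrals [tr] and
    a relation [isT] in place of a limit operator; the completed measure, complex values and the
    factor 1/pi enter only at the end. *)

Lemma integrable_bounded_mul (R : realType) (B : set (measurableTypeR R)) (w k : R -> R) (C : R) :
  measurable B -> mu.-integrable B (EFin \o w) ->
  measurable_fun B k -> (forall x, B x -> `|k x| <= C) ->
  mu.-integrable B (EFin \o (fun x => w x * k x)).
Proof.
move=> mB iw mk kC.
have mw : measurable_fun B w by have /integrableP[/measurable_EFinP] := iw.
have iC : mu.-integrable B (EFin \o (fun x => C * w x)).
  have := integrableZl mB C iw.
  by apply: eq_integrable => // x _ /=; rewrite EFinM.
apply: le_integrable iC => //.
  by apply/measurable_EFinP; apply: measurable_funM.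
move=> x Bx /=; rewrite lee_fin !normrM mulrC ler_wpM2r//.
by rewrite (le_trans (kC _ Bx))// ler_norm.
Qed.

(** Writing the integrand as an integrable weight times a bounded kernel provides the dominating
    function at once: a constant multiple of [|w|]. *)
Lemma derive_under_integral (R : realType) (B : set (measurableTypeR R)) (w : R -> R)
    (k k' : R -> R -> R) (p0 u v C : R) :
  measurable B -> mu.-integrable B (EFin \o w) ->
  u < p0 < v ->
  (forall p, u < p < v -> measurable_fun B (k p)) ->
  (forall p x, u < p < v -> B x -> `|k p x| <= C) ->
  (forall p x, u < p < v -> B x -> is_derive p 1 (k ^~ x) (k' p x)) ->
  (forall p x, u < p < v -> B x -> `|k' p x| <= C) ->
  is_derive p0 1 (fun p => \int[mu]_(x in B) (w x * k p x))
    (\int[mu]_(x in B) (w x * k' p0 x)).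
Proof.
move=> mB iw up0v mk kC kk' k'C.
have d1 p x : u < p < v -> B x ->
    is_derive p 1 (fun p => w x * k p x) (w x * k' p x).
  move=> upv Bx; have := kk' _ _ upv Bx => H.
  by apply: (@is_deriveZ _ _ _ _ (w x)).
have p0I : `]u, v[%classic p0 by rewrite /= in_itv.
have intf p : `]u, v[%classic p ->
   mu.-integrable B (EFin \o (fun x => w x * k p x)).
  rewrite /= in_itv /= => upv.
  by apply: (@integrable_bounded_mul _ _ _ _ C) => // [|x Bx]; [exact: mk|exact: kC].
have derf p x : `]u, v[%classic p -> B x -> derivable (fun p => w x * k p x) p 1.
  by rewrite /= in_itv /= => upv Bx; have [] := d1 _ _ upv Bx.
pose G x := C * `|w x|.
have C0 x : B x -> 0 <= C.
  by move=> Bx; exact: le_trans (kC _ _ up0v Bx).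
(* [|C|] replaces [C] because the bounds force [C] to be nonnegative only when [B] is inhabited. *)
have iG : mu.-integrable B (EFin \o (fun x => `|C| * `|w x|)).
  have := integrableZl mB `|C| (integrable_norm iw).
  by apply: eq_integrable => // x _ /=; rewrite EFinM.
have Gub p x : `]u, v[%classic p -> B x ->
    `|partial1of2 (fun p x => w x * k p x) p x| <= `|C| * `|w x|.
  rewrite /= in_itv /= => upv Bx; rewrite partial1of2E.
  have [_ ->] := d1 _ _ upv Bx; rewrite normrM mulrC ler_wpM2r//.
  by rewrite (le_trans (k'C _ _ upv Bx))// ler_norm.
have G0 y : 0 <= `|C| * `|w y| by rewrite mulr_ge0.
have D := derivable_under_integral mB p0I intf derf G0 iG Gub.
have E := differentiation_under_integral mB p0I intf derf G0 iG Gub.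
split => //; rewrite -derive1E E.
apply: eq_Rintegral => x /set_mem Bx; rewrite partial1of2E.
by have [_ ->] := d1 _ _ up0v Bx.
Qed.

Notation I1 := (`]-1, 1[%classic : set (measurableTypeR _)).
Notation L1 f := (mu.-integrable I1 (EFin \o f)).

(** * Contour integration of the Cauchy transform *)

(** The Poisson kernel and its conjugate: 1 / (s - i y) = [qker] + i [pker] and 1 / (s - i y)^2 =
    [dpker] + i [dqker]. With s = x - t, integration against f gives u from [pker] and v from
    [qker], and u - i v is -i times the Cauchy integral of f at t + i y; for f >= 0 its real part u
    is nonnegative. *)
Definition pker (R : realType) (s y : R) : R := y / (s ^+ 2 + y ^+ 2).
Definition qker (R : realType) (s y : R) : R := s / (s ^+ 2 + y ^+ 2).
Definition dpker (R : realType) (s y : R) : R :=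
  (s ^+ 2 - y ^+ 2) / (s ^+ 2 + y ^+ 2) ^+ 2.
Definition dqker (R : realType) (s y : R) : R :=
  2 * s * y / (s ^+ 2 + y ^+ 2) ^+ 2.

Lemma ssqr_gt0 (R : realType) (s y : R) : 0 < y -> 0 < s ^+ 2 + y ^+ 2.
Proof. by move=> y0; rewrite ltr_wpDl ?sqr_ge0// exprn_gt0. Qed.

Lemma pker_ge0 (R : realType) (s y : R) : 0 < y -> 0 <= pker s y.
Proof. by move=> y0; rewrite /pker divr_ge0 ?ltW// ssqr_gt0. Qed.

Lemma pker_le (R : realType) (s y : R) : 0 < y -> `|pker s y| <= y^-1.
Proof.
move=> y0; rewrite ger0_norm ?pker_ge0// /pker ler_pdivrMr ?ssqr_gt0//.
rewrite mulrDr [y^-1 * y ^+ 2]mulrC [y ^+ 2]expr2 mulfK ?gt_eqF//.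
by rewrite lerDr mulr_ge0 ?sqr_ge0// invr_ge0 ltW.
Qed.

Lemma qker_le (R : realType) (s y : R) : 0 < y -> `|qker s y| <= y^-1.
Proof.
move=> y0; rewrite /qker normrM normfV (gtr0_norm (ssqr_gt0 s y0)).
rewrite ler_pdivrMr ?ssqr_gt0// ler_pdivlMl// -[s ^+ 2]real_normK ?num_real//.
set a := `|s|; have a0 : 0 <= a by rewrite /a.
by nra.
Qed.

Lemma dpker_le (R : realType) (s y : R) : 0 < y -> `|dpker s y| <= y^-1 ^+ 2.
Proof.
move=> y0; rewrite /dpker normrM normfV (gtr0_norm (exprn_gt0 _ (ssqr_gt0 s y0))).
rewrite ler_pdivrMr ?exprn_gt0 ?ssqr_gt0// exprVn ler_pdivlMl ?exprn_gt0//.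
have s2 : 0 <= s ^+ 2 := sqr_ge0 _.
have y2 : 0 <= y ^+ 2 := sqr_ge0 _.
have h : `|s ^+ 2 - y ^+ 2| <= s ^+ 2 + y ^+ 2.
  by rewrite ler_norml; apply/andP; split; lra.
by rewrite expr2 ler_pM// lerDr.
Qed.

Lemma dqker_le (R : realType) (s y : R) : 0 < y -> `|dqker s y| <= y^-1 ^+ 2.
Proof.
move=> y0; rewrite /dqker normrM normfV (gtr0_norm (exprn_gt0 _ (ssqr_gt0 s y0))).
rewrite ler_pdivrMr ?exprn_gt0 ?ssqr_gt0// exprVn ler_pdivlMl ?exprn_gt0//.
have s2 : 0 <= s ^+ 2 := sqr_ge0 _.
have y2 : 0 <= y ^+ 2 := sqr_ge0 _.
have d : `|2 * s * y| <= s ^+ 2 + y ^+ 2.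
  rewrite ler_norml; apply/andP; split.
    by have := sqr_ge0 (s + y); nra.
  by have := sqr_ge0 (s - y); nra.
rewrite expr2 ler_pM ?sqr_ge0//.
by rewrite lerDr.
Qed.

Lemma is_derive_div (R : realType) (f g : R -> R) (x df dg d : R) :
  is_derive x 1 f df -> is_derive x 1 g dg -> g x != 0 ->
  d = (df * g x - f x * dg) / (g x) ^+ 2 ->
  is_derive x 1 (fun x => f x / g x) d.
Proof.
move=> fd gd g0 ->.
have gV := is_deriveV g0 gd.
apply: (is_derive_eq (is_deriveM fd gV)).
by rewrite /GRing.scale /= /GRing.scale /=; field.
Qed.

Lemma is_derive_cst_sub (R : realType) (x t : R) : is_derive t 1 (fun t => x - t) (-1).
Proof. by have := @is_deriveB _ _ _ (cst x) id t 1 0 1 _ _; rewrite sub0r; apply. Qed.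

Lemma is_derive_sqr (R : realType) (f : R -> R) (x df : R) :
  is_derive x 1 f df -> is_derive x 1 (fun x => f x ^+ 2) (2 * f x * df).
Proof.
move=> fd; apply: (is_derive_eq (is_deriveM fd fd)).
by rewrite /GRing.scale /=; ring.
Qed.

Lemma is_derive_ssqr_s (R : realType) (x t y : R) :
  is_derive t 1 (fun t => (x - t) ^+ 2 + y ^+ 2) (- (2 * (x - t))).
Proof.
have h := is_derive_sqr (is_derive_cst_sub x t).
have := @is_deriveD _ _ _ _ (cst (y ^+ 2)) t 1 _ 0 h _; rewrite addr0 mulrN1.
by apply.
Qed.

Lemma is_derive_ssqr_y (R : realType) (s y : R) :
  is_derive y 1 (fun y => s ^+ 2 + y ^+ 2) (2 * y).
Proof.
have h := is_derive_sqr (@is_derive_id _ _ y (1:R)).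
have := @is_deriveD _ _ _ (cst (s ^+ 2)) _ y 1 0 _ _ h; rewrite add0r mulr1.
by apply.
Qed.

Lemma is_derive_pker_t (R : realType) (x t y : R) : 0 < y ->
  is_derive t 1 (fun t => pker (x - t) y) (dqker (x - t) y).
Proof.
move=> y0; have n0 : (x - t) ^+ 2 + y ^+ 2 != 0 by rewrite gt_eqF// ssqr_gt0.
apply: (is_derive_div (@is_derive_cst _ _ _ y t (1:R)) (is_derive_ssqr_s x t y)) => //.
by rewrite /dqker; congr (_ / _); rewrite /cst; ring.
Qed.

Lemma is_derive_qker_t (R : realType) (x t y : R) : 0 < y ->
  is_derive t 1 (fun t => qker (x - t) y) (dpker (x - t) y).
Proof.
move=> y0; have n0 : (x - t) ^+ 2 + y ^+ 2 != 0 by rewrite gt_eqF// ssqr_gt0.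
apply: (is_derive_div (is_derive_cst_sub x t) (is_derive_ssqr_s x t y)) => //.
by rewrite /dpker; congr (_ / _); ring.
Qed.

Lemma is_derive_pker_y (R : realType) (s y : R) : 0 < y ->
  is_derive y 1 (fun y => pker s y) (dpker s y).
Proof.
move=> y0; have n0 : s ^+ 2 + y ^+ 2 != 0 by rewrite gt_eqF// ssqr_gt0.
apply: (is_derive_div (@is_derive_id _ _ y (1:R)) (is_derive_ssqr_y s y)) => //.
by rewrite /dpker; congr (_ / _); ring.
Qed.

Lemma is_derive_qker_y (R : realType) (s y : R) : 0 < y ->
  is_derive y 1 (fun y => qker s y) (- dqker s y).
Proof.
move=> y0; have n0 : s ^+ 2 + y ^+ 2 != 0 by rewrite gt_eqF// ssqr_gt0.
apply: (is_derive_div (@is_derive_cst _ _ _ s y (1:R)) (is_derive_ssqr_y s y)) => //.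
by rewrite /dqker -mulNr; congr (_ / _); rewrite /cst; ring.
Qed.

Lemma is_derive_continuous (R : realType) (f : R -> R) (x df : R) :
  is_derive x 1 f df -> {for x, continuous f}.
Proof. by case=> d _; apply: differentiable_continuous; apply/derivable1_diffP. Qed.

Lemma continuous_ssqr (R : realType) (y : R) :
  continuous (fun s : R => s ^+ 2 + y ^+ 2).
Proof. by move=> s; apply: cvgD; [exact: exprn_continuous|exact: cvg_cst]. Qed.

Lemma continuous_pker (R : realType) (y : R) : 0 < y ->
  continuous (fun s : R => pker s y).
Proof.
move=> y0 s; apply: cvgM; first exact: cvg_cst.
by apply: cvgV; [rewrite gt_eqF// ssqr_gt0|exact: continuous_ssqr].
Qed.

Lemma continuous_qker (R : realType) (y : R) : 0 < y ->
  continuous (fun s : R => qker s y).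
Proof.
move=> y0 s; apply: cvgM; first exact: cvg_id.
by apply: cvgV; [rewrite gt_eqF// ssqr_gt0|exact: continuous_ssqr].
Qed.

Lemma continuous_dpker (R : realType) (y : R) : 0 < y ->
  continuous (fun s : R => dpker s y).
Proof.
move=> y0 s; apply: cvgM.
  by apply: cvgB; [exact: exprn_continuous|exact: cvg_cst].
apply: cvgV; first by rewrite gt_eqF// exprn_gt0// ssqr_gt0.
by apply: (@continuous_comp _ _ _ (fun s : R => s ^+ 2 + y ^+ 2) (fun z => z ^+ 2));
  [exact: continuous_ssqr|exact: exprn_continuous].
Qed.

Lemma continuous_dqker (R : realType) (y : R) : 0 < y ->
  continuous (fun s : R => dqker s y).
Proof.
move=> y0 s; apply: cvgM.
  by apply: cvgM; [apply: cvgM; [exact: cvg_cst|exact: cvg_id]|exact: cvg_cst].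
apply: cvgV; first by rewrite gt_eqF// exprn_gt0// ssqr_gt0.
by apply: (@continuous_comp _ _ _ (fun s : R => s ^+ 2 + y ^+ 2) (fun z => z ^+ 2));
  [exact: continuous_ssqr|exact: exprn_continuous].
Qed.

Lemma continuous_shift_measurable (R : realType) (k : R -> R) (t : R)
    (B : set (measurableTypeR R)) :
  continuous k -> measurable B ->
  measurable_fun B (fun x : measurableTypeR R => k (x - t)).
Proof.
move=> kc mB; apply: measurable_funTS; apply: continuous_measurable_fun.
move=> x; apply: (@continuous_comp _ _ _ (fun x => x - t) k); last exact: kc.
by apply: cvgB; [exact: cvg_id|exact: cvg_cst].
Qed.

(** The parameter y is the height above the real axis for the Poisson kernels, the truncation for
    [ktr] and the radius for [bker]; one operator thus serves for all of them. *)
Definition uker (R : realType) (k : R -> R -> R) (f : R -> R) (t y : R) : R :=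
  \int[mu]_(x in I1) (f x * k (x - t) y).

Lemma mI1 (R : realType) : measurable (I1 : set (measurableTypeR R)).
Proof. exact: measurable_itv. Qed.

Lemma uker_derive_t (R : realType) (k k' : R -> R -> R) (f : R -> R) (t y C : R) :
  L1 f -> 0 < y ->
  continuous (k ^~ y) -> (forall s, `|k s y| <= C) -> (forall s, `|k' s y| <= C) ->
  (forall x t : R, is_derive t 1 (fun t => k (x - t) y) (k' (x - t) y)) ->
  is_derive t 1 (fun t => uker k f t y) (uker k' f t y).
Proof.
move=> intf y0 kc kC k'C dk.
apply: (@derive_under_integral _ I1 f (fun t x => k (x - t) y)
   (fun t x => k' (x - t) y) t (t - 1) (t + 1) C) => //.
- by apply/andP; split; lra.
- by move=> p _; apply: (@continuous_shift_measurable _ (k ^~ y)) => //; exact: mI1.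
Qed.

Lemma uker_derive_y (R : realType) (k k' : R -> R -> R) (f : R -> R) (t y0 C : R) :
  L1 f -> 0 < y0 ->
  (forall y, 0 < y -> continuous (k ^~ y)) ->
  (forall s y, y0 / 2 < y -> `|k s y| <= C) ->
  (forall s y, y0 / 2 < y -> `|k' s y| <= C) ->
  (forall s y : R, 0 < y -> is_derive y 1 (fun y => k s y) (k' s y)) ->
  is_derive y0 1 (fun y => uker k f t y) (uker k' f t y0).
Proof.
move=> intf y00 kc kC k'C dk.
(* The kernels are bounded by powers of 1/y, uniformly only away from the real axis; hence the
   window from y0 / 2 to y0 + 1. *)
have y20 : 0 < y0 / 2 by rewrite divr_gt0.
apply: (@derive_under_integral _ I1 f (fun y x => k (x - t) y)
   (fun y x => k' (x - t) y) y0 (y0 / 2) (y0 + 1) C) => //.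
- by apply/andP; split; lra.
- move=> p /andP[yp _]; apply: (@continuous_shift_measurable _ (k ^~ p)); last exact: mI1.
  by apply: kc; exact: lt_trans yp.
- by move=> p x /andP[yp _] _; exact: kC.
- by move=> p x /andP[yp _] _; apply: dk; exact: lt_trans yp.
- by move=> p x /andP[yp _] _; exact: k'C.
Qed.

Lemma uker_continuous (R : realType) (k : R -> R -> R) (f : R -> R) (y C : R) :
  L1 f -> 0 < y ->
  continuous (k ^~ y) -> (forall s, `|k s y| <= C) ->
  continuous (fun t => uker k f t y).
Proof.
move=> intf y0 kc kC t.
have intG : L1 (fun x => C * `|f x|).
  have := integrableZl (@mI1 R) C (integrable_norm intf).
  by apply: eq_integrable => [|x _ /=]; [exact: mI1|rewrite EFinM].
have := @continuity_under_integral R _ _ mu (fun t x => f x * k (x - t) y) I1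
  (@mI1 R) (t - 1) (t + 1) _ _ (fun x => C * `|f x|) intG _ .
move=> /(_ _ _ _ t); apply.
- move=> s _; apply: (@integrable_bounded_mul _ _ _ _ C) => //.
  by apply: (@continuous_shift_measurable _ (k ^~ y)) => //; exact: mI1.
- apply: aeW => x _ s _; apply: cvgM; first exact: cvg_cst.
  apply: (@continuous_comp _ _ _ (fun t => x - t) (k ^~ y)); last exact: kc.
  by apply: cvgB; [exact: cvg_cst|exact: cvg_id].
- move=> s _; apply: aeW => x _; rewrite normrM mulrC ler_wpM2r//.
- by apply/mem_set; rewrite /= in_itv /=; apply/andP; split; lra.
Qed.

(* Real and imaginary parts of z^2 / (z + l) = z - l + l^2 / (z + l) at
   z = u - i v, and their differentials. *)
Definition Hre (R : realType) (l u v : R) : R :=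
  u - l + l ^+ 2 * (u + l) / ((u + l) ^+ 2 + v ^+ 2).
Definition Him (R : realType) (l u v : R) : R :=
  - v + l ^+ 2 * v / ((u + l) ^+ 2 + v ^+ 2).
Definition dHre (R : realType) (l u v du dv : R) : R :=
  du + l ^+ 2 * (du * ((u + l) ^+ 2 + v ^+ 2) -
    (u + l) * (2 * (u + l) * du + 2 * v * dv)) / ((u + l) ^+ 2 + v ^+ 2) ^+ 2.
Definition dHim (R : realType) (l u v du dv : R) : R :=
  - dv + l ^+ 2 * (dv * ((u + l) ^+ 2 + v ^+ 2) -
    v * (2 * (u + l) * du + 2 * v * dv)) / ((u + l) ^+ 2 + v ^+ 2) ^+ 2.

(** A Cauchy-Riemann equation for z^2 / (z + l) composed with a holomorphic function. If u and v
    have the t-derivatives b and a, their y-derivatives are a and - b, so the left side is the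
    y-derivative of the real part and the right side minus the t-derivative of the imaginary
    part. *)
Lemma dHre_dHim (R : realType) (l u v a b : R) : 0 < u + l ->
  dHre l u v a (- b) = - dHim l u v b a.
Proof.
move=> ul; have n0 : (u + l) ^+ 2 + v ^+ 2 != 0.
  by rewrite gt_eqF// ltr_pwDl ?sqr_ge0// exprn_gt0.
by rewrite /dHre /dHim; field.
Qed.

Lemma is_derive_den (R : realType) (l : R) (U V : R -> R) (x du dv : R) :
  is_derive x 1 U du -> is_derive x 1 V dv ->
  is_derive x 1 (fun x => (U x + l) ^+ 2 + V x ^+ 2)
    (2 * (U x + l) * du + 2 * V x * dv).
Proof.
move=> dU dV.
have dUl : is_derive x 1 (fun x => U x + l) du.
  by apply: (is_derive_eq (is_deriveD dU (@is_derive_cst _ _ _ l x (1:R)))); rewrite addr0.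
exact: (is_deriveD (is_derive_sqr dUl) (is_derive_sqr dV)).
Qed.

Lemma is_derive_Hre (R : realType) (l : R) (U V : R -> R) (x du dv : R) :
  is_derive x 1 U du -> is_derive x 1 V dv -> 0 < U x + l ->
  is_derive x 1 (fun x => Hre l (U x) (V x)) (dHre l (U x) (V x) du dv).
Proof.
move=> dU dV ul; have n0 : (U x + l) ^+ 2 + V x ^+ 2 != 0.
  by rewrite gt_eqF// ltr_pwDl ?sqr_ge0// exprn_gt0.
have dUl : is_derive x 1 (fun x => U x + l) du.
  by apply: (is_derive_eq (is_deriveD dU (@is_derive_cst _ _ _ l x (1:R)))); rewrite addr0.
have dUB : is_derive x 1 (fun x => U x - l) du.
  by apply: (is_derive_eq (is_deriveB dU (@is_derive_cst _ _ _ l x (1:R)))); rewrite subr0.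
have dUZ : is_derive x 1 (fun x => l ^+ 2 * (U x + l)) (l ^+ 2 * du).
  exact: (is_deriveZ (l ^+ 2) dUl).
have := is_derive_div dUZ (is_derive_den l dU dV) n0 erefl.
move=> h; apply: (is_derive_eq (is_deriveD dUB h)); rewrite /dHre.
by field.
Qed.

Lemma is_derive_Him (R : realType) (l : R) (U V : R -> R) (x du dv : R) :
  is_derive x 1 U du -> is_derive x 1 V dv -> 0 < U x + l ->
  is_derive x 1 (fun x => Him l (U x) (V x)) (dHim l (U x) (V x) du dv).
Proof.
move=> dU dV ul; have n0 : (U x + l) ^+ 2 + V x ^+ 2 != 0.
  by rewrite gt_eqF// ltr_pwDl ?sqr_ge0// exprn_gt0.
have dVN : is_derive x 1 (fun x => - V x) (- dv) by exact: is_deriveN.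
have dVZ : is_derive x 1 (fun x => l ^+ 2 * V x) (l ^+ 2 * dv).
  exact: (is_deriveZ (l ^+ 2) dV).
have := is_derive_div dVZ (is_derive_den l dU dV) n0 erefl.
move=> h; apply: (is_derive_eq (is_deriveD dVN h)); rewrite /dHim.
by field.
Qed.

Lemma dHim_continuous (R : realType) (l : R) (U V A B : R -> R) (x : R) :
  {for x, continuous U} -> {for x, continuous V} ->
  {for x, continuous A} -> {for x, continuous B} -> 0 < U x + l ->
  {for x, continuous (fun x => dHim l (U x) (V x) (A x) (B x))}.
Proof.
move=> cU cV cA cB ul; have n0 : (U x + l) ^+ 2 + V x ^+ 2 != 0.
  by rewrite gt_eqF// ltr_pwDl ?sqr_ge0// exprn_gt0.
have cUl : U t + l @[t --> x] --> U x + l by apply: cvgD => //; exact: cvg_cst.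
have cX (h : R -> R) (z : R) : h t @[t --> x] --> z -> h t ^+ 2 @[t --> x] --> z ^+ 2.
  by move=> hz; under eq_fun do rewrite expr2; rewrite expr2; exact: cvgM.
have cN : (U t + l) ^+ 2 + V t ^+ 2 @[t --> x] --> (U x + l) ^+ 2 + V x ^+ 2.
  by apply: cvgD; apply: cX.
apply: cvgD; first exact: cvgN.
apply: cvgM; last by apply: cvgV; [rewrite expf_neq0|apply: cX].
apply: cvgM; first exact: cvg_cst.
apply: cvgB; first by apply: cvgM.
apply: cvgM => //; apply: cvgD.
  by apply: cvgM => //; apply: cvgM => //; exact: cvg_cst.
by apply: cvgM => //; apply: cvgM => //; exact: cvg_cst.
Qed.

(** The complex derivative 1 - l^2 / (z + l)^2 is bounded on the half plane u >= 0, where |z + l| >=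
    l. The bound is the domination needed to differentiate under the integral. *)
Lemma dHre_le (R : realType) (l u v a b C : R) : 0 <= u -> 0 < l ->
  `|a| <= C -> `|b| <= C -> `|dHre l u v a b| <= 5 * C.
Proof.
move=> u0 l0 aC bC.
set N := (u + l) ^+ 2 + v ^+ 2.
have C0 : 0 <= C by exact: le_trans aC.
have Nl : l ^+ 2 <= N by rewrite /N; have := sqr_ge0 v; nra.
have N0 : 0 < N by apply: lt_le_trans Nl; rewrite exprn_gt0.
have E : `|a * N - (u + l) * (2 * (u + l) * a + 2 * v * b)| <= 4 * C * N.
  have -> : a * N - (u + l) * (2 * (u + l) * a + 2 * v * b) =
    a * (v ^+ 2 - (u + l) ^+ 2) - b * (2 * (u + l) * v) by rewrite /N; ring.
  rewrite (le_trans (ler_normB _ _))// !normrM.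
  have h1 : `|v ^+ 2 - (u + l) ^+ 2| <= N.
    by rewrite /N ler_norml; have := sqr_ge0 v; have := sqr_ge0 (u + l);
      move=> ? ?; apply/andP; split; lra.
  have h2 : `|2 * (u + l) * v| <= N.
    rewrite /N ler_norml; have := sqr_ge0 (u + l - v); have := sqr_ge0 (u + l + v).
    by move=> ? ?; apply/andP; split; nra.
  have h3 := ler_pM (normr_ge0 a) (normr_ge0 _) aC h1.
  have h4 := ler_pM (normr_ge0 b) (normr_ge0 _) bC h2.
  rewrite !normrM in h4.
  by have := mulr_ge0 C0 (ltW N0); lra.
rewrite /dHre -/N (le_trans (ler_normD _ _))//.
have -> : 5 * C = C + 4 * C by ring.
rewrite lerD// normrM normfV (gtr0_norm (exprn_gt0 _ N0)).
rewrite ler_pdivrMr ?exprn_gt0// normrM (gtr0_norm (exprn_gt0 _ l0)).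
have := ler_pM (sqr_ge0 l) (normr_ge0 _) Nl E.
by move/le_trans; apply; rewrite expr2 mulrCA.
Qed.

Lemma FTC_derive (R : realType) (f F : R -> R) (a b : R) : a < b ->
  (forall x : R, is_derive x 1 F (f x)) -> continuous f ->
  \int[mu]_(x in `[a, b]) f x = F b - F a.
Proof.
move=> ab dF cf.
have cF : continuous F by move=> x; exact: is_derive_continuous (dF x).
rewrite /Rintegral (@continuous_FTC2 _ f F)//.
- exact: continuous_subspaceT.
- split; last 2 first.
  + by apply: cvg_at_right_filter; exact: cF.
  + by apply: cvg_at_left_filter; exact: cF.
  by move=> x _; have [] := dF x.
- by move=> x _; rewrite derive1E; have [_ ->] := dF x.
Qed.

Lemma uker_le (R : realType) (k : R -> R -> R) (f : R -> R) (t y C : R) :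
  L1 f ->
  measurable_fun (I1 : set (measurableTypeR R)) (fun x => k (x - t) y) ->
  (forall x, I1 x -> `|k (x - t) y| <= C) ->
  `|uker k f t y| <= C * \int[mu]_(x in I1) `|f x|.
Proof.
move=> intf mk kC; have mI := @mI1 R.
have i1 := @integrable_bounded_mul _ I1 f _ C mI intf mk kC.
rewrite (le_trans (le_normr_Rintegral mI i1))//.
rewrite -RintegralZl//; last exact: integrable_norm.
apply: le_Rintegral => //.
- exact: integrable_norm i1.
- have := integrableZl mI C (integrable_norm intf).
  by apply: eq_integrable => // x _ /=; rewrite EFinM.
- by move=> x Ix; rewrite normrM mulrC ler_wpM2r// kC.
Qed.

Lemma uker_ge0 (R : realType) (k : R -> R -> R) (f : R -> R) (t y : R) :
  (forall x, 0 <= f x) -> (forall s, 0 <= k s y) -> 0 <= uker k f t y.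
Proof. by move=> f0 k0; apply: Rintegral_ge0 => x _; rewrite mulr_ge0. Qed.

Lemma Hre_eq (R : realType) (l u v : R) : 0 < u + l ->
  Hre l u v = (u ^+ 2 * (u + l) + v ^+ 2 * (u - l)) / ((u + l) ^+ 2 + v ^+ 2).
Proof.
move=> ul; have n0 : (u + l) ^+ 2 + v ^+ 2 != 0.
  by rewrite gt_eqF// ltr_pwDl ?sqr_ge0// exprn_gt0.
by rewrite /Hre; field.
Qed.

Lemma Him_eq (R : realType) (l u v : R) : 0 < u + l ->
  Him l u v = - (v * (u ^+ 2 + 2 * u * l + v ^+ 2)) / ((u + l) ^+ 2 + v ^+ 2).
Proof.
move=> ul; have n0 : (u + l) ^+ 2 + v ^+ 2 != 0.
  by rewrite gt_eqF// ltr_pwDl ?sqr_ge0// exprn_gt0.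
by rewrite /Him; field.
Qed.

(** The bound is |z|^2 / |z + l| with |z| of order m. It is kept in the form m^2 / (m + l), which
    [kap_mass] later compares with the integral of [kap l] of f; the cases m <= l and l < m are the
    two regimes of this quotient. *)
Lemma Hre_le (R : realType) (l u v m : R) : 0 <= u <= m -> 0 < l -> `|v| <= m ->
  `|Hre l u v| <= 4 * (m ^+ 2 / (m + l)).
Proof.
move=> /andP[u0 um] l0 vm; have ul : 0 < u + l by lra.
have N0 : 0 < (u + l) ^+ 2 + v ^+ 2 by rewrite ltr_pwDl ?sqr_ge0// exprn_gt0.
have ml : 0 < m + l by lra.
rewrite Hre_eq// normrM normfV (gtr0_norm N0) ler_pdivrMr//.
have h1 : `|u ^+ 2 * (u + l) + v ^+ 2 * (u - l)| <= (u ^+ 2 + v ^+ 2) * (u + l).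
  rewrite mulrDl (le_trans (ler_normD _ _))// !normrM lerD//.
    by rewrite !ger0_norm ?sqr_ge0// ltW.
  have -> : `|v| * `|v| = v ^+ 2 by rewrite -expr2 real_normK ?num_real.
  rewrite ler_wpM2l ?sqr_ge0// ler_norml.
  by apply/andP; split; lra.
apply: (le_trans h1).
have v2 : v ^+ 2 <= m ^+ 2 by rewrite -[v ^+ 2]real_normK ?num_real// lerXn2r// nnegrE; lra.
have u2 : u ^+ 2 <= m ^+ 2 by rewrite lerXn2r// nnegrE; lra.
set q := m ^+ 2 / (m + l).
have qE : q * (m + l) = m ^+ 2 by rewrite /q divfK// gt_eqF.
have q0 : 0 <= q by rewrite divr_ge0 ?sqr_ge0// ltW.
clearbody q.
have [ml1|ml1] := leP m l.
  have h : 2 * m ^+ 2 <= 4 * q * l by rewrite -qE; nra.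
  have h3 : (u ^+ 2 + v ^+ 2) * (u + l) <= 2 * m ^+ 2 * (u + l).
    by rewrite ler_wpM2r ?(ltW ul)//; lra.
  apply: (le_trans h3).
  have h4 : 2 * m ^+ 2 * (u + l) <= 4 * q * l * (u + l).
    by rewrite ler_wpM2r ?(ltW ul).
  apply: (le_trans h4); rewrite -[leLHS]mulrA ler_wpM2l ?mulr_ge0//.
  by have := sqr_ge0 v; nra.
have h : 2 * m <= 4 * q by nra.
have h3 : (u ^+ 2 + v ^+ 2) * (u + l) <= ((u + l) ^+ 2 + v ^+ 2) * (2 * m).
  apply: ler_pM; [by rewrite addr_ge0 ?sqr_ge0|exact: ltW| |by lra].
  by have := mulr_ge0 u0 (ltW l0); have := sqr_ge0 l; nra.
by apply: (le_trans h3); rewrite mulrC ler_wpM2r ?(ltW N0).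
Qed.

Lemma Him_le (R : realType) (l u v m : R) : 0 <= u <= m -> 0 < l -> `|v| <= m ->
  `|Him l u v| <= 8 * (m ^+ 2 / (m + l)).
Proof.
move=> /andP[u0 um] l0 vm; have ul : 0 < u + l by lra.
have N0 : 0 < (u + l) ^+ 2 + v ^+ 2 by rewrite ltr_pwDl ?sqr_ge0// exprn_gt0.
have m0 : 0 <= m by lra.
have ml : 0 < m + l by lra.
have q0 : 0 <= u ^+ 2 + 2 * u * l + v ^+ 2.
  by rewrite !addr_ge0 ?sqr_ge0// !mulr_ge0// ltW.
rewrite Him_eq// normrM normfV (gtr0_norm N0) ler_pdivrMr// normrN normrM (ger0_norm q0).
have v2 : v ^+ 2 <= m ^+ 2 by rewrite -[v ^+ 2]real_normK ?num_real// lerXn2r// nnegrE; lra.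
set q := m ^+ 2 / (m + l).
have qE : q * (m + l) = m ^+ 2 by rewrite /q divfK// gt_eqF.
have q1 : 0 <= q by rewrite divr_ge0 ?sqr_ge0// ltW.
clearbody q.
have [ml1|ml1] := leP m l.
  have h : m * (4 * m * l) <= 8 * q * l ^+ 2.
    have -> : m * (4 * m * l) = 4 * (q * (m + l)) * l by rewrite qE; ring.
    have -> : 8 * q * l ^+ 2 = 4 * (q * (2 * l)) * l by ring.
    by rewrite ler_wpM2r ?(ltW l0)// ler_wpM2l// ler_wpM2l//; lra.
  have h3 : `|v| * (u ^+ 2 + 2 * u * l + v ^+ 2) <= m * (4 * m * l).
    by rewrite ler_pM//; nra.
  apply: (le_trans h3); apply: (le_trans h); rewrite ler_wpM2l ?mulr_ge0//.
  by have := sqr_ge0 v; nra.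
have h : m <= 8 * q by nra.
apply: ler_pM => //; first exact: le_trans h.
by nra.
Qed.

Lemma Rintegral_cst33 (R : realType) (c : R) :
  \int[mu]_(t in `[(-3 : R), 3]) (cst c t) = 6 * c.
Proof.
have E : @lebesgue_measure R `[(-3 : R), 3]%classic = 6%:E.
  rewrite lebesgue_measure_itv /= lte_fin ifT; last by lra.
  by rewrite -EFinD; congr EFin; lra.
rewrite Rintegral_cst; last exact: measurable_itv.
by transitivity (c * fine (6%:E : \bar R)); [congr (_ * fine _)|rewrite mulrC].
Qed.

(* On the two sides and on the top of the rectangle [-3,3] x [d,d+2] the
   Cauchy transform is O(m); hence so is its bottom integral. *)
Lemma Hre_bottom (R : realType) (f : R -> R) (l d : R) (m := \int[mu]_(x in I1) f x) :
  L1 f -> (forall x, 0 <= f x) -> 0 < l -> 0 < d ->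
  `|\int[mu]_(t in `[-3, 3]) Hre l (uker (@pker R) f t d) (uker (@qker R) f t d)|
    <= 56 * (m ^+ 2 / (m + l)).
Proof.
move=> intf f0 l0 d0; have mI := @mI1 R.
have mS : measurable (`[(-3 : R), 3]%classic : set (measurableTypeR R)) by exact: measurable_itv.
have nf : \int[mu]_(x in I1) `|f x| = m.
  by apply: eq_Rintegral => x _; rewrite ger0_norm.
have m0 : 0 <= m by exact: Rintegral_ge0.
pose U (t y : R) := uker (@pker R) f t y.
pose V (t y : R) := uker (@qker R) f t y.
pose A (t y : R) := uker (@dpker R) f t y.
pose B (t y : R) := uker (@dqker R) f t y.
have U0 (t y : R) : 0 < y -> 0 <= U t y by move=> y0; apply: uker_ge0 => // s; exact: pker_ge0.
have shc (k : R -> R) (t : R) : continuous k ->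
    measurable_fun (I1 : set (measurableTypeR R)) (fun x => k (x - t)).
  by move=> kc; exact: continuous_shift_measurable.
have ULe (t y C : R) : 0 < y -> (forall x, I1 x -> `|pker (x - t) y| <= C) -> `|U t y| <= C * m.
  by move=> y0 kC; rewrite -nf; apply: uker_le => //; apply: (shc (@pker R ^~ y)); exact: continuous_pker.
have VLe (t y C : R) : 0 < y -> (forall x, I1 x -> `|qker (x - t) y| <= C) -> `|V t y| <= C * m.
  by move=> y0 kC; rewrite -nf; apply: uker_le => //; apply: (shc (@qker R ^~ y)); exact: continuous_qker.
have ALe (t y C : R) : 0 < y -> (forall x, I1 x -> `|dpker (x - t) y| <= C) -> `|A t y| <= C * m.
  by move=> y0 kC; rewrite -nf; apply: uker_le => //; apply: (shc (@dpker R ^~ y)); exact: continuous_dpker.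
have BLe (t y C : R) : 0 < y -> (forall x, I1 x -> `|dqker (x - t) y| <= C) -> `|B t y| <= C * m.
  by move=> y0 kC; rewrite -nf; apply: uker_le => //; apply: (shc (@dqker R ^~ y)); exact: continuous_dqker.
have Ut (t y : R) : 0 < y -> is_derive t 1 (U ^~ y) (B t y).
  move=> y0; apply: (@uker_derive_t _ _ _ f t y (y^-1 + y^-1 ^+ 2)) => //.
  - exact: continuous_pker.
  - by move=> s; rewrite (le_trans (pker_le _ y0))// lerDl sqr_ge0.
  - by move=> s; rewrite (le_trans (dqker_le _ y0))// lerDr invr_ge0 ltW.
  - by move=> x t'; exact: is_derive_pker_t.
have Vt (t y : R) : 0 < y -> is_derive t 1 (V ^~ y) (A t y).
  move=> y0; apply: (@uker_derive_t _ _ _ f t y (y^-1 + y^-1 ^+ 2)) => //.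
  - exact: continuous_qker.
  - by move=> s; rewrite (le_trans (qker_le _ y0))// lerDl sqr_ge0.
  - by move=> s; rewrite (le_trans (dpker_le _ y0))// lerDr invr_ge0 ltW.
  - by move=> x t'; exact: is_derive_qker_t.
have invle (y0 y : R) : 0 < y0 -> y0 / 2 < y -> y^-1 <= (y0 / 2)^-1 /\ 0 < y.
  move=> h h'; have y0' : 0 < y by apply: lt_trans h'; rewrite divr_gt0.
  by split => //; rewrite lef_pV2 ?posrE ?divr_gt0// ltW.
have c1 (y0 y : R) : 0 < y0 -> y0 / 2 < y ->
    y^-1 <= (y0 / 2)^-1 + (y0 / 2)^-1 ^+ 2.
  by move=> h h'; have [h1 _] := invle _ _ h h'; rewrite (le_trans h1)// lerDl sqr_ge0.
have c2 (y0 y : R) : 0 < y0 -> y0 / 2 < y ->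
    y^-1 ^+ 2 <= (y0 / 2)^-1 + (y0 / 2)^-1 ^+ 2.
  move=> h h'; have [h1 h2] := invle _ _ h h'.
  have h3 : 0 < (y0 / 2)^-1 by rewrite invr_gt0 divr_gt0.
  rewrite -[leLHS]add0r lerD ?(ltW h3)// lerXn2r// nnegrE ?invr_ge0 ltW//.
  by rewrite divr_gt0.
have Uy (t y : R) : 0 < y -> is_derive y 1 (U t) (A t y).
  move=> y0; apply: (@uker_derive_y _ _ _ f t y ((y / 2)^-1 + (y / 2)^-1 ^+ 2)) => //.
  - by move=> z z0; exact: continuous_pker.
  - by move=> s z z0; have [_ z1] := invle _ _ y0 z0; rewrite (le_trans (pker_le _ z1))// c1.
  - by move=> s z z0; have [_ z1] := invle _ _ y0 z0; rewrite (le_trans (dpker_le _ z1))// c2.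
  - by move=> s z z0; exact: is_derive_pker_y.
have Vy (t y : R) : 0 < y -> is_derive y 1 (V t) (- B t y).
  move=> y0.
  have -> : - B t y = uker (fun s y => - dqker s y) f t y.
    rewrite (_ : - B t y = (-1) * B t y); last by rewrite mulN1r.
    rewrite /B /uker -RintegralZl//; last first.
      apply: (@integrable_bounded_mul _ _ _ _ (y^-1 ^+ 2)) => //.
        by apply: (shc (@dqker R ^~ y)); exact: continuous_dqker.
      by move=> x _; exact: dqker_le.
    by apply: eq_Rintegral => x _; ring.
  apply: (@uker_derive_y _ _ _ f t y ((y / 2)^-1 + (y / 2)^-1 ^+ 2)) => //.
  - by move=> z z0; exact: continuous_qker.
  - by move=> s z z0; have [_ z1] := invle _ _ y0 z0; rewrite (le_trans (qker_le _ z1))// c1.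
  - by move=> s z z0; have [_ z1] := invle _ _ y0 z0; rewrite normrN (le_trans (dqker_le _ z1))// c2.
  - by move=> s z z0; exact: is_derive_qker_y.
have ul (t y : R) : 0 < y -> 0 < U t y + l by move=> y0; rewrite ltr_wpDl// U0.
have Uc (y : R) : 0 < y -> continuous (U ^~ y).
  by move=> y0 t; exact: is_derive_continuous (Ut t y y0).
have Vc (y : R) : 0 < y -> continuous (V ^~ y).
  by move=> y0 t; exact: is_derive_continuous (Vt t y y0).
have Ac (y : R) : 0 < y -> continuous (A ^~ y).
  move=> y0; apply: (@uker_continuous _ _ _ _ (y^-1 ^+ 2)) => //.
    exact: continuous_dpker.
  by move=> s; exact: dpker_le.
have Bc (y : R) : 0 < y -> continuous (B ^~ y).
  move=> y0; apply: (@uker_continuous _ _ _ _ (y^-1 ^+ 2)) => //.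
    exact: continuous_dqker.
  by move=> s; exact: dqker_le.
have Hrec0 (y : R) : 0 < y -> continuous (fun t => Hre l (U t y) (V t y)).
  by move=> y0 t; exact: is_derive_continuous (is_derive_Hre (Ut t y y0) (Vt t y y0) (ul t y y0)).
(* At distance at least 2 from the support both kernels are at most 1, so that u and |v| are at most
   m, whatever the height y. *)
have side (t y : R) : 0 < y -> (forall x, I1 x -> 2 <= `|x - t|) ->
    `|Him l (U t y) (V t y)| <= 8 * (m ^+ 2 / (m + l)).
  move=> y0 far.
  have den x : I1 x -> 4 <= (x - t) ^+ 2.
    move=> Ix; rewrite -[(x - t) ^+ 2]real_normK ?num_real//.
    by have := far x Ix; nra.
  apply: Him_le => //.
  - rewrite U0//= -[m]mul1r -[leLHS]ger0_norm ?U0//; apply: ULe => // x Ix.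
    rewrite ger0_norm ?pker_ge0// /pker ler_pdivrMr ?ssqr_gt0// mul1r.
    by have := den _ Ix; nra.
  - rewrite -[m]mul1r; apply: VLe => // x Ix.
    rewrite /qker normrM normfV (gtr0_norm (ssqr_gt0 _ y0)) ler_pdivrMr ?ssqr_gt0// mul1r.
    have := den _ Ix; rewrite -[(x - t) ^+ 2]real_normK ?num_real//.
    by have := far _ Ix; have := sqr_ge0 y; nra.
(* At height d + 2 both kernels are at most 1 / (d + 2) <= 1; 24 is the length 6 of the interval
   times the 4 of [Hre_le]. *)
have top : `|\int[mu]_(t in `[-3, 3]) Hre l (U t (d + 2)) (V t (d + 2))| <= 24 * (m ^+ 2 / (m + l)).
  have d2 : 0 < d + 2 by lra.
  have ci : mu.-integrable `[(-3 : R), 3]%classic (EFin \o (fun t => Hre l (U t (d + 2)) (V t (d + 2)))).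
    by apply: continuous_compact_integrable; [exact: segment_compact|apply: continuous_subspaceT; exact: (Hrec0 _ d2)].
  rewrite (le_trans (le_normr_Rintegral mS ci))//.
  have -> : 24 * (m ^+ 2 / (m + l)) =
      \int[mu]_(t in `[(-3 : R), 3]) (cst (4 * (m ^+ 2 / (m + l))) t).
    by rewrite Rintegral_cst33; ring.
  apply: le_Rintegral => //.
  - exact: integrable_norm ci.
  - by apply: continuous_compact_integrable; [exact: segment_compact|move=> ?; exact: cvg_cst].
  have dle : (d + 2)^-1 <= 1 by rewrite invf_le1//; lra.
  move=> t _; apply: Hre_le => //.
  - rewrite U0//= -[m]mul1r -[leLHS]ger0_norm ?U0//; apply: ULe => // x Ix.
    exact: le_trans (pker_le _ d2) dle.
  - rewrite -[m]mul1r; apply: VLe => // x Ix.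
    exact: le_trans (qker_le _ d2) dle.
have JE t : uker (@pker R) f t d = U t d by [].
have JE' t : uker (@qker R) f t d = V t d by [].
clearbody U V A B.
(* Cauchy's theorem for the rectangle is replaced by a mean value argument in the height: by
   [dHre_dHim] and the fundamental theorem of calculus in t, the derivative of [J] is minus the
   difference of [Him] on the two vertical sides. *)
pose J (y : R) := \int[mu]_(t in `[(-3 : R), 3]) Hre l (U t y) (V t y).
have Hrec (y : R) : 0 < y -> continuous (fun t => Hre l (U t y) (V t y)).
  by move=> y0 t; exact: is_derive_continuous (is_derive_Hre (Ut t y y0) (Vt t y y0) (ul t y y0)).
have Hbd (t y0 y : R) : 0 < y0 -> y0 / 2 < y ->
  `|U t y| <= ((y0 / 2)^-1 + (y0 / 2)^-1 ^+ 2) * m /\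
  `|V t y| <= ((y0 / 2)^-1 + (y0 / 2)^-1 ^+ 2) * m /\
  `|A t y| <= ((y0 / 2)^-1 + (y0 / 2)^-1 ^+ 2) * m /\
  `|B t y| <= ((y0 / 2)^-1 + (y0 / 2)^-1 ^+ 2) * m.
  move=> h h'; have [_ h1] := invle _ _ h h'; repeat split.
  - by apply: ULe => // x _; rewrite (le_trans (pker_le _ h1))// c1.
  - by apply: VLe => // x _; rewrite (le_trans (qker_le _ h1))// c1.
  - by apply: ALe => // x _; rewrite (le_trans (dpker_le _ h1))// c2.
  - by apply: BLe => // x _; rewrite (le_trans (dqker_le _ h1))// c2.
have dJ (y : R) : 0 < y -> is_derive y 1 J (- (Him l (U 3 y) (V 3 y) - Him l (U (-3) y) (V (-3) y))).
  move=> y0.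
  set C := ((y / 2)^-1 + (y / 2)^-1 ^+ 2) * m.
  have C0 : 0 <= C by rewrite mulr_ge0// addr_ge0 ?sqr_ge0// invr_ge0 divr_ge0// ltW.
  have i1 : mu.-integrable (`[(-3 : R), 3]%classic) (EFin \o (cst (1 : R))).
    by apply: continuous_compact_integrable; [exact: segment_compact|move=> ?; exact: cvg_cst].
  have D : is_derive y 1 (fun y => \int[mu]_(t in `[(-3 : R), 3]) (cst 1 t * Hre l (U t y) (V t y)))
     (\int[mu]_(t in `[(-3 : R), 3]) (cst 1 t * dHre l (U t y) (V t y) (A t y) (- B t y))).
    apply: (@derive_under_integral _ _ (cst (1:R)) (fun y t => Hre l (U t y) (V t y))
     (fun y t => dHre l (U t y) (V t y) (A t y) (- B t y)) y (y / 2) (y + 1) (5 * C + 2 * l) mS i1).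
    - by apply/andP; split; lra.
    - move=> z /andP[z1 _]; have [_ z0] := invle _ _ y0 z1.
      by apply: measurable_funTS; apply: continuous_measurable_fun; exact: Hrec.
    - move=> z t /andP[z1 _] _; have [_ z0] := invle _ _ y0 z1.
      have [b1 _] := Hbd t _ _ y0 z1.
      rewrite /Hre.
      have N0 : 0 < (U t z + l) ^+ 2 + V t z ^+ 2.
        by rewrite ltr_pwDl ?sqr_ge0// exprn_gt0// ul.
      have q : 0 <= l ^+ 2 * (U t z + l) / ((U t z + l) ^+ 2 + V t z ^+ 2) <= l.
        rewrite divr_ge0 ?(ltW N0)//=; last by apply: mulr_ge0; [exact: sqr_ge0|exact: ltW (ul _ _ z0)].
        rewrite ler_pdivrMr//; have := U0 t z z0; have := sqr_ge0 (V t z).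
        set uu := U t z; set vv := V t z ^+ 2 => v0 u0.
        by have := mulr_ge0 u0 (ltW l0); have := mulr_ge0 u0 u0; nra.
      case/andP: q => q1 q2; move: b1; rewrite (ger0_norm (U0 t z z0)) -/C => b1.
      have := U0 t z z0.
      by rewrite ler_norml => ?; apply/andP; split; lra.
    - move=> z t /andP[z1 _] _; have [_ z0] := invle _ _ y0 z1.
      by apply: is_derive_Hre; [exact: Uy|exact: Vy|exact: ul].
    - move=> z t /andP[z1 _] _; have [_ z0] := invle _ _ y0 z1.
      have [_ [_ [b1 b2]]] := Hbd t _ _ y0 z1.
      have : `|dHre l (U t z) (V t z) (A t z) (- B t z)| <= 5 * C.
        by apply: dHre_le => //; [exact: U0|rewrite normrN].
      by move/le_trans; apply; rewrite lerDl mulr_ge0// ltW.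
  have -> : J = (fun y => \int[mu]_(t in `[(-3 : R), 3]) (cst 1 t * Hre l (U t y) (V t y))).
    by apply/funext => z; apply: eq_Rintegral => t _; rewrite mul1r.
  apply: (is_derive_eq D).
  have F : \int[mu]_(t in `[(-3 : R), 3]) dHim l (U t y) (V t y) (B t y) (A t y) =
      Him l (U 3 y) (V 3 y) - Him l (U (-3) y) (V (-3) y).
    apply: (@FTC_derive R _ (fun t => Him l (U t y) (V t y)) (-3) 3).
    - by lra.
    - by move=> t; apply: is_derive_Him; [exact: Ut|exact: Vt|exact: ul].
    - by move=> t; apply: dHim_continuous; [exact: Uc|exact: Vc|exact: Bc|exact: Ac|exact: ul].
  rewrite -F.
  rewrite (_ : forall z : R, - z = (-1) * z); last by move=> z; rewrite mulN1r.
  rewrite -RintegralZl//.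
    by apply: eq_Rintegral => t _; rewrite mul1r dHre_dHim ?mulN1r// ul.
  apply: continuous_compact_integrable; first exact: segment_compact.
  apply: continuous_subspaceT => t.
  by apply: dHim_continuous; [exact: Uc|exact: Vc|exact: Bc|exact: Ac|exact: ul].
have dJle (y : R) : 0 < y -> `|- (Him l (U 3 y) (V 3 y) - Him l (U (-3) y) (V (-3) y))| <=
    16 * (m ^+ 2 / (m + l)).
  move=> y0; rewrite normrN (le_trans (ler_normB _ _))//.
  have -> : 16 * (m ^+ 2 / (m + l)) = 8 * (m ^+ 2 / (m + l)) + 8 * (m ^+ 2 / (m + l)) by ring.
  apply: lerD; apply: side => // x; rewrite /= in_itv /= => /andP[x1 x2].
    by rewrite ler0_norm; lra.
  by rewrite ger0_norm; lra.
have cJ : {within `[d, d + 2], continuous J}.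
  apply: derivable_within_continuous => y; rewrite in_itv /= => /andP[y1 _].
  by have [] := dJ y (lt_le_trans d0 y1).
have dJ' (y : R) : y \in `]d, d + 2[ ->
    is_derive y 1 J (- (Him l (U 3 y) (V 3 y) - Him l (U (-3) y) (V (-3) y))).
  by rewrite in_itv /= => /andP[y1 _]; apply: dJ; exact: lt_trans y1.
have dd2 : d <= d + 2 by lra.
(* The total is 24 from the top plus the height 2 times 16 from the two sides, that is 56. *)
have [c cI E] := MVT_segment dd2 dJ' cJ.
have c0 : 0 < c by move: cI; rewrite in_itv /= => /andP[y1 _]; exact: lt_le_trans y1.
rewrite (_ : \int[mu]_(t in _) _ = J d); last by apply: eq_Rintegral => t _; rewrite JE JE'.
have -> : J d = J (d + 2) - (J (d + 2) - J d) by ring.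
rewrite (le_trans (ler_normB _ _))// E normrM.
have -> : `|d + 2 - d| = 2 by rewrite addrAC subrr add0r ger0_norm.
by have := dJle c c0; move: top; rewrite -/(J (d + 2)); set q := m ^+ 2 / (m + l); lra.
Qed.

Notation S3 := (`[(-3)%R, 3%R]%classic : set (measurableTypeR _)).

(** * Weak type bounds for the truncated transforms *)

(* Bounding level sets by integrals of kap l, instead of |f|, loses nothing when
   the bounds are summed over the dyadic levels l = 2^k. *)
Definition kap (R : realType) (l s : R) : R := s ^+ 2 / (`|s| + l).

Lemma kap_norm (R : realType) (l s : R) : kap l `|s| = kap l s.
Proof. by rewrite /kap normr_id real_normK ?num_real. Qed.

Lemma kap_ge0 (R : realType) (l s : R) : 0 < l -> 0 <= kap l s.
Proof. by move=> l0; rewrite divr_ge0 ?sqr_ge0// addr_ge0 ?normr_ge0 ?(ltW l0). Qed.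

Lemma kap_le (R : realType) (l s : R) : 0 < l -> kap l s <= `|s|.
Proof.
move=> l0; have h := normr_ge0 s; rewrite /kap ler_pdivrMr; last by lra.
by rewrite -[s ^+ 2]real_normK ?num_real//; nra.
Qed.

Lemma kap_den (R : realType) (l s : R) : 0 < l -> 0 <= s ->
  kap l s * (s + l) = s ^+ 2.
Proof. by move=> l0 s0; rewrite /kap ger0_norm// divfK// gt_eqF//; lra. Qed.

Lemma kap_scale (R : realType) (c l s : R) : 1 <= c -> 0 < l ->
  kap l (c * s) <= c ^+ 2 * kap l s.
Proof.
move=> c1 l0; have c0 : 0 <= c by lra.
have h := normr_ge0 s.
rewrite /kap exprMn mulrA normrM (ger0_norm c0) ler_pM//.
- by rewrite mulr_ge0 ?sqr_ge0.
- by rewrite invr_ge0 addr_ge0 ?mulr_ge0// ltW.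
- by rewrite lef_pV2 ?posrE; nra.
Qed.

Lemma kap_half (R : realType) (l s : R) : 0 < l -> kap (l / 2) s <= 2 * kap l s.
Proof.
move=> l0; have h := normr_ge0 s; rewrite /kap ler_pdivrMr; last by lra.
rewrite mulrA mulrAC ler_pdivlMr; last by lra.
by have := mulr_ge0 (sqr_ge0 s) h; lra.
Qed.

(** [kap l] is convex on the half line and lies above its tangent at [s0]. Integrating the tangent
    inequality yields the two instances of Jensen's inequality used below. *)
Lemma kap_tangent (R : realType) (l s0 s : R) : 0 < l -> 0 <= s0 -> 0 <= s ->
  (s0 ^+ 2 + 2 * s0 * l) / (s0 + l) ^+ 2 * s - s0 ^+ 2 * l / (s0 + l) ^+ 2 <= kap l s.
Proof.
move=> l0 s00 s1.
rewrite -subr_ge0 /kap ger0_norm//.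
have n1 : s + l != 0 by rewrite gt_eqF//; lra.
have n2 : s0 + l != 0 by rewrite gt_eqF//; lra.
rewrite (_ : _ - _ = (l * (s - s0)) ^+ 2 / ((s + l) * (s0 + l) ^+ 2)); last first.
  by field; rewrite n1 n2.
by rewrite divr_ge0 ?sqr_ge0// mulr_ge0 ?sqr_ge0//; lra.
Qed.

Lemma kap_tangent_eq (R : realType) (l s0 : R) : 0 < l -> 0 <= s0 ->
  (s0 ^+ 2 + 2 * s0 * l) / (s0 + l) ^+ 2 * s0 - s0 ^+ 2 * l / (s0 + l) ^+ 2 = kap l s0.
Proof.
move=> l0 s00; have n2 : s0 + l != 0 by rewrite gt_eqF//; lra.
by rewrite /kap ger0_norm//; field.
Qed.

Lemma kap_continuous (R : realType) (l : R) : 0 < l -> continuous (kap l).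
Proof.
move=> l0 s; apply: cvgM; first exact: exprn_continuous.
apply: cvgV; first by rewrite gt_eqF// ltr_wpDl.
by apply: cvgD; [exact: norm_continuous|exact: cvg_cst].
Qed.

Lemma kap_integrable (R : realType) (B : set (measurableTypeR R)) (l : R) (f : R -> R) :
  measurable B -> 0 < l -> mu.-integrable B (EFin \o f) ->
  mu.-integrable B (EFin \o (fun x => kap l (f x))).
Proof.
move=> mB l0 intf.
have mf : measurable_fun B f by have /integrableP[/measurable_EFinP] := intf.
apply: le_integrable (integrable_norm intf) => //.
  apply/measurable_EFinP; apply: measurableT_comp => //.
  by apply: continuous_measurable_fun; exact: kap_continuous.
move=> x Bx /=; rewrite lee_fin ger0_norm ?kap_ge0// normr_id.
exact: kap_le.
Qed.

(** In the numerator of [Hre_eq], u^2 (u + l) equals [kap l u] times (u + l)^2, and u - l <=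
    [kap l u] because u^2 - l^2 <= u^2. Hence [Hre] has no positive part beyond [kap l u]. *)
Lemma Hre_kap (R : realType) (l u v : R) : 0 <= u -> 0 < l ->
  0 <= - Hre l u v + 5 * kap l u.
Proof.
move=> u0 l0; have ul : 0 < u + l by lra.
have N0 : 0 < (u + l) ^+ 2 + v ^+ 2 by rewrite ltr_pwDl ?sqr_ge0// exprn_gt0.
have kE := kap_den l0 u0.
have k0 := kap_ge0 u l0.
rewrite addrC subr_ge0 Hre_eq// ler_pdivrMr//.
set v2 := v ^+ 2; have v20 : 0 <= v2 := sqr_ge0 _.
have h1 : u ^+ 2 * (u + l) = kap l u * (u + l) ^+ 2 by rewrite -kE; ring.
have h2 : v2 * (u - l) <= v2 * kap l u.
  rewrite ler_wpM2l//; rewrite -(ler_pM2r ul) kE; have := sqr_ge0 l; nra.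
have h3 := mulr_ge0 k0 v20; have h4 := mulr_ge0 k0 (sqr_ge0 (u + l)).
by lra.
Qed.

(** Together with the sign in [Hre_kap] this sets up a Chebyshev inequality for the level sets. If u
    > l / 2, then [kap l u] alone is at least l / 6. If u <= l / 2 < l < |v|, the term v^2 (u - l)
    is at most - v^2 l / 2 against a denominator of at most 13/4 v^2, which gains 2 l / 13 > l /
    7. *)
Lemma Hre_kap_large (R : realType) (l u v : R) : 0 <= u -> 0 < l ->
  l < `|v| \/ l < u -> l / 7 <= - Hre l u v + 6 * kap l u.
Proof.
move=> u0 l0 uv; have ul : 0 < u + l by lra.
have kE := kap_den l0 u0.
have k0 := kap_ge0 u l0.
have [lu|lu] := ltP (l / 2) u.
  have h : l / 7 <= kap l u by rewrite -(ler_pM2r ul) kE; nra.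
  have := @Hre_kap _ l u v u0 l0; lra.
have {uv} lv : l < `|v| by case: uv => // h; lra.
have N0 : 0 < (u + l) ^+ 2 + v ^+ 2 by rewrite ltr_pwDl ?sqr_ge0// exprn_gt0.
suff : Hre l u v <= kap l u - l / 7 by lra.
rewrite Hre_eq// ler_pdivrMr//.
have v2 : l ^+ 2 <= v ^+ 2.
  by rewrite -[v ^+ 2]real_normK ?num_real// lerXn2r ?nnegrE ?(ltW l0)// ltW.
have h1 : u ^+ 2 * (u + l) = kap l u * (u + l) ^+ 2 by rewrite -kE; ring.
rewrite h1; set w := v ^+ 2 in v2 *.
have w0 : 0 <= w by apply: le_trans v2; exact: sqr_ge0.
have h3 := mulr_ge0 k0 w0.
have h4 : w * (u - l) <= - (w * (l / 2)) by rewrite -mulrN ler_wpM2l//; lra.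
have h5 : (u + l) ^+ 2 <= (9 / 4) * w.
  have : (u + l) ^+ 2 <= (3 / 2 * l) ^+ 2 by rewrite lerXn2r ?nnegrE; lra.
  by move/le_trans; apply; rewrite exprMn; lra.
have h6 : l * (u + l) ^+ 2 <= l * ((9 / 4) * w) by rewrite ler_wpM2l ?(ltW l0).
have h7 := mulr_ge0 (ltW l0) w0.
by lra.
Qed.

Lemma measurable_inv (R : realType) :
  measurable_fun [set: measurableTypeR R] (@GRing.inv R : measurableTypeR R -> R).
Proof.
have -> : [set: measurableTypeR R] = [set x : R | x != 0] `|` [set 0 : R].
  apply/seteqP; split => // x _ /=; have [->|x0] := eqVneq x 0; [by right|by left].
have o : open [set x : R | x != 0].
  rewrite (_ : [set x : R | x != 0] = ~` [set (0 : R)]); last first.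
    by apply/seteqP; split => x /=; [move/eqP|move/eqP].
  rewrite openC; apply: accessible_closed_set1.
  by apply: hausdorff_accessible; exact: Rhausdorff.
apply/measurable_funU => //; first exact: open_measurable.
split; last exact: measurable_fun_set1.
apply: open_continuous_measurable_fun => // x /set_mem /= x0.
exact: inv_continuous.
Qed.

(* tr f t e is the truncated principal value integral, without the factor 1/pi. *)
Definition ktr (R : realType) (s e : R) : R := if e < `|s| then s^-1 else 0.

Notation tr := (uker (@ktr _)).

Lemma ktr_measurable (R : realType) (t e : R) (B : set (measurableTypeR R)) :
  measurable_fun B (fun x : measurableTypeR R => ktr (x - t) e).
Proof.
apply: measurable_funTS.
have ms : measurable_fun [set: measurableTypeR R] (fun x : measurableTypeR R => x - t).
  by apply: continuous_measurable_fun => x; apply: cvgB; [exact: cvg_id|exact: cvg_cst].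
apply: measurable_fun_ifT => //.
  apply: measurable_fun_ltr => //.
  exact: measurableT_comp.
by apply: measurableT_comp => //; exact: measurable_inv.
Qed.

Lemma ktr_le (R : realType) (s e : R) : 0 < e -> `|ktr s e| <= e^-1.
Proof.
move=> e0; rewrite /ktr; case: ifPn => [es|_]; last by rewrite normr0 invr_ge0 ltW.
have s0 := lt_trans e0 es.
by rewrite normfV lef_pV2 ?posrE ?normrV// ltW.
Qed.

(** Beyond e the difference 1/s - s / (s^2 + e^2) equals e^2 / (s (s^2 + e^2)); below e only [qker]
    is left and |s| <= e. This transfers bounds from the Cauchy integral at height e to the sharp
    truncation at e. *)
Lemma ktr_qker_dist (R : realType) (s e : R) : 0 < e ->
  `|ktr s e - qker s e| <= pker s e.
Proof.
move=> e0.
have n := ssqr_gt0 s e0.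
rewrite /ktr; case: ifPn => [es|]; last first.
  rewrite -leNgt => es; rewrite sub0r normrN /qker /pker normrM normfV (gtr0_norm n).
  by rewrite ler_pM2r ?invr_gt0.
have s0 : s != 0 by rewrite -normr_eq0 gt_eqF// (lt_trans e0).
have -> : s^-1 - qker s e = e ^+ 2 / (s * (s ^+ 2 + e ^+ 2)).
  by rewrite /qker; field; rewrite s0 gt_eqF.
rewrite /pker normf_div [`|s * _|]normrM (gtr0_norm n) (gtr0_norm (exprn_gt0 2 e0)).
rewrite invfM mulrA ler_pM2r ?invr_gt0// ler_pdivrMr ?(lt_trans e0)//.
by rewrite expr2 ler_pM2l// ltW.
Qed.

Lemma tonelli2 (R : realType) (A B : set (measurableTypeR R))
    (g : measurableTypeR R * measurableTypeR R -> R) :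
  measurable A -> measurable B -> measurable_fun (A `*` B) g ->
  (forall t x, A t -> B x -> 0 <= g (t, x)) ->
  measurable_fun A (fun t => \int[mu]_(x in B) (g (t, x))%:E)%E /\
  (\int[mu]_(t in A) \int[mu]_(x in B) (g (t, x))%:E =
   \int[mu]_(x in B) \int[mu]_(t in A) (g (t, x))%:E)%E.
Proof.
move=> mA mB mg g0.
have mAB : measurable (A `*` B) by exact: measurableX.
pose h := (EFin \o g) \_ (A `*` B).
have mh : measurable_fun setT h.
  by apply/(measurable_restrictT _ _).1 => //; exact/measurable_EFinP.
have h0 z : (0 <= h z)%E.
  rewrite /h /patch; case: ifPn => // /set_mem; case: z => t x [/= At Bx].
  by rewrite lee_fin g0.
have E t : A t -> (\int[mu]_(x in B) (g (t, x))%:E = \int[mu]_x h (t, x))%E.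
  move=> At; rewrite integral_mkcond; apply: eq_integral => x _.
  rewrite /h /patch; congr (if _ then _ else _).
  by apply/idP/idP => /set_mem; [move=> Bx; apply/mem_set|case=> _ Bx; apply/mem_set].
have E' x : B x -> (\int[mu]_(t in A) (g (t, x))%:E = \int[mu]_t h (t, x))%E.
  move=> Bx; rewrite integral_mkcond; apply: eq_integral => t _.
  rewrite /h /patch; congr (if _ then _ else _).
  by apply/idP/idP => /set_mem; [move=> At; apply/mem_set|case=> At _; apply/mem_set].
have Z t : ~ A t -> (\int[mu]_x h (t, x) = 0)%E.
  move=> At; apply: integral0_eq => x _; rewrite /h /patch ifF//.
  by apply/negP => /set_mem [].
have Z' x : ~ B x -> (\int[mu]_t h (t, x) = 0)%E.
  move=> Bx; apply: integral0_eq => t _; rewrite /h /patch ifF//.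
  by apply/negP => /set_mem [].
split.
  have := measurable_fun_fubini_tonelli_F (m2 := mu) h mh h0.
  move/(@measurable_funS _ _ _ _ setT A) => /(_ measurableT (@subsetT _ _)).
  by apply: eq_measurable_fun => t /set_mem At; rewrite /fubini_F E.
transitivity (\int[mu]_t \int[mu]_x h (t, x))%E.
  rewrite integral_mkcond; apply: eq_integral => t _.
  rewrite /patch; case: ifPn => [/set_mem|/negP] At; first exact: E.
  by rewrite Z// => /mem_set.
rewrite (fubini_tonelli h mh h0) [RHS]integral_mkcond.
apply: eq_integral => x _; rewrite /patch; case: ifPn => [/set_mem|/negP] Bx; first by rewrite E'.
by rewrite Z'// => /mem_set.
Qed.

Lemma shift_kernel_measurable (R : realType) (k : R -> R) (f : R -> R)
    (A B : set (measurableTypeR R)) :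
  measurable A -> measurable B ->
  measurable_fun setT (k : measurableTypeR R -> R) ->
  measurable_fun B (f : measurableTypeR R -> R) ->
  measurable_fun (A `*` B)
    (fun z : measurableTypeR R * measurableTypeR R => f z.2 * k (z.2 - z.1)).
Proof.
move=> mA mB mk mf.
have mAB : measurable (A `*` B) by exact: measurableX.
apply: measurable_funM.
  apply: (@measurable_comp _ _ _ _ _ _ B f) => //.
    by move=> _ [z [_ Bz] <-].
  by apply: measurable_funTS; exact: measurable_snd.
apply: measurable_funTS; apply: measurableT_comp => //.
by apply: measurable_funB; [exact: measurable_snd|exact: measurable_fst].
Qed.

Lemma Rintegral_lee (R : realType) (B : set (measurableTypeR R)) (f : R -> R) :
  measurable B -> mu.-integrable B (EFin \o f) ->
  (\int[mu]_(x in B) (f x)%:E = (\int[mu]_(x in B) f x)%:E)%E.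
Proof.
by move=> mB intf; rewrite /Rintegral fineK//; exact: integrable_fin_num.
Qed.

Lemma pi_le4 (R : realType) : (pi : R) <= 4.
Proof. by have /andP[_] := @pihalf_02 R; lra. Qed.

Lemma integrableZ_R (R : realType) (B : set (measurableTypeR R)) (f : R -> R) (c : R) :
  measurable B -> mu.-integrable B (EFin \o f) ->
  mu.-integrable B (EFin \o (fun x => c * f x)).
Proof.
move=> mB intf; have := integrableZl mB c intf.
by apply: eq_integrable => // x _ /=; rewrite EFinM.
Qed.

Lemma integrableD_R (R : realType) (B : set (measurableTypeR R)) (f g : R -> R) :
  measurable B -> mu.-integrable B (EFin \o f) -> mu.-integrable B (EFin \o g) ->
  mu.-integrable B (EFin \o (fun x => f x + g x)).
Proof.
move=> mB intf intg; have := integrableD mB intf intg.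
by apply: eq_integrable => // x _ /=; rewrite EFinD.
Qed.

Lemma integrableB_R (R : realType) (B : set (measurableTypeR R)) (f g : R -> R) :
  measurable B -> mu.-integrable B (EFin \o f) -> mu.-integrable B (EFin \o g) ->
  mu.-integrable B (EFin \o (fun x => f x - g x)).
Proof.
move=> mB intf intg; have := integrableB mB intf intg.
by apply: eq_integrable => // x _ /=; rewrite EFinB.
Qed.

Lemma Rintegral_cstI (R : realType) (c : R) :
  \int[mu]_(t in (I1 : set (measurableTypeR R))) (cst c t) = 2 * c.
Proof.
have E : @lebesgue_measure R I1 = 2%:E.
  rewrite lebesgue_measure_itv /= lte_fin ifT; last by lra.
  by rewrite -EFinD; congr EFin; lra.
rewrite Rintegral_cst; last exact: mI1.
by transitivity (c * fine (2%:E : \bar R)); [congr (_ * fine _)|rewrite mulrC].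
Qed.

Lemma integrable_cstI (R : realType) (c : R) :
  mu.-integrable (I1 : set (measurableTypeR R)) (EFin \o cst c).
Proof.
apply: (@integrableS _ _ _ mu `[(-1:R), 1]%classic) => //.
- by apply: subset_itv_oo_cc.
by apply: continuous_compact_integrable; [exact: segment_compact|move=> ?; exact: cvg_cst].
Qed.

(** The total mass of the Poisson kernel is pi, by the primitive atan ((x - t) / y), rounded up to
    4. *)
Lemma pker_int_le (R : realType) (B : set (measurableTypeR R)) (t y : R) :
  measurable B -> (B `<=` S3) -> 0 < y ->
  (\int[mu]_(x in B) (pker (x - t) y)%:E <= 4%:E)%E.
Proof.
move=> mB B3 y0.
have cp : continuous (fun x : R => pker (x - t) y).
  move=> x; apply: (@continuous_comp _ _ _ (fun x => x - t) (@pker R ^~ y)); last exact: continuous_pker.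
  by apply: cvgB; [exact: cvg_id|exact: cvg_cst].
have mS : measurable (S3 : set (measurableTypeR R)) by exact: measurable_itv.
apply: (@le_trans _ _ (\int[mu]_(x in S3) (pker (x - t) y)%:E)%E).
  apply: ge0_subset_integral => //.
    by apply/measurable_EFinP; apply: measurable_funTS; exact: continuous_measurable_fun.
  by move=> x _; rewrite lee_fin pker_ge0.
rewrite Rintegral_lee//; last first.
  by apply: continuous_compact_integrable; [exact: segment_compact|exact: continuous_subspaceT].
rewrite lee_fin.
have dF (x : R) : is_derive x 1 (fun x => atan ((x - t) / y)) (pker (x - t) y).
  have d1 : is_derive x 1 (fun x : R => (x - t) / y) (y^-1).
    have d0 : is_derive x 1 (fun x : R => x - t) 1.
      have := is_deriveB (@is_derive_id _ _ x (1:R)) (@is_derive_cst _ _ _ t x (1:R)).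
      by move=> h; apply: (is_derive_eq h); rewrite subr0.
    have := is_deriveZ (y^-1) d0 => h.
    rewrite (_ : (fun x : R => (x - t) / y) = (fun x : R => y^-1 *: (x - t))).
      by apply: (is_derive_eq h); rewrite /GRing.scale /= mulr1.
    by apply/funext => z; rewrite /GRing.scale /= mulrC.
  have := @is_derive1_comp R atan (fun x : R => (x - t) / y) x _ _ (is_derive1_atan ((x - t) / y)) d1.
  move=> h; apply: (is_derive_eq h); rewrite /pker.
  have := ssqr_gt0 (x - t) y0 => n.
  have n1 : 1 + ((x - t) / y) ^+ 2 != 0 by rewrite gt_eqF// ltr_pwDl// sqr_ge0.
  have yn : y != 0 by rewrite gt_eqF.
  field; rewrite yn (gt_eqF n) andbT /=.
  by [].
have lt33 : (-3 : R) < 3 by lra.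
rewrite (FTC_derive lt33 dF cp).
have := @atan_ltpi2 R ((3 - t) / y); have := @atan_gtNpi2 R ((-3 - t) / y).
by have := @pi_le4 R; lra.
Qed.

Lemma uker_kap (R : realType) (f : R -> R) (l d : R) :
  L1 f -> (forall x, 0 <= f x) -> 0 < l -> 0 < d ->
  forall t, kap l (uker (@pker R) f t d) <=
    4 * \int[mu]_(x in I1) (kap l (f x) * pker (x - t) d).
Proof.
move=> intf f0 l0 d0 t; have mI := @mI1 R.
have mk : measurable_fun (I1 : set (measurableTypeR R)) (fun x => pker (x - t) d).
  by apply: (@continuous_shift_measurable _ (@pker R ^~ d)) => //; exact: continuous_pker.
have kb x : I1 x -> `|pker (x - t) d| <= d^-1 by move=> _; exact: pker_le.
have ip g : L1 g ->
    L1 (fun x => g x * pker (x - t) d).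
  by move=> ig; exact: integrable_bounded_mul ig mk kb.
have ik := ip _ (kap_integrable mI l0 intf).
have i1 := @integrable_cstI R 1.
have ip1 : L1 (fun x => pker (x - t) d).
  by apply: eq_integrable (ip _ i1) => // x _ /=; rewrite mul1r.
set u := uker (@pker R) f t d.
have u0 : 0 <= u by apply: uker_ge0 => // s; exact: pker_ge0.
set p := \int[mu]_(x in I1) pker (x - t) d.
have p4 : p <= 4.
  rewrite -lee_fin /p -Rintegral_lee//; apply: pker_int_le => //.
  by move=> x; rewrite /= !in_itv /= => /andP[? ?]; apply/andP; split; lra.
(* Jensen's inequality for a kernel whose mass p is at most 4 but not normalized: the tangent at u /
   4 gives 4 [kap l s0] <= a u - b p, and [kap_scale] returns from u / 4 to u at the price of 16. *)
set s0 := u / 4; have s00 : 0 <= s0 by rewrite divr_ge0.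
pose a := (s0 ^+ 2 + 2 * s0 * l) / (s0 + l) ^+ 2.
pose b := s0 ^+ 2 * l / (s0 + l) ^+ 2.
have b0 : 0 <= b.
  by rewrite /b divr_ge0 ?sqr_ge0// mulr_ge0 ?sqr_ge0// ltW.
have E : \int[mu]_(x in I1) (a * (f x * pker (x - t) d) - b * pker (x - t) d) <=
    \int[mu]_(x in I1) (kap l (f x) * pker (x - t) d).
  apply: le_Rintegral => //.
    by apply: integrableB_R => //; apply: integrableZ_R => //; exact: ip.
  move=> x _; rewrite mulrA -mulrBl ler_wpM2r ?pker_ge0//.
  exact: kap_tangent.
have E2 : \int[mu]_(x in I1) (a * (f x * pker (x - t) d) - b * pker (x - t) d) = a * u - b * p.
  have ifp := ip _ intf.
  rewrite RintegralB//; last 2 first.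
    exact: integrableZ_R.
    exact: integrableZ_R.
  by congr (_ - _); rewrite RintegralZl.
rewrite E2 in E.
have ks0 := kap_tangent_eq l0 s00; rewrite -/a -/b in ks0.
have us : u = 4 * s0 by rewrite /s0; lra.
have h : 4 * kap l s0 <= a * u - b * p.
  by rewrite -ks0 us; have := ler_wpM2l b0 p4; lra.
have h2 : kap l u <= 16 * kap l s0.
  rewrite us; apply: le_trans (kap_scale _ _ _) _ => //; first by lra.
  by rewrite (_ : 4 ^+ 2 = 16)//; rewrite expr2; lra.
by lra.
Qed.

(** Jensen's inequality on an interval of length 2, with the tangent at the mean m / 2. It turns the
    contour bound of [Hre_bottom] into an integral of [kap l] of f. *)
Lemma kap_mass (R : realType) (f : R -> R) (l : R) (m := \int[mu]_(x in I1) f x) :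
  L1 f -> (forall x, 0 <= f x) -> 0 < l ->
  m ^+ 2 / (m + l) <= 2 * \int[mu]_(x in I1) kap l (f x).
Proof.
move=> intf f0 l0; have mI := @mI1 R.
have m0 : 0 <= m by exact: Rintegral_ge0.
set s0 := m / 2; have s00 : 0 <= s0 by rewrite divr_ge0.
pose a := (s0 ^+ 2 + 2 * s0 * l) / (s0 + l) ^+ 2.
pose b := s0 ^+ 2 * l / (s0 + l) ^+ 2.
have ia : L1 (fun x => a * f x).
  exact: integrableZ_R.
have E : \int[mu]_(x in I1) (a * f x - cst b x) <= \int[mu]_(x in I1) kap l (f x).
  apply: le_Rintegral => //.
  - by apply: integrableB_R => //; exact: integrable_cstI.
  - exact: kap_integrable.
  - by move=> x _; exact: kap_tangent.
rewrite RintegralB// in E; last exact: integrable_cstI.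
rewrite RintegralZl// Rintegral_cstI -/m in E.
have ks0 := kap_tangent_eq l0 s00; rewrite -/a -/b in ks0.
have ms : m = 2 * s0 by rewrite /s0; lra.
have h : 2 * kap l s0 <= \int[mu]_(x in I1) kap l (f x).
  by rewrite -ks0; move: E; rewrite ms; lra.
suff : m ^+ 2 / (m + l) <= 4 * kap l s0 by lra.
rewrite ms /kap (ger0_norm s00) mulrA ler_pdivrMr; last by lra.
rewrite mulrAC ler_pdivlMr; last by lra.
by have := mulr_ge0 (sqr_ge0 s0) s00; have := mulr_ge0 (sqr_ge0 s0) (ltW l0); lra.
Qed.

Lemma uker_measurable (R : realType) (k : R -> R -> R) (f : R -> R) (y C : R)
    (A : set (measurableTypeR R)) : measurable A ->
  L1 f ->
  measurable_fun setT (k ^~ y : measurableTypeR R -> R) ->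
  (forall s, `|k s y| <= C) ->
  measurable_fun A (fun t : measurableTypeR R => uker k f t y).
Proof.
move=> mA; wlog f0 : f / (forall x, 0 <= f x).
  move=> W intf mk kC; have mI := @mI1 R.
  have ip : L1 (f^\+) by exact: integrable_funrpos.
  have iN : L1 (f^\-) by exact: integrable_funrneg.
  have mkt t : measurable_fun (I1 : set (measurableTypeR R)) (fun x => k (x - t) y).
    apply: measurable_funTS; apply: (@measurableT_comp _ _ _ _ _ _ (k ^~ y)) => //.
    by apply: measurable_funB => //.
  have -> : (fun t => uker k f t y) = (fun t => uker k f^\+ t y - uker k f^\- t y).
    apply/funext => t; rewrite /uker -RintegralB//; last 2 first.
      by apply: (@integrable_bounded_mul _ _ _ _ C).
      by apply: (@integrable_bounded_mul _ _ _ _ C).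
    apply: eq_Rintegral => x _; rewrite -mulrBl; congr (_ * _).
    by rewrite -[in LHS](funrposBneg f).
  by apply: measurable_funB; apply: W.
move=> intf mk kC; have mI := @mI1 R.
have mf : measurable_fun I1 (f : measurableTypeR R -> R).
  by have /integrableP[/measurable_EFinP] := intf.
pose k' s := k s y + C.
have k'0 s : 0 <= k' s by rewrite /k'; have := kC s; rewrite ler_norml => /andP[h _]; lra.
have mk' : measurable_fun setT (k' : measurableTypeR R -> R) by exact: measurable_funD.
have mg := shift_kernel_measurable mA mI mk' mf.
have [h _] := @tonelli2 R A I1 (fun z => f z.2 * k' (z.2 - z.1)) mA mI mg
  (fun t x _ _ => mulr_ge0 (f0 x) (k'0 _)).
have mkt t : measurable_fun (I1 : set (measurableTypeR R)) (fun x => k (x - t) y).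
  apply: measurable_funTS; apply: (@measurableT_comp _ _ _ _ _ _ (k ^~ y)) => //.
  by apply: measurable_funB => //.
have -> : (fun t => uker k f t y) = (fun t => fine (\int[mu]_(x in I1) (f x * k' (x - t))%:E)%E - C * \int[mu]_(x in I1) f x).
  apply/funext => t; rewrite -/(Rintegral _ _ _) /uker.
  rewrite (_ : \int[mu]_(x in I1) (f x * k' (x - t)) =
     \int[mu]_(x in I1) (f x * k (x - t) y) + \int[mu]_(x in I1) (f x * C)); last first.
    rewrite -RintegralD//.
    - by apply: eq_Rintegral => x _; rewrite /k' mulrDr.
    - by apply: (@integrable_bounded_mul _ _ _ _ C).
    - by apply: (@integrable_bounded_mul _ _ _ _ `|C|).
  by rewrite RintegralZr// mulrC addrK.
apply: measurable_funB => //.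
apply: (@measurableT_comp _ _ _ _ _ _ fine) => //.
Qed.

Lemma pker_kernel (R : realType) (d : R) : 0 < d ->
  measurable_fun setT (@pker R ^~ d : measurableTypeR R -> R).
Proof. by move=> d0; apply: continuous_measurable_fun; exact: continuous_pker. Qed.

Lemma uker_pker_continuous (R : realType) (f : R -> R) (d : R) :
  L1 f -> 0 < d -> continuous (fun t => uker (@pker R) f t d).
Proof.
move=> intf d0; apply: (@uker_continuous _ _ _ _ d^-1) => //.
  exact: continuous_pker.
by move=> s; exact: pker_le.
Qed.

Lemma uker_qker_continuous (R : realType) (f : R -> R) (d : R) :
  L1 f -> 0 < d -> continuous (fun t => uker (@qker R) f t d).
Proof.
move=> intf d0; apply: (@uker_continuous _ _ _ _ d^-1) => //.
  exact: continuous_qker.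
by move=> s; exact: qker_le.
Qed.

Lemma continuous_S3 (R : realType) (g : R -> R) : continuous g ->
  mu.-integrable (S3 : set (measurableTypeR R)) (EFin \o g).
Proof.
move=> cg; apply: continuous_compact_integrable; first exact: segment_compact.
exact: continuous_subspaceT.
Qed.

Lemma tonelli_kernel_le (R : realType) (A B : set (measurableTypeR R))
    (k g : R -> R) (c : R) :
  measurable A -> measurable B -> 0 <= c ->
  measurable_fun setT (k : measurableTypeR R -> R) -> (forall s, 0 <= k s) ->
  measurable_fun B (g : measurableTypeR R -> R) -> (forall x, 0 <= g x) ->
  (forall x, B x -> \int[mu]_(t in A) (k (x - t))%:E <= c%:E)%E ->
  measurable_fun A (fun t => \int[mu]_(x in B) (g x * k (x - t))%:E)%E /\
  (\int[mu]_(t in A) \int[mu]_(x in B) (g x * k (x - t))%:E <=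
   c%:E * \int[mu]_(x in B) (g x)%:E)%E.
Proof.
move=> mA mB c0 mk k0 mg g0 kc.
have mh := shift_kernel_measurable mA mB mk mg.
have [m1 T] := tonelli2 mA mB mh (fun t x _ _ => mulr_ge0 (g0 x) (k0 (x - t))).
split; first exact: m1.
rewrite [X in (X <= _)%E]T /= {T m1 mh}.
have mh : measurable_fun (B `*` A) (fun z : measurableTypeR R * measurableTypeR R =>
    g z.1 * k (z.1 - z.2)).
  apply: measurable_funM.
    apply: (@measurable_comp _ _ _ _ _ _ B g).
    - exact: mB.
    - by move=> _ [z [Bz _] <-].
    - exact: mg.
    - by apply: measurable_funTS; exact: measurable_fst.
  apply: measurable_funTS; apply: (@measurableT_comp _ _ _ _ _ _ k); first exact: mk.
  by apply: measurable_funB; [exact: measurable_fst|exact: measurable_snd].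
have [m1 _] := tonelli2 mB mA mh (fun x t _ _ => mulr_ge0 (g0 x) (k0 (x - t))).
rewrite /= in m1; move: mh => _.
rewrite -ge0_integralZl; last 4 first.
- exact: mB.
- exact/measurable_EFinP.
- by move=> x _; rewrite lee_fin.
- by rewrite lee_fin.
apply: ge0_le_integral.
- exact: mB.
- by move=> x _; apply: integral_ge0 => t _; rewrite lee_fin mulr_ge0.
- exact: m1.
- by apply: measurable_funeM; exact/measurable_EFinP.
- move=> x Bx.
  have -> : (\int[mu]_(t in A) (g x * k (x - t))%:E =
      \int[mu]_(t in A) ((g x)%:E * (k (x - t))%:E))%E.
    by apply: eq_integral => t _; rewrite EFinM.
  rewrite ge0_integralZl; last 4 first.
  + exact: mA.
  + apply/measurable_EFinP; apply: measurable_funTS.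
    apply: (@measurableT_comp _ _ _ _ _ _ k); first exact: mk.
    exact: measurable_funB.
  + by move=> t _; rewrite lee_fin.
  + by rewrite lee_fin.
  by rewrite [X in (_ <= X)%E]muleC; apply: lee_wpmul2l; [rewrite lee_fin|exact: kc].
Qed.

Lemma uker_kap_int (R : realType) (f : R -> R) (l d : R) :
  L1 f -> (forall x, 0 <= f x) -> 0 < l -> 0 < d ->
  \int[mu]_(t in S3) kap l (uker (@pker R) f t d) <=
    16 * \int[mu]_(x in I1) kap l (f x).
Proof.
move=> intf f0 l0 d0; have mI := @mI1 R.
have mS : measurable (S3 : set (measurableTypeR R)) by exact: measurable_itv.
have ik := kap_integrable mI l0 intf.
have cu : continuous (fun t => kap l (uker (@pker R) f t d)).
  move=> t; apply: (@continuous_comp _ _ _ (fun t => uker (@pker R) f t d) (kap l)).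
    exact: uker_pker_continuous.
  exact: kap_continuous.
rewrite -lee_fin -Rintegral_lee//; last exact: continuous_S3.
have mk : measurable_fun I1 ((fun x => kap l (f x)) : measurableTypeR R -> R).
  by have /integrableP[/measurable_EFinP] := ik.
have psym (x : R) : I1 x -> (\int[mu]_(t in S3) (pker (x - t) d)%:E <= 4%:E)%E.
  move=> _; rewrite (_ : integral _ _ _ = \int[mu]_(t in S3) (pker (t - x) d)%:E)%E.
    by apply: pker_int_le.
  by apply: eq_integral => t _; rewrite /pker -[(x - t) ^+ 2]sqrrN opprB.
have [m1 T] := @tonelli_kernel_le R S3 I1 (@pker R ^~ d) (fun x => kap l (f x)) 4
  mS mI (ler0n _ _) (pker_kernel d0) (fun s => pker_ge0 s d0) mk (fun x => kap_ge0 (f x) l0) psym.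
have mkt t : measurable_fun (I1 : set (measurableTypeR R)) (fun x => pker (x - t) d).
  by apply: (@continuous_shift_measurable _ (@pker R ^~ d)); [exact: continuous_pker|exact: mI].
have ikp t : L1 (fun x => kap l (f x) * pker (x - t) d).
  apply: (@integrable_bounded_mul _ _ _ _ d^-1); [exact: mI|exact: ik|exact: mkt|].
  by move=> x _; exact: pker_le.
have p0 t x : (0 <= (kap l (f x) * pker (x - t) d)%:E)%E.
  by rewrite lee_fin mulr_ge0 ?kap_ge0 ?pker_ge0.
have s1 : (\int[mu]_(t in S3) (kap l (uker (@pker R) f t d))%:E <=
    \int[mu]_(t in S3) (4%:E * \int[mu]_(x in I1) (kap l (f x) * pker (x - t) d)%:E))%E.
  apply: ge0_le_integral.
  - exact: mS.
  - by move=> t _; rewrite lee_fin kap_ge0.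
  - by apply/measurable_EFinP; apply: measurable_funTS; exact: continuous_measurable_fun.
  - by apply: measurable_funeM; exact: m1.
  - by move=> t _; rewrite (Rintegral_lee mI (ikp t)) -EFinM lee_fin; exact: uker_kap.
apply: (le_trans s1).
rewrite ge0_integralZl; last 4 first.
- exact: mS.
- exact: m1.
- by move=> t _; apply: integral_ge0 => x _; exact: p0.
- by rewrite lee_fin.
have -> : 16 * \int[mu]_(x in I1) kap l (f x) = 4 * (4 * \int[mu]_(x in I1) kap l (f x)) by ring.
rewrite EFinM; apply: lee_wpmul2l; first by rewrite lee_fin.
by apply: le_trans T _; rewrite Rintegral_lee.
Qed.

Lemma ktr_kernel (R : realType) (d : R) :
  measurable_fun setT (@ktr R ^~ d : measurableTypeR R -> R).
Proof.
have := @ktr_measurable R 0 d setT; congr measurable_fun.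
by apply/funext => x; rewrite subr0.
Qed.

Lemma tr_le_uv (R : realType) (f : R -> R) (t d : R) :
  L1 f -> (forall x, 0 <= f x) -> 0 < d ->
  `|tr f t d| <= `|uker (@qker R) f t d| + uker (@pker R) f t d.
Proof.
move=> intf f0 d0; have mI := @mI1 R.
have ik (k : R -> R -> R) (C : R) : measurable_fun (I1 : set (measurableTypeR R)) (fun x => k (x - t) d) ->
    (forall s, `|k s d| <= C) ->
    L1 (fun x => f x * k (x - t) d).
  by move=> mk kC; apply: (@integrable_bounded_mul _ _ _ _ C).
have i1 := ik (@ktr R) _ (@ktr_measurable R t d I1) (fun s => ktr_le s d0).
have i2 : L1 (fun x => f x * pker (x - t) d).
  apply: (ik _ d^-1); last by move=> s; exact: pker_le.
  by apply: (@continuous_shift_measurable _ (@pker R ^~ d)) => //; exact: continuous_pker.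
have i3 : L1 (fun x => f x * qker (x - t) d).
  apply: (ik _ d^-1); last by move=> s; exact: qker_le.
  by apply: (@continuous_shift_measurable _ (@qker R ^~ d)) => //; exact: continuous_qker.
rewrite -lerBlDl; apply: le_trans (lerB_dist _ _) _.
rewrite /uker -RintegralB//.
have i4 := integrableB_R mI i1 i3.
rewrite (le_trans (le_normr_Rintegral mI i4))//.
apply: le_Rintegral => //; first exact: integrable_norm i4.
move=> x _; rewrite -mulrBr normrM ger0_norm// ler_wpM2l//.
exact: ktr_qker_dist.
Qed.

(** Taken in [-3,3] and not in (-1,1): Cotlar's argument picks points at distance less than 1 from a
    point of (-1,1), possibly outside that interval. *)
Definition tr_level (R : realType) (f : R -> R) (l d : R) : set (measurableTypeR R) :=
  [set t | S3 t /\ l < `|tr f t d|].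

Lemma tr_level_measurable (R : realType) (f : R -> R) (l d : R) :
  L1 f -> 0 < d -> measurable (tr_level f l d).
Proof.
move=> intf d0.
have mS : measurable (S3 : set (measurableTypeR R)) by exact: measurable_itv.
have mT : measurable_fun S3 (fun t : measurableTypeR R => tr f t d).
  by apply: (@uker_measurable _ _ _ _ d^-1) => //; [exact: ktr_kernel|move=> s; exact: ktr_le].
have mN : measurable_fun S3 (fun t : measurableTypeR R => `|tr f t d|).
  exact: measurableT_comp.
have := mN mS `]l, +oo[%classic (measurable_itv _); congr measurable.
by apply/seteqP; split => t /=; rewrite /tr_level /= !in_itv /= ?andbT => -[].
Qed.

Lemma tr_weak_ge0 (R : realType) (f : R -> R) (l d : R) :
  L1 f -> (forall x, 0 <= f x) -> 0 < l -> 0 < d ->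
  (l%:E * mu (tr_level f l d) <=
   ((60 * 100) * \int[mu]_(x in I1) kap l (f x))%:E)%E.
Proof.
move=> intf f0 l0 d0; have mI := @mI1 R.
have mS : measurable (S3 : set (measurableTypeR R)) by exact: measurable_itv.
(* The final arithmetic: 14 (56 * 2 + 6 * 16) * 2 = 5824, rounded up to 6000. *)
have fin (a b c e q : R) : 0 <= b -> - (56 * q) <= c -> e <= 16 * a -> q <= 2 * a -> a <= 2 * b ->
    14 * (- c + 6 * e) <= (60 * 100) * b.
  by move=> b0 h1 h2 h3 h4; lra.
(* By [tr_le_uv] a truncation above l forces |v| or u above l / 2, which is the alternative required
   by [Hre_kap_large]. *)
pose k := l / 2; have k0 : 0 < k by rewrite divr_gt0.
pose u t := uker (@pker R) f t d; pose v t := uker (@qker R) f t d.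
have u0 t : 0 <= u t by apply: uker_ge0 => // s; exact: pker_ge0.
have cu : continuous u by exact: uker_pker_continuous.
have cv : continuous v by exact: uker_qker_continuous.
set E := tr_level f l d.
have mE : measurable E by exact: tr_level_measurable.
have cN : continuous (fun t => (u t + k) ^+ 2 + v t ^+ 2).
  move=> t; have cX (h : R -> R) (z : R) : h x @[x --> t] --> z -> h x ^+ 2 @[x --> t] --> z ^+ 2.
    by move=> hz; under eq_fun do rewrite expr2; rewrite expr2; exact: cvgM.
  apply: cvgD; apply: cX; last exact: cv.
  by apply: cvgD; [exact: cu|exact: cvg_cst].
have cH : continuous (fun t => Hre k (u t) (v t)).
  move=> t; apply: cvgD; first by apply: cvgB; [exact: cu|exact: cvg_cst].
  apply: cvgM; last first.
    by apply: cvgV; [rewrite gt_eqF// ltr_pwDl ?sqr_ge0// exprn_gt0// ltr_wpDl|exact: cN].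
  by apply: cvgM; [exact: cvg_cst|apply: cvgD; [exact: cu|exact: cvg_cst]].
have ck : continuous (fun t => kap k (u t)).
  move=> t; apply: (@continuous_comp _ _ _ u (kap k)); [exact: cu|exact: kap_continuous].
have Hk t : 0 <= - Hre k (u t) (v t) + 6 * kap k (u t).
  by have := Hre_kap (v t) (u0 t) k0; have := kap_ge0 (u t) k0; lra.
have cg : continuous (fun t => - Hre k (u t) (v t) + 6 * kap k (u t)).
  move=> t; apply: cvgD; first by apply: cvgN; exact: cH.
  by apply: cvgM; [exact: cvg_cst|exact: ck].
have s1 : ((k / 7)%:E * mu E <=
   \int[mu]_(t in S3) (- Hre k (u t) (v t) + 6 * kap k (u t))%:E)%E.
  have ES : E `<=` S3 by move=> t [].
  rewrite -integral_cst//.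
  apply: (@le_trans _ _ (\int[mu]_(t in E) (- Hre k (u t) (v t) + 6 * kap k (u t))%:E)%E).
    apply: ge0_le_integral => //.
    - by move=> t _; rewrite lee_fin divr_ge0// ltW.
    - by apply/measurable_EFinP; apply: measurable_funTS; exact: continuous_measurable_fun.
    - move=> t [_ lt]; rewrite lee_fin; apply: Hre_kap_large => //.
      have := tr_le_uv t intf f0 d0; rewrite -/(u t) -/(v t) => h.
      have [h1|h1] := ltP k `|v t|; first by left.
      by right; rewrite /k in h1 *; lra.
  apply: ge0_subset_integral => //.
  - by apply/measurable_EFinP; apply: measurable_funTS; exact: continuous_measurable_fun.
  - by move=> t _; rewrite lee_fin.
rewrite Rintegral_lee// in s1; last exact: continuous_S3.
have e1 : \int[mu]_(t in S3) (- Hre k (u t) (v t) + 6 * kap k (u t)) =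
    - (\int[mu]_(t in S3) Hre k (u t) (v t)) + 6 * (\int[mu]_(t in S3) kap k (u t)).
  have i1 := continuous_S3 cH; have i2 := continuous_S3 ck.
  rewrite RintegralD//; last first.
    exact: integrableZ_R.
    by have := integrableZ_R (-1) mS i1; apply: eq_integrable => // x _ /=; rewrite mulN1r.
  rewrite RintegralZl//; congr (_ + _).
  rewrite -[RHS]mulN1r -RintegralZl//.
  by apply: eq_Rintegral => x _; rewrite mulN1r.
have h1 := Hre_bottom intf f0 k0 d0.
have h2 := uker_kap_int intf f0 k0 d0.
have h3 := kap_mass intf f0 k0.
have h4 : \int[mu]_(x in I1) kap k (f x) <= 2 * \int[mu]_(x in I1) kap l (f x).
  rewrite -RintegralZl//; last exact: kap_integrable.
  apply: le_Rintegral => //; first exact: kap_integrable.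
    by apply: integrableZ_R => //; exact: kap_integrable.
  by move=> x _; exact: kap_half.
have -> : (l%:E = 14%:E * (k / 7)%:E)%E.
  by rewrite -EFinM; congr EFin; rewrite /k; field.
rewrite -muleA.
apply: (@le_trans _ _ (14%:E * (\int[mu]_(t in S3) (- Hre k (u t) (v t) + 6 * kap k (u t)))%R%:E)%E).
  by apply: lee_wpmul2l => //; rewrite lee_fin.
rewrite -EFinM lee_fin e1.
move: h1; rewrite ler_norml => /andP[h1 _].
by apply: (fin _ _ _ _ _ _ h1 h2 h3 h4); apply: Rintegral_ge0 => x _; exact: kap_ge0.
Qed.

Lemma ktr_integrable (R : realType) (f : R -> R) (t d : R) :
  L1 f -> 0 < d ->
  L1 (fun x => f x * ktr (x - t) d).
Proof.
move=> intf d0; apply: (@integrable_bounded_mul _ _ _ _ d^-1).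
- exact: mI1.
- exact: intf.
- exact: ktr_measurable.
- by move=> x _; exact: ktr_le.
Qed.

Lemma trB (R : realType) (f g : R -> R) (t d : R) :
  L1 f -> L1 g -> 0 < d ->
  tr (fun x => f x - g x) t d = tr f t d - tr g t d.
Proof.
move=> intf intg d0; rewrite /uker -RintegralB.
- by apply: eq_Rintegral => x _; rewrite mulrBl.
- exact: mI1.
- exact: ktr_integrable.
- exact: ktr_integrable.
Qed.

Lemma trD (R : realType) (f g : R -> R) (t d : R) :
  L1 f -> L1 g -> 0 < d ->
  tr (fun x => f x + g x) t d = tr f t d + tr g t d.
Proof.
move=> intf intg d0; rewrite /uker -RintegralD.
- by apply: eq_Rintegral => x _; rewrite mulrDl.
- exact: mI1.
- exact: ktr_integrable.
- exact: ktr_integrable.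
Qed.

Lemma trZ (R : realType) (c : R) (f : R -> R) (t d : R) :
  L1 f -> 0 < d ->
  tr (fun x => c * f x) t d = c * tr f t d.
Proof.
move=> intf d0; rewrite /uker -RintegralZl.
- by apply: eq_Rintegral => x _; rewrite mulrA.
- exact: mI1.
- exact: ktr_integrable.
Qed.

Lemma funrposneg_eq (R : realType) (f : R -> R) (x : R) : f x = f^\+ x - f^\- x.
Proof. by rewrite -[in LHS](funrposBneg f). Qed.

Lemma kap_posneg (R : realType) (l : R) (f : R -> R) (x : R) : 0 < l ->
  kap l (f^\+ x) + kap l (f^\- x) = kap l (f x).
Proof.
move=> l0; have k00 : kap l 0 = 0 by rewrite /kap expr0n mul0r.
have [f0|f0] := leP 0 (f x).
  have -> : f^\+ x = f x by rewrite /funrpos; apply/max_idPl.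
  have -> : f^\- x = 0 by rewrite /funrneg; apply/max_idPr; rewrite oppr_le0.
  by rewrite k00 addr0.
have -> : f^\+ x = 0 by rewrite /funrpos; apply/max_idPr; rewrite ltW.
have -> : f^\- x = - f x by rewrite /funrneg; apply/max_idPl; rewrite oppr_ge0 ltW.
by rewrite k00 add0r -kap_norm normrN kap_norm.
Qed.

(** Four times the 6000 of [tr_weak_ge0]: a factor 2 for splitting the level l between the positive
    and the negative part, another from [kap_half]. *)
Definition weakC (R : realType) : R := 240 * 100.

Lemma weakC_gt0 (R : realType) : 0 < weakC R.
Proof. by rewrite /weakC; lra. Qed.

Lemma tr_weak (R : realType) (f : R -> R) (l d : R) :
  L1 f -> 0 < l -> 0 < d ->
  (l%:E * mu (tr_level f l d) <=
   (weakC R * \int[mu]_(x in I1) kap l (f x))%:E)%E.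
Proof.
move=> intf l0 d0; have mI := @mI1 R.
have ip : L1 (f^\+) by exact: integrable_funrpos.
have iN : L1 (f^\-) by exact: integrable_funrneg.
have l20 : 0 < l / 2 by rewrite divr_gt0.
have p0 x : 0 <= f^\+ x by exact: funrpos_ge0.
have n0 x : 0 <= f^\- x by exact: funrneg_ge0.
have wp := tr_weak_ge0 ip p0 l20 d0.
have wn := tr_weak_ge0 iN n0 l20 d0.
have m1 := tr_level_measurable (l / 2) ip d0.
have m2 := tr_level_measurable (l / 2) iN d0.
have sub : tr_level f l d `<=` tr_level f^\+ (l / 2) d `|` tr_level f^\- (l / 2) d.
  move=> t [St lt]; have := trB t ip iN d0.
  rewrite (_ : (fun x => _) = f); last by apply/funext => x; rewrite -funrposneg_eq.
  move=> E; rewrite E in lt.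
  have := ler_normB (tr f^\+ t d) (tr f^\- t d) => h.
  have [h1|h1] := ltP (l / 2) `|tr f^\+ t d|; first by left.
  by right; split => //; lra.
have h : (mu (tr_level f l d) <= mu (tr_level f^\+%R (l / 2)%R d) + mu (tr_level f^\-%R (l / 2)%R d))%E.
  apply: le_trans (measureU2 mu m1 m2).
  by apply: le_measure; rewrite ?inE//; [exact: tr_level_measurable|exact: measurableU].
have e1 : (l%:E = 2%:E * (l / 2)%:E)%E by rewrite -EFinM; congr EFin; field.
have s1 := lee_wpmul2l (_ : 0 <= l%:E)%E h.
apply: (le_trans (s1 _)); first by rewrite lee_fin ltW.
rewrite e1 -muleA ge0_muleDr ?measure_ge0//.
apply: (@le_trans _ _ (2%:E * (((60 * 100) * \int[mu]_(x in I1) kap (l / 2) (f^\+%R x))%:E +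
   ((60 * 100) * \int[mu]_(x in I1) kap (l / 2) (f^\-%R x))%:E))%E).
  by apply: lee_wpmul2l; [rewrite lee_fin|exact: leeD].
rewrite -EFinD -EFinM lee_fin.
have h1 : \int[mu]_(x in I1) kap (l / 2) (f^\+ x) + \int[mu]_(x in I1) kap (l / 2) (f^\- x) <=
   2 * \int[mu]_(x in I1) kap l (f x).
  rewrite -RintegralD//; [|exact: kap_integrable|exact: kap_integrable].
  rewrite -RintegralZl//; last exact: kap_integrable.
  apply: le_Rintegral => //.
  - by apply: integrableD_R => //; exact: kap_integrable.
  - by apply: integrableZ_R => //; exact: kap_integrable.
  - by move=> x _; rewrite kap_posneg// kap_half.
by move: h1; rewrite /weakC; lra.
Qed.

(** * Maximal truncations *)

Definition bker (R : realType) (s r : R) : R := if `|s| < r then 1 else 0.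

Lemma bker_ge0 (R : realType) (s r : R) : 0 <= bker s r.
Proof. by rewrite /bker; case: ifP. Qed.

Lemma bker_le (R : realType) (s r : R) : `|bker s r| <= 1.
Proof. by rewrite /bker; case: ifP => _; rewrite ?normr1 ?normr0. Qed.

Lemma shift_measurable (R : realType) (t : R) :
  measurable_fun [set: measurableTypeR R] (fun x : measurableTypeR R => x - t).
Proof. by apply: continuous_measurable_fun => x; apply: cvgB; [exact: cvg_id|exact: cvg_cst]. Qed.

Lemma bker_measurable (R : realType) (t r : R) (B : set (measurableTypeR R)) :
  measurable_fun B (fun x : measurableTypeR R => bker (x - t) r).
Proof.
apply: measurable_funTS; apply: measurable_fun_ifT => //.
apply: measurable_fun_ltr => //.
by apply: measurableT_comp => //; exact: shift_measurable.
Qed.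

(** On the dyadic annulus 2^n e <= |s| < 2^(n+1) e the box of radius 2^(n+1) e alone suffices: its
    height 4 / (4^(n+1) e) is e / (2^n e)^2, which is at least e / s^2. *)
Lemma pker_bker (R : realType) (s e : R) (n : nat) : 0 < e -> `|s| < 2 ^+ n * e ->
  pker s e <= \sum_(k < n.+1) 4 / (4 ^+ k * e) * bker s (2 ^+ k * e).
Proof.
move=> e0; elim: n => [|n IH] h.
  rewrite big_ord_recl big_ord0 addr0 /= expr0 mul1r in h *.
  rewrite /bker h mulr1 /pker ler_pdivrMr ?ssqr_gt0//.
  rewrite mulrAC ler_pdivlMr//; have := sqr_ge0 s; have := sqr_ge0 e; nra.
rewrite big_ord_recr /=.
have [h1|h1] := ltP `|s| (2 ^+ n * e).
  rewrite -[leLHS]addr0 lerD ?IH// mulr_ge0 ?bker_ge0//.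
  by rewrite divr_ge0// mulr_ge0 ?exprn_ge0// ltW.
rewrite /bker h mulr1 -[leLHS]add0r lerD//.
  apply: sumr_ge0 => k _; rewrite mulr_ge0 ?bker_ge0//.
  by rewrite divr_ge0// mulr_ge0 ?exprn_ge0// ltW.
rewrite /pker ler_pdivrMr ?ssqr_gt0// mulrAC ler_pdivlMr; last by rewrite mulr_gt0 ?exprn_gt0.
have h2 : 4 ^+ n * (e * e) <= s ^+ 2.
  rewrite -[s ^+ 2]real_normK ?num_real//.
  have -> : 4 ^+ n * (e * e) = (2 ^+ n * e) ^+ 2.
    have -> : (4 : R) ^+ n = (2 ^+ n) ^+ 2.
      by rewrite exprAC; congr (_ ^+ _); rewrite expr2; lra.
    by ring.
  by rewrite lerXn2r ?nnegrE ?mulr_ge0 ?exprn_ge0 ?(ltW e0).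
rewrite exprS; have := sqr_ge0 e.
rewrite (_ : e * (4 * 4 ^+ n * e) = 4 * (4 ^+ n * (e * e))); last by ring.
by lra.
Qed.

(** The box of radius 2^k e contributes at most 4 / (4^k e) times 2 c 2^k e, that is 8 c / 2^k, and
    these sum to 16 c. *)
Lemma poisson_le_maximal (R : realType) (f : R -> R) (t e c : R) :
  L1 f -> (forall x, 0 <= f x) -> 0 < e -> 0 <= c ->
  (forall r, 0 < r -> uker (@bker R) f t r <= c * (r *+ 2)) ->
  uker (@pker R) f t e <= 16 * c.
Proof.
move=> intf f0 e0 c0 H; have mI := @mI1 R.
(* From this radius on the box around t covers (-1,1), so finitely many boxes are enough. *)
have [n nP] : exists n : nat, 1 + `|t| < 2 ^+ n * e.
  have [n h] : exists n : nat, (1 + `|t|) / e < n%:R.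
    by exists (Num.truncn ((1 + `|t|) / e)).+1; exact: truncnS_gt.
  exists n; move: h; rewrite ltr_pdivrMr// => /lt_le_trans; apply.
  rewrite ler_pM2r// -natrX ler_nat; apply: ltnW; exact: ltn_expl.
have ib r : L1 (fun x => f x * bker (x - t) r).
  apply: (@integrable_bounded_mul _ _ _ _ 1) => //.
    exact: bker_measurable.
  by move=> x _; exact: bker_le.
have ibs (m : nat) : L1 (fun x => \sum_(k < m) 4 / (4 ^+ k * e) * (f x * bker (x - t) (2 ^+ k * e))) /\
  \int[mu]_(x in I1) (\sum_(k < m) 4 / (4 ^+ k * e) * (f x * bker (x - t) (2 ^+ k * e))) <=
   16 * c * (1 - 2^-1 ^+ m).
  elim: m => [|m [IH1 IH2]].
    split.
      rewrite (_ : (fun x : R => _) = cst 0); first exact: integrable_cstI.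
      by apply/funext => x; rewrite big_ord0.
    rewrite (_ : Rintegral _ _ _ = 2 * 0); last first.
      by rewrite -Rintegral_cstI; apply: eq_Rintegral => x _; rewrite big_ord0.
    by rewrite expr0 subrr !mulr0.
  have i2 := integrableZ_R (4 / (4 ^+ m * e)) mI (ib (2 ^+ m * e)).
  split.
    rewrite (_ : (fun x : R => _) = (fun x => (\sum_(k < m) 4 / (4 ^+ k * e) * (f x * bker (x - t) (2 ^+ k * e))) + 4 / (4 ^+ m * e) * (f x * bker (x - t) (2 ^+ m * e)))).
      exact: integrableD_R.
    by apply/funext => x; rewrite big_ord_recr.
  rewrite (_ : Rintegral _ _ _ = \int[mu]_(x in I1) (\sum_(k < m) 4 / (4 ^+ k * e) * (f x * bker (x - t) (2 ^+ k * e))) +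
     4 / (4 ^+ m * e) * uker (@bker R) f t (2 ^+ m * e)); last first.
    rewrite /uker -RintegralZl// -RintegralD//.
    by apply: eq_Rintegral => x _; rewrite big_ord_recr.
  have e2m : 0 < 2 ^+ m * e by rewrite mulr_gt0 ?exprn_gt0.
  have h := H _ e2m.
  have h2 : 4 / (4 ^+ m * e) * uker (@bker R) f t (2 ^+ m * e) <= 8 * c * 2^-1 ^+ m.
    have q : 0 <= 4 / (4 ^+ m * e) by rewrite divr_ge0// mulr_ge0 ?exprn_ge0// ltW.
    apply: (le_trans (ler_wpM2l q h)).
    have -> : (4 : R) ^+ m = 2 ^+ m * 2 ^+ m by rewrite -exprMn; congr (_ ^+ _); lra.
    rewrite exprVn mulr2n le_eqVlt; apply/orP; left; apply/eqP; field.
    by rewrite (gt_eqF e0) /= expf_neq0.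
  by move: IH2 h2; rewrite exprS; lra.
have [i1 i2] := ibs n.+1.
apply: (@le_trans _ _ (\int[mu]_(x in I1) (\sum_(k < n.+1) 4 / (4 ^+ k * e) * (f x * bker (x - t) (2 ^+ k * e))))).
  apply: le_Rintegral => //.
    apply: (@integrable_bounded_mul _ _ _ _ e^-1) => //.
      by apply: (@continuous_shift_measurable _ (@pker R ^~ e)) => //; exact: continuous_pker.
    by move=> x _; exact: pker_le.
  move=> x; rewrite /= in_itv /= => /andP[x1 x2].
  have xt : `|x - t| < 2 ^+ n * e.
    apply: le_lt_trans nP; rewrite (le_trans (ler_normB _ _))// lerD2r.
    by rewrite ler_norml; apply/andP; split; lra.
  have := ler_wpM2l (f0 x) (pker_bker e0 xt).
  rewrite mulr_sumr => /le_trans; apply.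
  by apply: ler_sum => k _; rewrite mulrCA.
apply: (le_trans i2); rewrite -[leRHS]mulr1; apply: ler_wpM2l; first by rewrite mulr_ge0.
by rewrite lerBlDr lerDl exprn_ge0.
Qed.

(** The smoothness estimate of Calderon-Zygmund theory: for |x - t| > e the point s is still at
    distance more than e / 2 >= d from x, so neither kernel is truncated and their difference is (t
    - s) / ((x - t) (x - s)). The points with |x - t| <= e are taken out of the second kernel. *)
Lemma ktr_cotlar (R : realType) (x t s e d : R) : 0 < d -> d <= e / 2 ->
  `|t - s| < e / 2 ->
  `|ktr (x - t) e - (if `|x - t| <= e then 0 else ktr (x - s) d)| <=
    2 * pker (x - t) e.
Proof.
move=> d0 de ts; have e0 : 0 < e by lra.
have [h|h] := leP `|x - t| e.
  by rewrite /ktr ltNge h /= subr0 normr0 mulr_ge0// pker_ge0.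
have xs : e / 2 < `|x - s|.
  have := ler_normD (x - s) (s - t); rewrite (_ : x - s + (s - t) = x - t); last by ring.
  by move: ts; rewrite distrC; lra.
rewrite /ktr h ifT; last by lra.
have n1 : x - t != 0 by rewrite -normr_eq0 gt_eqF//; lra.
have n2 : x - s != 0 by rewrite -normr_eq0 gt_eqF//; lra.
have -> : (x - t)^-1 - (x - s)^-1 = (t - s) / ((x - t) * (x - s)).
  by field; rewrite n1 n2.
rewrite normf_div normrM ler_pdivrMr; last by rewrite mulr_gt0 ?normr_gt0.
have hs : `|x - t| <= 2 * `|x - s|.
  have := ler_normD (x - s) (s - t); rewrite (_ : x - s + (s - t) = x - t); last by ring.
  by move: ts; rewrite distrC; lra.
rewrite /pker -[(x - t) ^+ 2]real_normK ?num_real//.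
set a := `|x - t| in h hs *; set b := `|x - s| in xs hs *.
have n : 0 < a ^+ 2 + e ^+ 2 by exact: ssqr_gt0.
rewrite mulrA mulrAC ler_pdivlMr//.
have a0 : 0 < a by lra.
have h1 : a ^+ 2 + e ^+ 2 <= 2 * a * a by nra.
have h2 : 2 * a * a <= 4 * (a * b) by nra.
have h3 : `|t - s| * (a ^+ 2 + e ^+ 2) <= e / 2 * (4 * (a * b)).
  by apply: ler_pM => //; [exact: ltW|exact: ltW|lra].
by lra.
Qed.

Lemma HL_bker (R : realType) (f : R -> R) (t c : R) :
  L1 f ->
  (HL_maximal (f \_ I1) t <= c%:E)%E ->
  forall r, 0 < r -> uker (@bker R) (fun x => `|f x|) t r <= c * (r *+ 2).
Proof.
move=> intf H r r0; have mI := @mI1 R.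
have mb : measurable (ball t r : set (measurableTypeR R)) by exact: measurable_ball.
have h : (iavg (f \_ I1) (ball t r) <= c%:E)%E.
  apply: le_trans H; apply: ereal_sup_ubound; exists r => //.
  by rewrite /= in_itv /= andbT.
move: h; rewrite iavg_restrict// lebesgue_measure_ball ?(ltW r0)//.
rewrite inver mulrn_eq0 /= gt_eqF//.
have ib : L1 (fun x => `|f x| * bker (x - t) r).
  apply: (@integrable_bounded_mul _ _ _ _ 1).
  - exact: mI.
  - exact: integrable_norm.
  - exact: bker_measurable.
  - by move=> x _; exact: bker_le.
have -> : (\int[mu]_(y in I1 `&` ball t r) `|f y|%:E = (uker (@bker R) (fun x => `|f x|) t r)%:E)%E.
  rewrite /uker -Rintegral_lee// integral_mkcondr; apply: eq_integral => x _.
  rewrite /patch /bker; have -> : (x \in (ball t r : set R)) = (`|x - t| < r).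
    by apply/idP/idP => [/set_mem|]; rewrite /ball /= distrC // => h; exact/mem_set.
  by case: ifP; rewrite ?mulr1 ?mulr0.
by rewrite -EFinM lee_fin mulrC ler_pdivrMr// pmulrn_lgt0.
Qed.

(* Cotlar's inequality: the truncation at scale e is compared with the one at a
   much smaller scale d at a nearby point where the latter is small. *)
Lemma tr_cotlar (R : realType) (f : R -> R) (l d e t : R) :
  L1 f -> 0 < l -> 0 < d -> d <= e / 2 -> I1 t ->
  (HL_maximal (f \_ I1) t <= (l / (16 * weakC R))%:E)%E ->
  (HL_maximal (\1_(tr_level f l d)) t <= (2^-1)%:E)%E ->
  `|tr f t e| <= 4 * l.
Proof.
move=> intf l0 d0 de It H1 H2; have mI := @mI1 R.
have e0 : 0 < e by lra.
have w0 := weakC_gt0 R.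
have w1 : 2 <= weakC R by rewrite /weakC; lra.
have c0 : 0 < l / (16 * weakC R) by rewrite divr_gt0// mulr_gt0.
have Bk := HL_bker intf H1.
move: It; rewrite /= in_itv /= => /andP[t1 t2].
have [e2|e2] := leP 2 e.
  rewrite (_ : uker _ _ _ _ = 2 * 0).
    by rewrite mulr0 normr0 mulr_ge0// ltW.
  rewrite -Rintegral_cstI; apply: eq_Rintegral => x /set_mem.
  rewrite /= in_itv /= => /andP[x1 x2].
  rewrite /ktr ifF ?mulr0//; apply/negbTE; rewrite -leNgt.
  by rewrite ler_norml; apply/andP; split; lra.
(* [f1] below is f cut to distance e from t; subtracting its truncation at s from that of f leaves
   exactly the part compared in [ktr_cotlar]. *)
pose g x := if `|x - t| <= e then 1 else 0 : R.
have mg : measurable_fun I1 (g : measurableTypeR R -> R).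
  apply: measurable_funTS; apply: measurable_fun_ifT => //.
  apply: measurable_fun_ler => //.
  by apply: measurableT_comp => //; exact: shift_measurable.
have g1 x : `|g x| <= 1 by rewrite /g; case: ifP; rewrite ?normr1 ?normr0.
pose f1 x := f x * g x.
have if1 : L1 f1.
  by apply: (@integrable_bounded_mul _ _ _ _ 1) => // x _; exact: g1.
(* The radius 2 e appears because [bker] is strict and [g] is not. The right side is l e / (4
   [weakC]), chosen so that [tr_weak] leaves a bad set of measure at most e / 4 for [f1]. *)
have n1 : \int[mu]_(x in I1) kap l (f1 x) <= l / (16 * weakC R) * (2 * e *+ 2).
  apply: le_trans (Bk (2 * e) _); last by rewrite mulr_gt0.
  apply: le_Rintegral.
  - exact: mI.
  - exact: kap_integrable.
  - apply: (@integrable_bounded_mul _ _ _ _ 1).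
    + exact: mI.
    + exact: integrable_norm.
    + exact: bker_measurable.
    + by move=> x _; exact: bker_le.
  - move=> x _; rewrite (le_trans (kap_le _ l0))// /f1 normrM ler_wpM2l// /g /bker.
    case: ifPn => [h|_]; last by rewrite normr0; case: ifP.
    by rewrite ifT ?normr1//; lra.
have mB : measurable (ball t (e / 2) : set (measurableTypeR R)) by exact: measurable_ball.
have muB : mu (ball t (e / 2)) = e%:E.
  by rewrite lebesgue_measure_ball; [congr EFin; rewrite mulr2n; lra|lra].
have BS s : ball t (e / 2) s -> S3 s.
  rewrite /ball /= in_itv /= ltr_norml => /andP[h1 h2].
  by apply/andP; split; lra.
have mE := tr_level_measurable l intf d0.
have mE1 := tr_level_measurable l if1 d0.
have muE : (mu (tr_level f l d `&` ball t (e / 2)) <= (e / 2)%:E)%E.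
  have h : (iavg \1_(tr_level f l d) (ball t (e / 2)) <= (2^-1)%:E)%E.
    apply: le_trans H2; apply: ereal_sup_ubound; exists (e / 2) => //.
    by rewrite /= in_itv /= andbT divr_gt0.
  move: h; rewrite /iavg [X in (X^-1)%E]muB inver gt_eqF//.
  have -> : (\int[mu]_(y in ball t (e / 2)) `|((\1_(tr_level f l d) y) : R)%:E| =
      mu (tr_level f l d `&` ball t (e / 2)))%E.
    rewrite -integral_indic//; apply: eq_integral => x _.
    by rewrite gee0_abs// lee_fin.
  rewrite muleC lee_pdivrMr//.
  by rewrite -EFinM mulrC.
have muE1 : (mu (tr_level f1 l d) <= (e / 4)%:E)%E.
  have h := tr_weak if1 l0 d0.
  have h2 : (l%:E * mu (tr_level f1 l d) <= l%:E * (e / 4)%:E)%E.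
    apply: (le_trans h); rewrite -EFinM lee_fin.
    apply: (le_trans (ler_wpM2l (ltW w0) n1)).
    rewrite le_eqVlt; apply/orP; left; apply/eqP; rewrite mulr2n; field.
    by rewrite gt_eqF.
  by move: h2; rewrite lee_pmul2l// ?lte_fin.
(* The bad sets take at most e / 2 + e / 4 of a ball of measure e, so a good point is left. *)
have [s [Bs nE nE1]] : exists s, [/\ ball t (e / 2) s, ~ tr_level f l d s & ~ tr_level f1 l d s].
  apply: contrapT => no.
  have sub : ball t (e / 2) `<=` (tr_level f l d `&` ball t (e / 2)) `|` tr_level f1 l d.
    move=> s Bs; have [h|h] := pselect (tr_level f l d s); first by left.
    have [h'|h'] := pselect (tr_level f1 l d s); first by right.
    by exfalso; apply: no; exists s.
  have : (mu (ball t (e / 2)) <= (e / 2)%:E + (e / 4)%:E)%E.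
    apply: (@le_trans _ _ (mu ((tr_level f l d `&` ball t (e / 2)%R) `|` tr_level f1 l d))%E).
      apply: le_measure; rewrite ?inE//.
      by apply: measurableU => //; exact: measurableI.
    apply: le_trans (measureU2 _ _ _) _ => //; first exact: measurableI.
    exact: leeD.
  by rewrite muB -EFinD lee_fin; lra.
have Ss := BS _ Bs.
have u1 : `|tr f s d| <= l by rewrite leNgt; apply/negP => h; apply: nE.
have u2 : `|tr f1 s d| <= l by rewrite leNgt; apply/negP => h; apply: nE1.
have ts : `|t - s| < e / 2 by exact: Bs.
have it := ktr_integrable t intf e0.
have ifs := ktr_integrable s intf d0.
have if1s := ktr_integrable s if1 d0.
have u3 : `|tr f t e - (tr f s d - tr f1 s d)| <=
    2 * uker (@pker R) (fun x => `|f x|) t e.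
  rewrite /uker -RintegralB// -RintegralB//; last exact: integrableB_R.
  have i4 := integrableB_R mI it (integrableB_R mI ifs if1s).
  rewrite (le_trans (le_normr_Rintegral mI i4))//.
  have ip : L1 (fun x => `|f x| * pker (x - t) e).
    apply: (@integrable_bounded_mul _ _ _ _ e^-1) => //.
    + exact: integrable_norm.
    + by apply: (@continuous_shift_measurable _ (@pker R ^~ e)) => //; exact: continuous_pker.
    + by move=> x _; exact: pker_le.
  rewrite -RintegralZl//.
  apply: le_Rintegral => //.
  - exact: integrable_norm i4.
  - exact: integrableZ_R.
  - move=> x _; have := ktr_cotlar x d0 de ts => h.
    have -> : f x * ktr (x - t) e - (f x * ktr (x - s) d - f1 x * ktr (x - s) d) =
       f x * (ktr (x - t) e - (if `|x - t| <= e then 0 else ktr (x - s) d)).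
      by rewrite /f1 /g; case: ifP => _; ring.
    by rewrite normrM mulrCA ler_wpM2l.
have u4 := poisson_le_maximal (integrable_norm intf) (fun x => normr_ge0 (f x)) e0 (ltW c0) Bk.
have u5 : 32 * (l / (16 * weakC R)) <= l.
  have -> : 32 * (l / (16 * weakC R)) = l * (2 / weakC R) by field; rewrite gt_eqF.
  by rewrite -[leRHS]mulr1 ler_wpM2l ?(ltW l0)// ler_pdivrMr// mul1r.
have tri : forall a b c p q : R, `|a - (b - c)| <= 2 * p -> p <= 16 * q -> 32 * q <= l ->
    `|b| <= l -> `|c| <= l -> `|a| <= 4 * l.
  by clear; move=> a b c p q; rewrite !ler_norml => /andP[? ?] ? ? /andP[? ?] /andP[? ?]; apply/andP; split; lra.
exact: (tri _ _ _ _ _ u3 u4 u5 u1 u2).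
Qed.

(** One exceptional set serves for all truncations at once, so no supremum over e has to be
    measured. It is the set where the Hardy-Littlewood function of f is large (3 * 16 = 48),
    together with the lower limit of the sets where that of the bad set at scale 1/(n+1) exceeds 1/2
    (3 * 2 = 6). *)
Lemma tr_maximal (R : realType) (f : R -> R) (l : R) :
  L1 f -> 0 < l ->
  exists E : set (measurableTypeR R), [/\ measurable E,
    (l%:E * mu E <= (54 * weakC R * \int[mu]_(x in I1) `|f x|)%:E)%E &
    forall t, I1 t -> ~ E t -> forall e, 0 < e -> `|tr f t e| <= 4 * l].
Proof.
move=> intf l0; have mI := @mI1 R.
have w0 := weakC_gt0 R.
set N := \int[mu]_(x in I1) `|f x|.
have N0 : 0 <= N by apply: Rintegral_ge0.
pose c := l / (16 * weakC R).
have c0 : 0 < c by rewrite divr_gt0// mulr_gt0.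
have lf : locally_integrable [set: R] (f \_ I1) by exact: integrable_locally_restrict.
pose E0 : set (measurableTypeR R) := [set t | (HL_maximal (f \_ I1) t > c%:E)%E].
have mHL (g : R -> R) (a : R) : locally_integrable [set: R] g ->
    measurable ([set t | (HL_maximal g t > a%:E)%E] : set (measurableTypeR R)).
  by move=> lg; rewrite -[X in measurable X]setTI; apply: emeasurable_fun_o_infty => //; exact: measurable_HL_maximal.
have mE0 : measurable E0 by exact: mHL.
have muE0 : (l%:E * mu E0 <= (48 * weakC R * N)%:E)%E.
  have h := maximal_inequality lf c0.
  have e1 : (\int[mu]_(y in setT) `|((f \_ I1) y)%:E| = N%:E)%E.
    rewrite /N -Rintegral_lee//; last exact: integrable_norm.
    rewrite [RHS]integral_mkcond; apply: eq_integral => x _.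
    by rewrite /patch; case: ifP => // _; rewrite /= normr0.
  rewrite e1 in h.
  have h2 : (l%:E * mu E0 <= l%:E * ((3 / c)%:E * N%:E))%E.
    by apply: lee_wpmul2l => //; rewrite lee_fin ltW.
  apply: (le_trans h2); rewrite -!EFinM lee_fin /c le_eqVlt; apply/orP; left; apply/eqP.
  by field; rewrite !gt_eqF.
pose dn (n : nat) : R := n.+1%:R^-1.
have dn0 n : 0 < dn n by rewrite invr_gt0.
pose F n := tr_level f l (dn n).
have mF n : measurable (F n) by exact: tr_level_measurable.
have muF n : (l%:E * mu (F n) <= (weakC R * N)%:E)%E.
  apply: (le_trans (tr_weak intf l0 (dn0 n))); rewrite lee_fin ler_wpM2l ?(ltW w0)//.
  apply: le_Rintegral => //; [exact: kap_integrable|exact: integrable_norm|].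
  by move=> x _; exact: kap_le.
have lF n : locally_integrable [set: R] (\1_(F n)).
  by apply: locally_integrable_indic; [exact: openT|exact: mF].
pose G n : set (measurableTypeR R) := [set t | (HL_maximal (\1_(F n)) t > (2^-1)%:E)%E].
have mG n : measurable (G n) by exact: mHL.
have muG n : (l%:E * mu (G n) <= (6 * weakC R * N)%:E)%E.
  have i2 : (0 : R) < 2^-1 by rewrite invr_gt0.
  have h := maximal_inequality (lF n) i2.
  have e1 : (\int[mu]_(y in setT) `|((\1_(F n) y) : R)%:E| = mu (F n))%E.
    transitivity (\int[mu]_(y in setT) ((\1_(F n) y) : R)%:E)%E.
      by apply: eq_integral => x _; rewrite gee0_abs// lee_fin.
    by rewrite integral_indic// setIT.
  rewrite e1 in h.
  apply: (@le_trans _ _ (l%:E * (6%:E * mu (F n)))%E).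
    apply: lee_wpmul2l; first by rewrite lee_fin ltW.
    apply: (le_trans h); rewrite invrK.
    by rewrite (_ : 3 * 2 = 6 :> R); [exact: lexx|lra].
  rewrite muleCA (_ : 6 * weakC R * N = 6 * (weakC R * N)); last by ring.
  by rewrite EFinM; apply: lee_wpmul2l => //; rewrite lee_fin.
(* Outside the union of the [K n] a point avoids [G k] for arbitrarily large k, hence for some scale
   d <= e / 2. Since the [K n] increase, the uniform bound on the [G n] passes to the union. *)
pose K n := \bigcap_(k in [set k | (n <= k)%N]) G k.
have mK n : measurable (K n) by apply: bigcap_measurable; [exists n => /=|move=> k _; exact: mG].
have Kn : nondecreasing_seq K.
  by move=> n m nm; apply/subsetPset => t Kt k /= mk; apply: Kt; exact: leq_trans mk.
have mUK : measurable (\bigcup_n K n) by exact: bigcup_measurable.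
have cK := nondecreasing_cvg_mu (mu := mu) mK mUK Kn.
have muK : (l%:E * mu (\bigcup_n K n) <= (6 * weakC R * N)%:E)%E.
  rewrite -lee_pdivlMl// -EFinM.
  move/cvg_lim : (cK) => <- //; apply: lime_le; first by apply/cvg_ex; eexists; exact: cK.
  apply: nearW => n /=; rewrite EFinM lee_pdivlMl//.
  apply: le_trans (muG n); apply: lee_wpmul2l; first by rewrite lee_fin ltW.
  apply: le_measure; rewrite ?inE; [exact: mK|exact: mG|].
  by move=> t; apply => /=.
exists (E0 `|` \bigcup_n K n); split.
- exact: measurableU.
- apply: (@le_trans _ _ (l%:E * (mu E0 + mu (\bigcup_n K n)))%E).
    by apply: lee_wpmul2l; [rewrite lee_fin ltW|exact: measureU2].
  rewrite ge0_muleDr ?measure_ge0//.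
  apply: (@le_trans _ _ ((48 * weakC R * N)%:E + (6 * weakC R * N)%:E)%E); first exact: leeD.
  by rewrite -EFinD lee_fin; lra.
move=> t It nE e e0.
have [n nP] : exists n : nat, 2 / e < n.+1%:R.
  by exists (Num.truncn (2 / e)); exact: truncnS_gt.
have [k nk Gk] : exists2 k, (n <= k)%N & ~ G k t.
  apply: contrapT => no; apply: nE; right; exists n => // k /= nk.
  by apply: contrapT => nG; apply: no; exists k.
apply: (@tr_cotlar R f l (dn k) e t) => //.
- rewrite /dn invf_ple ?posrE ?divr_gt0//.
  rewrite invf_div; apply: (le_trans (ltW nP)); rewrite ler_nat ltnS//.
- by rewrite leNgt; apply/negP => h; apply: nE; left.
- by rewrite leNgt; apply/negP.
Qed.

(** * The transform of weighted polynomials *)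

Lemma FTC_derive_itv (R : realType) (f F : R -> R) (a b : R) : a < b ->
  (forall x : R, a <= x <= b -> is_derive x 1 F (f x)) ->
  (forall x : R, a <= x <= b -> {for x, continuous f}) ->
  (\int[mu]_(x in `[a, b]) (f x)%:E = (F b - F a)%:E)%E.
Proof.
move=> ab dF cf.
have cF (x : R) : a <= x <= b -> {for x, continuous F}.
  by move=> xab; exact: is_derive_continuous (dF x xab).
rewrite (@continuous_FTC2 _ f F)//.
- apply: continuous_in_subspaceT => x /set_mem; rewrite /= in_itv /=; exact: cf.
- split.
  + move=> x; rewrite in_itv /= => /andP[xa xb].
    by have [] := dF x _; rewrite // (ltW xa) (ltW xb).
  + by apply: cvg_at_right_filter; apply: cF; rewrite lexx ltW.
  + by apply: cvg_at_left_filter; apply: cF; rewrite lexx ltW.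
- move=> x; rewrite in_itv /= => /andP[xa xb].
  have xab : a <= x <= b by rewrite (ltW xa) (ltW xb).
  by rewrite derive1E; have [_ ->] := dF x xab.
Qed.

Lemma FTC_open_ge0 (R : realType) (f F : R -> R) (a b la lb : R) : a < b ->
  (forall x : R, a < x < b -> 0 <= f x) ->
  (forall x : R, a < x < b -> is_derive x 1 F (f x)) ->
  (forall x : R, a < x < b -> {for x, continuous f}) ->
  F x @[x --> a^'+] --> la -> F x @[x --> b^'-] --> lb ->
  measurable_fun (`]a, b[%classic : set (measurableTypeR R)) f /\
  (\int[mu]_(x in (`]a, b[%classic : set (measurableTypeR R))) (f x)%:E = (lb - la)%:E)%E.
Proof.
move=> ab f0 dF cf Fa Fb.
have mf : measurable_fun (`]a, b[%classic : set (measurableTypeR R)) f.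
  apply: open_continuous_measurable_fun; first exact: interval_open.
  by move=> x /set_mem; rewrite /= in_itv /=; exact: cf.
split => //.
(* The shift by 3 keeps a + e n below b - e n from n = 0 on. *)
pose e (n : nat) := (b - a) / n.+3%:R.
have ba0 : 0 < b - a by rewrite subr_gt0.
have e0 n : 0 < e n by rewrite divr_gt0.
have e3 n : e n <= (b - a) / 3.
  by rewrite /e ler_pM2l// lef_pV2 ?posrE// ler_nat.
have emono n m : (n <= m)%N -> e m <= e n.
  by move=> nm; rewrite /e ler_pM2l// lef_pV2 ?posrE// ler_nat !ltnS.
have ecvg : e n @[n --> \oo] --> (0 : R).
  rewrite -[X in _ --> X](mulr0 (b - a)); apply: cvgM; first exact: cvg_cst.
  have := @cvg_harmonic R; rewrite -(cvg_shiftn 2) => h.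
  apply: cvg_trans h; apply: near_eq_cvg; apply: nearW => n /=.
  by rewrite addn2.
pose S n : set (measurableTypeR R) := `[a + e n, b - e n]%classic.
have mS n : measurable (S n) by exact: measurable_itv.
have Sab n : S n `<=` `]a, b[%classic.
  by move=> x; rewrite /S /= !in_itv /= => /andP[x1 x2]; have := e0 n; move=> ?; apply/andP; split; lra.
have ndS : nondecreasing_seq S.
  move=> n m nm; apply/subsetPset => x; rewrite /S /= !in_itv /= => /andP[x1 x2].
  by have := emono _ _ nm => ?; apply/andP; split; lra.
have US : \bigcup_n S n = `]a, b[%classic.
  apply/seteqP; split; first by move=> x [n _]; exact: Sab.
  move=> x; rewrite /= in_itv /= => /andP[x1 x2].
  have p1 : 0 < x - a by rewrite subr_gt0.
  have p2 : 0 < b - x by rewrite subr_gt0.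
  have h1 : \forall n \near \oo, e n < x - a by apply: (cvgr_lt (0 : R)).
  have h2 : \forall n \near \oo, e n < b - x by apply: (cvgr_lt (0 : R)).
  have [n _ H] := filterI h1 h2.
  have [H1 H2] := H n (leqnn n).
  by exists n => //; rewrite /S /= in_itv /=; apply/andP; split; lra.
have cv := @ge0_nondecreasing_set_cvg_integral _ _ _ S (EFin \o f) mu ndS mS.
have mSf n : measurable_fun (S n) (EFin \o f).
  by apply/measurable_EFinP; exact: (measurable_funS (measurable_itv _) (Sab n) mf).
have {}cv := cv mSf.
have Sf0 n x : S n x -> (0 <= (EFin \o f) x)%E.
  by move=> /Sab; rewrite /= in_itv /= lee_fin => /f0.
have {}cv := cv Sf0.
rewrite US in cv.
have E n : (\int[mu]_(x in S n) (f x)%:E = (F (b - e n) - F (a + e n))%:E)%E.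
  have h := e0 n; have h3 := e3 n.
  by apply: FTC_derive_itv; [lra|move=> x /andP[x1 x2]; apply: dF; apply/andP; split; lra|
     move=> x /andP[x1 x2]; apply: cf; apply/andP; split; lra].
have c1 : F (b - e n) @[n --> \oo] --> lb.
  apply: (cvg_at_leftP _ _ _).1 Fb _ _; split.
    by move=> n; rewrite ltrBlDr ltrDl.
  by rewrite -[X in _ --> X]subr0; apply: cvgB => //; exact: cvg_cst.
have c2 : F (a + e n) @[n --> \oo] --> la.
  apply: (cvg_at_rightP _ _ _).1 Fa _ _; split.
    by move=> n; rewrite ltrDl.
  by rewrite -[X in _ --> X]addr0; apply: cvgD => //; exact: cvg_cst.
have c3 : (F (b - e n) - F (a + e n))%:E @[n --> \oo] --> (lb - la)%:E.
  by apply: cvg_EFin; [exact: nearW|exact: cvgB].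
apply: (cvg_unique _ _ c3) => //.
by move: cv; under eq_fun do rewrite E.
Qed.

(** The improper fundamental theorem for signed f follows from the nonnegative one applied to f + g
    and to g. *)
Lemma FTC_open (R : realType) (f F g G : R -> R) (a b la lb ma mb : R) : a < b ->
  (forall x : R, a < x < b -> `|f x| <= g x) ->
  (forall x : R, a < x < b -> is_derive x 1 F (f x)) ->
  (forall x : R, a < x < b -> is_derive x 1 G (g x)) ->
  (forall x : R, a < x < b -> {for x, continuous f}) ->
  (forall x : R, a < x < b -> {for x, continuous g}) ->
  F x @[x --> a^'+] --> la -> F x @[x --> b^'-] --> lb ->
  G x @[x --> a^'+] --> ma -> G x @[x --> b^'-] --> mb ->
  mu.-integrable (`]a, b[%classic : set (measurableTypeR R)) (EFin \o f) /\
  \int[mu]_(x in (`]a, b[%classic : set (measurableTypeR R))) f x = lb - la.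
Proof.
move=> ab fg dF dG cf cg Fa Fb Ga Gb.
have mI : measurable (`]a, b[%classic : set (measurableTypeR R)) by exact: measurable_itv.
have g0 (x : R) : a < x < b -> 0 <= g x.
  by move=> xab; exact: le_trans (fg _ xab).
have [mg ig] := FTC_open_ge0 ab g0 dG cg Ga Gb.
have intg : mu.-integrable (`]a, b[%classic : set (measurableTypeR R)) (EFin \o g).
  apply/integrableP; split; first exact/measurable_EFinP.
  rewrite (_ : integral _ _ _ = \int[mu]_(x in (`]a, b[%classic : set (measurableTypeR R))) (g x)%:E)%E.
    by rewrite ig ltry.
  by apply: eq_integral => x /set_mem; rewrite /= in_itv /= => xab; rewrite ger0_norm// g0.
have fg0 (x : R) : a < x < b -> 0 <= f x + g x.
  by move=> xab; have := fg x xab; rewrite ler_norml => /andP[? ?]; lra.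
have dFG (x : R) : a < x < b -> is_derive x 1 (fun x => F x + G x) (f x + g x).
  by move=> xab; exact: (is_deriveD (dF x xab) (dG x xab)).
have cfg (x : R) : a < x < b -> {for x, continuous (fun x => f x + g x)}.
  by move=> xab; apply: cvgD; [exact: cf|exact: cg].
have [mfg ifg] := FTC_open_ge0 ab fg0 dFG cfg (cvgD Fa Ga) (cvgD Fb Gb).
have intfg : mu.-integrable (`]a, b[%classic : set (measurableTypeR R)) (EFin \o (fun x => f x + g x)).
  apply/integrableP; split; first exact/measurable_EFinP.
  rewrite (_ : integral _ _ _ = \int[mu]_(x in (`]a, b[%classic : set (measurableTypeR R))) (f x + g x)%:E)%E.
    by rewrite ifg ltry.
  by apply: eq_integral => x /set_mem; rewrite /= in_itv /= => xab; rewrite ger0_norm// fg0.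
have fE : f = (fun x => (f x + g x) - g x) by apply/funext => x; rewrite addrK.
split; first by rewrite fE; exact: integrableB_R.
rewrite fE RintegralB// /Rintegral ifg ig /=; ring.
Qed.

(** The bridge to the two integrals in the definition of [fht]; for t in (-1,1) the strict
    inequality in [ktr] matches the open intervals. *)
Lemma tr_split (R : realType) (f : R -> R) (t e : R) :
  L1 f -> I1 t -> 0 < e ->
  tr f t e =
    \int[mu]_(x in `]-1, t - e[) (f x / (x - t)) +
    \int[mu]_(x in `]t + e, 1[) (f x / (x - t)).
Proof.
move=> intf; rewrite /= in_itv /= => /andP[t1 t2] e0.
have mA : measurable (`]-1, t - e[%classic : set (measurableTypeR R)) by exact: measurable_itv.
have mB : measurable (`]t + e, 1[%classic : set (measurableTypeR R)) by exact: measurable_itv.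
have AI : `]-1, t - e[%classic `<=` (I1 : set (measurableTypeR R)).
  by move=> x; rewrite /= !in_itv /= => /andP[x1 x2]; apply/andP; split; lra.
have BI : `]t + e, 1[%classic `<=` (I1 : set (measurableTypeR R)).
  by move=> x; rewrite /= !in_itv /= => /andP[x1 x2]; apply/andP; split; lra.
have it := ktr_integrable t intf e0.
have iA := integrableS (@mI1 R) mA AI it.
have iB := integrableS (@mI1 R) mB BI it.
have eA : \int[mu]_(x in `]-1, t - e[) (f x / (x - t)) =
    \int[mu]_(x in `]-1, t - e[) (f x * ktr (x - t) e).
  apply: eq_Rintegral => x /set_mem; rewrite /= in_itv /= => /andP[x1 x2].
  by rewrite /ktr ifT// ltr0_norm; lra.
have eB : \int[mu]_(x in `]t + e, 1[) (f x / (x - t)) =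
    \int[mu]_(x in `]t + e, 1[) (f x * ktr (x - t) e).
  apply: eq_Rintegral => x /set_mem; rewrite /= in_itv /= => /andP[x1 x2].
  by rewrite /ktr ifT// gtr0_norm; lra.
rewrite eA eB -Rintegral_setU//; last 2 first.
- apply: (integrableS (@mI1 R) _ _ it); first exact: measurableU.
  by move=> x [/AI|/BI].
- rewrite disj_set2E; apply/eqP/seteqP; split => // x [].
  by rewrite /= !in_itv /= => /andP[x1 x2] /andP[x3 x4]; lra.
rewrite /uker Rintegral_mkcond [RHS]Rintegral_mkcond.
apply: eq_Rintegral => x _; rewrite /patch; case: ifPn => [/set_mem Ix|Ix].
  case: ifPn => // /negP nU; rewrite /ktr; case: ifPn; last by rewrite mulr0.
  rewrite /= in_itv /= in Ix; move: Ix => /andP[x1 x2].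
  rewrite ltr_normr => /orP[h|h]; exfalso; apply: nU; apply/mem_set.
    by right; rewrite /= in_itv /=; apply/andP; split; lra.
  by left; rewrite /= in_itv /=; apply/andP; split; lra.
rewrite ifF//; apply/negP => /set_mem [/AI|/BI] h; move/negP: Ix; apply; exact/mem_set.
Qed.

(** * The weight sqrt (1 - x^2) and the transform of its inverse *)

Definition wt (R : realType) (x : R) : R := Num.sqrt (1 - x ^+ 2).

Lemma onesqr_gt0 (R : realType) (x : R) : -1 < x < 1 -> 0 < 1 - x ^+ 2.
Proof. move=> /andP[x1 x2]; have : 0 < (1 - x) * (1 + x) by apply: mulr_gt0; lra.
by lra. Qed.

Lemma wt_gt0 (R : realType) (x : R) : -1 < x < 1 -> 0 < wt x.
Proof. by move=> h; rewrite sqrtr_gt0 onesqr_gt0. Qed.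

Lemma wt_ge0 (R : realType) (x : R) : 0 <= wt x.
Proof. exact: sqrtr_ge0. Qed.

Lemma wt_sqr (R : realType) (x : R) : -1 <= x <= 1 -> wt x ^+ 2 = 1 - x ^+ 2.
Proof.
move=> /andP[x1 x2]; rewrite sqr_sqrtr//.
by have : 0 <= (1 - x) * (1 + x); [rewrite mulr_ge0; lra|lra].
Qed.

Lemma wt_continuous (R : realType) : continuous (@wt R).
Proof.
move=> x; apply: (@continuous_comp _ _ _ (fun x : R => 1 - x ^+ 2) Num.sqrt).
  by apply: cvgB; [exact: cvg_cst|exact: exprn_continuous].
exact: sqrt_continuous.
Qed.

Lemma is_derive_wt (R : realType) (x : R) : -1 < x < 1 ->
  is_derive x 1 (@wt R) (- x / wt x).
Proof.
move=> x1; have w0 := wt_gt0 x1.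
have d1 : is_derive x 1 (fun x : R => 1 - x ^+ 2) (- (2 * x)).
  have := is_deriveB (@is_derive_cst _ _ _ (1:R) x (1:R)) (is_derive_sqr (@is_derive_id _ _ x (1:R))).
  by move=> h; apply: (is_derive_eq h); rewrite sub0r mulr1.
have := @is_derive1_comp R Num.sqrt (fun x : R => 1 - x ^+ 2) x _ _ (is_derive1_sqrt (onesqr_gt0 x1)) d1.
move=> h; apply: (is_derive_eq h); rewrite -/(wt x); field.
by rewrite gt_eqF.
Qed.

Lemma is_derive_sqrt_lin (R : realType) (c x : R) : 0 < 1 + c * x ->
  is_derive x 1 (fun x => Num.sqrt (1 + c * x)) (c / (2 * Num.sqrt (1 + c * x))).
Proof.
move=> h.
have d1 : is_derive x 1 (fun x : R => 1 + c * x) c.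
  have := is_deriveD (@is_derive_cst _ _ _ (1:R) x (1:R)) (is_deriveZ c (@is_derive_id _ _ x (1:R))).
  by move=> H; apply: (is_derive_eq H); rewrite add0r /GRing.scale /= mulr1.
have := @is_derive1_comp R Num.sqrt (fun x : R => 1 + c * x) x _ _ (is_derive1_sqrt h) d1.
by move=> H; apply: (is_derive_eq H); rewrite mulrC.
Qed.

Lemma sqrt_lin_continuous (R : realType) (c : R) : continuous (fun x : R => Num.sqrt (1 + c * x)).
Proof.
move=> x; apply: (@continuous_comp _ _ _ (fun x : R => 1 + c * x) Num.sqrt).
  by apply: cvgD; [exact: cvg_cst|apply: cvgM; [exact: cvg_cst|exact: cvg_id]].
exact: sqrt_continuous.
Qed.

(* wprim is a primitive of wmaj, which majorizes 1 / wt. *)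
Definition wmaj (R : realType) (x : R) : R :=
  (Num.sqrt (1 + 1 * x))^-1 + (Num.sqrt (1 + -1 * x))^-1.
Definition wprim (R : realType) (x : R) : R :=
  2 * Num.sqrt (1 + 1 * x) - 2 * Num.sqrt (1 + -1 * x).

(** With a and b the square roots of 1 + x and 1 - x, a^2 + b^2 = 2 forces a + b >= 1, and 1/a + 1/b
    = (a + b) / (a b). *)
Lemma wt_inv_le (R : realType) (x : R) : -1 < x < 1 -> (wt x)^-1 <= wmaj x.
Proof.
move=> /andP[x1 x2].
have p1 : 0 < 1 + 1 * x by lra.
have p2 : 0 < 1 + -1 * x by lra.
have -> : wt x = Num.sqrt (1 + 1 * x) * Num.sqrt (1 + -1 * x).
  by rewrite -sqrtrM ?(ltW p1)//; congr Num.sqrt; ring.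
set a := Num.sqrt (1 + 1 * x); set b := Num.sqrt (1 + -1 * x).
have a0 : 0 < a by rewrite sqrtr_gt0.
have b0 : 0 < b by rewrite sqrtr_gt0.
have ab : a ^+ 2 + b ^+ 2 = 2 by rewrite !sqr_sqrtr ?(ltW p1) ?(ltW p2)//; lra.
have h : 1 <= a + b.
  have := mulr_gt0 a0 b0; have : 0 < a + b by exact: addr_gt0.
  by nra.
rewrite /wmaj -/a -/b (_ : a^-1 + b^-1 = (a + b) / (a * b)); last by field; rewrite !gt_eqF.
by rewrite -[leLHS]mul1r ler_wpM2r// invr_ge0 mulr_ge0// ltW.
Qed.

Lemma is_derive_wprim (R : realType) (x : R) : -1 < x < 1 ->
  is_derive x 1 (@wprim R) (wmaj x).
Proof.
move=> /andP[x1 x2].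
have p1 : 0 < 1 + 1 * x by lra.
have p2 : 0 < 1 + -1 * x by lra.
have d1 := is_deriveZ 2 (is_derive_sqrt_lin p1).
have d2 := is_deriveZ 2 (is_derive_sqrt_lin p2).
have h := is_deriveB d1 d2.
apply: (is_derive_eq h); rewrite /wmaj /GRing.scale /=; field.
by rewrite !gt_eqF ?sqrtr_gt0.
Qed.

Lemma wprim_continuous (R : realType) : continuous (@wprim R).
Proof.
move=> x; apply: cvgB; apply: cvgM; try exact: cvg_cst; exact: sqrt_lin_continuous.
Qed.

Lemma wmaj_continuous (R : realType) (x : R) : -1 < x < 1 -> {for x, continuous (@wmaj R)}.
Proof.
move=> /andP[x1 x2].
have p1 : 0 < 1 + 1 * x by lra.
have p2 : 0 < 1 + -1 * x by lra.
by apply: cvgD; apply: cvgV; rewrite ?gt_eqF ?sqrtr_gt0//; exact: sqrt_lin_continuous.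
Qed.

Lemma FTC_wt (R : realType) (f F : R -> R) (a b la lb M : R) : -1 <= a -> a < b -> b <= 1 ->
  (forall x : R, a < x < b -> `|f x| <= M * (wt x)^-1) ->
  (forall x : R, a < x < b -> is_derive x 1 F (f x)) ->
  (forall x : R, a < x < b -> {for x, continuous f}) ->
  F x @[x --> a^'+] --> la -> F x @[x --> b^'-] --> lb ->
  mu.-integrable (`]a, b[%classic : set (measurableTypeR R)) (EFin \o f) /\
  \int[mu]_(x in (`]a, b[%classic : set (measurableTypeR R))) f x = lb - la.
Proof.
move=> a1 ab b1 fM dF cf Fa Fb.
have sub (x : R) : a < x < b -> -1 < x < 1 by move=> /andP[? ?]; apply/andP; split; lra.
have M0 : 0 <= M.
  have h : a < (a + b) / 2 < b by apply/andP; split; lra.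
  have w0 := wt_gt0 (sub _ h).
  have := le_trans (normr_ge0 _) (fM _ h).
  by rewrite pmulr_lge0 ?invr_gt0.
apply: (@FTC_open R f F (fun x => M * wmaj x) (fun x => M * wprim x) a b la lb
  (M * wprim a) (M * wprim b)).
- exact: ab.
- move=> x xab; apply: (le_trans (fM _ xab)); rewrite ler_wpM2l// wt_inv_le//.
  exact: sub.
- by move=> x xab; exact: (is_deriveZ M (is_derive_wprim (sub _ xab))).
- exact: cf.
- by move=> x xab; apply: cvgM; [exact: cvg_cst|apply: wmaj_continuous; exact: sub].
- exact: Fa.
- exact: Fb.
- by apply: cvg_at_right_filter; apply: cvgM; [exact: cvg_cst|exact: wprim_continuous].
- by apply: cvg_at_left_filter; apply: cvgM; [exact: cvg_cst|exact: wprim_continuous].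
Qed.

Definition pw (R : realType) (p : {poly R}) (x : R) : R := p.[x] / wt x.

Lemma pw_bound (R : realType) (p : {poly R}) : exists M : R, forall x : R,
  -1 <= x <= 1 -> `|p.[x]| <= M.
Proof.
have cp : {within `[(-1 : R), 1], continuous (horner p)}.
  by apply: continuous_subspaceT; exact: continuous_horner.
have [M [Mr hM]] := compact_bounded (continuous_compact cp (@segment_compact R (-1) 1)).
exists (M + 1) => x x1; apply: (hM (M + 1)); first by rewrite ltrDl.
by exists x => //; rewrite /= in_itv.
Qed.

Lemma pw_continuous (R : realType) (p : {poly R}) (x : R) : -1 < x < 1 ->
  {for x, continuous (pw p)}.
Proof.
move=> x1; apply: cvgM; first exact: continuous_horner.
by apply: cvgV; [rewrite gt_eqF// wt_gt0|exact: wt_continuous].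
Qed.

Lemma wtV_integrable (R : realType) :
  L1 (fun x : R => (wt x)^-1).
Proof.
have m11 : (-1 : R) < 1 by lra.
have g0 (x : R) : -1 < x < 1 -> 0 <= wmaj x.
  by move=> h; apply: le_trans (wt_inv_le h); rewrite invr_ge0 wt_ge0.
have [mg ig] := FTC_open_ge0 m11 g0 (@is_derive_wprim R)
  (@wmaj_continuous R) (cvg_at_right_filter (@wprim_continuous R (-1)))
  (cvg_at_left_filter (@wprim_continuous R 1)).
have mI := @mI1 R.
have i1 : L1 (@wmaj R).
  apply/integrableP; split; first exact/measurable_EFinP.
  rewrite (_ : integral _ _ _ = \int[mu]_(x in I1) (wmaj x)%:E)%E.
    by rewrite ig ltry.
  apply: eq_integral => x /set_mem; rewrite /= in_itv /= => x1; rewrite ger0_norm//.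
  by apply: le_trans (wt_inv_le x1); rewrite invr_ge0 wt_ge0.
apply: (le_integrable mI _ _ i1).
  apply/measurable_EFinP; apply: measurable_funTS.
  apply: (@measurableT_comp _ _ _ _ _ _ (@GRing.inv R)); first exact: measurable_inv.
  by apply: continuous_measurable_fun; exact: wt_continuous.
move=> x; rewrite /= in_itv /= => x1; rewrite lee_fin ger0_norm ?invr_ge0 ?wt_ge0//.
by rewrite (le_trans (wt_inv_le x1))// ler_norm.
Qed.

Lemma horner_measurable (R : realType) (p : {poly R}) (B : set (measurableTypeR R)) :
  measurable_fun B (horner p : measurableTypeR R -> R).
Proof. by apply: measurable_funTS; apply: continuous_measurable_fun; exact: continuous_horner. Qed.

Lemma pw_integrable (R : realType) (p : {poly R}) :
  L1 (pw p).
Proof.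
have [M hM] := pw_bound p.
have := @integrable_bounded_mul R I1 (fun x => (wt x)^-1) (horner p) M (@mI1 R)
  (wtV_integrable R) (@horner_measurable R p I1).
move=> h; apply: eq_integrable (h _); first exact: mI1.
  by move=> x _ /=; rewrite /pw mulrC.
by move=> x; rewrite /= in_itv /= => /andP[x1 x2]; apply: hM; rewrite !ltW.
Qed.

(** The primitive asin of 1 / [wt] is needed up to the endpoints, where it is not differentiable;
    the limit is read off from the monotonicity of sin. *)
Lemma asin_lim1 (R : realType) : @asin R x @[x --> 1^'-] --> (pi / 2 : R).
Proof.
have p0 : 0 < (pi : R) / 2 by rewrite divr_gt0// pi_gt0.
apply/cvgrPdist_le => e e0.
pose d := Num.min e (pi / 2) : R.
have d0 : 0 < d by rewrite lt_min e0.
have dp : d <= pi / 2 by rewrite ge_min lexx orbT.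
have s1 : sin (pi / 2 - d) < 1 :> R.
  have := @ltr_sin R (pi / 2 - d) (pi / 2); rewrite sin_pihalf => ->; first by lra.
    by rewrite in_itv /=; apply/andP; split; lra.
  by rewrite in_itv /=; apply/andP; split; lra.
near=> x.
have xs : sin (pi / 2 - d) <= x by near: x; exact: nbhs_left_ge.
have x1 : x < 1 by near: x; exact: nbhs_left_lt.
have x0 : -1 <= x by apply: le_trans xs; exact: sin_geN1.
have xx : -1 <= x <= 1 by rewrite x0 ltW.
have a1 := asin_lepi2 xx; have a2 := asin_geNpi2 xx.
have h : pi / 2 - d <= asin x.
  rewrite leNgt; apply/negP => h.
  have : sin (asin x) < sin (pi / 2 - d).
    by rewrite ltr_sin ?in_itv/= //; apply/andP; split; lra.
  by rewrite asinK ?in_itv//= ltNge xs.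
rewrite ger0_norm; last by lra.
by have : d <= e; [rewrite ge_min lexx|lra].
Unshelve. all: by end_near. Qed.

Lemma asin_limN1 (R : realType) : @asin R x @[x --> (-1)^'+] --> (- (pi / 2) : R).
Proof.
have p0 : 0 < (pi : R) / 2 by rewrite divr_gt0// pi_gt0.
apply/cvgrPdist_le => e e0.
pose d := Num.min e (pi / 2) : R.
have d0 : 0 < d by rewrite lt_min e0.
have dp : d <= pi / 2 by rewrite ge_min lexx orbT.
have s1 : -1 < sin (- (pi / 2) + d) :> R.
  have := @ltr_sin R (- (pi / 2)) (- (pi / 2) + d); rewrite sinN sin_pihalf => ->; first by lra.
    by rewrite in_itv /=; apply/andP; split; lra.
  by rewrite in_itv /=; apply/andP; split; lra.
near=> x.
have xs : x <= sin (- (pi / 2) + d) by near: x; exact: nbhs_right_le.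
have x1 : -1 < x by near: x; exact: nbhs_right_gt.
have x0 : x <= 1 by apply: (le_trans xs); exact: sin_le1.
have xx : -1 <= x <= 1 by rewrite x0 ltW.
have a1 := asin_lepi2 xx; have a2 := asin_geNpi2 xx.
have h : asin x <= - (pi / 2) + d.
  rewrite leNgt; apply/negP => h.
  have : sin (- (pi / 2) + d) < sin (asin x).
    by rewrite ltr_sin ?in_itv/= //; apply/andP; split; lra.
  by rewrite asinK ?in_itv//= ltNge xs.
rewrite ler0_norm; last by lra.
by have : d <= e; [rewrite ge_min lexx|lra].
Unshelve. all: by end_near. Qed.

Lemma Rintegral_wtV (R : realType) : \int[mu]_(x in I1) (wt x)^-1 = pi :> R.
Proof.
have m11 : (-1 : R) < 1 by lra.
have [] := @FTC_wt R (fun x => (wt x)^-1) (@asin R) (-1) 1 (- (pi / 2)) (pi / 2) 1.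
- exact: lexx.
- exact: m11.
- exact: lexx.
- by move=> x x1; rewrite mul1r ger0_norm// invr_ge0 wt_ge0.
- by move=> x x1; apply: cvgV; [rewrite gt_eqF// wt_gt0|exact: wt_continuous].
- exact: asin_limN1.
- exact: asin_lim1.
by move=> _ ->; field.
Qed.

(** With x = cos a and t = cos b this is 1 - cos (a + b) = 2 sin^2 ((a + b) / 2), so that |x - t| /
    [pvD t x] is the classical quotient |sin ((a - b) / 2) / sin ((a + b) / 2)|. *)
Definition pvD (R : realType) (t x : R) : R := 1 - x * t + wt t * wt x.

Lemma pvD_gt0 (R : realType) (t x : R) : -1 < t < 1 -> -1 <= x <= 1 -> 0 < pvD t x.
Proof.
move=> /andP[t1 t2] /andP[x1 x2]; rewrite /pvD ltr_wpDr ?mulr_ge0 ?wt_ge0//.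
have : `|x * t| < 1.
  rewrite normrM; have : `|t| < 1 by rewrite ltr_norml t1.
  have : `|x| <= 1 by rewrite ler_norml x1.
  by have := normr_ge0 x; have := normr_ge0 t; nra.
by rewrite ltr_norml => /andP[_ h]; lra.
Qed.

Lemma pvD_continuous (R : realType) (t : R) : continuous (pvD t).
Proof.
move=> x; apply: cvgD; last by apply: cvgM; [exact: cvg_cst|exact: wt_continuous].
by apply: cvgB; [exact: cvg_cst|apply: cvgM; [exact: cvg_id|exact: cvg_cst]].
Qed.

(** The parameter c is 1 to the right of t and -1 to the left, so that the argument of the logarithm
    is |x - t|. *)
Definition pvF (R : realType) (c t x : R) : R :=
  (wt t)^-1 * (ln (c * (x - t)) - ln (pvD t x)).

Lemma is_derive_pvF (R : realType) (c t x : R) : -1 < t < 1 -> -1 < x < 1 ->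
  0 < c * (x - t) -> is_derive x 1 (pvF c t) ((wt x)^-1 / (x - t)).
Proof.
move=> t1 x1 c0; have x1' : -1 <= x <= 1 by case/andP: x1 => ? ?; rewrite !ltW.
have D0 := pvD_gt0 t1 x1'.
have w0 := wt_gt0 x1; have s0 := wt_gt0 t1.
have dx : is_derive x 1 (fun x : R => c * (x - t)) c.
  have := is_deriveZ c (is_deriveB (@is_derive_id _ _ x (1:R)) (@is_derive_cst _ _ _ t x (1:R))).
  by move=> h; apply: (is_derive_eq h); rewrite subr0 /GRing.scale /= mulr1.
have d1 := @is_derive1_comp R (@ln R) (fun x : R => c * (x - t)) x _ _ (is_derive1_ln c0) dx.
have dD : is_derive x 1 (pvD t) (- t - wt t * (x / wt x)).
  have h1 : is_derive x 1 (fun x : R => 1 - x * t) (- t).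
    have := is_deriveB (@is_derive_cst _ _ _ (1:R) x (1:R)) (is_deriveM (@is_derive_id _ _ x (1:R)) (@is_derive_cst _ _ _ t x (1:R))).
    by move=> h; apply: (is_derive_eq h); rewrite sub0r /GRing.scale /= mulr0 add0r mulr1.
  have := is_deriveD h1 (is_deriveZ (wt t) (is_derive_wt x1)).
  by move=> h; apply: (is_derive_eq h); rewrite /GRing.scale /=; ring.
have d2 := @is_derive1_comp R (@ln R) (pvD t) x _ _ (is_derive1_ln D0) dD.
have := is_deriveZ (wt t)^-1 (is_deriveB d1 d2).
move=> h; apply: (is_derive_eq h); rewrite /GRing.scale /=.
have c1 : c != 0 by apply: contraTneq c0 => ->; rewrite mul0r ltxx.
have xt : x - t != 0 by apply: contraTneq c0 => ->; rewrite mulr0 ltxx.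
have e1 : (c * (x - t))^-1 * c = (x - t)^-1 by field; rewrite c1 xt.
rewrite e1.
(* The logarithmic derivative of [pvD] is (wt x - wt t) / ((x - t) wt x); subtracted from 1 / (x -
   t) it leaves wt t / ((x - t) wt x), and the prefactor removes wt t. *)
have E : (- t - wt t * (x / wt x)) * (x - t) * wt x = pvD t x * (wt x - wt t).
  have q1 := wt_sqr x1'.
  have q2 : wt t ^+ 2 = 1 - t ^+ 2 by apply: wt_sqr; case/andP: t1 => ? ?; rewrite !ltW.
  rewrite /pvD.
  have -> : (- t - wt t * (x / wt x)) * (x - t) * wt x = - t * (x - t) * wt x - wt t * x * (x - t).
    by field; rewrite gt_eqF.
  have -> : (1 - x * t + wt t * wt x) * (wt x - wt t) =
     (1 - x * t) * (wt x - wt t) + wt t * wt x ^+ 2 - wt t ^+ 2 * wt x by ring.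
  by rewrite q1 q2; ring.
have E2 : (pvD t x)^-1 * (- t - wt t * (x / wt x)) = (wt x - wt t) / ((x - t) * wt x).
  apply: (mulfI (lt0r_neq0 D0)); rewrite (mulVKf (lt0r_neq0 D0)).
  apply: (mulIf xt); apply: (mulIf (lt0r_neq0 w0)).
  rewrite E; field; rewrite xt andbT; exact: lt0r_neq0.
rewrite E2; field.
by rewrite xt !lt0r_neq0.
Qed.

Lemma cvg_at_right0 (R : realType) (h : R -> R) (l : R) :
  {for 0, continuous h} -> h 0 = l -> h e @[e --> (0 : R)^'+] --> l.
Proof. by move=> hc <-; apply: cvg_at_right_filter; exact: hc. Qed.

(* On the two sides of the singularity the primitive of 1/(wt x (x - t)) is
   pvF; its boundary values at -1 and 1 vanish and those at t - e, t + e cancel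
   in the limit. *)
Lemma pv_wtV (R : realType) (t : R) : I1 t ->
  tr (fun x => (wt x)^-1) t e @[e --> (0 : R)^'+] --> (0 : R).
Proof.
move=> It; have t1 : -1 < t < 1 by move: It; rewrite /= in_itv.
have [tm tp] := andP t1.
have s0 := wt_gt0 t1.
have E (e : R) : 0 < e -> e < 1 - t -> e < 1 + t ->
    tr (fun x => (wt x)^-1) t e = (wt t)^-1 * (ln (pvD t (t + e)) - ln (pvD t (t - e))).
  move=> e0 e1 e2; rewrite tr_split//; last exact: wtV_integrable.
  have lnc (c : R) (x : R) : -1 <= x <= 1 -> 0 < c * (x - t) -> {for x, continuous (pvF c t)}.
    move=> x1 cx; apply: cvgM; first exact: cvg_cst; apply: cvgB.
      apply: (@continuous_comp _ _ _ (fun x : R => c * (x - t)) (@ln R)); last exact: continuous_ln.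
      by apply: cvgM; [exact: cvg_cst|apply: cvgB; [exact: cvg_id|exact: cvg_cst]].
    apply: (@continuous_comp _ _ _ (pvD t) (@ln R)); first exact: pvD_continuous.
    by apply: continuous_ln; exact: pvD_gt0.
  have kb (x : R) : -1 < x < 1 -> e <= `|x - t| -> `|(wt x)^-1 / (x - t)| <= e^-1 * (wt x)^-1.
    move=> x1 ex; have w0 := wt_gt0 x1.
    rewrite normrM mulrC normfV [X in _ * X]ger0_norm ?invr_ge0 ?wt_ge0//.
    by rewrite ler_wpM2r ?invr_ge0 ?wt_ge0// lef_pV2 ?posrE//; lra.
  have kc (x : R) : -1 < x < 1 -> x - t != 0 -> {for x, continuous (fun x => (wt x)^-1 / (x - t))}.
    move=> x1 xt; apply: cvgM.
      by apply: cvgV; [rewrite gt_eqF// wt_gt0|exact: wt_continuous].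
    by apply: cvgV => //; apply: cvgB; [exact: cvg_id|exact: cvg_cst].
  have wm1 : wt (-1 : R) = 0 by rewrite /wt sqrrN expr1n subrr sqrtr0.
  have w1 : wt (1 : R) = 0 by rewrite /wt expr1n subrr sqrtr0.
  have [_ ->] : mu.-integrable (`]-1, t - e[%classic : set (measurableTypeR R)) (EFin \o (fun x => (wt x)^-1 / (x - t))) /\
      \int[mu]_(x in `]-1, t - e[) ((wt x)^-1 / (x - t)) = pvF (-1) t (t - e) - pvF (-1) t (-1).
    apply: (@FTC_wt R _ (pvF (-1) t) (-1) (t - e) _ _ e^-1).
    - exact: lexx.
    - by lra.
    - by lra.
    - by move=> x /andP[x1 x2]; apply: kb; [apply/andP; split; lra|rewrite ler0_norm; lra].
    - by move=> x /andP[x1 x2]; apply: is_derive_pvF => //; [apply/andP; split; lra|lra].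
    - by move=> x /andP[x1 x2]; apply: kc; [apply/andP; split; lra|rewrite lt_eqF//; lra].
    - by apply: cvg_at_right_filter; apply: lnc; [apply/andP; split; lra|lra].
    - by apply: cvg_at_left_filter; apply: lnc; [apply/andP; split; lra|lra].
  have [_ ->] : mu.-integrable (`]t + e, 1[%classic : set (measurableTypeR R)) (EFin \o (fun x => (wt x)^-1 / (x - t))) /\
      \int[mu]_(x in `]t + e, 1[) ((wt x)^-1 / (x - t)) = pvF 1 t 1 - pvF 1 t (t + e).
    apply: (@FTC_wt R _ (pvF 1 t) (t + e) 1 _ _ e^-1).
    - by lra.
    - by lra.
    - exact: lexx.
    - by move=> x /andP[x1 x2]; apply: kb; [apply/andP; split; lra|rewrite ger0_norm; lra].
    - by move=> x /andP[x1 x2]; apply: is_derive_pvF => //; [apply/andP; split; lra|lra].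
    - by move=> x /andP[x1 x2]; apply: kc; [apply/andP; split; lra|rewrite gt_eqF//; lra].
    - by apply: cvg_at_right_filter; apply: lnc; [apply/andP; split; lra|lra].
    - by apply: cvg_at_left_filter; apply: lnc; [apply/andP; split; lra|lra].
  have D1 : pvD t 1 = 1 - t by rewrite /pvD w1 mulr0 addr0 mul1r.
  have DN1 : pvD t (-1) = 1 + t by rewrite /pvD wm1 mulr0 addr0 mulN1r opprK.
  rewrite /pvF D1 DN1 !mul1r.
  have -> : -1 * (-1 - t) = 1 + t by ring.
  have -> : -1 * (t - e - t) = e by ring.
  have -> : t + e - t = e by ring.
  by ring.
have c1 (c : R) : {for 0, continuous (fun e => ln (pvD t (t + c * e)))}.
  apply: (@continuous_comp _ _ _ (fun e => pvD t (t + c * e)) (@ln R)).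
    apply: (@continuous_comp _ _ _ (fun e => t + c * e) (pvD t)); last exact: pvD_continuous.
    by apply: cvgD; [exact: cvg_cst|apply: cvgM; [exact: cvg_cst|exact: cvg_id]].
  by apply: continuous_ln; rewrite mulr0 addr0; apply: pvD_gt0 => //; rewrite !ltW.
have L : (wt t)^-1 * (ln (pvD t (t + 1 * e)) - ln (pvD t (t + -1 * e))) @[e --> (0 : R)^'+] --> (0 : R).
  apply: (@cvg_at_right0 _ (fun e => (wt t)^-1 * (ln (pvD t (t + 1 * e)) - ln (pvD t (t + -1 * e))))).
    by apply: cvgM; [exact: cvg_cst|apply: cvgB; exact: c1].
  by rewrite !mulr0 subrr mulr0.
apply: cvg_trans L; apply: near_eq_cvg; near=> e.
rewrite E; last 3 first.
- by near: e; exact: nbhs_right_gt.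
- by near: e; apply: nbhs_right_lt; lra.
- by near: e; apply: nbhs_right_lt; lra.
by rewrite mul1r mulN1r.
Unshelve. all: by end_near. Qed.

(* Chebyshev polynomials: cheb n = (T_n, U_(n-1)) *)
Fixpoint cheb (R : realType) (n : nat) : {poly R} * {poly R} :=
  if n is m.+1 then
    ('X * (cheb R m).1 - (1 - 'X ^+ 2) * (cheb R m).2,
     'X * (cheb R m).2 + (cheb R m).1)
  else (1, 0).

(** T_n' = n U_(n-1), and the equation for U_(n-1)' that yields a primitive of T_n / [wt]. The
    recursion couples both sequences, so both identities go through one induction. *)
Lemma cheb_deriv (R : realType) (n : nat) :
  (cheb R n).1^`() = n%:R *: (cheb R n).2 /\
  (1 - 'X ^+ 2) * (cheb R n).2^`() = 'X * (cheb R n).2 - n%:R *: (cheb R n).1.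
Proof.
elim: n => [|n [IH1 IH2]] /=.
  by rewrite deriv0 derivC !scale0r !mulr0 subrr.
have dX2 : (1 - 'X ^+ 2 : {poly R})^`() = - (2%:R *: 'X).
  by rewrite derivB derivC derivXn sub0r -scaler_nat expr1.
have IH2' : (1 - 'X ^+ 2) * (cheb R n).2^`() = 'X * (cheb R n).2 - n%:R%:P * (cheb R n).1.
  by rewrite IH2 mul_polyC.
move: IH1; rewrite -!mul_polyC => IH1.
split.
  rewrite derivB !derivM derivX dX2 IH1 IH2' -mul_polyC -natr1 polyCD.
  by ring.
rewrite derivD derivM derivX mulrDr mulrDr [(1 - _) * ('X * _)]mulrCA IH2' IH1 -natr1 polyCD.
by ring.
Qed.

Lemma cheb3 (R : realType) (n : nat) :
  (cheb R n.+2).1 = 2%:R *: 'X * (cheb R n.+1).1 - (cheb R n).1.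
Proof. by rewrite /= -!mul_polyC; ring. Qed.

(** * Multiplication by x and pairs of polynomials exchanged by the transform *)

Definition pwi (R : realType) (p : {poly R}) : R := \int[mu]_(x in I1) pw p x.

Lemma pwiD (R : realType) (p q : {poly R}) : pwi (p + q) = pwi p + pwi q.
Proof.
rewrite /pwi -RintegralD; [|exact: mI1|exact: pw_integrable|exact: pw_integrable].
by apply: eq_Rintegral => x _; rewrite /pw hornerD mulrDl.
Qed.

Lemma pwiZ (R : realType) (c : R) (p : {poly R}) : pwi (c *: p) = c * pwi p.
Proof.
rewrite /pwi -RintegralZl; [|exact: mI1|exact: pw_integrable].
by apply: eq_Rintegral => x _; rewrite /pw hornerZ mulrA.
Qed.

Lemma pwiB (R : realType) (p q : {poly R}) : pwi (p - q) = pwi p - pwi q.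
Proof. by rewrite -[- q]scaleN1r pwiD pwiZ mulN1r. Qed.

Lemma pwi1 (R : realType) : pwi (1 : {poly R}) = pi.
Proof.
rewrite /pwi -Rintegral_wtV; apply: eq_Rintegral => x _.
by rewrite /pw hornerC mul1r.
Qed.

(** For n >= 1 a primitive of T_n / [wt] is - [wt] U_(n-1) / n, which vanishes at both endpoints. *)
Lemma pwi_cheb (R : realType) (n : nat) : pwi (cheb R n.+1).1 = 0.
Proof.
have [dT dV] := cheb_deriv R n.+1.
set T := (cheb R n.+1).1 in dT dV *; set V := (cheb R n.+1).2 in dT dV *.
clearbody T V.
have [M hM] := pw_bound T.
have m11 : (-1 : R) < 1 by lra.
have wm1 : wt (-1 : R) = 0 by rewrite /wt sqrrN expr1n subrr sqrtr0.
have w1 : wt (1 : R) = 0 by rewrite /wt expr1n subrr sqrtr0.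
have cF : continuous (fun x : R => - n.+1%:R^-1 * (wt x * V.[x])).
  by move=> x; apply: cvgM; [exact: cvg_cst|apply: cvgM; [exact: wt_continuous|exact: continuous_horner]].
pose F (x : R) := - n.+1%:R^-1 * (wt x * V.[x]).
have [_ E] : L1 (pw T) /\ \int[mu]_(x in I1) pw T x = F 1 - F (-1).
  apply: (@FTC_wt R (pw T) F (-1) 1 (F (-1)) (F 1) M (lexx _) m11 (lexx _)).
  - move=> x /andP[x1 x2]; rewrite /pw normrM normfV (ger0_norm (wt_ge0 x)) ler_wpM2r ?invr_ge0 ?wt_ge0//.
    by apply: hM; rewrite !ltW.
  - move=> x x1; have w0 := wt_gt0 x1.
    have x1' : -1 <= x <= 1 by case/andP: x1 => ? ?; rewrite !ltW.
    have dh : is_derive x 1 (horner V) (V^`().[x]).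
      split; first exact: derivable_horner.
      by rewrite -derive1E -derivE.
    have h := is_deriveZ (- n.+1%:R^-1) (is_deriveM (is_derive_wt x1) dh).
    apply: (is_derive_eq h); rewrite /GRing.scale /= /GRing.scale /=.
    have := congr1 (horner^~ x) dV; rewrite !hornerE /= => e.
    have e2 : wt x * V^`().[x] = (x * V.[x] - n.+1%:R * T.[x]) / wt x.
      rewrite -e -(wt_sqr x1') expr2; field; exact: lt0r_neq0.
    rewrite e2 /pw; field.
    by rewrite lt0r_neq0//= nat1r pnatr_eq0.
  - by move=> x x1; exact: pw_continuous.
  - by apply: cvg_at_right_filter; exact: cF.
  - by apply: cvg_at_left_filter; exact: cF.
by rewrite /pwi E /F wm1 w1 !mul0r mulr0 subrr.
Qed.

(** Writing x = t + (x - t) cancels the singularity in the second term, whose limit is the integral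
    of f. In the limit, T (x f) = t T f plus that integral; this rule alone generates all the
    polynomial cases from 1 / [wt]. *)
Lemma tr_mulX (R : realType) (f : R -> R) (t e : R) :
  L1 f -> 0 < e ->
  tr (fun x => x * f x) t e =
    t * tr f t e + \int[mu]_(x in I1) (f x * ((x - t) * ktr (x - t) e)).
Proof.
move=> intf e0; rewrite /uker.
have ik := ktr_integrable t intf e0.
rewrite -RintegralZl; [|exact: mI1|exact: ik].
rewrite -RintegralD.
- by apply: eq_Rintegral => x _; ring.
- exact: mI1.
- by apply: integrableZ_R; [exact: mI1|exact: ik].
- apply: (@integrable_bounded_mul _ _ _ _ 1).
  + exact: mI1.
  + exact: intf.
  + apply: measurable_funM; last exact: ktr_measurable.
    by apply: measurable_funTS; exact: shift_measurable.
  + move=> x _; rewrite /ktr; case: ifPn => [h|_]; last by rewrite mulr0 normr0.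
    by rewrite mulfV ?normr1// -normr_eq0 gt_eqF// (lt_trans e0).
Qed.

Lemma tr_mulX_rem (R : realType) (f : R -> R) (t : R) :
  L1 f ->
  \int[mu]_(x in I1) (f x * ((x - t) * ktr (x - t) e)) @[e --> (0 : R)^'+] -->
  \int[mu]_(x in I1) f x.
Proof.
move=> intf; apply/cvg_at_rightP => u [u0 ucvg].
have mI := @mI1 R.
have mf : measurable_fun I1 f by have /integrableP[/measurable_EFinP] := intf.
have mh (n : nat) : measurable_fun I1 (fun x : measurableTypeR R => f x * ((x - t) * ktr (x - t) (u n))).
  apply: measurable_funM => //; apply: measurable_funM; last exact: ktr_measurable.
  by apply: measurable_funTS; exact: shift_measurable.
have hb (n : nat) x : `|f x * ((x - t) * ktr (x - t) (u n))| <= `|f x|.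
  rewrite normrM -[leRHS]mulr1 ler_wpM2l// /ktr; case: ifPn => [h|_]; last by rewrite mulr0 normr0.
  by rewrite mulfV ?normr1// -normr_eq0 gt_eqF// (lt_trans (u0 n)).
have ae1 : {ae mu, forall x, I1 x -> (f x * ((x - t) * ktr (x - t) (u n)))%:E @[n --> \oo] --> (f x)%:E}.
  exists [set t]; split; [exact: measurable_set1|exact: lebesgue_measure_set1|].
  move=> x /= H; apply: contrapT => xt; apply: H => Ix.
  apply: cvg_EFin; first exact: nearW.
  have x0 : 0 < `|x - t| by rewrite normr_gt0 subr_eq0; apply/eqP.
  have : \forall n \near \oo, u n < `|x - t| by apply: (cvgr_lt (0 : R)).
  move=> h; apply: (@cvg_trans _ (cst (f x) @ \oo)); last exact: cvg_cst.
  apply: near_eq_cvg; apply: filterS h => n h /=.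
  by rewrite /ktr h mulfV ?mulr1// -normr_eq0 gt_eqF.
pose G := EFin \o (fun x : measurableTypeR R => `|f x|).
have ae2 : {ae mu, forall x n, I1 x -> (`|(f x * ((x - t) * ktr (x - t) (u n)))%:E| <= G x)%E}.
  by apply: aeW => x n _; rewrite /= lee_fin.
have mhE n : measurable_fun I1 (fun x : measurableTypeR R => (f x * ((x - t) * ktr (x - t) (u n)))%:E).
  exact/measurable_EFinP.
have [_ _ c] := @dominated_convergence _ _ _ mu _ mI
  (fun n x => (f x * ((x - t) * ktr (x - t) (u n)))%:E) (EFin \o f) G
  mhE ((measurable_EFinP _ _).2 mf) ae1 (integrable_norm intf) ae2.
rewrite (Rintegral_lee mI intf) in c.
exact: (fine_cvg c).
Qed.

Lemma cvg_right_eq (R : realType) (h g : R -> R) (l : R) :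
  (forall e, 0 < e -> h e = g e) -> g e @[e --> (0 : R)^'+] --> l ->
  h e @[e --> (0 : R)^'+] --> l.
Proof.
move=> hg; apply: cvg_trans; apply: near_eq_cvg; near=> e.
by rewrite hg//; near: e; exact: nbhs_right_gt.
Unshelve. all: by end_near. Qed.

Lemma pv_mulX (R : realType) (f : R -> R) (t l : R) :
  L1 f ->
  tr f t e @[e --> (0 : R)^'+] --> l ->
  tr (fun x => x * f x) t e @[e --> (0 : R)^'+] -->
    t * l + \int[mu]_(x in I1) f x.
Proof.
move=> intf fl.
apply: (cvg_right_eq (fun e e0 => tr_mulX t intf e0)); apply: cvgD; last exact: tr_mulX_rem.
by apply: cvgM; [exact: cvg_cst|exact: fl].
Qed.

Definition pvp (R : realType) (p q : {poly R}) : Prop := forall t : R, I1 t ->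
  tr (pw p) t e @[e --> (0 : R)^'+] --> q.[t].

Lemma pvpD (R : realType) (p1 q1 p2 q2 : {poly R}) :
  pvp p1 q1 -> pvp p2 q2 -> pvp (p1 + p2) (q1 + q2).
Proof.
move=> h1 h2 t It; rewrite hornerD.
have E e : 0 < e -> tr (pw (p1 + p2)) t e = tr (pw p1) t e + tr (pw p2) t e.
  move=> e0; rewrite -(trD t (pw_integrable p1) (pw_integrable p2) e0).
  by congr (uker _ _ _ _); apply/funext => x; rewrite /pw hornerD mulrDl.
by apply: (cvg_right_eq E); apply: cvgD; [exact: h1|exact: h2].
Qed.

Lemma pvpZ (R : realType) (c : R) (p q : {poly R}) : pvp p q -> pvp (c *: p) (c *: q).
Proof.
move=> h t It; rewrite hornerZ.
have E e : 0 < e -> tr (pw (c *: p)) t e = c * tr (pw p) t e.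
  move=> e0; rewrite -(trZ c t (pw_integrable p) e0).
  by congr (uker _ _ _ _); apply/funext => x; rewrite /pw hornerZ mulrA.
by apply: (cvg_right_eq E); apply: cvgM; [exact: cvg_cst|exact: h].
Qed.

Lemma pvpB (R : realType) (p1 q1 p2 q2 : {poly R}) :
  pvp p1 q1 -> pvp p2 q2 -> pvp (p1 - p2) (q1 - q2).
Proof.
by move=> h1 h2; rewrite -[- p2]scaleN1r -[- q2]scaleN1r; apply: pvpD => //; exact: pvpZ.
Qed.

Lemma pvpX (R : realType) (p q : {poly R}) : pvp p q -> pvp ('X * p) ('X * q + (pwi p)%:P).
Proof.
move=> h t It; rewrite !hornerE.
have := pv_mulX (pw_integrable p) (h t It).
rewrite (_ : (fun x => x * pw p x) = pw ('X * p))//.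
by apply/funext => x; rewrite /pw hornerM hornerX mulrA.
Qed.

Lemma pvp1 (R : realType) : pvp (1 : {poly R}) 0.
Proof.
move=> t It; rewrite horner0; have := pv_wtV It.
rewrite (_ : (fun x => (wt x)^-1) = pw 1)//.
by apply/funext => x; rewrite /pw hornerC mul1r.
Qed.

(** [wt] U is encoded as (1 - 'X^2) U / [wt], so both identities concern weighted polynomials. The
    constants produced by the multiplication rule vanish through [pwi_cheb] except for n = 0, where
    [cheb R 0] = (1, 0) leaves the correction pi. *)
Lemma pvp_cheb (R : realType) (n : nat) :
  pvp (cheb R n).1 (pi *: (cheb R n).2) /\
  pvp ((1 - 'X ^+ 2) * (cheb R n).2) (- pi *: (cheb R n).1 + (n == 0%N)%:R *: pi%:P).
Proof.
elim: n => [|n [IH1 IH2]].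
  rewrite /= scaler0; split; first exact: pvp1.
  rewrite mulr0 scale1r scaleNr (_ : pi%:P = pi *: 1); last by rewrite alg_polyC.
  rewrite addNr => t It; rewrite horner0.
  by have := @pvpZ R 0 _ _ (@pvp1 R) t It; rewrite !scale0r horner0.
have E1 : pvp (cheb R n.+1).1 (pi *: (cheb R n.+1).2).
  have := pvpB (pvpX IH1) IH2; rewrite -/(cheb R n.+1).1; congr pvp.
  rewrite /= -!mul_polyC; case: n {IH1 IH2} => [|n].
    by rewrite /= pwi1 polyCN; ring.
  by rewrite pwi_cheb polyCN /=; ring.
split => //.
have XX := pvpX (pvpX IH1).
have H := pvpD (pvpX IH2) (pvpB IH1 XX).
have pE : 'X * ((1 - 'X ^+ 2) * (cheb R n).2) + ((cheb R n).1 - 'X * ('X * (cheb R n).1)) =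
    (1 - 'X ^+ 2) * (cheb R n.+1).2 by rewrite /=; ring.
rewrite pE in H.
move: H; congr pvp.
have mE : pwi ((1 - 'X ^+ 2) * (cheb R n).2) = pwi ('X * (cheb R n).1).
  have := @pwi_cheb R n; rewrite /= pwiB => /eqP; rewrite subr_eq0 => /eqP ->//.
rewrite mE -!mul_polyC; case: n {IH1 IH2 XX E1 pE mE} => [|n].
  by rewrite /= pwi1 polyCN; ring.
by rewrite pwi_cheb polyCN /=; ring.
Qed.

Definition pv_pair (R : realType) (p : {poly R}) : Prop := exists2 q : {poly R},
  pvp p (pi *: q) & pvp ((1 - 'X ^+ 2) * q) (- pi *: p + (pwi p)%:P).

Lemma pv_pairD (R : realType) (p1 p2 : {poly R}) :
  pv_pair p1 -> pv_pair p2 -> pv_pair (p1 + p2).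
Proof.
move=> [q1 h1 k1] [q2 h2 k2]; exists (q1 + q2).
  by rewrite scalerDr; exact: pvpD.
by rewrite mulrDr scalerDr pwiD polyCD addrACA; exact: pvpD.
Qed.

Lemma pv_pairZ (R : realType) (c : R) (p : {poly R}) : pv_pair p -> pv_pair (c *: p).
Proof.
move=> [q h k]; exists (c *: q).
  by rewrite scalerA mulrC -scalerA; exact: pvpZ.
have -> : (1 - 'X ^+ 2) * (c *: q) = c *: ((1 - 'X ^+ 2) * q) by rewrite scalerAr.
have -> : - pi *: (c *: p) + (pwi (c *: p))%:P = c *: (- pi *: p + (pwi p)%:P).
  by rewrite pwiZ polyCM -!mul_polyC; ring.
exact: pvpZ.
Qed.

Lemma pv_pair_cheb (R : realType) (n : nat) : pv_pair (cheb R n).1.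
Proof.
have [h k] := pvp_cheb R n; exists (cheb R n).2 => //.
move: k; congr pvp; congr (_ + _); case: n h => [|n] _.
  by rewrite /= pwi1 scale1r.
by rewrite pwi_cheb /= scale0r.
Qed.

(** [pv_pair] is linear, but its stability under multiplication by 'X is not apparent. The induction
    therefore carries a factor T_n and uses X T_(n+1) = (T_(n+2) + T_n) / 2. *)
Lemma pv_pair_all (R : realType) (p : {poly R}) : pv_pair p.
Proof.
suff H : forall n, pv_pair (p * (cheb R n).1) by have := H 0%N; rewrite mulr1.
elim/poly_ind: p => [|p c IH] n.
  by rewrite mul0r -(scale0r (cheb R 0).1); exact/pv_pairZ/pv_pair_cheb.
rewrite mulrDl mul_polyC -mulrA; apply: pv_pairD; last exact/pv_pairZ/pv_pair_cheb.
case: n => [|n].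
  have -> : 'X * (cheb R 0).1 = (cheb R 1).1 by rewrite /=; ring.
  exact: IH.
have -> : p * ('X * (cheb R n.+1).1) = 2^-1 *: (p * (cheb R n.+2).1) + 2^-1 *: (p * (cheb R n).1).
  rewrite -scalerDr -mulrDr cheb3 subrK -scalerAl -scalerAr scalerA mulVf ?scale1r//.
by apply: pv_pairD; apply: pv_pairZ; exact: IH.
Qed.

(** Multiplication by 'X on the p side produces q 'X plus a constant; since 'X itself is mapped to
    the constant pi, a multiple of 'X corrects it. *)
Lemma pvp_range (R : realType) (q : {poly R}) : exists p : {poly R}, pvp p (pi *: q).
Proof.
have pX : pvp ('X : {poly R}) pi%:P.
  have := pvpX (@pvp1 R); rewrite mulr1 mulr0 add0r pwi1; exact.
elim/poly_ind: q => [|q c [p IH]].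
  exists (0 *: 1); have := @pvpZ R 0 _ _ (@pvp1 R); by rewrite !scaler0.
exists ('X * p + (c - (pwi p / pi)) *: 'X).
have pi0 : (pi : R) != 0 by rewrite gt_eqF// pi_gt0.
have := pvpD (pvpX IH) (@pvpZ R (c - pwi p / pi) _ _ pX); congr pvp.
rewrite -!mul_polyC -[(_ - _)%:P * pi%:P]polyCM mulrBl divfK// polyCB polyCM.
by ring.
Qed.

(** * Density of polynomials *)

(** Uniform continuity in the shape required by Chebyshev's inequality: the quadratic term will be
    averaged to a variance. A failure for every C = n gives two sequences whose distance tends to 0,
    and Bolzano-Weierstrass contradicts the continuity of g. *)
Lemma continuous_quadratic_modulus (R : realType) (g : R -> R) (e : R) :
  continuous g -> 0 < e -> exists2 C : R, 0 <= C &
  forall x y : R, -1 <= x <= 1 -> -1 <= y <= 1 -> `|g x - g y| <= e + C * (x - y) ^+ 2.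
Proof.
move=> cg e0.
have cpt : {within `[(-1 : R), 1], continuous g} by exact: continuous_subspaceT.
have [M0 [Mr hM]] := compact_bounded (continuous_compact cpt (@segment_compact R (-1) 1)).
pose M := M0 + 1.
have gM x : -1 <= x <= 1 -> `|g x| <= M.
  by move=> x1; apply: (hM M); [rewrite ltrDl|exists x => //; rewrite /= in_itv].
apply: contrapT => no.
have H (n : nat) : {xy : R * R | [/\ -1 <= xy.1 <= 1, -1 <= xy.2 <= 1 &
    e + n%:R * (xy.1 - xy.2) ^+ 2 < `|g xy.1 - g xy.2|]}.
  apply: cid; apply: contrapT => no2; apply: no; exists n%:R => // x y x1 y1.
  rewrite leNgt; apply/negP => h; apply: no2; by exists (x, y).
pose u n := (sval (H n)).1; pose v n := (sval (H n)).2.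
have uP n : -1 <= u n <= 1 by rewrite /u; case: (H n) => ? [].
have vP n : -1 <= v n <= 1 by rewrite /v; case: (H n) => ? [].
have uvP n : e + n%:R * (u n - v n) ^+ 2 < `|g (u n) - g (v n)|.
  by rewrite /u /v; case: (H n) => ? [].
have bu : bounded_fun u.
  exists 1; split; first exact: num_real.
  by move=> z z1 n _ /=; have := uP n; rewrite -ler_norml => /le_trans; apply; exact: ltW.
have [f fi fc] := bolzano_weierstrass bu.
have [l lc] := (cvg_ex _).1 fc.
have fge n : (n <= f n)%N.
  elim: n => // n IH; apply: (leq_ltn_trans IH).
  have : ~~ (f n.+1 <= f n)%O by rewrite fi ltnn.
  by rewrite leEnat -ltnNge.
have uv0 : (u (f n) - v (f n)) @[n --> \oo] --> (0 : R).
  apply/cvgrPdist_le => d d0; near=> n.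
  have n0 : 0 < n%:R :> R by near: n; exists 1%N => // k /=; rewrite ltr0n.
  have hn : 2 * M / d ^+ 2 <= n%:R.
    by near: n; exact: nbhs_infty_ger.
  rewrite sub0r normrN.
  have h1 := uvP (f n).
  have h2 : `|g (u (f n)) - g (v (f n))| <= 2 * M.
    by rewrite (le_trans (ler_normB _ _))// mulr_natl mulr2n lerD// gM.
  have h3 : n%:R * (u (f n) - v (f n)) ^+ 2 <= 2 * M.
    have : n%:R * (u (f n) - v (f n)) ^+ 2 <= (f n)%:R * (u (f n) - v (f n)) ^+ 2.
      by rewrite ler_wpM2r ?sqr_ge0// ler_nat.
    by lra.
  have h4 : (u (f n) - v (f n)) ^+ 2 <= d ^+ 2.
    rewrite ler_pdivrMr ?exprn_gt0// in hn.
    rewrite -(ler_pM2l n0); exact: le_trans h3 hn.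
  by rewrite -ler_sqr ?nnegrE ?(ltW d0)// real_normK ?num_real.
have vc : v (f n) @[n --> \oo] --> l.
  rewrite (_ : (fun n => v (f n)) = (fun n => u (f n) - (u (f n) - v (f n)))); last first.
    by apply/funext => n; ring.
  by rewrite -[X in _ --> X]subr0; apply: cvgB.
have gu : g (u (f n)) @[n --> \oo] --> g l by apply: continuous_cvg; [exact: cg|exact: lc].
have gv : g (v (f n)) @[n --> \oo] --> g l by apply: continuous_cvg; [exact: cg|exact: vc].
have guv : `|g (u (f n)) - g (v (f n))| @[n --> \oo] --> (0 : R).
  by rewrite -(normr0 R) -(subrr (g l)); apply: cvg_norm; apply: cvgB.
have : \forall n \near \oo, `|g (u (f n)) - g (v (f n))| < e by apply: (cvgr_lt (0 : R)).
move=> [n _ /(_ n (leqnn n)) /=]; rewrite ltNge => /negP; apply.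
apply: le_trans (ltW (uvP (f n))); rewrite lerDl mulr_ge0 ?sqr_ge0//.
Unshelve. all: by end_near. Qed.

(* Bernstein polynomials on [-1,1] through the recursion of the binomial
   random walk of parameter (1 + x) / 2: bern n phi is E (phi (S_n)). *)
Definition bernX (R : realType) : {poly R} := (2^-1)%:P * (1 + 'X).

Fixpoint bern (R : realType) (n : nat) (phi : nat -> R) : {poly R} :=
  if n is m.+1 then bernX R * bern m (fun k => phi k.+1) + (1 - bernX R) * bern m phi
  else (phi 0%N)%:P.

Lemma bernXE (R : realType) (x : R) : (bernX R).[x] = (1 + x) / 2.
Proof. by rewrite /bernX !hornerE mulrC. Qed.

Lemma bernS (R : realType) (n : nat) (phi : nat -> R) (x : R) :
  (bern n.+1 phi).[x] = (1 + x) / 2 * (bern n (fun k => phi k.+1)).[x] +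
    (1 - (1 + x) / 2) * (bern n phi).[x].
Proof.
have h : (1 - bernX R).[x] = 1 - (1 + x) / 2 by rewrite hornerD hornerN hornerC bernXE.
have -> : bern n.+1 phi = bernX R * bern n (fun k => phi k.+1) + (1 - bernX R) * bern n phi by [].
rewrite hornerD (hornerM (bernX R)) (hornerM (1 - bernX R)) h.
by rewrite bernXE.
Qed.

Lemma bern_le (R : realType) (n : nat) (phi psi : nat -> R) (x : R) :
  -1 <= x <= 1 -> (forall k, (k <= n)%N -> phi k <= psi k) ->
  (bern n phi).[x] <= (bern n psi).[x].
Proof.
move=> x1; elim: n phi psi => [|n IH] phi psi H.
  by rewrite /= !hornerC H.
rewrite !bernS; case/andP: x1 IH => x1 x2 IH; apply: lerD; apply: ler_wpM2l; try lra.
  by apply: IH => k kn; exact: H.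
by apply: IH => k kn; apply: H; exact: leqW.
Qed.

(** The second moment of the binomial law about c: squared bias plus the variance n s (1 - s). *)
Lemma bern_quad (R : realType) (n : nat) (a b c : R) (x : R) (s := (1 + x) / 2) :
  (bern n (fun k => a + b * (k%:R - c) ^+ 2)).[x] =
    a + b * ((n%:R * s - c) ^+ 2 + n%:R * s * (1 - s)).
Proof.
elim: n c => [|n IH] c; first by rewrite /= hornerC; ring.
rewrite bernS -/s IH.
rewrite (_ : (fun k => a + b * (k.+1%:R - c) ^+ 2) = (fun k => a + b * (k%:R - (c - 1)) ^+ 2)).
  by rewrite IH -natr1; ring.
by apply/funext => k; rewrite -natr1; ring.
Qed.

Lemma weierstrass (R : realType) (g : R -> R) (e : R) :
  continuous g -> 0 < e -> exists p : {poly R}, forall x : R, -1 <= x <= 1 ->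
  `|g x - p.[x]| <= e.
Proof.
move=> cg e0; have e20 : 0 < e / 2 by rewrite divr_gt0.
have [C C0 hC] := continuous_quadratic_modulus cg e20.
have [n nP] : exists n : nat, 2 * C / e < n.+1%:R.
  by exists (Num.truncn (2 * C / e)); exact: truncnS_gt.
set N := n.+1 in nP; have N0 : 0 < N%:R :> R by rewrite ltr0n.
pose phi k : R := g (2 * k%:R / N%:R - 1).
exists (bern N phi) => x x1.
pose s := (1 + x) / 2.
have Hk k : (k <= N)%N -> `|g x - phi k| <= e / 2 + C * 4 / N%:R ^+ 2 * (k%:R - N%:R * s) ^+ 2.
  move=> kN; have h : -1 <= (2 * k%:R / N%:R - 1 : R) <= 1.
    have k0 : 0 <= k%:R / N%:R :> R by rewrite divr_ge0.
    have k1 : k%:R / N%:R <= 1 :> R by rewrite ler_pdivrMr// mul1r ler_nat.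
    have -> : 2 * k%:R / N%:R - 1 = 2 * (k%:R / N%:R) - 1 :> R by rewrite mulrA.
    have fin (a : R) : 0 <= a -> a <= 1 -> -1 <= 2 * a - 1 <= 1.
      by move=> a0 a1; apply/andP; split; lra.
    exact: fin.
  apply: (le_trans (hC _ _ x1 h)); rewrite lerD2l le_eqVlt; apply/orP; left; apply/eqP.
  by rewrite /s; field; rewrite gt_eqF.
have E : e / 2 + C * 4 / N%:R ^+ 2 * ((N%:R * s - N%:R * s) ^+ 2 + N%:R * s * (1 - s)) <= e.
  rewrite subrr expr0n /= add0r.
  have -> : C * 4 / N%:R ^+ 2 * (N%:R * s * (1 - s)) = C / N%:R * (4 * s * (1 - s)).
    by field; rewrite gt_eqF.
  have h1 : 4 * s * (1 - s) <= 1.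
    by have := sqr_ge0 (2 * s - 1); rewrite /s; lra.
  have h2 : C / N%:R <= e / 2.
    by move: nP; rewrite ltr_pdivrMr// ler_pdivrMr// => ?; lra.
  have h3 : 0 <= C / N%:R by rewrite divr_ge0// ltW.
  have := ler_wpM2l h3 h1; lra.
have up : (bern N phi).[x] <= g x + e.
  have := @bern_le R N phi (fun k => (g x + e / 2) + C * 4 / N%:R ^+ 2 * (k%:R - N%:R * s) ^+ 2) x x1.
  rewrite bern_quad => h; apply: (le_trans (h _)).
    by move=> k /Hk; rewrite ler_norml => /andP[? ?]; lra.
  by move: E; rewrite -/s; lra.
have dn : g x - e <= (bern N phi).[x].
  have := @bern_le R N (fun k => (g x - e / 2) + (- (C * 4 / N%:R ^+ 2)) * (k%:R - N%:R * s) ^+ 2) phi x x1.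
  rewrite bern_quad => h; apply: le_trans (h _).
    by move: E; rewrite -/s; lra.
  by move=> k /Hk; rewrite ler_norml => /andP[? ?]; lra.
by rewrite ler_norml; apply/andP; split; lra.
Qed.

Lemma L1_measurable (R : realType) (f : R -> R) : L1 f -> measurable_fun I1 f.
Proof. by move=> /integrableP[/measurable_EFinP]. Qed.

Lemma L1_le (R : realType) (f g : R -> R) : measurable_fun I1 f -> L1 g ->
  (forall x : R, I1 x -> `|f x| <= g x) -> L1 f.
Proof.
move=> mf ig fg; apply: le_integrable ig.
- exact: mI1.
- exact/measurable_EFinP.
by move=> x Ix /=; rewrite lee_fin (le_trans (fg x Ix))// ler_norm.
Qed.

Lemma L1D (R : realType) (f g : R -> R) : L1 f -> L1 g -> L1 (fun x => f x + g x).
Proof. by move=> If Ig; apply: integrableD_R => //; exact: mI1. Qed.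

Lemma L1B (R : realType) (f g : R -> R) : L1 f -> L1 g -> L1 (fun x => f x - g x).
Proof. by move=> If Ig; apply: integrableB_R => //; exact: mI1. Qed.

Lemma L1Z (R : realType) (c : R) (f : R -> R) : L1 f -> L1 (fun x => c * f x).
Proof. by move=> If; apply: integrableZ_R => //; exact: mI1. Qed.

Lemma L1_norm (R : realType) (f : R -> R) : L1 f -> L1 (fun x => `|f x|).
Proof. by move=> If; exact: integrable_norm. Qed.

Lemma L1M (R : realType) (C : R) (f k : R -> R) : L1 f -> measurable_fun I1 k ->
  (forall x : R, I1 x -> `|k x| <= C) -> L1 (fun x => f x * k x).
Proof. by move=> If mk kC; apply: (integrable_bounded_mul (@mI1 R) If mk kC). Qed.

Lemma le_RI (R : realType) (f g : R -> R) : L1 f -> L1 g ->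
  (forall x : R, I1 x -> f x <= g x) -> \int[mu]_(x in I1) f x <= \int[mu]_(x in I1) g x.
Proof. by move=> If Ig fg; apply: le_Rintegral => //; exact: mI1. Qed.

Lemma RID (R : realType) (f g : R -> R) : L1 f -> L1 g ->
  \int[mu]_(x in I1) (f x + g x) = \int[mu]_(x in I1) f x + \int[mu]_(x in I1) g x.
Proof. by move=> If Ig; rewrite RintegralD//; exact: mI1. Qed.

Lemma RIZ (R : realType) (c : R) (f : R -> R) : L1 f ->
  \int[mu]_(x in I1) (c * f x) = c * \int[mu]_(x in I1) f x.
Proof. by move=> If; rewrite RintegralZl//; exact: mI1. Qed.

Lemma L1_dct (R : realType) (F : nat -> R -> R) (g : R -> R) :
  (forall n, measurable_fun I1 (F n)) -> L1 g ->
  (forall n (x : R), I1 x -> `|F n x| <= g x) ->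
  (forall x : R, I1 x -> F n x @[n --> \oo] --> (0 : R)) ->
  \int[mu]_(x in I1) F n x @[n --> \oo] --> (0 : R).
Proof.
move=> mF ig Fg F0.
have [|||_ _ H] := @dominated_convergence _ _ R mu I1 (@mI1 R) (fun n => EFin \o F n) (cst 0%E)
  (EFin \o g) _ (measurable_cst _) _ ig.
- by move=> n; apply/measurable_EFinP.
- by apply: aeW => x Ix; apply: cvg_EFin; [exact: nearW|exact: F0].
- by apply: aeW => x Ix n /=; rewrite lee_fin; exact: Fg.
rewrite integral0 in H.
rewrite (_ : (fun n => _) = fine \o (fun n => \int[mu]_(x in I1) (EFin \o F n) x))%E//.
by apply: fine_cvg; exact: H.
Qed.

Definition clamp (R : realType) (N s : R) : R := Num.max (- N) (Num.min N s).

Lemma clamp_le (R : realType) (N s : R) : 0 <= N -> `|clamp N s| <= N.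
Proof.
by move=> N0; rewrite ler_norml /clamp le_max lexx /= ge_max ge_min lexx/= andbT; lra.
Qed.

Lemma clamp_id (R : realType) (N s : R) : `|s| <= N -> clamp N s = s.
Proof.
by rewrite ler_norml => /andP[h1 h2]; rewrite /clamp min_r// max_r.
Qed.

Lemma clamp_lip (R : realType) (N s t : R) : `|clamp N s - clamp N t| <= `|s - t|.
Proof.
have h1 := ler_norm (s - t); have h2 := ler_norm (- (s - t)); rewrite normrN in h2.
move: h1 h2; set C := `|s - t| => h1 h2; rewrite ler_norml /clamp.
case: (lerP N s) => ?; case: (lerP N t) => ?; case: (lerP (- N) N) => ?;
  case: (lerP (- N) s) => ?; case: (lerP (- N) t) => ?; apply/andP; split; lra.
Qed.

Lemma clamp_sub (R : realType) (N s : R) : 0 <= N -> `|s - clamp N s| <= `|s|.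
Proof.
move=> N0; have h1 := ler_norm s; have h2 := ler_norm (- s); rewrite normrN in h2.
move: h1 h2; set C := `|s| => h1 h2; rewrite ler_norml /clamp.
case: (lerP N s) => ?; case: (lerP (- N) N) => ?; case: (lerP (- N) s) => ?;
  apply/andP; split; lra.
Qed.

Lemma clamp_measurable (R : realType) (N : R) (B : set (measurableTypeR R)) (f : R -> R) :
  measurable_fun B f -> measurable_fun B (fun x => clamp N (f x)).
Proof.
by move=> mf; apply: measurable_maxr; [exact: measurable_cst|apply: measurable_minr; [exact: measurable_cst|]].
Qed.

Lemma clamp_continuous (R : realType) (N : R) (f : R -> R) : continuous f ->
  continuous (fun x => clamp N (f x)).
Proof.
move=> cf x; apply/cvgrPdist_le => e e0; near=> y.
apply: (le_trans (clamp_lip _ _ _)).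
by near: y; move: e e0; apply/cvgrPdist_le; exact: cf.
Unshelve. all: by end_near. Qed.

Lemma sub_min_norm_le (R : realType) (a b : R) : 0 <= a -> 0 <= b -> `|a - Num.min a b| <= a.
Proof.
move=> a0 b0; rewrite ler_norml; case: (lerP a b) => ?; apply/andP; split; lra.
Qed.

(** The weight w may be unbounded: it is cut at a level K, and phi is approximated in the unweighted
    L^1 by a clamped continuous function, then by a polynomial. The uniform bound N + 1 controls the
    part of w above K and, later, the logarithm in the modular. *)
Lemma poly_approx (R : realType) (phi w : R -> R) (N e : R) : 0 <= N -> 0 < e ->
  measurable_fun I1 phi -> (forall x : R, I1 x -> `|phi x| <= N) ->
  L1 w -> (forall x : R, I1 x -> 0 <= w x) ->
  exists p : {poly R}, (forall x : R, I1 x -> `|p.[x]| <= N + 1) /\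
    \int[mu]_(x in I1) (`|phi x - p.[x]| * w x) <= e.
Proof.
move=> N0 e0 mphi phiN iw w0.
have mw := L1_measurable iw.
pose wk (n : nat) (x : R) := w x - Num.min (w x) n%:R.
have wk0 : \int[mu]_(x in I1) wk n x @[n --> \oo] --> (0 : R).
  apply: (@L1_dct _ _ w) => //.
  - move=> n; apply: measurable_funB => //; apply: measurable_minr => //; exact: measurable_cst.
  - by move=> n x Ix; apply: sub_min_norm_le => //; exact: w0.
  - move=> x Ix; apply: cvg_near_cst; near=> n; rewrite /wk min_l ?subrr//.
    near: n; exact: nbhs_infty_ger.
have e1 : 0 < e / (2 * (2 * N + 1)) by rewrite divr_gt0//; lra.
have [K hK] : exists K : nat, \int[mu]_(x in I1) wk K x < e / (2 * (2 * N + 1)).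
  have : \forall n \near \oo, \int[mu]_(x in I1) wk n x < e / (2 * (2 * N + 1)) by apply: (cvgr_lt (0 : R)).
  by move=> [n _ /(_ n (leqnn n)) /= h]; exists n.
have K0 : (0 : R) <= K%:R by [].
have iphi : L1 phi.
  by apply: (L1_le mphi (integrable_cstI N)) => x Ix; exact: phiN.
pose d := e / (4 * (K%:R + 1)).
have d0 : 0 < d by rewrite divr_gt0//; lra.
have muI : (mu (I1 : set (measurableTypeR R)) < +oo)%E.
  by rewrite lebesgue_measure_itv/= lte_fin ifT; [rewrite -EFinB ltry|lra].
have [h_ [hc hi hl]] := approximation_continuous_integrable (@mI1 R) muI iphi.
have [n hn] : exists n : nat, \int[mu]_(z in I1) `|phi z - h_ n z| < d.
  have hl' : \int[mu]_(z in I1) `|phi z - h_ n z| @[n --> \oo] --> (0 : R).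
    by apply: fine_cvg; exact: hl.
  have : \forall n \near \oo, \int[mu]_(z in I1) `|phi z - h_ n z| < d.
    by apply: (cvgr_lt (0 : R)) => //; exact: hl'.
  by move=> [n _ /(_ n (leqnn n)) /= h]; exists n.
have e2 : 0 < Num.min 1 (d / 2) by rewrite lt_min ltr01/= divr_gt0.
have [p hp] := weierstrass (clamp_continuous (N := N) (hc n)) e2.
have pI x : I1 x -> `|clamp N (h_ n x) - p.[x]| <= 1 /\ `|clamp N (h_ n x) - p.[x]| <= d / 2.
  rewrite /= in_itv/= => /andP[x1 x2].
  have : `|clamp N (h_ n x) - p.[x]| <= Num.min 1 (d / 2) by apply: hp; rewrite !ltW.
  by rewrite le_min => /andP[].
have pN x : I1 x -> `|p.[x]| <= N + 1.
  move=> Ix; have [h1 _] := pI x Ix; have h2 := clamp_le (h_ n x) N0.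
  rewrite -[p.[x]](subKr (clamp N (h_ n x))).
  by apply: (le_trans (ler_normB _ _)); apply: lerD.
exists p; split => //.
have mp : measurable_fun I1 (fun x : R => p.[x]) by exact: horner_measurable.
have md : measurable_fun I1 (fun x : R => `|phi x - p.[x]|).
  by apply: measurableT_comp => //; apply: measurable_funB.
have dN x : I1 x -> `|phi x - p.[x]| <= 2 * N + 1.
  move=> Ix; apply: (le_trans (ler_normB _ _)).
  by have := phiN x Ix; have := pN x Ix; lra.
have iphih : L1 (fun x => `|phi x - h_ n x|).
  by apply: L1_norm; apply: L1B.
have h1 := ltW hn.
have id : L1 (fun x => `|phi x - p.[x]|).
  by apply: (L1_le md (integrable_cstI (2 * N + 1))) => x Ix; rewrite normr_id; exact: dN.
have h2 : \int[mu]_(x in I1) `|phi x - p.[x]| <= 2 * d.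
  have : \int[mu]_(x in I1) `|phi x - p.[x]| <= \int[mu]_(x in I1) (`|phi x - h_ n x| + cst (d / 2) x).
    apply: le_RI => //.
      by apply: L1D => //; exact: integrable_cstI.
    move=> x Ix; have [_ h3] := pI x Ix.
    have := clamp_lip N (phi x) (h_ n x); rewrite (clamp_id (phiN x Ix)).
    have := ler_normD (phi x - clamp N (h_ n x)) (clamp N (h_ n x) - p.[x]).
    rewrite addrA subrK /cst; move: h3; set A := `|_|; set B := `|_|; set C := `|_|; lra.
  rewrite RID//; last exact: integrable_cstI.
  rewrite Rintegral_cstI.
  have fin (a b c : R) : a <= b + 2 * (d / 2) -> b <= d -> a <= 2 * d by clear; lra.
  by move=> /fin; apply.
have iwk : L1 (wk K).
  apply: (L1_le _ iw).
    by apply: measurable_funB => //; apply: measurable_minr => //; exact: measurable_cst.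
  by move=> x Ix; apply: sub_min_norm_le => //; exact: w0.
have : \int[mu]_(x in I1) (`|phi x - p.[x]| * w x) <=
    \int[mu]_(x in I1) (K%:R * `|phi x - p.[x]| + (2 * N + 1) * wk K x).
  apply: le_RI.
  - rewrite (_ : (fun x => `|phi x - p.[x]| * w x) = (fun x => w x * `|phi x - p.[x]|)).
      by apply: (L1M (C := 2 * N + 1) iw md) => x Ix; rewrite normr_id; exact: dN.
    by apply/funext => x; rewrite mulrC.
  - by apply: L1D; exact: L1Z.
  - move=> x Ix; have h3 := dN x Ix; have h4 := w0 x Ix; rewrite /wk.
    have h5 : 0 <= `|phi x - p.[x]| by [].
    have h6 : Num.min (w x) K%:R <= K%:R by rewrite ge_min lexx orbT.
    have h7 : 0 <= w x - Num.min (w x) K%:R by rewrite subr_ge0 ge_min lexx.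
    have h8 := ler_wpM2r h7 h3; have h9 := ler_wpM2l h5 h6.
    rewrite -{1}(subrK (Num.min (w x) K%:R) (w x)) mulrDr addrC lerD//.
    by rewrite (mulrC K%:R).
rewrite RID; [|exact: L1Z..].
rewrite RIZ// RIZ//.
move: h2 hK; set X := \int[mu]_(x in I1) `|_|; set Y := \int[mu]_(x in I1) wk K x => h2 hK h.
apply: (le_trans h).
have h3 : K%:R * X <= e / 2.
  apply: (@le_trans _ _ (K%:R * (2 * d))); first exact: ler_wpM2l.
  rewrite /d (_ : K%:R * (2 * (e / (4 * (K%:R + 1)))) = (e / 2) * (K%:R / (K%:R + 1))).
    by rewrite ler_piMr ?divr_ge0 ?(ltW e0)// ler_pdivrMr; clear -K0; lra.
  by field; rewrite gt_eqF//; lra.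
have h4 : (2 * N + 1) * Y <= e / 2.
  have N1 : 0 < 2 * N + 1 by lra.
  have := ltW hK; rewrite -(ler_pM2l N1).
  by rewrite (_ : (2 * N + 1) * (e / (2 * (2 * N + 1))) = e / 2)//; field; rewrite gt_eqF.
by rewrite [leRHS](splitr e) lerD.
Unshelve. all: by end_near. Qed.

(** * Powers of 1 - x^2 and the modular of L log L *)

Lemma powR_small (R : realType) (g e : R) : 0 < g -> 0 < e ->
  exists2 d : R, 0 < d & forall y : R, 0 <= y <= d -> y `^ g <= e.
Proof.
move=> g0 e0; exists (e `^ (g^-1)); first exact: powR_gt0.
move=> y /andP[y0 yd].
have -> : e = (e `^ (g^-1)) `^ g by rewrite -powRrM mulVf ?gt_eqF// powRr1// ltW.
by apply: ge0_ler_powR; rewrite ?nnegrE ?powR_ge0//; exact: ltW.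
Qed.

Lemma cvg_powR_endpoint (R : realType) (g : R) : 0 < g ->
  (1 + x) `^ g @[x --> (-1 : R)^'+] --> (0 : R) /\
  (1 - x) `^ g @[x --> (1 : R)^'-] --> (0 : R).
Proof.
move=> g0; split; apply/cvgrPdist_le => e e0; have [d d0 H] := powR_small g0 e0; near=> x;
  rewrite sub0r normrN ger0_norm ?powR_ge0//; apply: H.
- have h1 : -1 <= x by near: x; exact: nbhs_right_ge.
  have h2 : x <= -1 + d by near: x; apply: nbhs_right_le; rewrite ltrDl.
  by apply/andP; split; lra.
- have h1 : x <= 1 by near: x; exact: nbhs_left_le.
  have h2 : 1 - d <= x by near: x; apply: nbhs_left_ge; rewrite ltrBlDr ltrDl.
  by apply/andP; split; lra.
Unshelve. all: by end_near. Qed.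

Lemma is_derive_powR_lin (R : realType) (c x : R) (a : R) : 0 < 1 + c * x ->
  is_derive x 1 (fun y : R => (1 + c * y) `^ a) (c * (a * (1 + c * x) `^ (a - 1))).
Proof.
move=> h.
have d1 : is_derive x 1 (fun y : R => 1 + c * y) c.
  by apply: is_derive_eq; rewrite add0r /GRing.scale /= mulr1 mul1r ?mulr0 ?addr0 ?add0r.
have d2 := is_derive1_powR a h.
have := @is_derive1_comp R (fun y => y `^ a) (fun y : R => 1 + c * y) x _ _ d2 d1.
by move=> h3; apply: (is_derive_eq h3); rewrite mulrC.
Qed.

(** The factor of (1 + x) (1 - x) that is at least 1 is dropped according to the sign of x. The
    explicit growth in 1 / (1 - b) is what [lam_kW_integral] exploits, with b depending on a
    point. *)
Lemma powR_integrable (R : realType) (b : R) : 0 <= b -> b < 1 ->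
  L1 (fun x : R => (1 - x ^+ 2) `^ (- b)) /\
  \int[mu]_(x in I1) ((1 - x ^+ 2) `^ (- b)) <= 4 / (1 - b).
Proof.
move=> b0 b1; set g := 1 - b; have g0 : 0 < g by rewrite /g; lra.
have gE : g - 1 = - b by rewrite /g; ring.
pose f (x : R) := (1 + 1 * x) `^ (- b) + (1 + -1 * x) `^ (- b).
pose F (x : R) := g^-1 * ((1 + 1 * x) `^ g - (1 + -1 * x) `^ g).
have pos (x : R) : -1 < x < 1 -> 0 < 1 + 1 * x /\ 0 < 1 + -1 * x by move=> /andP[? ?]; lra.
have f0 (x : R) : -1 < x < 1 -> 0 <= f x by move=> _; rewrite addr_ge0 ?powR_ge0.
have dF (x : R) : -1 < x < 1 -> is_derive x 1 F (f x).
  move=> /pos[h1 h2].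
  have d1 := is_derive_powR_lin g h1; have d2 := is_derive_powR_lin g h2.
  apply: (is_derive_eq (is_deriveZ g^-1 (is_deriveB d1 d2))).
  by rewrite gE /f /GRing.scale /=; field; rewrite gt_eqF.
have cf (x : R) : -1 < x < 1 -> {for x, continuous f}.
  move=> /pos[h1 h2].
  have k1 := is_derive_continuous (is_derive_powR_lin (- b) h1).
  have k2 := is_derive_continuous (is_derive_powR_lin (- b) h2).
  exact: cvgD k1 k2.
have [c1 c2] := cvg_powR_endpoint g0.
have two : 2 `^ g <= 2 :> R by rewrite -[leRHS]powRr1//; apply: ler_powR; rewrite /g; lra.
have cl (x c : R) : c = 1 \/ c = -1 -> c * x = 1 -> (1 + c * y) `^ g @[y --> x] --> 2 `^ g.
  move=> _ cx; have h : 0 < 1 + c * x by rewrite cx.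
  have := is_derive_continuous (is_derive_powR_lin g h).
  have -> : (2 : R) = 1 + c * x by rewrite cx.
  by [].
have L1' : F x @[x --> (-1)^'+] --> g^-1 * (0 - 2 `^ g).
  apply: cvgM; first exact: cvg_cst.
  apply: cvgB.
    by under eq_fun do rewrite mul1r.
  by apply: cvg_at_right_filter; apply: cl; [right|rewrite mulN1r opprK].
have L2 : F x @[x --> 1^'-] --> g^-1 * (2 `^ g - 0).
  apply: cvgM; first exact: cvg_cst.
  apply: cvgB.
    by apply: cvg_at_left_filter; apply: cl; [left|rewrite mulr1].
  by under eq_fun do rewrite mulN1r.
have m11 : (-1 : R) < 1 by lra.
have [mf If] := FTC_open_ge0 m11 f0 dF cf L1' L2.
have if1 : L1 f.
  apply/integrableP; split; first exact/measurable_EFinP.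
  rewrite (_ : integral _ _ _ = \int[mu]_(x in I1) (f x)%:E)%E; first by rewrite If ltry.
  by apply: eq_integral => x _; rewrite /= ger0_norm// addr_ge0 ?powR_ge0.
have le (x : R) : I1 x -> (1 - x ^+ 2) `^ (- b) <= f x.
  rewrite /= in_itv/= => x1; have [h1 h2] := pos x x1.
  have -> : 1 - x ^+ 2 = (1 + 1 * x) * (1 + -1 * x) by ring.
  rewrite powRM; [|exact: ltW..].
  have key (y : R) : 1 <= y -> y `^ (- b) <= 1.
    by move=> y1; rewrite -(powRr0 y); apply: ler_powR => //; rewrite oppr_le0.
  have [x0|x0] := lerP 0 x.
    apply: (@le_trans _ _ (1 * (1 + -1 * x) `^ (- b))).
      by apply: ler_wpM2r; [exact: powR_ge0|apply: key; lra].
    by rewrite mul1r lerDr powR_ge0.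
  apply: (@le_trans _ _ ((1 + 1 * x) `^ (- b) * 1)).
    by apply: ler_wpM2l; [exact: powR_ge0|apply: key; lra].
  by rewrite mulr1 lerDl powR_ge0.
have mp : measurable_fun I1 (fun x : R => (1 - x ^+ 2) `^ (- b)).
  apply: measurable_funTS; apply: (measurableT_comp (@measurable_powR R (- b))).
  by apply: measurable_funB; [exact: measurable_cst|apply: measurable_funX; exact: measurable_id].
have ip : L1 (fun x : R => (1 - x ^+ 2) `^ (- b)).
  by apply: (L1_le mp if1) => x Ix; rewrite ger0_norm ?powR_ge0//; exact: le.
split => //; apply: (le_trans (le_RI ip if1 le)).
have -> : \int[mu]_(x in I1) f x = g^-1 * (2 `^ g - 0) - g^-1 * (0 - 2 `^ g).
  by rewrite /Rintegral If.
rewrite -mulrBr (_ : 2 `^ g - 0 - (0 - 2 `^ g) = 2 * 2 `^ g); last by ring.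
have fin (a : R) : a <= 2 -> 2 * a <= 4 by lra.
by rewrite mulrC; apply: ler_wpM2r; [rewrite invr_ge0 ltW|exact: fin].
Qed.

Lemma ln1p_ge0 (R : realType) (y : R) : 0 <= y -> 0 <= ln (1 + y).
Proof. by move=> y0; apply: ln_ge0; rewrite lerDl. Qed.

Lemma ln1p_mono (R : realType) (y z : R) : 0 <= y -> y <= z -> ln (1 + y) <= ln (1 + z).
Proof. by move=> y0 yz; rewrite ler_ln ?posrE; lra. Qed.

Lemma ln1p_le (R : realType) (y : R) : 0 <= y -> ln (1 + y) <= y.
Proof. by move=> y0; apply: le_ln1Dx; lra. Qed.

Lemma ln1p_sqr (R : realType) (y z : R) : 0 <= y -> 0 <= z -> 1 + y <= (1 + z) ^+ 2 ->
  ln (1 + y) <= 2 * ln (1 + z).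
Proof.
move=> y0 z0 h; rewrite mulr_natl -lnXn; last by lra.
by rewrite ler_ln ?posrE ?exprn_gt0//; lra.
Qed.

Lemma ln1p_double (R : realType) (y : R) : 0 <= y -> ln (1 + 2 * y) <= 2 * ln (1 + y).
Proof. by move=> y0; apply: ln1p_sqr => //; nra. Qed.

Lemma ln1p_sqrt (R : realType) (y : R) : 0 <= y -> ln (1 + y) <= 2 * Num.sqrt y.
Proof.
move=> y0; have s0 := sqrtr_ge0 y; have s2 := sqr_sqrtr y0.
apply: (@le_trans _ _ (2 * ln (1 + Num.sqrt y))).
  by apply: ln1p_sqr => //; nra.
by have := ln1p_le s0; lra.
Qed.

(** c = 0 gives L^1 and c = 1 gives L log L. The scale e is the lowest level in the layer
    decomposition, so the additive error there is proportional to e. *)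
Definition Phi (R : realType) (c e s : R) : R := `|s| * (1 + c * ln (1 + `|s| / e)).


Lemma Phi_log_ge1 (R : realType) (c e : R) (c0 : 0 <= c) (e0 : 0 < e) (s : R) : 1 <= 1 + c * ln (1 + `|s| / e).
Proof. by rewrite lerDl mulr_ge0// ln1p_ge0// divr_ge0// ltW. Qed.

Lemma Phi_ge (R : realType) (c e : R) (c0 : 0 <= c) (e0 : 0 < e) (s : R) : `|s| <= Phi c e s.
Proof. by rewrite ler_peMr// Phi_log_ge1. Qed.

Lemma Phi_ge0 (R : realType) (c e : R) (c0 : 0 <= c) (e0 : 0 < e) (s : R) : 0 <= Phi c e s.
Proof. exact: le_trans (Phi_ge c0 e0 s). Qed.

Lemma Phi_mono (R : realType) (c e : R) (c0 : 0 <= c) (e0 : 0 < e) (s t : R) : `|s| <= `|t| -> Phi c e s <= Phi c e t.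
Proof.
move=> st; apply: ler_pM => //; first exact: le_trans (Phi_log_ge1 c0 e0 s).
rewrite lerD2l ler_wpM2l// ln1p_mono ?divr_ge0 ?(ltW e0)//.
by rewrite ler_pM2r ?invr_gt0.
Qed.

Lemma Phi_double (R : realType) (c e : R) (c0 : 0 <= c) (e0 : 0 < e) (s : R) : Phi c e (2 * s) <= 4 * Phi c e s.
Proof.
have y0 : 0 <= `|s| / e by rewrite divr_ge0// ltW.
have -> : Phi c e (2 * s) = 2 * (`|s| * (1 + c * ln (1 + 2 * (`|s| / e)))).
  by rewrite /Phi normrM (ger0_norm (ler0n R 2)) !mulrA.
have -> : 4 * Phi c e s = 2 * (`|s| * (2 * (1 + c * ln (1 + `|s| / e)))) by rewrite /Phi; ring.
rewrite ler_pM2l//; apply: ler_wpM2l => //.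
have h := ler_wpM2l c0 (ln1p_double y0); move: h.
by rewrite mulrA; set A := c * ln _; set B := ln _; nra.
Qed.

Lemma Phi_add (R : realType) (c e : R) (c0 : 0 <= c) (e0 : 0 < e) (s t : R) : Phi c e (s + t) <= 4 * Phi c e s + 4 * Phi c e t.
Proof.
have H (a b : R) : `|b| <= `|a| -> Phi c e (a + b) <= 4 * Phi c e a.
  move=> ba; apply: le_trans (Phi_double c0 e0 a); apply: Phi_mono => //.
  by rewrite (le_trans (ler_normD _ _))// normrM ger0_norm// mulr_natl mulr2n lerD2l.
have [st|/ltW st] := lerP `|t| `|s|.
  by apply: (le_trans (H _ _ st)); rewrite lerDl mulr_ge0// Phi_ge0.
by rewrite addrC; apply: (le_trans (H _ _ st)); rewrite lerDr mulr_ge0// Phi_ge0.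
Qed.

Lemma Phi_measurable (R : realType) (c e : R) (B : set (measurableTypeR R)) (f : R -> R) :
  measurable_fun B f -> measurable_fun B (fun x => Phi c e (f x)).
Proof.
move=> mf; have mn : measurable_fun B (fun x => `|f x|) by exact: measurableT_comp.
apply: measurable_funM => //; apply: measurable_funD; first exact: measurable_cst.
apply: measurable_funM; first exact: measurable_cst.
apply: (measurableT_comp (@measurable_ln R)); apply: measurable_funD; first exact: measurable_cst.
by apply: measurable_funM => //; exact: measurable_cst.
Qed.

Lemma Phi0 (R : realType) (c e : R) : Phi c e 0 = 0.
Proof. by rewrite /Phi normr0 mul0r. Qed.


(** Stated once for two uses: rho = 1 / [wt] with v = 0, and rho = 1 with v the square of [lam].
    First f / rho is clamped at n, which converges by domination; then the clamped quotient is
    approximated in the weight that bounds the modular of bounded multiples of rho. *)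
Lemma poly_dense (R : realType) (c e eps : R) (f rho v : R -> R) : 0 <= c -> 0 < e -> 0 < eps ->
  measurable_fun I1 f -> measurable_fun I1 rho -> measurable_fun I1 v ->
  (forall x : R, I1 x -> 0 < rho x) -> (forall x : R, I1 x -> 0 <= v x) ->
  L1 (fun x => Phi c e (f x)) -> L1 (fun x => v x * `|f x|) ->
  (forall K : R, 0 <= K -> L1 (fun x => rho x * (1 + c * ln (1 + K * rho x / e) + v x))) ->
  exists p : {poly R},
    L1 (fun x => Phi c e (f x - p.[x] * rho x) + v x * `|f x - p.[x] * rho x|) /\
    \int[mu]_(x in I1) (Phi c e (f x - p.[x] * rho x) + v x * `|f x - p.[x] * rho x|) <= eps.
Proof.
move=> c0 e0 eps0 mf mrho mv rho0 v0 iPf ivf iw.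
have mfr : measurable_fun I1 (fun x => f x / rho x).
  by apply: measurable_funM => //; apply: (measurableT_comp (@measurable_inv R)).
pose phi (n : nat) (x : R) := clamp n%:R (f x / rho x).
have mphi n : measurable_fun I1 (phi n) by exact: clamp_measurable.
pose G (h : R -> R) (x : R) := Phi c e (h x) + v x * `|h x|.
have mG h : measurable_fun I1 h -> measurable_fun I1 (G h).
  move=> mh; apply: measurable_funD; first exact: Phi_measurable.
  by apply: measurable_funM => //; exact: measurableT_comp.
have G0 h (x : R) : I1 x -> 0 <= G h x.
  by move=> Ix; rewrite addr_ge0 ?Phi_ge0// mulr_ge0// v0.
have Gmono h k (x : R) : I1 x -> `|h x| <= `|k x| -> G h x <= G k x.
  by move=> Ix hk; apply: lerD; [exact: Phi_mono|apply: ler_wpM2l => //; exact: v0].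
have iGf : L1 (G f) by exact: L1D.
have le n (x : R) : I1 x -> `|f x - phi n x * rho x| <= `|f x|.
  move=> Ix; have r0 := rho0 x Ix.
  have -> : f x - phi n x * rho x = (f x / rho x - phi n x) * rho x.
    by rewrite mulrBl divfK// gt_eqF.
  rewrite normrM.
  have := clamp_sub (f x / rho x) (ler0n R n).
  rewrite -(ler_pM2r (_ : 0 < `|rho x|)); last by rewrite normr_gt0 gt_eqF.
  by rewrite -[X in _ <= X -> _]normrM divfK// gt_eqF.
have mh n : measurable_fun I1 (fun x => f x - phi n x * rho x).
  by apply: measurable_funB => //; exact: measurable_funM.
have lim : \int[mu]_(x in I1) G (fun x => f x - phi n x * rho x) x @[n --> \oo] --> (0 : R).
  apply: (@L1_dct _ _ (G f)) => //.
  - by move=> n; exact: mG.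
  - by move=> n x Ix; rewrite ger0_norm ?G0//; apply: Gmono => //; exact: le.
  - move=> x Ix; apply: cvg_near_cst; near=> n.
    have h : `|f x / rho x| <= n%:R by near: n; exact: nbhs_infty_ger.
    by rewrite /G /phi clamp_id// divfK ?gt_eqF ?rho0// subrr Phi0 normr0 mulr0 addr0.
have [n hn] : exists n, \int[mu]_(x in I1) G (fun x => f x - phi n x * rho x) x < eps / 8.
  have : \forall n \near \oo, \int[mu]_(x in I1) G (fun x => f x - phi n x * rho x) x < eps / 8.
    by apply: (cvgr_lt (0 : R)) => //; rewrite divr_gt0.
  by move=> [n _ /(_ n (leqnn n)) /= h]; exists n.
have n0 : 0 <= n%:R :> R by [].
have K0 : 0 <= 2 * n%:R + 1 :> R by lra.
(* n bounds the clamped quotient and n + 1 the polynomial; their difference is at most K, which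
   makes the logarithmic factor independent of the polynomial. *)
set K : R := 2 * n%:R + 1 in K0.
pose w (x : R) := rho x * (1 + c * ln (1 + K * rho x / e) + v x).
have lnK (x : R) : I1 x -> 0 <= c * ln (1 + K * rho x / e).
  by move=> Ix; rewrite mulr_ge0// ln1p_ge0// divr_ge0 ?(ltW e0)// mulr_ge0// ltW// rho0.
have w0 (x : R) : I1 x -> 0 <= w x.
  move=> Ix; rewrite mulr_ge0 ?(ltW (rho0 _ Ix))//.
  by have := lnK x Ix; have := v0 x Ix; lra.
have e80 : 0 < eps / 8 by rewrite divr_gt0.
have [p [pN hp]] := poly_approx n0 e80 (mphi n) (fun x _ => clamp_le (f x / rho x) n0) (iw K K0) w0.
have pK (x : R) : I1 x -> `|phi n x - p.[x]| <= K.
  move=> Ix; apply: (le_trans (ler_normB _ _)); have := pN x Ix.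
  by have := clamp_le (f x / rho x) n0; rewrite -/(phi n x) /K; lra.
have mp : measurable_fun I1 (fun x : R => p.[x]) by exact: horner_measurable.
have bound (x : R) : I1 x -> G (fun x => f x - p.[x] * rho x) x <=
    4 * G (fun x => f x - phi n x * rho x) x + 4 * (`|phi n x - p.[x]| * w x).
  move=> Ix; have r0 := rho0 x Ix; have vx := v0 x Ix; rewrite /G /w.
  have -> : f x - p.[x] * rho x = (f x - phi n x * rho x) + (phi n x - p.[x]) * rho x by ring.
  set a := f x - _; set d := phi n x - p.[x].
  have h1 := Phi_add c0 e0 a (d * rho x).
  have h2 : v x * `|a + d * rho x| <= v x * `|a| + v x * `|d * rho x|.
    by rewrite -mulrDr ler_wpM2l// ler_normD.
  have h3 : Phi c e (d * rho x) <= `|d| * (rho x * (1 + c * ln (1 + K * rho x / e))).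
    rewrite /Phi normrM (gtr0_norm r0) -(mulrA `|d|); apply: ler_wpM2l => //; apply: ler_wpM2l; first exact: ltW.
    rewrite lerD2l; apply: ler_wpM2l => //; apply: ln1p_mono.
      by rewrite divr_ge0 ?(ltW e0)// mulr_ge0// ltW.
    by rewrite ler_pM2r ?invr_gt0// ler_pM2r//; exact: pK.
  have h4 : v x * `|d * rho x| = `|d| * (rho x * v x).
    by rewrite normrM (gtr0_norm r0); ring.
  have h5 : 0 <= v x * `|a| by rewrite mulr_ge0.
  have h6 : 0 <= `|d| * (rho x * v x) by rewrite mulr_ge0// mulr_ge0// ltW.
  have fin (A B C D X Y Z : R) : 0 <= Z -> 0 <= X -> A <= 4 * B + 4 * C -> D <= Z + X -> C <= Y ->
      A + D <= 4 * (B + Z) + 4 * (Y + X) by clear; lra.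
  have -> : `|d| * (rho x * (1 + c * ln (1 + K * rho x / e) + v x)) =
    `|d| * (rho x * (1 + c * ln (1 + K * rho x / e))) + `|d| * (rho x * v x) by rewrite !mulrDr.
  by rewrite h4 in h2; exact: fin h5 h6 h1 h2 h3.
have iGn : L1 (G (fun x => f x - phi n x * rho x)).
  by apply: (L1_le (mG _ (mh n)) iGf) => x Ix; rewrite ger0_norm ?G0//; apply: Gmono => //; exact: le.
have md : measurable_fun I1 (fun x : R => `|phi n x - p.[x]|).
  by apply: measurableT_comp => //; apply: measurable_funB.
have idw : L1 (fun x => `|phi n x - p.[x]| * w x).
  rewrite (_ : (fun x => `|phi n x - p.[x]| * w x) = (fun x => w x * `|phi n x - p.[x]|)).
    by apply: (L1M (C := K) (iw K K0) md) => x Ix; rewrite normr_id; exact: pK.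
  by apply/funext => x; rewrite mulrC.
have iR := L1D (L1Z 4 iGn) (L1Z 4 idw).
have iG : L1 (G (fun x => f x - p.[x] * rho x)).
  apply: (L1_le _ iR).
    by apply: mG; apply: measurable_funB => //; exact: measurable_funM.
  by move=> x Ix; rewrite ger0_norm ?G0//; exact: bound.
exists p; split; first exact: iG.
apply: (le_trans (le_RI iG iR bound)).
rewrite RID; [|exact: L1Z..].
rewrite RIZ// RIZ//.
move: hn hp; set X := \int[mu]_(x in I1) _; set Y := \int[mu]_(x in I1) _.
have fin (a b : R) : a < eps / 8 -> b <= eps / 8 -> 4 * a + 4 * b <= eps by clear; lra.
exact: fin.
Unshelve. all: by end_near. Qed.

Lemma wt_powR (R : realType) (x : R) : I1 x -> (wt x)^-1 = (1 - x ^+ 2) `^ (- 2^-1).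
Proof.
rewrite /= in_itv/= => x1; have h := onesqr_gt0 x1.
by rewrite powRN powR12_sqrt// ltW.
Qed.

Lemma wtV_gt0 (R : realType) (x : R) : I1 x -> 0 < (wt x)^-1.
Proof. by rewrite /= in_itv/= => x1; rewrite invr_gt0 wt_gt0. Qed.

Lemma wt_measurable (R : realType) (B : set (measurableTypeR R)) :
  measurable_fun B (@wt R).
Proof.
by apply: measurable_funTS; apply: continuous_measurable_fun; exact: wt_continuous.
Qed.

Lemma wtV_measurable (R : realType) (B : set (measurableTypeR R)) :
  measurable_fun B (fun x : R => (wt x)^-1).
Proof. apply: (measurableT_comp (@measurable_inv R)); exact: wt_measurable. Qed.

(** ln (1 + y) <= 2 sqrt y reduces the logarithm to a power, and wt^(-3/2) = (1 - x^2)^(-3/4) is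
    integrable. The summand 0 is the weight v of [poly_dense]. *)
Lemma wtV_log_integrable (R : realType) (c e K : R) : 0 <= c -> 0 < e -> 0 <= K ->
  L1 (fun x : R => (wt x)^-1 * (1 + c * ln (1 + K * (wt x)^-1 / e) + 0)).
Proof.
move=> c0 e0 K0; have mV := @wtV_measurable R I1.
pose g (x : R) := (wt x)^-1 + 2 * c * Num.sqrt (K / e) * (1 - x ^+ 2) `^ (- (3 / 4)).
have ig : L1 g.
  apply: L1D; first exact: wtV_integrable.
  have h1 : 0 <= 3 / 4 :> R by lra.
  have h2 : 3 / 4 < 1 :> R by lra.
  by apply: L1Z; have [] := powR_integrable h1 h2.
apply: (L1_le _ ig).
  apply: measurable_funM => //; apply: measurable_funD; last exact: measurable_cst.
  apply: measurable_funD; first exact: measurable_cst.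
  apply: measurable_funM; first exact: measurable_cst.
  apply: (measurableT_comp (@measurable_ln R)); apply: measurable_funD; first exact: measurable_cst.
  apply: measurable_funM; last exact: measurable_cst.
  by apply: measurable_funM => //; exact: measurable_cst.
move=> x Ix; have w0 := wtV_gt0 Ix.
have y0 : 0 <= K * (wt x)^-1 / e by rewrite divr_ge0 ?(ltW e0)// mulr_ge0// ltW.
rewrite addr0 ger0_norm; last first.
  by rewrite mulr_ge0 ?(ltW w0)// addr_ge0// mulr_ge0// ln1p_ge0.
rewrite /g mulrDr mulr1 lerD2l.
have h : ln (1 + K * (wt x)^-1 / e) <= 2 * (Num.sqrt (K / e) * Num.sqrt (wt x)^-1).
  rewrite -sqrtrM ?divr_ge0 ?(ltW e0)//.
  have -> : K / e * (wt x)^-1 = K * (wt x)^-1 / e by ring.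
  exact: ln1p_sqrt.
have -> : 2 * c * Num.sqrt (K / e) * (1 - x ^+ 2) `^ (- (3 / 4)) =
    (wt x)^-1 * (c * (2 * (Num.sqrt (K / e) * Num.sqrt (wt x)^-1))).
  have -> : (1 - x ^+ 2) `^ (- (3 / 4)) = (wt x)^-1 * Num.sqrt (wt x)^-1; last by ring.
  rewrite -powR12_sqrt ?(ltW w0)// wt_powR// -powRrM -powRD.
    by congr (_ `^ _); field.
  have : 0 < 1 - x ^+ 2 by move: Ix; rewrite /= in_itv; exact: onesqr_gt0.
  by move=> /gt_eqF ->; rewrite implybT.
apply: ler_wpM2l; first exact: ltW.
exact: ler_wpM2l.
Qed.

Lemma pw_dense (R : realType) (c e eps : R) (f : R -> R) : 0 <= c -> 0 < e -> 0 < eps ->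
  measurable_fun I1 f -> L1 (fun x => Phi c e (f x)) ->
  exists p : {poly R}, L1 (fun x => Phi c e (f x - pw p x)) /\
    \int[mu]_(x in I1) (Phi c e (f x - pw p x)) <= eps.
Proof.
move=> c0 e0 eps0 mf iPf.
have i0 : L1 (fun x => (0 : R) * `|f x|).
  rewrite (_ : (fun _ => _) = cst 0); first exact: integrable_cstI.
  by apply/funext => x; rewrite mul0r.
have [p [ip hp]] := @poly_dense R c e eps f (fun x => (wt x)^-1) (fun=> 0) c0 e0 eps0 mf
  (@wtV_measurable R I1) (measurable_cst _) (@wtV_gt0 R) (fun _ _ => lexx 0) iPf i0
  (fun K K0 => wtV_log_integrable c0 e0 K0).
exists p.
have E : (fun x => Phi c e (f x - p.[x] * (wt x)^-1) + 0 * `|f x - p.[x] * (wt x)^-1|) =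
    (fun x => Phi c e (f x - pw p x)).
  by apply/funext => x; rewrite mul0r addr0.
by rewrite E in ip hp.
Qed.

Lemma pw_dense1 (R : realType) (eps : R) (f : R -> R) : 0 < eps -> L1 f ->
  exists p : {poly R}, \int[mu]_(x in I1) `|f x - pw p x| <= eps.
Proof.
move=> eps0 If; have E (h : R -> R) : (fun x => Phi 0 1 (h x)) = (fun x => `|h x|).
  by apply/funext => x; rewrite /Phi mul0r addr0 mulr1.
have [|p []] := @pw_dense R 0 1 eps f (lexx 0) ltr01 eps0 (L1_measurable If).
  by rewrite E; exact: L1_norm.
by rewrite (E (fun x => f x - pw p x)) => _ h; exists p.
Qed.

Lemma aeS (R : realType) (P Q : R -> Prop) : (forall t, P t -> Q t) ->
  {ae (@lebesgue_measure R), forall t, P t} -> {ae (@lebesgue_measure R), forall t, Q t}.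
Proof. by move=> PQ; apply: negligibleS => t /= h p; apply: h; exact: PQ. Qed.

Lemma aeS2 (R : realType) (P Q S : R -> Prop) : (forall t, P t -> Q t -> S t) ->
  {ae (@lebesgue_measure R), forall t, P t} -> {ae (@lebesgue_measure R), forall t, Q t} ->
  {ae (@lebesgue_measure R), forall t, S t}.
Proof.
move=> PQS hp hq; apply: (negligibleS _ (negligibleU hp hq)) => t /= h.
by apply: contrapT => /not_orP[/contrapT p /contrapT q]; apply: h; exact: PQS.
Qed.

(** * The principal value transform *)

(** A relation, because g is a measurable representative of the principal value and may be changed
    on null sets ([isT_ae]). The factor 1/pi is restored in [fht_rep]. *)
Definition isT (R : realType) (f g : R -> R) : Prop := measurable_fun I1 g /\
  {ae (@lebesgue_measure R), forall t : R, I1 t -> tr f t e @[e --> (0 : R)^'+] --> g t}.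

Lemma isT_pvp (R : realType) (p q : {poly R}) : pvp p q -> isT (pw p) (fun t => q.[t]).
Proof. by move=> h; split; [exact: horner_measurable|apply: aeW => t; exact: h]. Qed.

Lemma isTB (R : realType) (f g f' g' : R -> R) : L1 f -> L1 g -> isT f f' -> isT g g' ->
  isT (fun x => f x - g x) (fun x => f' x - g' x).
Proof.
move=> If Ig [mf' hf] [mg' hg]; split; first exact: measurable_funB.
apply: aeS2 hf hg => t hf hg It.
apply: (cvg_right_eq (fun e e0 => trB t If Ig e0)).
by apply: cvgB; [exact: hf|exact: hg].
Qed.

Lemma isTZ (R : realType) (c : R) (f f' : R -> R) : L1 f -> isT f f' ->
  isT (fun x => c * f x) (fun x => c * f' x).
Proof.
move=> If [mf' hf]; split; first by apply: measurable_funM => //; exact: measurable_cst.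
apply: aeS hf => t hf It.
apply: (cvg_right_eq (fun e e0 => trZ c t If e0)).
by apply: cvgM; [exact: cvg_cst|exact: hf].
Qed.

Lemma isT_ae (R : realType) (f g h : R -> R) : isT f g -> measurable_fun I1 h ->
  {ae (@lebesgue_measure R), forall t : R, I1 t -> g t = h t} -> isT f h.
Proof.
move=> [_ hg] mh hh; split => //; apply: aeS2 hg hh => t hg hh It.
by rewrite -hh//; exact: hg.
Qed.

(** The Banach principle: f is a weighted polynomial, whose truncations converge everywhere, plus a
    remainder so small in L^1 that its maximal truncation exceeds 4 l only on a set of measure d;
    the fifth l is the error of the convergent part. *)
Lemma tr_osc (R : realType) (f : R -> R) (l d : R) : L1 f -> 0 < l -> 0 < d ->
  exists E : set (measurableTypeR R), [/\ measurable E, (mu E <= d%:E)%E &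
    forall t : R, I1 t -> ~ E t -> exists c : R, \forall e \near (0 : R)^'+,
      `|tr f t e - c| <= 5 * l].
Proof.
move=> If l0 d0; have C0 : 0 < 54 * weakC R by rewrite mulr_gt0// weakC_gt0.
have eps0 : 0 < l * d / (54 * weakC R) by rewrite divr_gt0// mulr_gt0.
have [p hp] := pw_dense1 eps0 If.
have [q hq _] := pv_pair_all p.
have ip := pw_integrable p.
have [E [mE hE EP]] := tr_maximal (L1B If ip) l0.
exists E; split => //.
  rewrite -(@lee_pmul2l _ l%:E) ?lte_fin//=; apply: (le_trans hE).
  rewrite -EFinM lee_fin.
  by rewrite mulrC -ler_pdivlMr.
move=> t It Et; exists (pi *: q).[t]; have := hq t It.
move=> /cvgrPdist_le /(_ l l0) h; near=> e.
have e0 : 0 < e by near: e; exact: nbhs_right_gt.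
have h1 := EP t It Et e e0.
have h2 : `|(pi *: q).[t] - tr (pw p) t e| <= l by near: e; exact: h.
rewrite trB// in h1.
move: h1 h2; set a := uker _ f t e; set b := uker _ _ t e; set c := _.[t] => h1 h2.
have -> : a - c = (a - b) - (c - b) by ring.
by apply: (le_trans (ler_normB _ _)); lra.
Unshelve. all: by end_near. Qed.

Lemma pv_ae_cvg (R : realType) (f : R -> R) : L1 f ->
  {ae (@lebesgue_measure R), forall t : R, I1 t -> cvg (tr f t e @[e --> (0 : R)^'+])}.
Proof.
move=> If.
have H (n m : nat) : {E : set (measurableTypeR R) | [/\ measurable E, (mu E <= (m.+1%:R^-1)%:E)%E &
    forall t : R, I1 t -> ~ E t -> exists c : R, \forall e \near (0 : R)^'+,
      `|tr f t e - c| <= 5 * n.+1%:R^-1]}.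
  by apply: cid; apply: tr_osc.
pose E n m := sval (H n m).
have mE n m : measurable (E n m) by rewrite /E; case: (H n m) => ? [].
(* For a fixed tolerance the exceptional sets are arbitrarily small, so their intersection is null;
   outside all [N n] the truncations form a Cauchy filter. *)
pose N n := \bigcap_m E n m.
have mN n : measurable (N n) by apply: bigcapT_measurable.
have N0 n : mu.-negligible (N n).
  apply/(negligibleP _ (mN n)); apply/eqP; rewrite eq_le measure_ge0 andbT.
  apply/lee_addgt0Pr => e e0; rewrite add0e.
  have [m hm] : exists m : nat, m.+1%:R^-1 <= e.
    exists (Num.truncn e^-1); rewrite invf_ple ?posrE//.
    exact/ltW/truncnS_gt.
  apply: (@le_trans _ _ (mu (E n m))).
    by apply: le_measure; rewrite ?inE//; exact: bigcap_inf.
  apply: (@le_trans _ _ (m.+1%:R^-1)%:E); last by rewrite lee_fin.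
  by rewrite /E; case: (H n m) => ? [].
apply: (negligibleS _ (negligible_bigcup N0)).
move=> t /= bad; apply: contrapT => Nt; apply: bad => It.
apply: cauchy_cvg; apply: cauchy_exP => e e0.
have [n hn] : exists n : nat, 5 * n.+1%:R^-1 < e.
  exists (Num.truncn (5 / e)); rewrite -ltr_pdivlMl// invf_plt ?posrE//; last by rewrite mulr_gt0.
  by rewrite invfM invrK mulrC; exact: truncnS_gt.
have : ~ N n t by move=> h; apply: Nt; exists n.
move=> /existsNP[m /not_implyP[_ hm]].
have : exists c : R, \forall e \near (0 : R)^'+, `|tr f t e - c| <= 5 * n.+1%:R^-1.
  by move: hm; rewrite /E; case: (H n m) => ? [_ _ h] /=; exact: h.
move=> [c hc]; exists c; apply: filterS hc => r hr.
by rewrite /ball/= distrC; exact: le_lt_trans hr hn.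
Qed.

(** The upper limit along e = 1/(n+1) is measurable everywhere, and coincides with the principal
    value wherever the latter exists. *)
Lemma isT_exists (R : realType) (f : R -> R) : L1 f -> exists g, isT f g.
Proof.
move=> If; pose u (n : nat) (t : R) := tr f t n.+1%:R^-1.
have n0 (n : nat) : 0 < n.+1%:R^-1 :> R by rewrite invr_gt0.
have mu_ n : measurable_fun I1 (fun t : measurableTypeR R => u n t).
  apply: (uker_measurable (C := (n.+1%:R^-1)^-1)) => //.
  - exact: ktr_kernel.
  - by move=> s; exact: ktr_le.
exists (fun t => fine (limn_esup (fun n => (u n t)%:E))); split.
  apply: (@measurableT_comp _ _ _ _ _ _ (@fine R)) => //.
  apply: (@measurable_fun_limn_esup _ _ R I1 (fun n t => (u n t)%:E)) => n.
  by apply/measurable_EFinP; exact: mu_.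
apply: aeS (pv_ae_cvg If) => t h It; have [l hl] := (cvg_ex _).1 (h It).
have ul : u n t @[n --> \oo] --> l.
  apply: (cvg_at_rightP _ _ _).1 hl (fun n => n.+1%:R^-1) _; split => //.
  exact: cvg_harmonic.
rewrite (_ : fine _ = l); first exact: hl.
have ule : (u n t)%:E @[n --> \oo] --> l%:E by apply: cvg_EFin; [exact: nearW|exact: ul].
rewrite is_cvg_limn_esupE; last by apply/cvg_ex; exists l%:E.
by rewrite (cvg_lim _ ule).
Qed.

Lemma null_cover_le (R : realType) (G B : set (measurableTypeR R)) (b : \bar R) : measurable G ->
  measurable B -> (mu B <= b)%E -> {ae (@lebesgue_measure R), forall t, G t -> B t} -> (mu G <= b)%E.
Proof.
move=> mG mB Bb [N [mN N0 sub]].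
apply: (@le_trans _ _ (mu (B `|` N))).
  apply: le_measure; rewrite ?inE//; first exact: measurableU.
  move=> t Gt; have [Nt|Nt] := pselect (N t); first by right.
  by left; apply: contrapT => nB; apply: Nt; apply: sub => /= h; apply: nB; exact: h.
apply: (le_trans (measureU2 _ mB mN)).
by rewrite [X in (_ + X <= _)%E]N0 adde0.
Qed.

Lemma level_measurable (R : realType) (g : R -> R) (l : R) : measurable_fun I1 g ->
  measurable (I1 `&` [set t | l < `|g t|] : set (measurableTypeR R)).
Proof.
move=> mg; have mn : measurable_fun I1 (fun x => `|g x|) by exact: measurableT_comp.
have := mn (@mI1 R) _ (measurable_itv `]l, +oo[).
by congr measurable; congr (_ `&` _); apply/seteqP; split => t /=; rewrite in_itv/= andbT.
Qed.

(** Almost everywhere, a point of the level set of g lies in the level sets of all truncations at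
    1/(n+1) for n large. Their lower limit inherits the uniform bound of [tr_weak]. *)
Lemma isT_weak (R : realType) (f g : R -> R) (l : R) : L1 f -> isT f g -> 0 < l ->
  (l%:E * mu (I1 `&` [set t | (l < `|g t|)%R] : set (measurableTypeR R)) <=
   (weakC R * \int[mu]_(x in I1) kap l (f x))%:E)%E.
Proof.
move=> If [mg hg] l0; set b := weakC R * _.
pose A (n : nat) := tr_level f l n.+1%:R^-1.
have n0 (n : nat) : 0 < n.+1%:R^-1 :> R by rewrite invr_gt0.
have mA n : measurable (A n) by exact: tr_level_measurable.
have muA n : (mu (A n) <= (b / l)%:E)%E.
  rewrite -(@lee_pmul2l _ l%:E) ?lte_fin//= -EFinM mulrCA divff ?gt_eqF// mulr1.
  exact: tr_weak.
pose B (k : nat) := \bigcap_(n in [set n | (k <= n)%N]) A n.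
have mB k : measurable (B k).
  by apply: bigcap_measurable => //; exists k => /=.
have muB k : (mu (B k) <= (b / l)%:E)%E.
  apply: le_trans (muA k); apply: le_measure; rewrite ?inE//.
  by apply: bigcap_inf => /=.
have mUB : measurable (\bigcup_k B k) by exact: bigcupT_measurable.
have ndB : nondecreasing_seq B.
  by move=> i j ij; apply/subsetPset => t Bt n jn; apply: Bt; exact: leq_trans jn.
have muU : (mu (\bigcup_k B k) <= (b / l)%:E)%E.
  have h := nondecreasing_cvg_mu (mu := @lebesgue_measure R) mB mUB ndB.
  rewrite -(cvg_lim _ h)//; apply: lime_le; first by apply/cvg_ex; eexists; exact: h.
  by apply: nearW.
have mG := level_measurable l mg.
have -> : b = l * (b / l) by rewrite mulrCA divff ?gt_eqF// mulr1.
rewrite EFinM (@lee_pmul2l _ l%:E) ?lte_fin//=.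
apply: (null_cover_le mG mUB muU); apply: aeS hg => t hg [It lt].
have ul : `|tr f t n.+1%:R^-1| @[n --> \oo] --> `|g t|.
  apply: cvg_norm; apply: (cvg_at_rightP _ _ _).1 (hg It) (fun n => n.+1%:R^-1) _; split => //.
  exact: cvg_harmonic.
have : \forall n \near \oo, l < `|tr f t n.+1%:R^-1|.
  by apply: (cvgr_gt _ ul).
move=> [k _ hk]; exists k => // n /= kn; split; last by apply: hk.
by move: It; rewrite /= !in_itv/= => /andP[? ?]; apply/andP; split; lra.
Qed.

(** * Logarithmic bounds *)

Lemma layer_le (R : realType) (Q : R -> R) (l b : nat -> R) (N : nat) (v : R) :
  (forall u w : R, 0 <= u -> u <= w -> Q u <= Q w) ->
  (forall n m, (n <= m)%N -> l n <= l m) ->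
  (forall k, 0 <= b k) -> (forall k, Q (l k.+1) - Q (l k) <= b k) -> 0 <= v -> v <= l N ->
  Q v <= Q (l 0%N) + \sum_(k < N) b k * (l k < v)%R%:R.
Proof.
move=> Qm lm b0 Qb v0; elim: N v v0 => [|N IH] v v0 vN.
  by rewrite big_ord0 addr0; exact: Qm.
rewrite big_ord_recr /=; have [vl|lv] := lerP v (l N).
  by rewrite addrA (le_trans (IH v v0 vl))// lerDl mulr0.
rewrite mulr1.
have -> : \sum_(k < N) b k * (l k < v)%R%:R = \sum_(k < N) b k.
  apply: eq_bigr => k _; rewrite (_ : l k < v = true) ?mulr1//.
  by apply: le_lt_trans lv; apply: lm; exact: ltnW.
apply: (le_trans (Qm _ _ v0 vN)).
have h (n : nat) : Q (l n) <= Q (l 0%N) + \sum_(k < n) b k.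
  elim: n => [|n IHn]; first by rewrite big_ord0 addr0.
  by rewrite big_ord_recr/=; have := Qb n; lra.
by have := h N.+1; rewrite big_ord_recr.
Qed.

(** A discrete layer cake formula integrated term by term: by [isT_weak], level l k costs at most
    [weakC] b k / l k times the integral of [kap (l k)] of f, and the costs are summed under the
    integral sign against M. The 2 is the length of the interval. *)
Lemma layer_integral (R : realType) (f g Q M : R -> R) (l b : nat -> R) (B0 : R) :
  L1 f -> isT f g -> measurable_fun I1 (fun t => Q (g t)) -> (forall v : R, 0 <= Q v) ->
  0 <= B0 -> (forall k, 0 <= b k) -> (forall k, 0 < l k) ->
  (forall v : R, exists N : nat, Q v <= B0 + \sum_(k < N) b k * (l k < `|v|)%R%:R) ->
  L1 (fun x => M (f x)) ->
  (forall (N : nat) (s : R), \sum_(k < N) b k / l k * kap (l k) s <= M s) ->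
  L1 (fun t => Q (g t)) /\
  \int[mu]_(t in I1) Q (g t) <= 2 * B0 + weakC R * \int[mu]_(x in I1) M (f x).
Proof.
move=> If Tfg mQ Q0 B00 b0 l0 QN iM MN; have mI := @mI1 R.
have [mg _] := Tfg.
pose A k := I1 `&` [set t | l k < `|g t|] : set (measurableTypeR R).
have mA k : measurable (A k) by exact: level_measurable.
have mnd k : measurable_fun I1 (fun t => ((b k)%:E * (\1_(A k) t)%:E)%E).
  apply: emeasurable_funM; first exact: measurable_cst.
  by apply/measurable_EFinP; apply: measurable_funTS; exact: measurable_indic.
have nd0 k t : (0 <= (b k)%:E * (\1_(A k) t)%:E)%E by rewrite mule_ge0 ?lee_fin ?b0.
have i_ind k : (\int[mu]_(t in I1) ((b k)%:E * (\1_(A k) t)%:E) <=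
    (weakC R * (b k / l k * \int[mu]_(x in I1) kap (l k) (f x)))%:E)%E.
  rewrite ge0_integralZl_EFin//; last by apply/measurable_EFinP.
  rewrite integral_indic//.
  have -> : A k `&` I1 = A k by rewrite /A setIAC setIid.
  have h := isT_weak If Tfg (l0 k).
  have -> : weakC R * (b k / l k * \int[mu]_(x in I1) kap (l k) (f x)) =
     b k * ((l k)^-1 * (weakC R * \int[mu]_(x in I1) kap (l k) (f x))) by ring.
  rewrite EFinM; apply: lee_wpmul2l; first by rewrite lee_fin.
  rewrite -(@lee_pmul2l _ (l k)%:E) ?lte_fin//= -EFinM mulrA divff ?gt_eqF// mul1r.
  exact: h.
have ikap k : L1 (fun x => kap (l k) (f x)) by exact: kap_integrable.
have series_le : (\sum_(0 <= k <oo) \int[mu]_(t in I1) ((b k)%:E * (\1_(A k) t)%:E) <=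
    (weakC R * \int[mu]_(x in I1) M (f x))%:E)%E.
  apply: lime_le; first by apply: is_cvg_nneseries => k _ _; apply: integral_ge0 => t _.
  apply: nearW => N; apply: le_trans.
    by apply: lee_sum => k _; exact: i_ind.
  rewrite sumEFin lee_fin -mulr_sumr ler_wpM2l ?(ltW (weakC_gt0 R))//.
  have [iS hS] : L1 (fun x => \sum_(0 <= k < N) b k / l k * kap (l k) (f x)) /\
     \int[mu]_(x in I1) (\sum_(0 <= k < N) b k / l k * kap (l k) (f x)) =
     \sum_(0 <= k < N) b k / l k * \int[mu]_(x in I1) kap (l k) (f x).
    elim: N => [|N [IH1 IH2]].
      rewrite big_geq//.
      have -> : (fun x : R => \sum_(0 <= k < 0) b k / l k * kap (l k) (f x)) = cst 0.
        by apply/funext => x; rewrite big_geq.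
      split; first exact: integrable_cstI.
      by rewrite Rintegral_cstI mulr0.
    have -> : (fun x : R => \sum_(0 <= k < N.+1) b k / l k * kap (l k) (f x)) =
        (fun x => \sum_(0 <= k < N) b k / l k * kap (l k) (f x) + b N / l N * kap (l N) (f x)).
      by apply/funext => x; rewrite big_nat_recr.
    split; first by apply: L1D => //; exact: L1Z.
    rewrite RID//; last exact: L1Z.
    by rewrite IH2 RIZ// big_nat_recr.
  rewrite -hS; apply: le_RI => // x _.
  by rewrite big_mkord; exact: MN.
have bound : (\int[mu]_(t in I1) (Q (g t))%:E <= (2 * B0 + weakC R * \int[mu]_(x in I1) M (f x))%:E)%E.
  apply: (@le_trans _ _ (\int[mu]_(t in I1) (B0%:E + \sum_(0 <= k <oo) ((b k)%:E * (\1_(A k) t)%:E)))%E).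
    apply: ge0_le_integral => //.
    - by move=> t _; rewrite lee_fin.
    - exact/measurable_EFinP.
    - by apply: emeasurable_funD => //; apply: ge0_emeasurable_sum.
    - move=> t It; have [N hN] := QN (g t).
      apply: (@le_trans _ _ (B0%:E + \sum_(0 <= k < N) ((b k)%:E * (\1_(A k) t)%:E))%E); last first.
        by apply: leeD => //; exact: nneseries_lim_ge.
      rewrite (_ : (\sum_(0 <= k < N) ((b k)%:E * (\1_(A k) t)%:E))%E =
                   (\sum_(k < N) b k * (l k < `|g t|)%R%:R)%:E) ?lee_fin//.
      rewrite big_mkord -sumEFin; apply: eq_bigr => k _; rewrite -EFinM; congr (_ * _)%:E.
      rewrite indicE; congr (nat_of_bool _)%:R; apply/idP/idP.
        by rewrite inE => -[].
      by move=> h; rewrite inE; split.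
  rewrite ge0_integralD//; [|by move=> t _; apply: nneseries_ge0|by apply: ge0_emeasurable_sum].
  rewrite integral_nneseries// EFinD; apply: leeD => //.
  have h := Rintegral_lee mI (integrable_cstI B0); rewrite Rintegral_cstI in h.
  by rewrite -h.
have iQ : L1 (fun t => Q (g t)).
  apply/integrableP; split; first exact/measurable_EFinP.
  apply: (@le_lt_trans _ _ (2 * B0 + weakC R * \int[mu]_(x in I1) M (f x))%:E); last exact: ltry.
  apply: le_trans bound; rewrite le_eqVlt; apply/orP; left; apply/eqP.
  by apply: eq_integral => t _ /=; rewrite ger0_norm.
split => //; rewrite -lee_fin -Rintegral_lee//.
Qed.

Lemma ln_gap (R : realType) (r : R) : 0 <= r -> r / (1 + 2 * r) <= ln (1 + 2 * r) - ln (1 + r).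
Proof.
move=> r0; have h1 : 0 < 1 + r by lra.
have h2 : 0 < 1 + 2 * r by lra.
have h : -1 < - (r / (1 + 2 * r)) by rewrite ltrN2 ltr_pdivrMr//; lra.
have := le_ln1Dx h.
have -> : 1 + - (r / (1 + 2 * r)) = (1 + r) / (1 + 2 * r) by field; rewrite gt_eqF.
by rewrite ln_div ?posrE//; lra.
Qed.

(** The form of the right side makes the sum over dyadic levels telescope: doubling l turns the
    first logarithm into the second one of the previous level. *)
Lemma kap_gap (R : realType) (l s : R) : 0 < l ->
  kap l s <= 2 * `|s| * (ln (1 + 2 * (`|s| / l)) - ln (1 + `|s| / l)).
Proof.
move=> l0; set r := `|s| / l; have r0 : 0 <= r by rewrite divr_ge0// ltW.
apply: (@le_trans _ _ (2 * `|s| * (r / (1 + 2 * r)))); last first.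
  by apply: ler_wpM2l; [rewrite mulr_ge0|exact: ln_gap].
have s0 : 0 <= `|s| by [].
rewrite -kap_norm /kap normr_id /r; move: s0; set a := `|s| => s0.
have -> : 2 * a * (a / l / (1 + 2 * (a / l))) = a * (2 * a / (l + 2 * a)).
  by field; rewrite !gt_eqF//=; lra.
have -> : a ^+ 2 / (a + l) = a * (a / (a + l)) by ring.
apply: ler_wpM2l => //; rewrite ler_pdivrMr; last by lra.
rewrite mulrAC ler_pdivlMr; last by lra.
nra.
Qed.

Lemma layer_dyadic (R : realType) (Q : R -> R) (bk : nat -> R) (e v : R) : 0 < e ->
  (forall u w : R, 0 <= u -> u <= w -> Q u <= Q w) -> (forall k, 0 <= bk k) ->
  (forall k, Q (e * 2 ^+ k.+1) - Q (e * 2 ^+ k) <= bk k) ->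
  exists N : nat, Q `|v| <= Q e + \sum_(k < N) bk k * (e * 2 ^+ k < `|v|)%R%:R.
Proof.
move=> e0 Qm b0 Qb; exists (Num.truncn (`|v| / e)).+1.
have := @layer_le R Q (fun k => e * 2 ^+ k) bk (Num.truncn (`|v| / e)).+1 `|v| Qm.
rewrite expr0 mulr1; apply => //.
  by move=> n m nm; rewrite ler_pM2l// ler_eXn2l// ltr1n.
rewrite mulrC -ler_pdivrMr//; apply: (le_trans (ltW (truncnS_gt _))).
by rewrite -natrX ler_nat ltnW// ltn_expl.
Qed.

(** The layers start at level e, so values of |g| below e are estimated trivially, which gives 2 e.
    Applied with e and the modular of f both small, the estimate shows continuity from L log L to
    L^1. *)
Lemma norm_log_bound (R : realType) (f g : R -> R) (e : R) : L1 f -> isT f g -> 0 < e ->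
  L1 (fun x => Phi 1 e (f x)) ->
  L1 g /\ \int[mu]_(t in I1) `|g t| <= 2 * e + 4 * weakC R * \int[mu]_(x in I1) Phi 1 e (f x).
Proof.
move=> If Tfg e0 iP; have [mg _] := Tfg.
pose l (k : nat) := e * 2 ^+ k.
have l0 k : 0 < l k by rewrite mulr_gt0// exprn_gt0.
have lm n m : (n <= m)%N -> l n <= l m.
  by move=> nm; rewrite ler_pM2l// ler_eXn2l// ltr1n.
have mng : measurable_fun I1 (fun t => `|g t|) by exact: measurableT_comp.
have [|||||||ig hg] := @layer_integral R f g (fun v => `|v|) (fun s => 4 * Phi 1 e s) l l e If Tfg mng.
- by [].
- exact: ltW.
- by move=> k; exact: ltW.
- by [].
- move=> v; have [|||N] := @layer_dyadic R (fun v => `|v|) l e v e0.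
  + by move=> u w u0 uw; rewrite !ger0_norm// (le_trans u0).
  + by move=> k; exact: ltW.
  + move=> k; have h1 := l0 k.+1; have h2 := l0 k; rewrite /l in h1 h2 *.
    by rewrite (gtr0_norm h1) (gtr0_norm h2) exprS; lra.
  + by rewrite normr_id (gtr0_norm e0) => h; exists N.
- exact: L1Z.
- move=> N s.
  pose a k := ln (1 + 2 * (`|s| / l k)).
  have a0 k : 0 <= a k by rewrite ln1p_ge0// mulr_ge0// divr_ge0// ltW.
  have aS k : ln (1 + `|s| / l k) = a k.+1.
    by rewrite /a /l exprS; congr (ln (1 + _)); field; rewrite !gt_eqF// exprn_gt0.
  apply: (@le_trans _ _ (\sum_(k < N) 2 * `|s| * (a k - a k.+1))).
    apply: ler_sum => k _; rewrite divff ?gt_eqF// mul1r -aS; exact: kap_gap.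
  rewrite -mulr_sumr.
  have -> : \sum_(k < N) (a k - a k.+1) = a 0%N - a N.
    elim: N => [|N IH]; first by rewrite big_ord0 subrr.
    by rewrite big_ord_recr/= IH; ring.
  have h : a 0%N <= 2 * ln (1 + `|s| / e).
    by rewrite /a /l expr0 mulr1; apply: ln1p_double; rewrite divr_ge0// ltW.
  have s0 : 0 <= `|s| by [].
  rewrite /Phi mul1r; have := ler_wpM2l s0 h; have := mulr_ge0 s0 (a0 N).
  move: s0; set S := `|s|; set L := ln _ => s0 h1 h2; lra.
split; last by move: hg; rewrite RIZ// mulrA (mulrC _ 4).
by apply: (L1_le mg ig).
Qed.

(** The discrete analogue of integrating a logarithm to its square: along dyadic levels the right
    side telescopes. For r >= 1/2 the gap A - B is at least 1/4; for smaller r it is at least r / 2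
    while A <= 2 r. *)
Lemma ln_sqr_gap (R : realType) (r : R) (A := ln (1 + 2 * r)) (B := ln (1 + r)) : 0 <= r ->
  A <= 6 * (A ^+ 2 + A) - 6 * (B ^+ 2 + B).
Proof.
move=> r0; have B0 : 0 <= B by exact: ln1p_ge0.
have gap : r / (1 + 2 * r) <= A - B by exact: ln_gap.
have A2 : A <= 2 * r by apply: ln1p_le; rewrite mulr_ge0.
have AB : B <= A by apply: ln1p_mono => //; lra.
have E : 6 * (A ^+ 2 + A) - 6 * (B ^+ 2 + B) = 6 * (A - B) * (A + B + 1) by ring.
rewrite E; move: gap A2 AB B0 {E}; move: A B => A B gap A2 AB B0.
have [r2|r2] := lerP 2^-1 r.
  have h : 4^-1 <= A - B.
    by apply: le_trans gap; rewrite ler_pdivlMr; lra.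
  have h2 : 0 <= (A - B - 4^-1) * (A + B + 1) by apply: mulr_ge0; lra.
  by lra.
have h : r / 2 <= A - B.
  by apply: le_trans gap; rewrite ler_pdivlMr; [nra|lra].
have h2 : 0 <= (A - B) * (A + B) by apply: mulr_ge0; lra.
by lra.
Qed.

Definition Phi2 (R : realType) (s : R) : R := `|s| * (1 + ln (1 + `|s|)) ^+ 2.

Lemma ln_pow2_le (R : realType) (n : nat) : ln (1 + 2 ^+ n) <= n.+1%:R :> R.
Proof.
have two : ln 2 <= 1 :> R by have := @le_ln1Dx R 1; rewrite (_ : 1 + 1 = 2)//; apply; lra.
apply: (@le_trans _ _ (ln (2 ^+ n.+1))).
  have h : 1 <= 2 ^+ n :> R by rewrite exprn_ege1// ler1n.
  rewrite ler_ln ?posrE ?exprn_gt0//; first by rewrite exprS; lra.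
by rewrite lnXn// -[leLHS]mulr_natr -[leRHS]mul1r ler_wpM2r.
Qed.

Lemma log_log2_bound (R : realType) (f g : R -> R) : L1 f -> isT f g ->
  L1 (fun x => Phi2 (f x)) -> L1 (fun t => Phi 1 1 (g t)).
Proof.
move=> If Tfg iP; have [mg _] := Tfg.
have c0 : 0 <= 1 :> R by [].
have e0 : 0 < 1 :> R by [].
pose l (k : nat) : R := 1 * 2 ^+ k; pose b (k : nat) := 6 * k.+1%:R * l k.
have l0 k : 0 < l k by rewrite /l mul1r exprn_gt0.
have b0 k : 0 <= b k by rewrite mulr_ge0 ?mulr_ge0// ltW.
have [||||||||ig hg] := @layer_integral R f g (Phi 1 1) (fun s => 288 * Phi2 s) l b (Phi 1 1 1) If Tfg.
- exact: Phi_measurable.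
- by move=> v; exact: Phi_ge0.
- exact: Phi_ge0.
- exact: b0.
- exact: l0.
- move=> v; have [|||N] := @layer_dyadic R (Phi 1 1) b 1 v e0.
  + by move=> u w u0 uw; apply: Phi_mono => //; rewrite !ger0_norm// (le_trans u0).
  + exact: b0.
  + move=> k; apply: (@le_trans _ _ (Phi 1 1 (l k.+1))).
      by rewrite lerBlDr lerDl Phi_ge0.
    rewrite /Phi !mul1r divr1 gtr0_norm// /l mul1r.
    have h := @ln_pow2_le R k.+1.
    rewrite /b /l mul1r exprS.
    have p0 : 0 < 2 ^+ k :> R by rewrite exprn_gt0.
    have -> : 6 * k.+1%:R * 2 ^+ k = 2 * 2 ^+ k * (3 * k.+1%:R) :> R by ring.
    apply: ler_wpM2l; first by rewrite mulr_ge0// ltW.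
    rewrite exprS in h; apply: (@le_trans _ _ (1 + k.+2%:R)); first by rewrite lerD2l.
    have : 0 <= k%:R :> R by [].
    by rewrite -!natr1; lra.
  + by rewrite {1}/Phi normr_id => h; exists N.
- exact: L1Z.
- move=> N s; set S := `|s|; have S0 : 0 <= S by rewrite normr_ge0.
  pose a k := ln (1 + 2 * (S / l k)).
  have a0 k : 0 <= a k by rewrite ln1p_ge0// mulr_ge0// divr_ge0// ltW.
  have aS k : ln (1 + S / l k) = a k.+1.
    rewrite /a /l exprS; congr (ln (1 + _)); field.
    by rewrite !gt_eqF// exprn_gt0.
  apply: (@le_trans _ _ (\sum_(k < N) (12 * S) * (k.+1%:R * (a k - a k.+1)))).
    apply: ler_sum => k _; rewrite /b mulfK ?gt_eqF// -aS.
    have := ler_wpM2l (_ : 0 <= 6 * k.+1%:R) (kap_gap s (l0 k)); rewrite -/S.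
    rewrite (_ : 6 * k.+1%:R * (2 * S * (ln (1 + 2 * (S / l k)) - ln (1 + S / l k))) =
      12 * S * (k.+1%:R * (a k - ln (1 + S / l k)))); last by rewrite /a; ring.
    by apply; rewrite mulr_ge0.
  rewrite -mulr_sumr.
  (* Summation by parts: the increments of s (1 + ln (1 + s)) carry a factor k + 1, which turns the
     telescoping sum into a sum of logarithms, handled by [ln_sqr_gap]. *)
  have h1 : \sum_(k < N) k.+1%:R * (a k - a k.+1) = \sum_(k < N) a k - N%:R * a N.
    elim: N => [|N IH]; first by rewrite !big_ord0 mul0r subrr.
    by rewrite !big_ord_recr/= IH -natr1; ring.
  pose c k := 6 * (a k ^+ 2 + a k).
  have h2 : \sum_(k < N) a k <= c 0%N - c N.
    elim: N {h1} => [|N IH]; first by rewrite big_ord0 subrr.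
    rewrite big_ord_recr/=; have r0 : 0 <= S / l N by rewrite divr_ge0// ltW.
    have := ln_sqr_gap r0; rewrite aS -/(a N) -/(c N) -/(c N.+1) => h; lra.
  have h3 : a 0%N <= 2 * ln (1 + S).
    by rewrite /a /l expr0 mulr1 divr1; exact: ln1p_double.
  have h4 : \sum_(k < N) k.+1%:R * (a k - a k.+1) <= 24 * (1 + ln (1 + S)) ^+ 2.
    rewrite h1; have h5 : 0 <= N%:R * a N by rewrite mulr_ge0.
    have h6 : 0 <= c N by rewrite /c mulr_ge0// addr_ge0// sqr_ge0.
    have h7 : c 0%N <= 24 * (1 + ln (1 + S)) ^+ 2.
      rewrite /c; move: h3 (a0 0%N); set A := a 0%N; set L := ln _ => h3 A0.
      have : A ^+ 2 <= (2 * L) ^+ 2 by rewrite ler_sqr ?nnegrE//; lra.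
      have : 0 <= L by lra.
      by move=> ? ?; nra.
    by lra.
  rewrite /Phi2 -/S; have := ler_wpM2l (_ : 0 <= 12 * S) h4.
  rewrite (_ : 12 * S * (24 * (1 + ln (1 + S)) ^+ 2) = 288 * (S * (1 + ln (1 + S)) ^+ 2)); last by ring.
  by apply; rewrite mulr_ge0.
exact: ig.
Qed.

(** * The inversion formula *)

Lemma level_markov (R : realType) (w : R -> R) (l : R) : L1 w -> 0 < l ->
  (l%:E * mu (I1 `&` [set t | (l < `|w t|)%R] : set (measurableTypeR R)) <=
   (\int[mu]_(x in I1) `|w x|)%:E)%E.
Proof.
move=> Iw l0; have mw := L1_measurable Iw; have mI := @mI1 R.
have mA := level_measurable l mw; set A := I1 `&` _ in mA *.
rewrite -Rintegral_lee//; last exact: L1_norm.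
have -> : A = A `&` I1 by rewrite /A setIAC setIid.
rewrite -integral_indic// -ge0_integralZl_EFin//; last 2 first.
- by apply/measurable_EFinP; apply: measurable_funTS; exact: measurable_indic.
- exact: ltW.
apply: ge0_le_integral => //.
- by move=> t _; rewrite mule_ge0// lee_fin// ltW.
- apply: emeasurable_funM; first exact: measurable_cst.
  by apply/measurable_EFinP; apply: measurable_funTS; exact: measurable_indic.
- by apply/measurable_EFinP; exact: measurableT_comp.
move=> t It; rewrite -EFinM lee_fin indicE.
have [|_] := boolP (t \in A); last by rewrite mulr0.
by rewrite inE mulr1 => -[_ /ltW].
Qed.

Lemma level0_ae (R : realType) (u : R -> R) : measurable_fun I1 u ->
  (forall l d : R, 0 < l -> 0 < d ->
    (mu (I1 `&` [set t | (l < `|u t|)%R] : set (measurableTypeR R)) <= d%:E)%E) ->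
  {ae (@lebesgue_measure R), forall t : R, I1 t -> u t = 0}.
Proof.
move=> mu_ H; pose A (n : nat) := I1 `&` [set t | n.+1%:R^-1 < `|u t|] : set (measurableTypeR R).
have A0 n : mu.-negligible (A n).
  apply/negligibleP; first exact: level_measurable.
  apply/eqP; rewrite eq_le measure_ge0 andbT; apply/lee_addgt0Pr => e e0; rewrite add0e.
  by apply: H => //; rewrite invr_gt0.
apply: (negligibleS _ (negligible_bigcup A0)) => t /= /not_implyP[It ut].
have u0 : 0 < `|u t| by rewrite normr_gt0; apply/eqP.
exists (Num.truncn (`|u t|^-1)) => //; split => //=.
by rewrite invf_plt ?posrE//; exact: truncnS_gt.
Qed.

(* Weak type (1,1) identifies an a.e. limit obtained along an approximation. *)
Lemma ae_eq_approx (R : realType) (h k : R -> R) : measurable_fun I1 h -> measurable_fun I1 k ->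
  (forall e : R, 0 < e -> exists F v w : R -> R, [/\ L1 F, isT F v, L1 w,
    \int[mu]_(x in I1) `|F x| <= e /\ \int[mu]_(x in I1) `|w x| <= e &
    forall t : R, I1 t -> `|h t - k t| <= `|v t| + `|w t| + e]) ->
  {ae (@lebesgue_measure R), forall t : R, I1 t -> h t = k t}.
Proof.
move=> mh mk H; have mu_ : measurable_fun I1 (fun t => h t - k t) by exact: measurable_funB.
apply: (@aeS _ (fun t => I1 t -> h t - k t = 0)).
  by move=> t ht It; apply/eqP; rewrite -subr_eq0 ht.
apply: level0_ae => // l d l0 d0; have C0 := weakC_gt0 R.
pose m := l / 3; have m0 : 0 < m by rewrite divr_gt0.
pose e := Num.min m (m * d / (weakC R + 1)).
have C1 : 0 < weakC R + 1 by lra.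
have e0 : 0 < e by rewrite lt_min m0/= divr_gt0// mulr_gt0.
have [F [v [w [IF TF Iw [hF hw] hb]]]] := H e e0.
have em : e <= m by rewrite ge_min lexx.
have ed : e * (weakC R + 1) <= m * d by rewrite -ler_pdivlMr// ge_min lexx orbT.
have [mv _] := TF.
pose A := I1 `&` [set t | m < `|v t|] : set (measurableTypeR R).
pose B := I1 `&` [set t | m < `|w t|] : set (measurableTypeR R).
have mA : measurable A by exact: level_measurable.
have mB : measurable B by apply: level_measurable; exact: L1_measurable.
apply: (@le_trans _ _ (mu (A `|` B))).
  apply: le_measure; rewrite ?inE; [exact: level_measurable|exact: measurableU|].
  move=> t [It /= lt]; have := hb t It.
  have [vm|vm] := ltP m `|v t|; first by left.
  have [wm|wm] := ltP m `|w t|; first by right.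
  have E : l = 3 * m by rewrite /m; field.
  move: lt; rewrite E; set X := `|_|; set V := `|v t|; set W := `|w t| => h1 h2; exfalso.
  by have : ~ (3 * m < X) by clear -em h2 vm wm; move: vm wm; rewrite -/V -/W; lra.
apply: (le_trans (measureU2 _ mA mB)).
rewrite -(@lee_pmul2l _ m%:E) ?lte_fin//= ge0_muleDr// -EFinM.
apply: (@le_trans _ _ ((weakC R * e)%:E + e%:E)%E); last first.
  by rewrite -EFinD lee_fin; lra.
apply: leeD.
  apply: (le_trans (isT_weak IF TF m0)); rewrite lee_fin ler_wpM2l ?(ltW C0)//.
  apply: le_trans hF; apply: le_RI; [exact: kap_integrable|exact: L1_norm|].
  by move=> x _; exact: kap_le.
by apply: (le_trans (level_markov Iw m0)); rewrite lee_fin.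
Qed.

Lemma wt_le1 (R : realType) (x : R) : `|wt x| <= 1.
Proof.
rewrite ger0_norm ?wt_ge0// /wt -[leRHS]sqrtr1 ler_wsqrtr// gerDl oppr_le0.
exact: sqr_ge0.
Qed.

Lemma L1_wt (R : realType) (f : R -> R) : L1 f -> L1 (fun x => wt x * f x).
Proof.
move=> If; rewrite (_ : (fun x => wt x * f x) = (fun x => f x * wt x)).
  by apply: (L1M (C := 1) If); [exact: wt_measurable|move=> x _; exact: wt_le1].
by apply/funext => x; rewrite mulrC.
Qed.

Lemma horner_L1 (R : realType) (q : {poly R}) : L1 (fun x : R => q.[x]).
Proof.
have [M hM] := pw_bound q.
apply: (L1_le _ (integrable_cstI M)); first exact: horner_measurable.
move=> x.
rewrite /= in_itv/= => /andP[x1 x2]; apply: hM.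
by rewrite !ltW.
Qed.

(** Finiteness of the modular does not depend on the scale, only its size does; hence hypotheses at
    scale 1 allow approximation at a small scale. *)
Lemma Phi_rescale (R : realType) (e s : R) : 0 < e ->
  Phi 1 e s <= (1 + ln (1 + e^-1)) * Phi 1 1 s.
Proof.
move=> e0; have s0 : 0 <= `|s| by [].
have i0 : 0 <= e^-1 by rewrite invr_ge0 ltW.
rewrite /Phi !mul1r divr1 mulrCA; apply: ler_wpM2l => //.
have h1 := ln1p_ge0 s0; have h2 := ln1p_ge0 i0.
have h : ln (1 + `|s| / e) <= ln (1 + `|s|) + ln (1 + e^-1).
  rewrite -lnM ?posrE; [|lra|lra].
  rewrite ler_ln ?posrE; [nra| |by rewrite mulr_gt0//; lra].
  by have : 0 <= `|s| / e; [rewrite mulr_ge0|lra].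
by nra.
Qed.

Lemma Phi_L1 (R : realType) (f : R -> R) (c e : R) : 0 <= c -> 0 < e -> measurable_fun I1 f ->
  L1 (fun x => Phi c e (f x)) -> L1 f.
Proof. by move=> c0 e0 mf iP; apply: (L1_le mf iP) => x _; exact: Phi_ge. Qed.

Lemma Phi_L1_rescale (R : realType) (f : R -> R) (e : R) : 0 < e -> measurable_fun I1 f ->
  L1 (fun x => Phi 1 1 (f x)) -> L1 (fun x => Phi 1 e (f x)).
Proof.
move=> e0 mf iP; apply: (L1_le (Phi_measurable 1 e mf) (L1Z (1 + ln (1 + e^-1)) iP)) => x _.
by rewrite ger0_norm ?Phi_ge0//; exact: Phi_rescale.
Qed.

Lemma pw_wt (R : realType) (q : {poly R}) (x : R) : I1 x -> pw ((1 - 'X ^+ 2) * q) x = wt x * q.[x].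
Proof.
rewrite /= in_itv/= => x1; have w0 := wt_gt0 x1.
rewrite /pw !hornerE -(wt_sqr (_ : -1 <= x <= 1)).
  by field; rewrite gt_eqF.
by case/andP: x1 => ? ?; apply/andP; split; apply: ltW.
Qed.

Lemma isT_eq_arg (R : realType) (f f' g : R -> R) : (forall x : R, I1 x -> f x = f' x) ->
  isT f g -> isT f' g.
Proof.
move=> ff' [mg h]; split => //; apply: aeS h => t h It.
rewrite (_ : (fun e => tr f' t e) = (fun e => tr f t e)); first exact: h.
by apply/funext => e; apply: eq_Rintegral => x /set_mem Ix; rewrite ff'.
Qed.

Lemma inversion (R : realType) (f g : R -> R) : measurable_fun I1 f ->
  L1 (fun x => Phi 1 1 (f x)) -> isT f g ->
  isT (fun x => wt x * g x) (fun x => - pi ^+ 2 * (wt x * f x) + pi * \int[mu]_(x in I1) f x).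
Proof.
move=> mf iP Tfg; have If := Phi_L1 ler01 ltr01 mf iP; have [mg _] := Tfg.
have [Ig _] := norm_log_bound If Tfg ltr01 iP.
have Iwg := L1_wt Ig.
have [h Th] := isT_exists Iwg; have [mh _] := Th.
set k := (fun x => _ + _).
have mk : measurable_fun I1 k.
  apply: measurable_funD; last exact: measurable_cst.
  apply: measurable_funM; first exact: measurable_cst.
  by apply: measurable_funM => //; exact: wt_measurable.
apply: (isT_ae Th mk); apply: ae_eq_approx => // e e0.
have C0 := weakC_gt0 R; have p0 := pi_gt0 R; have p4 := pi_le4 R.
(* 2 a + 4 [weakC] a bounds the transform of the error through [norm_log_bound], and 16 a covers the
   terms with pi^2 <= 16. *)
pose a := e / (16 + 4 * weakC R).
have a0 : 0 < a by rewrite divr_gt0//; lra.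
have aE : (16 + 4 * weakC R) * a = e by rewrite /a mulrC divfK// gt_eqF//; lra.
have ca : 0 < weakC R * a by rewrite mulr_gt0.
have [p [ip hp]] := pw_dense ler01 a0 a0 mf (Phi_L1_rescale a0 mf iP).
have [q hq hq2] := pv_pair_all p.
have ipw := pw_integrable p.
have TD := isTB If ipw Tfg (isT_pvp hq).
have ID := L1B If ipw.
have [IgD hgD] := norm_log_bound ID TD a0 ip.
have hD : \int[mu]_(x in I1) `|f x - pw p x| <= a.
  apply: le_trans hp; apply: le_RI => //; first exact: L1_norm.
  by move=> x _; exact: Phi_ge.
have hpair : isT (fun x => wt x * (pi *: q).[x]) (fun x => (pi *: (- pi *: p + (pwi p)%:P)).[x]).
  apply: (@isT_eq_arg _ (pw (pi *: ((1 - 'X ^+ 2) * q)))).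
    by move=> x Ix; rewrite scalerAr pw_wt.
  by apply: isT_pvp; apply: pvpZ.
have Iwq : L1 (fun x => wt x * (pi *: q).[x]).
  by apply: L1_wt; exact: horner_L1.
(* By linearity and the identity for the pair (p, q), the defect splits into the transform of a
   function small in L^1, pi^2 times the approximation error of f, and the error of its integral. *)
exists (fun x => wt x * g x - wt x * (pi *: q).[x]),
  (fun x => h x - (pi *: (- pi *: p + (pwi p)%:P)).[x]),
  (fun x => 16 * (f x - pw p x)); split.
- exact: L1B.
- exact: isTB.
- exact: L1Z.
- split.
    apply: (@le_trans _ _ (\int[mu]_(t in I1) `|g t - (pi *: q).[t]|)).
      apply: le_RI; [by apply: L1_norm; exact: L1B|exact: L1_norm|].
      move=> x _; rewrite -mulrBr normrM ler_piMl//; exact: wt_le1.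
    by have := ler_wpM2l (ltW C0) hp; lra.
  have -> : (fun x : R => `|16 * (f x - pw p x)|) = (fun x => 16 * `|f x - pw p x|).
    by apply/funext => x; rewrite normrM ger0_norm.
  rewrite RIZ; last exact: L1_norm.
  by lra.
- move=> t It; rewrite /k hornerZ hornerD hornerZ hornerC.
  have w0 : wt t != 0 by move: It; rewrite /= in_itv/= => t1; rewrite gt_eqF// wt_gt0.
  have -> : h t - (- pi ^+ 2 * (wt t * f t) + pi * \int[mu]_(x in I1) f x) =
     (h t - pi * (- pi * p.[t] + pwi p)) + (pi ^+ 2 * (wt t * (f t - pw p t)) -
       pi * (\int[mu]_(x in I1) f x - pwi p)).
    by rewrite /pw; field.
  apply: (le_trans (ler_normD _ _)); rewrite -addrA lerD2l.
  apply: (le_trans (ler_normB _ _)); apply: lerD.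
    rewrite normrM (ger0_norm (sqr_ge0 _)) normrM [leRHS]normrM (ger0_norm (ler0n R 16)).
    apply: ler_pM; rewrite ?sqr_ge0//; first by nra.
    by rewrite ler_piMl//; exact: wt_le1.
  rewrite normrM (gtr0_norm p0).
  have : `|\int[mu]_(x in I1) f x - pwi p| <= a.
    apply: le_trans hD; rewrite /pwi -(RintegralB (@mI1 R) If ipw).
    exact: le_normr_Rintegral (@mI1 R) ID.
  set X := `|_| => hX; have X0 : 0 <= X by rewrite normr_ge0.
  by have : pi * X <= 4 * X; [rewrite ler_wpM2r|lra].
Qed.

(** * Solvability in L (log L)^2 *)

Definition kW (R : realType) (x s : R) : R := 2 / (wt x * (wt x + wt s)).

Definition Kop (R : realType) (g : R -> R) (x : R) : R := \int[mu]_(s in I1) (`|g s| * kW x s).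

(** The logarithmic weight at the endpoints: the operator [Kop] costs one power of it, from |g|
    [lam]^2 to [lam] [Kop g], and the remaining power pays for the logarithm in the modular of
    [Kop g]. *)
Definition lam (R : realType) (x : R) : R := 1 + ln (wt x)^-1.

Lemma I1_wt_gt0 (R : realType) (x : R) : I1 x -> 0 < wt x.
Proof. by rewrite /= in_itv/=; exact: wt_gt0. Qed.

Lemma wtV_ge1 (R : realType) (x : R) : I1 x -> 1 <= (wt x)^-1.
Proof.
move=> Ix; have := wt_le1 x; rewrite ger0_norm ?wt_ge0// => h.
by rewrite invf_ge1 ?I1_wt_gt0.
Qed.

Lemma lam_ge1 (R : realType) (x : R) : I1 x -> 1 <= lam x.
Proof. by move=> Ix; rewrite lerDl ln_ge0// wtV_ge1. Qed.

Lemma lam_measurable (R : realType) : measurable_fun I1 (@lam R).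
Proof.
apply: measurable_funD; first exact: measurable_cst.
by apply: (measurableT_comp (@measurable_ln R)); exact: wtV_measurable.
Qed.

(** ln y <= y applied to y = wt^(-d/2). The exponent d is left free, to be chosen as 1/2 or as 1 /
    [lam] of another point. *)
Lemma lam_le (R : realType) (d x : R) : I1 x -> 0 < d -> d <= 1 ->
  lam x <= 3 / d * (wt x)^-1 `^ (d / 2).
Proof.
move=> Ix d0 d1; have z1 := wtV_ge1 Ix; rewrite /lam; move: z1; set z := (wt x)^-1 => z1.
have h1 : 1 <= z `^ (d / 2).
  by rewrite -[leLHS](powRr0 z); apply: ler_powR => //; rewrite divr_ge0// ltW.
have h2 : ln (z `^ (d / 2)) <= z `^ (d / 2).
  have := @le_ln1Dx R (z `^ (d / 2) - 1); rewrite (_ : 1 + (z `^ (d / 2) - 1) = z `^ (d / 2)); last by ring.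
  by move=> h; apply: (le_trans (h _)); lra.
rewrite ln_powR in h2.
have h3 : ln z <= 2 / d * z `^ (d / 2).
  by rewrite -ler_pdivrMl ?divr_gt0// invf_div.
have h4 : 1 <= d^-1 by rewrite invf_ge1.
have h5 : 1 <= d^-1 * z `^ (d / 2) by nra.
have -> : 3 / d * z `^ (d / 2) = d^-1 * z `^ (d / 2) + 2 / d * z `^ (d / 2) by ring.
exact: lerD.
Qed.

Lemma wtV_pow (R : realType) (x r : R) : I1 x -> (wt x)^-1 `^ r = (1 - x ^+ 2) `^ (- (r / 2)).
Proof. by move=> Ix; rewrite wt_powR// -powRrM; congr (_ `^ _); ring. Qed.

Lemma kW_ge0 (R : realType) (x s : R) : I1 x -> 0 <= kW x s.
Proof.
move=> Ix; have := I1_wt_gt0 Ix; have := wt_ge0 s => ? ?.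
by rewrite divr_ge0// mulr_ge0 ?addr_ge0 ?wt_ge0.
Qed.

Lemma kW_le (R : realType) (x s : R) : I1 x -> `|kW x s| <= 2 * (wt x)^-1 ^+ 2.
Proof.
move=> Ix; rewrite ger0_norm ?kW_ge0//; have x0 := I1_wt_gt0 Ix; have s0 := wt_ge0 s.
rewrite /kW ler_pM2l// expr2 -invfM lef_pV2 ?posrE ?mulr_gt0//; last by lra.
by rewrite ler_pM2l//; lra.
Qed.

(* Interpolating a + b >= a^(1-d) b^d with d = 1 / lam s. *)
Lemma kW_pow (R : realType) (x s : R) (d := (lam s)^-1) : I1 x -> I1 s ->
  kW x s <= 2 * expR 1 * (wt x)^-1 `^ (2 - d).
Proof.
move=> Ix Is; have x0 := I1_wt_gt0 Ix; have s0 := I1_wt_gt0 Is.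
have l1 := lam_ge1 Is; have l0 : 0 < lam s by lra.
have d0 : 0 < d by rewrite invr_gt0.
have d1 : d <= 1 by rewrite invf_le1.
rewrite /kW; set a := wt x in x0 *; set b := wt s in s0 *; set m := a + b.
have m0 : 0 < m by rewrite /m; lra.
have hm : a `^ (1 - d) * b `^ d <= m.
  have -> : m = m `^ (1 - d) * m `^ d.
    rewrite -powRD; first by rewrite subrK powRr1// ltW.
    by rewrite (gt_eqF m0) implybT.
  apply: ler_pM; rewrite ?powR_ge0//; apply: ge0_ler_powR; rewrite ?nnegrE /m ?subr_ge0; lra.
have bd : (b `^ d)^-1 <= expR 1.
  rewrite -powRN /powR gt_eqF// ler_expR mulNr -mulrN -lnV ?posrE//.
  rewrite /d ler_pdivrMl// mulr1 /lam -/b; lra.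
have p1 : 0 < a `^ (1 - d) by exact: powR_gt0.
have p2 : 0 < b `^ d by exact: powR_gt0.
have E : a^-1 `^ (2 - d) = a^-1 * (a `^ (1 - d))^-1.
  have -> : 2 - d = 1 + (1 - d) by ring.
  rewrite powRD; last by rewrite invr_eq0 (gt_eqF x0) implybT.
  rewrite powRr1 ?invr_ge0 ?(ltW x0)//; congr (_ * _).
  by rewrite -powR_inv1 ?(ltW x0)// -powRrM mulN1r powRN.
have h : m^-1 <= (a `^ (1 - d))^-1 * expR 1.
  apply: (@le_trans _ _ (a `^ (1 - d) * b `^ d)^-1); first by rewrite lef_pV2 ?posrE ?mulr_gt0.
  by rewrite invfM ler_pM2l ?invr_gt0.
rewrite E invfM -!mulrA ler_pM2l// (mulrCA (expR 1)) ler_pM2l ?invr_gt0//.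
by rewrite mulrC.
Qed.

(** With d = 1 / [lam s], the integrand is at most 6 e / d times (1 - x^2)^(-(1 - d / 4)) with e =
    exp 1, whose integral is at most 16 / d by [powR_integrable]; the product is 96 e [lam s]^2. *)
Lemma lam_kW_integral (R : realType) (s : R) : I1 s ->
  (\int[mu]_(x in I1) (lam x * kW x s)%:E <= (96 * expR 1 * lam s ^+ 2)%:E)%E.
Proof.
move=> Is; have l1 := lam_ge1 Is; set d := (lam s)^-1.
have d0 : 0 < d by rewrite invr_gt0; lra.
have d1 : d <= 1 by rewrite invf_le1//; lra.
have b0 : 0 <= 1 - d / 4 by lra.
have b1 : 1 - d / 4 < 1 by lra.
have [ip hp] := powR_integrable b0 b1.
pose C := 6 * expR 1 / d.
have C0 : 0 <= C by rewrite divr_ge0 ?(ltW d0)// mulr_ge0// expR_ge0.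
apply: (@le_trans _ _ (\int[mu]_(x in I1) (C * (1 - x ^+ 2) `^ (- (1 - d / 4)))%:E)%E).
  apply: ge0_le_integral; first exact: mI1.
  - by move=> x Ix; rewrite lee_fin mulr_ge0 ?kW_ge0//; have := lam_ge1 Ix; lra.
  - apply/measurable_EFinP; apply: measurable_funM; first exact: lam_measurable.
    apply: measurable_funM; first exact: measurable_cst.
    apply: (measurableT_comp (@measurable_inv R)); apply: measurable_funM; first exact: wt_measurable.
    by apply: measurable_funD; [exact: wt_measurable|exact: measurable_cst].
  - by apply/measurable_EFinP; exact: L1_measurable (L1Z C ip).
  move=> x Ix; rewrite lee_fin.
  have h1 := lam_le Ix d0 d1; have h2 := kW_pow Ix Is; rewrite -/d in h2.
  apply: (le_trans (ler_pM _ (kW_ge0 s Ix) h1 h2)); first by have := lam_ge1 Ix; lra.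
  rewrite le_eqVlt; apply/orP; left; apply/eqP.
  have -> : 3 / d * (wt x)^-1 `^ (d / 2) * (2 * expR 1 * (wt x)^-1 `^ (2 - d)) =
    C * ((wt x)^-1 `^ (d / 2) * (wt x)^-1 `^ (2 - d)) by rewrite /C; ring.
  congr (_ * _); rewrite -powRD; last by rewrite (gt_eqF (wtV_gt0 Ix)) implybT.
  by rewrite wtV_pow//; congr (_ `^ _); field.
rewrite (Rintegral_lee (@mI1 R) (L1Z C ip)) lee_fin RIZ//.
apply: (le_trans (ler_wpM2l C0 hp)).
rewrite /C /d; move: l1; set L := lam s => l1.
rewrite le_eqVlt; apply/orP; left; apply/eqP; field.
by rewrite gt_eqF//; lra.
Qed.

Lemma Kop_integrable (R : realType) (g : R -> R) (x : R) : L1 g -> I1 x ->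
  L1 (fun s => `|g s| * kW x s).
Proof.
move=> Ig Ix; apply: (L1M (C := 2 * (wt x)^-1 ^+ 2) (L1_norm Ig)) => [|s _]; last exact: kW_le.
apply: measurable_funM; first exact: measurable_cst.
apply: (measurableT_comp (@measurable_inv R)); apply: measurable_funM; first exact: measurable_cst.
by apply: measurable_funD; [exact: measurable_cst|exact: wt_measurable].
Qed.

Lemma Kop_ge0 (R : realType) (g : R -> R) (x : R) : I1 x -> 0 <= Kop g x.
Proof. by move=> Ix; apply: Rintegral_ge0 => s _; rewrite mulr_ge0 ?kW_ge0. Qed.

Lemma Kop_le (R : realType) (g : R -> R) (x : R) : L1 g -> I1 x ->
  Kop g x <= 2 * (wt x)^-1 ^+ 2 * \int[mu]_(s in I1) `|g s|.
Proof.
move=> Ig Ix; rewrite -RIZ; last exact: L1_norm.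
apply: le_RI; [exact: Kop_integrable|exact: L1Z (L1_norm Ig)|].
move=> s _; rewrite mulrC; apply: ler_wpM2r => //.
by apply: le_trans (kW_le s Ix); exact: ler_norm.
Qed.

Lemma Kop_tonelli (R : realType) (g V : R -> R) : L1 g -> measurable_fun I1 V ->
  (forall x : R, I1 x -> 0 <= V x) ->
  [/\ measurable_fun I1 (fun x => V x * Kop g x),
  measurable_fun I1 (fun s => \int[mu]_(x in I1) (V x * (`|g s| * kW x s))%:E)%E &
  (\int[mu]_(x in I1) (V x * Kop g x)%:E =
   \int[mu]_(s in I1) \int[mu]_(x in I1) (V x * (`|g s| * kW x s))%:E)%E].
Proof.
move=> Ig mV V0; have mI := @mI1 R; have mg := L1_measurable Ig.
have mX : measurable (I1 `*` I1 : set (measurableTypeR R * measurableTypeR R)) by exact: measurableX.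
have m1 (k : R -> R) : measurable_fun I1 k ->
    measurable_fun (I1 `*` I1) (fun z : measurableTypeR R * measurableTypeR R => k z.1).
  move=> mk; apply: (@measurable_comp _ _ _ _ _ _ I1 k) => //.
    by move=> _ [z [Bz _] <-].
  by apply: measurable_funTS; exact: measurable_fst.
have m2 (k : R -> R) : measurable_fun I1 k ->
    measurable_fun (I1 `*` I1) (fun z : measurableTypeR R * measurableTypeR R => k z.2).
  move=> mk; apply: (@measurable_comp _ _ _ _ _ _ I1 k) => //.
    by move=> _ [z [_ Bz] <-].
  by apply: measurable_funTS; exact: measurable_snd.
have mw := @wt_measurable R I1.
have mG : measurable_fun (I1 `*` I1) (fun z : measurableTypeR R * measurableTypeR R =>
    V z.1 * (`|g z.2| * kW z.1 z.2)).
  apply: measurable_funM; first exact: m1.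
  apply: measurable_funM; first by apply: (m2 (fun s => `|g s|)); exact: measurableT_comp.
  apply: measurable_funM; first exact: measurable_cst.
  apply: (@measurableT_comp _ _ _ _ _ _ (@GRing.inv R)); first exact: measurable_inv.
  apply: measurable_funM; first exact: m1.
  by apply: measurable_funD; [exact: m1|exact: m2].
have [mT T] := tonelli2 mI mI mG (fun x s Ix _ => mulr_ge0 (V0 x Ix) (mulr_ge0 (normr_ge0 _) (kW_ge0 s Ix))).
have E x : I1 x -> (\int[mu]_(s in I1) (V x * (`|g s| * kW x s))%:E = (V x * Kop g x)%:E)%E.
  move=> Ix; have iK := Kop_integrable Ig Ix.
  by rewrite (Rintegral_lee mI (L1Z (V x) iK)) RIZ.
have mG' : measurable_fun (I1 `*` I1) (fun z : measurableTypeR R * measurableTypeR R =>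
    V z.2 * (`|g z.1| * kW z.2 z.1)).
  apply: measurable_funM; first exact: m2.
  apply: measurable_funM; first by apply: (m1 (fun s => `|g s|)); exact: measurableT_comp.
  apply: measurable_funM; first exact: measurable_cst.
  apply: (@measurableT_comp _ _ _ _ _ _ (@GRing.inv R)); first exact: measurable_inv.
  apply: measurable_funM; first exact: m2.
  by apply: measurable_funD; [exact: m2|exact: m1].
have [mT' _] := tonelli2 mI mI mG' (fun s x _ Ix => mulr_ge0 (V0 x Ix) (mulr_ge0 (normr_ge0 _) (kW_ge0 s Ix))).
split; [|exact: mT'|].
  apply/measurable_EFinP; apply: eq_measurable_fun mT => x /set_mem Ix /=.
  exact: E.
rewrite -[RHS]T; apply: eq_integral => x /set_mem Ix; rewrite -E//.
Qed.

Lemma Kop_lam (R : realType) (g : R -> R) : L1 g -> L1 (fun s => `|g s| * lam s ^+ 2) ->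
  L1 (fun x => lam x * Kop g x) /\
  \int[mu]_(x in I1) (lam x * Kop g x) <= 96 * expR 1 * \int[mu]_(s in I1) (`|g s| * lam s ^+ 2).
Proof.
move=> Ig Il; have mI := @mI1 R.
have l0 (x : R) : I1 x -> 0 <= lam x by move=> /lam_ge1; lra.
have [mK mK' hK] := Kop_tonelli Ig (@lam_measurable R) l0.
have Il' := L1Z (96 * expR 1) Il.
have bound : (\int[mu]_(x in I1) (lam x * Kop g x)%:E <=
    (96 * expR 1 * \int[mu]_(s in I1) (`|g s| * lam s ^+ 2))%:E)%E.
  rewrite hK -RIZ// -Rintegral_lee//.
  apply: ge0_le_integral => //.
  - move=> s _; apply: integral_ge0 => x Ix; rewrite lee_fin mulr_ge0 ?l0//.
    by rewrite mulr_ge0 ?kW_ge0.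
  - by apply/measurable_EFinP; exact: L1_measurable Il'.
  move=> s Is.
  have -> : (\int[mu]_(x in I1) (lam x * (`|g s| * kW x s))%:E =
     \int[mu]_(x in I1) (`|g s|%:E * (lam x * kW x s)%:E))%E.
    by apply: eq_integral => x _; rewrite -EFinM mulrCA.
  rewrite ge0_integralZl_EFin//; last 2 first.
  - by move=> x Ix; rewrite lee_fin mulr_ge0 ?l0 ?kW_ge0.
  - apply/measurable_EFinP; apply: measurable_funM; first exact: lam_measurable.
    apply: measurable_funM; first exact: measurable_cst.
    apply: (measurableT_comp (@measurable_inv R)); apply: measurable_funM; first exact: wt_measurable.
    by apply: measurable_funD; [exact: wt_measurable|exact: measurable_cst].
  rewrite mulrCA [leRHS]EFinM; apply: lee_wpmul2l; first by rewrite lee_fin.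
  exact: lam_kW_integral.
have iK : L1 (fun x => lam x * Kop g x).
  apply/integrableP; split; first exact/measurable_EFinP.
  apply: (@le_lt_trans _ _ (96 * expR 1 * \int[mu]_(s in I1) (`|g s| * lam s ^+ 2))%:E); last exact: ltry.
  apply: le_trans bound; rewrite le_eqVlt; apply/orP; left; apply/eqP.
  by apply: eq_integral => t /set_mem It /=; rewrite ger0_norm// mulr_ge0 ?l0 ?Kop_ge0.
by split => //; rewrite -lee_fin -Rintegral_lee.
Qed.

Lemma Kop_measurable (R : realType) (g : R -> R) : L1 g -> measurable_fun I1 (Kop g).
Proof.
move=> Ig; have [h _ _] := Kop_tonelli Ig (measurable_cst (1 : R)) (fun x _ => ler01).
by move: h; congr (measurable_fun I1); apply/funext => x; rewrite mul1r.
Qed.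

(* Where |g| >= (1 - x^2)^(-1/4) the weight is controlled by ln |g|, elsewhere
   by a power of 1 - x^2. *)
Lemma Phi2_lam (R : realType) (g : R -> R) : measurable_fun I1 g -> L1 (fun x => Phi2 (g x)) ->
  L1 (fun s => `|g s| * lam s ^+ 2).
Proof.
move=> mg iP; have iD := L1D (L1Z 4 iP) (L1Z 144 (wtV_integrable R)).
apply: (L1_le _ iD).
  apply: measurable_funM; first exact: measurableT_comp.
  by apply: measurable_funX; exact: lam_measurable.
move=> x Ix; have l1 := lam_ge1 Ix; have w1 := wtV_ge1 Ix; have w0 := wtV_gt0 Ix.
have g0 : 0 <= `|g x| by [].
have L0 := ln1p_ge0 g0.
have P0 : 0 <= Phi2 (g x) by rewrite mulr_ge0// sqr_ge0.
rewrite ger0_norm; last by rewrite mulr_ge0// sqr_ge0.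
set z := (wt x)^-1 in w1 w0 *.
have s1 : 1 <= Num.sqrt z by rewrite -[leLHS]sqrtr1 ler_wsqrtr.
have s2 : Num.sqrt z ^+ 2 = z by rewrite sqr_sqrtr// ltW.
have [gz|gz] := lerP (Num.sqrt z) `|g x|.
  have h : lam x <= 2 * (1 + ln (1 + `|g x|)).
    have : ln z <= 2 * ln (1 + `|g x|).
      rewrite mulr_natl -lnXn; last by lra.
      have p1 : 0 < 1 + `|g x| by lra.
      rewrite ler_ln ?posrE ?exprn_gt0//.
      by rewrite -s2 ler_sqr ?nnegrE; lra.
    by rewrite /lam -/z; lra.
  have h2 : lam x ^+ 2 <= 4 * (1 + ln (1 + `|g x|)) ^+ 2 by nra.
  apply: (@le_trans _ _ (4 * Phi2 (g x))); last by rewrite lerDl mulr_ge0// ltW.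
  by rewrite /Phi2 [leRHS]mulrCA; exact: ler_wpM2l.
have h12 : 0 < 2^-1 :> R by [].
have h := lam_le Ix h12 (_ : 2^-1 <= 1); rewrite -/z in h.
have {}h : lam x <= 6 * z `^ (4^-1).
  have -> : 6 = 3 / 2^-1 :> R by field.
  have -> : 4^-1 = 2^-1 / 2 :> R by field.
  by apply: h; lra.
have pz : z `^ (4^-1) ^+ 2 = Num.sqrt z.
  rewrite -powR12_sqrt ?(ltW w0)// expr2 -powRD; last by rewrite (gt_eqF w0) implybT.
  by congr (_ `^ _); field.
have p0 : 0 <= z `^ (4^-1) by exact: powR_ge0.
have h2 : lam x ^+ 2 <= 36 * Num.sqrt z.
  rewrite -pz (_ : 36 * z `^ (4^-1) ^+ 2 = (6 * z `^ (4^-1)) ^+ 2); last by ring.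
  by rewrite ler_sqr ?nnegrE//; lra.
have h3 : `|g x| * lam x ^+ 2 <= Num.sqrt z * (36 * Num.sqrt z).
  by apply: ler_pM => //; [exact: sqr_ge0|exact: ltW].
apply: (le_trans h3); rewrite mulrCA -expr2 s2.
by lra.
Qed.

(** The commutator of the weight with the transform has no singularity: (wt s - wt x) / (s - x) = -
    (s + x) / (wt x + wt s), as the squares of the weights differ by x^2 - s^2. *)
Lemma W_pointwise (R : realType) (g : R -> R) (x e : R) : L1 g -> I1 x -> 0 < e ->
  `|tr (fun s => wt s * g s) x e - wt x * tr g x e| <= wt x * Kop g x.
Proof.
move=> Ig Ix e0; have x0 := I1_wt_gt0 Ix; have mI := @mI1 R.
have i1 := ktr_integrable x (L1_wt Ig) e0.
have i2 := ktr_integrable x Ig e0.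
have iK := Kop_integrable Ig Ix.
rewrite /uker /Kop -RIZ// -RIZ// -RintegralB//; last exact: L1Z.
have iB := L1B i1 (L1Z (wt x) i2).
apply: (le_trans (le_normr_Rintegral mI iB)).
apply: le_RI; [exact: L1_norm|exact: L1Z|].
move=> s Is; have s0 := I1_wt_gt0 Is.
have -> : wt s * g s * ktr (s - x) e - wt x * (g s * ktr (s - x) e) =
  g s * ((wt s - wt x) * ktr (s - x) e) by ring.
rewrite normrM mulrCA; apply: ler_wpM2l => //.
have -> : wt x * kW x s = 2 / (wt x + wt s) by rewrite /kW; field; rewrite !gt_eqF// addr_gt0.
rewrite /ktr; case: ifPn => [h|_]; last by rewrite mulr0 normr0 divr_ge0// addr_ge0// ltW.
have sx : s - x != 0 by rewrite -normr_gt0 (lt_trans e0).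
have -> : (wt s - wt x) * (s - x)^-1 = - (s + x) / (wt x + wt s).
  have wx : wt x ^+ 2 = 1 - x ^+ 2.
    by apply: wt_sqr; move: Ix; rewrite /= in_itv/= => /andP[? ?]; rewrite !ltW.
  have ws : wt s ^+ 2 = 1 - s ^+ 2.
    by apply: wt_sqr; move: Is; rewrite /= in_itv/= => /andP[? ?]; rewrite !ltW.
  have n0 : wt x + wt s != 0 by rewrite gt_eqF// addr_gt0.
  apply: (mulIf n0); apply: (mulIf sx); rewrite divfK//.
  have -> : (wt s - wt x) * (s - x)^-1 * (wt x + wt s) * (s - x) = wt s ^+ 2 - wt x ^+ 2 by field.
  by rewrite ws wx; ring.
rewrite normrM normfV (gtr0_norm (addr_gt0 x0 s0)) ler_pM2r ?invr_gt0 ?addr_gt0// normrN.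
by move: Ix Is; rewrite /= !in_itv/= => /andP[? ?] /andP[? ?]; rewrite ler_norml; apply/andP; split; lra.
Qed.

Lemma W_dom (R : realType) (g Tg h : R -> R) : L1 g -> isT g Tg -> isT (fun s => wt s * g s) h ->
  {ae (@lebesgue_measure R), forall x : R, I1 x -> `|h x / wt x| <= `|Tg x| + Kop g x}.
Proof.
move=> Ig [_ hT] [_ hh]; apply: aeS2 hT hh => x hT hh Ix; have x0 := I1_wt_gt0 Ix.
have h1 : `|h x - wt x * Tg x| <= wt x * Kop g x.
  have l : `|tr (fun s => wt s * g s) x e - wt x * tr g x e|
      @[e --> (0 : R)^'+] --> `|h x - wt x * Tg x|.
    apply: cvg_norm; apply: cvgB; first exact: hh.
    by apply: cvgM; [exact: cvg_cst|exact: hT].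
  rewrite -(cvg_lim _ l)//; apply: limr_le; first by apply/cvg_ex; eexists; exact: l.
  near=> e; apply: W_pointwise => //; near: e; exact: nbhs_right_gt.
have -> : h x / wt x = Tg x + (h x - wt x * Tg x) / wt x by field; rewrite gt_eqF.
apply: (le_trans (ler_normD _ _)); rewrite lerD2l normrM normfV (gtr0_norm x0).
by rewrite ler_pdivrMr// [leRHS]mulrC.
Unshelve. all: by end_near. Qed.

(** The quantitative form, applied in [W_solves] to g minus a polynomial: smallness of the modular,
    of the weighted integral and of e makes T (wt g) / wt small in L^1. *)
Lemma W_L1 (R : realType) (g h : R -> R) (e : R) : 0 < e -> measurable_fun I1 g ->
  L1 (fun x => Phi 1 e (g x)) -> L1 (fun s => `|g s| * lam s ^+ 2) ->
  isT (fun s => wt s * g s) h ->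
  L1 (fun x => h x / wt x) /\
  \int[mu]_(x in I1) `|h x / wt x| <= 2 * e + 4 * weakC R * \int[mu]_(x in I1) Phi 1 e (g x) +
     96 * expR 1 * \int[mu]_(s in I1) (`|g s| * lam s ^+ 2).
Proof.
move=> e0 mg iP iL Th; have Ig := Phi_L1 ler01 e0 mg iP; have [mh _] := Th.
have [Tg TTg] := isT_exists Ig.
have [ITg hTg] := norm_log_bound Ig TTg e0 iP.
have dom := W_dom Ig TTg Th.
have [iK hK] := Kop_lam Ig iL.
have mW : measurable_fun I1 (fun x => h x / wt x).
  by apply: measurable_funM => //; exact: wtV_measurable.
have iS := L1D (L1_norm ITg) iK.
have dom' : {ae (@lebesgue_measure R), forall x : R, I1 x -> `|h x / wt x| <= `|Tg x| + lam x * Kop g x}.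
  apply: aeS dom => x dom Ix; apply: (le_trans (dom Ix)); rewrite lerD2l ler_peMl ?Kop_ge0//.
  exact: lam_ge1.
have mI := @mI1 R.
have bound : (\int[mu]_(x in I1) `|h x / wt x|%:E <= \int[mu]_(x in I1) (`|Tg x| + lam x * Kop g x)%:E)%E.
  apply: ae_ge0_le_integral => //.
  - by apply/measurable_EFinP; exact: measurableT_comp.
  - move=> x Ix; rewrite lee_fin addr_ge0// mulr_ge0 ?Kop_ge0//.
    by have := lam_ge1 Ix; lra.
  - by apply/measurable_EFinP; exact: L1_measurable iS.
have iW : L1 (fun x => h x / wt x).
  apply/integrableP; split; first exact/measurable_EFinP.
  by apply: (le_lt_trans bound); rewrite Rintegral_lee// ltry.
split => //; rewrite -lee_fin -Rintegral_lee//; last exact: L1_norm.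
apply: (le_trans bound); rewrite Rintegral_lee// lee_fin RID//; last exact: L1_norm.
exact: lerD.
Qed.

Lemma W_LlogL (R : realType) (g h : R -> R) : measurable_fun I1 g ->
  L1 (fun x => Phi2 (g x)) -> isT (fun s => wt s * g s) h ->
  L1 (fun x => Phi 1 1 (h x / wt x)).
Proof.
move=> mg iP2 Th; have [mh _] := Th.
have Ig : L1 g.
  apply: (L1_le mg iP2) => x _; rewrite ler_peMr// exprn_ege1//.
  by rewrite lerDl ln1p_ge0.
have iL := Phi2_lam mg iP2.
have [Tg TTg] := isT_exists Ig; have [mTg _] := TTg.
have iPT := log_log2_bound Ig TTg iP2.
have dom := W_dom Ig TTg Th.
have [iK _] := Kop_lam Ig iL.
pose m := \int[mu]_(s in I1) `|g s|.
have m0 : 0 <= m by apply: Rintegral_ge0.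
have mK := Kop_measurable Ig.
(* [Kop g] is at most a constant over wt^2, so its logarithm is bounded by a multiple of [lam] and
   the modular of [Kop g] by a multiple of [lam] [Kop g]. *)
have iPK : L1 (fun x => Phi 1 1 (Kop g x)).
  apply: (L1_le (Phi_measurable 1 1 mK) (L1Z (3 + ln (1 + 2 * m)) iK)) => x Ix.
  rewrite ger0_norm ?Phi_ge0// /Phi mul1r divr1; have K0 := Kop_ge0 g Ix.
  rewrite (ger0_norm K0) [leRHS]mulrC (mulrC (lam x)) -mulrA; apply: ler_wpM2l => //.
  have z1 := wtV_ge1 Ix; have l1 := lam_ge1 Ix; have hK := Kop_le Ig Ix; rewrite -/m in hK.
  have m20 : 0 <= 2 * m by lra.
  have L0 := ln1p_ge0 m20.
  have : ln (1 + Kop g x) <= ln (1 + 2 * m) + 2 * ln (wt x)^-1.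
    rewrite [2 * ln _]mulr_natl -lnXn; last by lra.
    rewrite -lnM ?posrE ?exprn_gt0//; [|lra|lra].
    have z2 : 1 <= (wt x)^-1 ^+ 2 by rewrite exprn_ege1.
    rewrite ler_ln ?posrE ?mulr_gt0//; first (by clear -hK z2; nra); lra.
  have l2 : ln (wt x)^-1 = lam x - 1 by rewrite /lam; ring.
  by rewrite l2 => hh; nra.
have iS := L1D (L1Z 4 iPT) (L1Z 4 iPK).
have mW : measurable_fun I1 (fun x => h x / wt x).
  by apply: measurable_funM => //; exact: wtV_measurable.
apply/integrableP; split; first by apply/measurable_EFinP; exact: Phi_measurable.
have mI := @mI1 R.
have bound : (\int[mu]_(x in I1) `|(Phi 1 1 (h x / wt x))%:E| <=
   \int[mu]_(x in I1) (4 * Phi 1 1 (Tg x) + 4 * Phi 1 1 (Kop g x))%:E)%E.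
  apply: ae_ge0_le_integral => //.
  - by apply/measurable_EFinP; apply: measurableT_comp => //; exact: Phi_measurable.
  - by move=> x Ix; rewrite lee_fin addr_ge0// mulr_ge0// Phi_ge0.
  - by apply/measurable_EFinP; exact: L1_measurable iS.
  - apply: aeS dom => x h1 Ix; rewrite /= lee_fin ger0_norm ?Phi_ge0//.
    have -> : Phi 1 1 (Tg x) = Phi 1 1 `|Tg x| by rewrite /Phi normr_id.
    apply: le_trans (Phi_add ler01 ltr01 _ _); apply: Phi_mono => //.
    by rewrite [leRHS]ger0_norm; [exact: h1|rewrite addr_ge0// Kop_ge0].
by apply: (le_lt_trans bound); rewrite Rintegral_lee// ltry.
Qed.

Lemma L1_cst_eq (R : realType) (c : R) : L1 (fun _ : R => c).
Proof. exact: (integrable_cstI c). Qed.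

(* T (wt (pi q)) for a polynomial q is again wt times a weighted polynomial, on
   which T can be evaluated. *)
Lemma W_poly (R : realType) (q : {poly R}) : exists r : {poly R},
  isT (fun s => wt s * (pi *: q).[s]) (fun x => wt x * pw r x) /\
  pvp r (- pi ^+ 2 *: (pi *: q)).
Proof.
have [p hp] := pvp_range q.
have [q' hq' hq2] := pv_pair_all p.
have E (x : R) : I1 x -> (pi *: q).[x] = (pi *: q').[x].
  by move=> Ix; exact: (cvg_unique _ (hp x Ix) (hq' x Ix)).
exists (pi *: (- pi *: p + (pwi p)%:P)); split.
  have h := isT_pvp (@pvpZ R pi _ _ hq2).
  apply: (@isT_eq_arg _ (pw (pi *: ((1 - 'X ^+ 2) * q')))).
    by move=> x Ix; rewrite E// scalerAr pw_wt.
  have [mh hh] := h; split.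
    apply: measurable_funM; first exact: wt_measurable.
    by apply: L1_measurable; exact: pw_integrable.
  apply: aeS hh => x hh Ix; have := hh Ix; set P := pi *: (_ + _).
  have -> // : wt x * pw P x = P.[x] by rewrite /pw mulrC divfK// gt_eqF// I1_wt_gt0.
have h := pvpD (@pvpZ R (- pi) _ _ hp) (@pvpZ R (pwi p) _ _ (@pvp1 R)).
have := @pvpZ R pi _ _ h; rewrite scaler0 addr0 alg_polyC.
by rewrite [in X in pvp _ X -> _]scalerA mulrN -expr2.
Qed.

Lemma W_solves (R : realType) (g h : R -> R) : measurable_fun I1 g ->
  L1 (fun x => Phi2 (g x)) -> isT (fun s => wt s * g s) h ->
  isT (fun x => h x / wt x) (fun x => - pi ^+ 2 * g x).
Proof.
move=> mg iP2 Th; have [mh _] := Th; have mI := @mI1 R.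
have iL := Phi2_lam mg iP2.
have iP1 : L1 (fun x => Phi 1 1 (g x)).
  apply: (L1_le (Phi_measurable 1 1 mg) iP2) => x _; rewrite ger0_norm ?Phi_ge0//.
  have g0 : 0 <= `|g x| by []. 
  rewrite /Phi /Phi2 mul1r divr1; apply: ler_wpM2l => //.
  by rewrite expr2 ler_peMl//; have := ln1p_ge0 g0; lra.
have Ig := Phi_L1 ler01 ltr01 mg iP1.
have [IW _] := W_L1 ltr01 mg iP1 iL Th.
have [H TH] := isT_exists IW; have [mH _] := TH.
have mk : measurable_fun I1 (fun x => - pi ^+ 2 * g x).
  by apply: measurable_funM => //; exact: measurable_cst.
apply: (isT_ae TH mk); apply: ae_eq_approx => // e e0.
have C0 := weakC_gt0 R; have p0 := pi_gt0 R; have p4 := pi_le4 R; have E0 := expR_gt0 (1 : R).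
(* It covers the 2 a + 4 [weakC] a + 96 (exp 1) a of [W_L1], and the 16 a coming from pi^2 <= 16. *)
pose C := 18 + 4 * weakC R + 96 * expR 1.
have C1 : 0 < C by rewrite /C; lra.
pose a := e / C.
have a0 : 0 < a by rewrite divr_gt0.
have aE : C * a = e by rewrite /a mulrC divfK// gt_eqF.
have l20 (x : R) : I1 x -> 0 <= lam x ^+ 2 by move=> _; exact: sqr_ge0.
have ml2 : measurable_fun I1 (fun x => @lam R x ^+ 2) by apply: measurable_funX; exact: lam_measurable.
have iL' : L1 (fun x => lam x ^+ 2 * `|g x|).
  by move: iL; congr (integrable _ _ (EFin \o _)); apply/funext => x; rewrite mulrC.
have iw (K : R) : 0 <= K -> L1 (fun x => 1 * (1 + 1 * ln (1 + K * 1 / a) + lam x ^+ 2)).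
  move=> K0; rewrite (_ : (fun x : R => _) = (fun x => (1 + ln (1 + K / a)) + lam x ^+ 2)); last first.
    by apply/funext => x; rewrite !mul1r mulr1.
  apply: L1D; first exact: L1_cst_eq.
  have := Phi2_lam (measurable_cst (1 : R)) (L1_cst_eq (Phi2 1)).
  by congr (integrable _ _ (EFin \o _)); apply/funext => x; rewrite normr1 mul1r.
(* Here plain polynomials are dense, for the modular together with the weight that bounds [Kop]; on
   them the identity to be proved is [W_poly]. *)
have [q0 [iq hq]] := @poly_dense R 1 a a g (fun _ => 1) (fun x => lam x ^+ 2) ler01 a0 a0 mg
  (measurable_cst _) ml2 (fun _ _ => ltr01) l20 (Phi_L1_rescale a0 mg iP1) iL' iw.
pose q := pi^-1 *: q0.
have qE : pi *: q = q0 by rewrite /q scalerA divff ?scale1r// gt_eqF.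
have [r [hr1 hr2]] := W_poly q; rewrite qE in hr1 hr2.
pose d x := g x - q0.[x].
have md : measurable_fun I1 d by apply: measurable_funB => //; exact: horner_measurable.
have mG : measurable_fun I1 (fun x => lam x ^+ 2 * `|d x|).
  by apply: measurable_funM => //; exact: measurableT_comp.
have Eq : (fun x => Phi 1 a (g x - q0.[x] * 1) + lam x ^+ 2 * `|g x - q0.[x] * 1|) =
    (fun x => Phi 1 a (d x) + lam x ^+ 2 * `|d x|).
  by apply/funext => x; rewrite mulr1.
rewrite Eq in iq hq.
have P0 (x : R) : 0 <= Phi 1 a (d x) by exact: Phi_ge0.
have V0 (x : R) : 0 <= lam x ^+ 2 * `|d x| by rewrite mulr_ge0// sqr_ge0.
have iPd : L1 (fun x => Phi 1 a (d x)).
  by apply: (L1_le (Phi_measurable 1 a md) iq) => x _; rewrite ger0_norm// lerDl.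
have iLd : L1 (fun x => lam x ^+ 2 * `|d x|).
  by apply: (L1_le mG iq) => x _; rewrite ger0_norm// lerDr.
have hPd : \int[mu]_(x in I1) Phi 1 a (d x) <= a.
  by apply: le_trans hq; apply: le_RI => // x _; rewrite lerDl.
have hLd : \int[mu]_(x in I1) (lam x ^+ 2 * `|d x|) <= a.
  by apply: le_trans hq; apply: le_RI => // x _; rewrite lerDr.
have ELd : (fun x => lam x ^+ 2 * `|d x|) = (fun x => `|d x| * lam x ^+ 2).
  by apply/funext => x; rewrite mulrC.
rewrite ELd in iLd hLd.
have Id := Phi_L1 ler01 a0 md iPd.
have Tdiff : isT (fun s => wt s * d s) (fun x => h x - wt x * pw r x).
  have E' : (fun s => wt s * d s) = (fun s => wt s * g s - wt s * q0.[s]).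
    by apply/funext => s; rewrite /d mulrBr.
  rewrite E'; apply: isTB => //; apply: L1_wt => //; exact: horner_L1.
have [IWd hWd] := W_L1 a0 md iPd iLd Tdiff.
have EW (x : R) : I1 x -> (h x - wt x * pw r x) / wt x = h x / wt x - pw r x.
  by move=> Ix; field; rewrite gt_eqF// I1_wt_gt0.
have ipr := pw_integrable r.
exists (fun x => h x / wt x - pw r x), (fun x => H x - (- pi ^+ 2 *: q0).[x]), (fun x => 16 * d x); split.
- exact: L1B.
- by apply: isTB => //; exact: isT_pvp.
- exact: L1Z.
- split.
    rewrite (_ : \int[mu]_(x in I1) _ = \int[mu]_(x in I1) `|(h x - wt x * pw r x) / wt x|); last first.
      by apply: eq_Rintegral => x /set_mem Ix; rewrite EW.
    apply: (le_trans hWd).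
    have h1 := ler_wpM2l (ltW C0) hPd; have h2 := ler_wpM2l (ltW E0) hLd.
    by rewrite -aE /C; clear -h1 h2 a0; lra.
  have -> : (fun x : R => `|16 * d x|) = (fun x => 16 * `|d x|).
    by apply/funext => x; rewrite normrM ger0_norm.
  rewrite RIZ; last exact: L1_norm.
  have : \int[mu]_(x in I1) `|d x| <= a.
    by apply: le_trans hPd; apply: le_RI => //; [exact: L1_norm|move=> x _; exact: Phi_ge].
  have : 0 < weakC R * a by rewrite mulr_gt0.
  have : 0 < expR 1 * a by rewrite mulr_gt0.
  by rewrite -aE /C; clear -a0; lra.
- move=> t It; rewrite hornerZ.
  have -> : H t - - pi ^+ 2 * g t = (H t - - pi ^+ 2 * q0.[t]) + pi ^+ 2 * d t by rewrite /d; ring.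
  apply: (le_trans (ler_normD _ _)); rewrite -addrA lerD2l.
  apply: (@le_trans _ _ `|16 * d t|); last by rewrite lerDl ltW.
  rewrite (normrM (pi ^+ 2)) (normrM 16); apply: ler_wpM2r => //; rewrite (ger0_norm (sqr_ge0 _)) ger0_norm//.
  by clear -p0 p4; nra.
Qed.

(** * Lebesgue measurable functions and the rearrangement norm *)

Notation lebR R := (@completed_lebesgue_measure R).

Lemma borel_leb (R : realType) (A : set R) : measurable (A : set (measurableTypeR R)) ->
  measurable (A : set (lebesgueR R)).
Proof. by move=> mA; apply: sub_caratheodory. Qed.

Lemma leb_borel (R : realType) (A : set R) : measurable (A : set (lebesgueR R)) ->
  exists X N : set (measurableTypeR R), [/\ measurable X, measurable N, mu N = 0%E,
    X `<=` A & A `<=` X `|` N].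
Proof.
rewrite -[measurable]/((wlength (R:=R) idfun)^*%mu.-cara.-measurable).
rewrite -completed_caratheodory_measurable g_sigma_completed_algebra_genE.
move=> -[X mX] [N' [N [mN N0 NN]]] <-; exists X, N; split => //.
by move=> x [Xx|/NN Nx]; [left|right].
Qed.

Lemma leb_negligible (R : realType) (A : set R) : (lebR R).-negligible A ->
  (@lebesgue_measure R).-negligible A.
Proof.
move=> [B [mB B0 AB]]; have [X [N [mX mN N0 XB BX]]] := leb_borel mB.
exists (X `|` N); split; [exact: measurableU| |exact: subset_trans BX].
apply/eqP; rewrite eq_le measure_ge0 andbT.
apply: (le_trans (measureU2 _ mX mN)); rewrite [X in (_ + X <= _)%E]N0 adde0 -B0.
by apply: (@le_measure _ _ _ (lebR R)); rewrite ?inE//; exact: borel_leb.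
Qed.

Lemma negligible_leb (R : realType) (A : set R) : (@lebesgue_measure R).-negligible A ->
  (lebR R).-negligible A.
Proof. by move=> [B [mB B0 AB]]; exists B; split => //; exact: borel_leb. Qed.

Lemma borel_leb_fun (R : realType) (B : set R) (f : R -> R) :
  measurable_fun (B : set (measurableTypeR R)) f ->
  measurable (B : set (measurableTypeR R)) ->
  measurable_fun (B : set (lebesgueR R)) f.
Proof. by move=> mf mB _ Y mY; apply: borel_leb; exact: mf. Qed.

(** Each sublevel set at a rational height is Borel up to a null set. The countably many null sets
    are collected in one, on which the function is reset to 0; rational heights determine the others
    by density. *)
Lemma borel_version (R : realType) (f : R -> R) : measurable_fun (I11 : set (lebesgueR R)) f ->
  exists f' : R -> R, measurable_fun I1 f' /\
    {ae (@lebesgue_measure R), forall x : R, I1 x -> f x = f' x}.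
Proof.
move=> mf; pose q (n : nat) : R := ratr (odflt 0 (unpickle n : option rat)).
have mI11 : measurable (I11 : set (lebesgueR R)) by apply: borel_leb; exact: mI1.
have H n : {XN : set (measurableTypeR R) * set (measurableTypeR R) | [/\ measurable XN.1,
    measurable XN.2, mu XN.2 = 0%E, XN.1 `<=` I1 `&` f @^-1` `]-oo, q n[ &
    I1 `&` f @^-1` `]-oo, q n[ `<=` XN.1 `|` XN.2]}.
  apply: cid; have [X [N [? ? ? ? ?]]] := leb_borel (mf mI11 _ (measurable_itv `]-oo, q n[)).
  by exists (X, N).
pose X n := (sval (H n)).1; pose N n := (sval (H n)).2.
have mX n : measurable (X n) by rewrite /X; case: (H n) => ? [].
have mN n : measurable (N n) by rewrite /N; case: (H n) => ? [].
have N0 n : mu.-negligible (N n).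
  by apply/negligibleP => //; rewrite /N; case: (H n) => ? [].
have XI n : X n `<=` I1 `&` f @^-1` `]-oo, q n[ by rewrite /X; case: (H n) => ? [].
have IX n : I1 `&` f @^-1` `]-oo, q n[ `<=` X n `|` N n by rewrite /X /N; case: (H n) => ? [].
pose M := \bigcup_n N n.
have mM : measurable M by exact: bigcupT_measurable.
pose f' x := if x \in M then 0 else f x.
exists f'; split; last first.
  apply: (negligibleS _ (negligible_bigcup N0)) => x /=; apply: contra_notP => Mx _.
  by rewrite /f' memNset.
apply: (measurability _ (RGenInftyO.measurableE R)) => _ [_ [y ->] <-].
pose Y n := if q n < y then X n `\` M else set0.
have -> : I1 `&` f' @^-1` `]-oo, y[ =
    (I1 `&` M `&` [set _ | 0 < y]) `|` \bigcup_n Y n.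
  apply/seteqP; split => x.
    move=> [Ix] /=; rewrite in_itv/= /f'; case: ifPn => [/set_mem Mx y0|/negP nM fy].
      by left.
    right; have [r] := rat_in_itvoo fy; rewrite in_itv/= => /andP[].
    move=> fr ry; exists (pickle r) => //; rewrite /Y.
    have qr : q (pickle r) = ratr r by rewrite /q pickleK.
    rewrite qr ry; split; last by move=> Mx; apply: nM; exact: mem_set.
    have [//|Nx] : (X (pickle r) `|` N (pickle r)) x.
      by apply: IX; split => //; rewrite /= in_itv/= qr.
    by exfalso; apply: nM; apply: mem_set; exists (pickle r).
  move=> [[[Ix Mx] /= y0]|[n _]].
    by split => //=; rewrite in_itv/= /f' mem_set.
  rewrite /Y; case: ifPn => // qy [Xx nM]; have [Ix /=] := XI n x Xx.
  rewrite in_itv/= => fq; split => //=; rewrite in_itv/= /f' memNset//.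
  exact: lt_trans fq qy.
apply: measurableU.
  apply: measurableI; first by apply: measurableI => //; exact: mI1.
  by have [h|h] := boolP (0 < y); [rewrite (_ : [set _ | _] = setT)|rewrite (_ : [set _ | _] = set0)];
     rewrite //; apply/seteqP; split => // x /=; rewrite // => h'; move/negP: h; apply.
apply: bigcupT_measurable => n; rewrite /Y; case: ifPn => _ //.
exact: measurableD.
Qed.

(** The identity is measurable from the Lebesgue to the Borel sigma-algebra, and the push-forward of
    the completed measure under it is the Borel one. *)
Lemma ge0_leb_integral (R : realType) (D : set R) (f : R -> \bar R) :
  measurable (D : set (measurableTypeR R)) ->
  measurable_fun (D : set (measurableTypeR R)) f -> (forall x, D x -> 0 <= f x)%E ->
  (\int[lebR R]_(x in (D : set (lebesgueR R))) f x = \int[mu]_(x in (D : set (measurableTypeR R))) f x)%E.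
Proof.
move=> mD mf f0.
have mid : measurable_fun (setT : set (lebesgueR R)) (id : lebesgueR R -> measurableTypeR R).
  by move=> _ Y mY; rewrite setTI; exact: borel_leb.
have := @ge0_integral_pushforward _ _ (lebesgueR R) (measurableTypeR R) R id mid (lebR R) D f mD mf.
move=> <-; last by move=> x /set_mem; exact: f0.
exact: eq_measure_integral.
Qed.

Lemma leb_integral (R : realType) (D : set R) (f : R -> \bar R) :
  measurable (D : set (measurableTypeR R)) ->
  measurable_fun (D : set (measurableTypeR R)) f ->
  (\int[lebR R]_(x in (D : set (lebesgueR R))) f x = \int[mu]_(x in (D : set (measurableTypeR R))) f x)%E.
Proof.
move=> mD mf; rewrite integralE [RHS]integralE.
congr (_ - _)%E; apply: ge0_leb_integral => //.
- exact: measurable_funepos.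
- exact: measurable_funeneg.
Qed.

Lemma leb_ae_le (R : realType) (A B : set R) : {ae (@lebesgue_measure R), forall x : R, A x -> B x} ->
  (lebR R A <= lebR R B)%E.
Proof.
move=> [N [mN N0 sub]].
apply: (@le_trans _ _ (lebR R (B `|` N))).
  apply: (@le_outer_measure _ _ ((wlength (R:=R) idfun)^*%mu)) => x Ax.
  have [Nx|Nx] := pselect (N x); [by right|left].
  by apply: contrapT => nB; apply: Nx; apply: sub => /= h; apply: nB; exact: h.
apply: (le_trans (outer_measureU2 ((wlength (R:=R) idfun)^*%mu) B N)).
rewrite [X in (_ + X <= _)%E](_ : _ = 0%E) ?adde0//; exact: N0.
Qed.

Lemma leb_ae_eq (R : realType) (A B : set R) : {ae (@lebesgue_measure R), forall x : R, A x <-> B x} ->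
  lebR R A = lebR R B.
Proof.
move=> h; apply/eqP; rewrite eq_le !leb_ae_le//.
- by apply: aeS h => x [].
- by apply: aeS h => x [].
Qed.

Lemma shifted_restrict_measurable (R : realType) (D : set (measurableTypeR R)) (F : R -> R) :
  measurable D -> measurable_fun D F ->
  measurable_fun (setT : set (measurableTypeR R)) ((fun x => F x + 1) \_ D : measurableTypeR R -> R).
Proof.
move=> mD mF; apply/(measurable_restrictT _ mD).
by apply: measurable_funD => //; exact: measurable_cst.
Qed.

(** Both sides are integrals over [1, +oo[ against push-forward measures, which agree on rays and
    hence on Borel sets. Adding 1 before the extension by 0 separates the values taken on the domain
    from those outside it. *)
Lemma equimeasurable_integral (R : realType) (D1 D2 : set (measurableTypeR R)) (F1 F2 psi : R -> R) :
  measurable D1 -> measurable D2 -> measurable_fun D1 F1 -> measurable_fun D2 F2 ->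
  (forall x, D1 x -> 0 <= F1 x) -> (forall x, D2 x -> 0 <= F2 x) ->
  mu D1 = mu D2 -> (mu D1 < +oo)%E ->
  (forall l : R, 0 <= l -> mu (D1 `&` [set x | (l < F1 x)%R]) = mu (D2 `&` [set x | (l < F2 x)%R])) ->
  measurable_fun (setT : set (measurableTypeR R)) psi -> (forall s, 0 <= psi s) ->
  (\int[mu]_(x in D1) (psi (F1 x))%:E = \int[mu]_(x in D2) (psi (F2 x))%:E)%E.
Proof.
move=> mD1 mD2 mF1 mF2 F10 F20 mu12 muoo muF mpsi psi0.
pose S := `[1%R, +oo[%classic : set (measurableTypeR R).
have mS : measurable S by exact: measurable_itv.
pose G1 : measurableTypeR R -> measurableTypeR R := (fun x => F1 x + 1) \_ D1.
pose G2 : measurableTypeR R -> measurableTypeR R := (fun x => F2 x + 1) \_ D2.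
have mG1 : measurable_fun setT G1 by exact: shifted_restrict_measurable.
have mG2 : measurable_fun setT G2 by exact: shifted_restrict_measurable.
have GE D (F : R -> R) : (forall x, D x -> 0 <= F x) -> ((fun x => F x + 1) \_ D) @^-1` S = D.
  move=> F0; apply/seteqP; split => x; rewrite /S /= in_itv/= andbT patchE.
    by case: ifPn => [/set_mem//|_]; rewrite ler10.
  by move=> Dx; rewrite mem_set// lerDr F0.
have mpsi1 : measurable_fun S (fun y : R => (psi (y - 1))%:E).
  apply/measurable_EFinP; apply: measurable_funTS; apply: (measurableT_comp mpsi).
  by apply: measurable_funB; [exact: measurable_id|exact: measurable_cst].
pose p1 : {mfun measurableTypeR R >-> measurableTypeR R} := HB.pack G1 (isMeasurableFun.Build _ _ _ _ _ mG1).
pose p2 : {mfun measurableTypeR R >-> measurableTypeR R} := HB.pack G2 (isMeasurableFun.Build _ _ _ _ _ mG2).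
have T (D : set (measurableTypeR R)) (F : R -> R) (p : {mfun measurableTypeR R >-> measurableTypeR R}) :
    (forall x, D x -> 0 <= F x) -> (p : R -> R) = (fun x => F x + 1) \_ D ->
   (\int[mu]_(x in D) (psi (F x))%:E = \int[pushforward mu p]_(y in S) (psi (y - 1))%:E)%E.
  move=> F0 pE.
  have := @ge0_integral_pushforward _ _ (measurableTypeR R) (measurableTypeR R) R p (measurable_funPT p)
    mu S _ mS mpsi1.
  move=> ->; last by move=> y _; rewrite lee_fin.
  have -> : (p @^-1` S) = D by rewrite pE; exact: GE.
  by apply: eq_integral => x Dx /=; rewrite pE patchE Dx addrK.
rewrite (T D1 F1 p1 F10 erefl) (T D2 F2 p2 F20 erefl).
apply: eq_measure_integral => A mA AS.
have ray D (F : R -> R) (l : R) : (forall x, D x -> 0 <= F x) ->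
    ((fun x => F x + 1) \_ D) @^-1` (`]l, +oo[ `&` S) =
    if l < 1 then D else D `&` [set x | l - 1 < F x].
  move=> F0; rewrite preimage_setI GE//; case: ifPn => l1; apply/seteqP; split => x /=.
  - by move=> [].
  - by move=> Dx; split => //; rewrite in_itv/= andbT patchE mem_set//; have := F0 x Dx; lra.
  - by move=> [+ Dx]; rewrite in_itv/= andbT patchE mem_set// => h; split => //=; lra.
  - by move=> [Dx /= h]; split => //; rewrite in_itv/= andbT patchE mem_set//; lra.
have /= := @measure_unique _ R (measurableTypeR R) (@RGenOInfty.G R) (fun n => `](- n%:R)%R, +oo[%classic)
  (RGenOInfty.measurableE R) _ _ _ (mrestr (pushforward mu p1) mS) (mrestr (pushforward mu p2) mS) _ _ A mA.
rewrite /mrestr /= setIidl//; apply.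
- by move=> _ _ [x ->] [y ->]; exists (Num.max x y); apply/seteqP; split => z /=;
    rewrite !in_itv/= !andbT gt_max => /andP.
- by move=> n; exists (- n%:R).
- rewrite -subTset => x _; exists (Num.truncn `|x|).+1 => //=; rewrite in_itv/= andbT.
  have := truncnS_gt `|x|; have := ler_norm (- x); rewrite normrN; set N := _%:R; lra.
- exact: mG1.
- exact: mG2.
- move=> _ [l ->]; rewrite /pushforward /mrestr/= !ray//.
  by case: ifPn => // l1; apply: muF; lra.
- move=> n; rewrite /pushforward /mrestr/= ray//; case: ifPn => // l1.
  apply: le_lt_trans muoo; apply: le_measure; rewrite ?inE//.
  have := mF1 mD1 _ (measurable_itv `](- n%:R - 1)%R, +oo[).
  by congr measurable; congr (_ `&` _); apply/seteqP; split => t /=; rewrite in_itv/= andbT.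
Qed.

(** * The decreasing rearrangement and the modular *)

Definition rstar (R : realType) (v : R -> R) (t : R) : R :=
  inf [set l : R | 0 <= l /\ (mu (I1 `&` [set x | (l < `|v x|)%R] : set (measurableTypeR R)) <= t%:E)%E].

Lemma rearrangement_rstar (R : realType) (f : R -> R[i]) (v : R -> R) (t : R) :
  {ae (@lebesgue_measure R), forall x : R, I1 x -> Normc.normc (f x) = `|v x|} ->
  rearrangement f t = rstar v t.
Proof.
move=> fv; rewrite /rearrangement /rstar; congr inf; apply/funext => l; congr (_ /\ (_ <= _)%E).
by apply: leb_ae_eq; apply: aeS fv => x fv; split => -[Ix]; rewrite /= ?fv// -?fv.
Qed.

Lemma mu_I1 (R : realType) : mu (I1 : set (measurableTypeR R)) = 2%:E.
Proof. by rewrite lebesgue_measure_itv/= lte_fin ifT -?EFinB; [congr _%:E; ring|lra]. Qed.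

Lemma level_le2 (R : realType) (v : R -> R) (l : R) : measurable_fun I1 v ->
  (mu (I1 `&` [set x | (l < `|v x|)%R] : set (measurableTypeR R)) <= 2%:E)%E.
Proof.
move=> mv; rewrite -mu_I1; apply: le_measure; rewrite ?inE; [exact: level_measurable|exact: mI1|].
exact: subIsetl.
Qed.

Lemma level_fin_num (R : realType) (v : R -> R) (l : R) : measurable_fun I1 v ->
  mu (I1 `&` [set x | (l < `|v x|)%R] : set (measurableTypeR R)) \is a fin_num.
Proof.
move=> mv; rewrite ge0_fin_numE//; apply: le_lt_trans (level_le2 l mv) _.
by rewrite ltry.
Qed.

Lemma level_vanish (R : realType) (v : R -> R) (t : R) : measurable_fun I1 v -> 0 < t ->
  exists2 l : R, 0 <= l & (mu (I1 `&` [set x | (l < `|v x|)%R] : set (measurableTypeR R)) <= t%:E)%E.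
Proof.
move=> mv t0; pose F (n : nat) := I1 `&` [set x | n%:R < `|v x|] : set (measurableTypeR R).
have mF n : measurable (F n) by exact: level_measurable.
have F0 : \bigcap_n F n = set0.
  rewrite -subset0 => x Fx; have [_ /=] := Fx (Num.truncn `|v x|).+1 I.
  by rewrite ltNge (ltW (truncnS_gt _)).
have h := @nonincreasing_cvg_mu _ _ _ (@lebesgue_measure R) F.
have {}h : mu (F n) @[n --> \oo] --> mu (set0 : set (measurableTypeR R)).
  rewrite -F0; apply: h => //.
  - by apply: (@le_lt_trans _ _ 2%:E); [exact: level_le2|rewrite ltry].
  - exact: bigcapT_measurable.
  - move=> m n mn; apply/subsetPset => x [Ix /= h]; split => //=.
    by apply: le_lt_trans h; rewrite ler_nat.
rewrite measure0 in h.
have {}h : fine (mu (F n)) @[n --> \oo] --> (0 : R) by apply: fine_cvg.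
have : \forall n \near \oo, fine (mu (F n)) < t by apply: (cvgr_lt (0 : R)).
move=> [n _ /(_ n (leqnn n)) /= hn]; exists n%:R => //.
by rewrite -/(F n) -(@fineK _ (mu (F n))) ?lee_fin ?ltW//; exact: level_fin_num.
Qed.

Lemma level_rcont (R : realType) (v : R -> R) (l : R) (b : \bar R) : measurable_fun I1 v ->
  (forall e : R, 0 < e -> (mu (I1 `&` [set x | (l + e < `|v x|)%R] : set (measurableTypeR R)) <= b)%E) ->
  (mu (I1 `&` [set x | (l < `|v x|)%R] : set (measurableTypeR R)) <= b)%E.
Proof.
move=> mv H; pose F (n : nat) := I1 `&` [set x | l + n.+1%:R^-1 < `|v x|] : set (measurableTypeR R).
have mF n : measurable (F n) by exact: level_measurable.
have FU : I1 `&` [set x | l < `|v x|] = \bigcup_n F n.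
  apply/seteqP; split => x.
    move=> [Ix /= lx]; have d0 : 0 < `|v x| - l by lra.
    exists (Num.truncn (`|v x| - l)^-1) => //; split => //=.
    rewrite -ltrBrDl invf_plt ?posrE//; exact: truncnS_gt.
  move=> [n _ [Ix /= h]]; split => //=; apply: lt_trans h.
  by rewrite ltrDl invr_gt0.
rewrite FU; have mU : measurable (\bigcup_n F n) by exact: bigcupT_measurable.
have ndF : nondecreasing_seq F.
  move=> m n mn; apply/subsetPset => x [Ix /= h]; split => //=; apply: le_lt_trans h.
  by rewrite lerD2l lef_pV2 ?posrE// ler_nat ltnS.
have h := nondecreasing_cvg_mu (mu := @lebesgue_measure R) mF mU ndF.
rewrite -(cvg_lim _ h)//; apply: lime_le; first by apply/cvg_ex; eexists; exact: h.
by apply: nearW => n; apply: H; rewrite invr_gt0.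
Qed.

Lemma rstar_has_inf (R : realType) (v : R -> R) (t : R) : measurable_fun I1 v -> 0 < t ->
  has_inf [set l : R | 0 <= l /\ (mu (I1 `&` [set x | (l < `|v x|)%R] : set (measurableTypeR R)) <= t%:E)%E].
Proof.
move=> mv t0; split; last by exists 0 => l [].
by have [l l0 hl] := level_vanish mv t0; exists l.
Qed.

Lemma rstar_ge0 (R : realType) (v : R -> R) (t : R) : measurable_fun I1 v -> 0 < t -> 0 <= rstar v t.
Proof.
by move=> mv t0; apply: lb_le_inf; [case: (rstar_has_inf mv t0)|move=> l []].
Qed.

(** The infimum is attained because the distribution function is right continuous ([level_rcont]).
    This equivalence makes the level sets of [rstar v] intervals with the measure of those of
    |v|. *)
Lemma rstar_le (R : realType) (v : R -> R) (t l : R) : measurable_fun I1 v -> 0 < t -> 0 <= l ->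
  (rstar v t <= l) = (mu (I1 `&` [set x | (l < `|v x|)%R] : set (measurableTypeR R)) <= t%:E)%E.
Proof.
move=> mv t0 l0; have hi := rstar_has_inf mv t0; apply/idP/idP => h; last first.
  by apply: ge_inf; [case: hi|].
apply: level_rcont => // e e0; have [m [m0 hm] ml] := inf_adherent e0 hi.
apply: le_trans hm; apply: le_measure; rewrite ?inE; [exact: level_measurable..|].
move=> x [Ix /= lx]; split => //=; apply: lt_trans lx; apply: (lt_le_trans ml).
by rewrite lerD2r.
Qed.

Notation I02 := (`]0%R, 2%R[%classic : set (measurableTypeR _)).

Lemma rstar_level (R : realType) (v : R -> R) (l : R) : measurable_fun I1 v -> 0 <= l ->
  (I02 : set (measurableTypeR R)) `&` [set t | l < rstar v t] =
  `]0, fine (mu (I1 `&` [set x | (l < `|v x|)%R] : set (measurableTypeR R)))[%classic.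
Proof.
move=> mv l0; set d := mu _.
have d2 : (d <= 2%:E)%E by exact: level_le2.
have dfin : d \is a fin_num by exact: level_fin_num.
apply/seteqP; split => t /=; rewrite !in_itv/=.
  move=> [/andP[t0 t2] h]; rewrite t0/= -lte_fin fineK// ltNge; apply/negP => h2.
  by move: h; rewrite ltNge => /negP; apply; rewrite rstar_le.
move=> /andP[t0 td].
have t2 : t < 2 by rewrite -lte_fin; apply: lt_le_trans d2; rewrite -(fineK dfin) lte_fin.
split; first by rewrite t0.
by rewrite ltNge rstar_le// -ltNge -/d -(fineK dfin) lte_fin.
Qed.

Lemma rstar_measurable (R : realType) (v : R -> R) : measurable_fun I1 v ->
  measurable_fun (I02 : set (measurableTypeR R)) (rstar v).
Proof.
move=> mv mD; apply: (measurability _ (RGenOInfty.measurableE R)) => // _ [_ [l ->] <-].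
have [l0|l0] := leP 0 l.
  rewrite (_ : I02 `&` _ = I02 `&` [set t | l < rstar v t]); last first.
    by congr (_ `&` _); apply/seteqP; split => t /=; rewrite in_itv/= andbT.
  by rewrite rstar_level//; exact: measurable_itv.
rewrite (_ : I02 `&` _ = I02); first exact: measurable_itv.
apply/seteqP; split => t /=; first by move=> [].
rewrite !in_itv/= => /andP[t0 t2]; rewrite t0 t2/= andbT; split => //.
by apply: (lt_le_trans l0); exact: rstar_ge0.
Qed.

Lemma rstar_equimeasurable (R : realType) (v psi : R -> R) : measurable_fun I1 v ->
  measurable_fun (setT : set (measurableTypeR R)) psi -> (forall s, 0 <= psi s) ->
  (\int[mu]_(t in I02) (psi (rstar v t))%:E = \int[mu]_(x in I1) (psi `|v x|)%:E)%E.
Proof.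
move=> mv mpsi psi0; apply: (@equimeasurable_integral R I02 I1 (rstar v) (fun x => `|v x|)) => //.
- exact: rstar_measurable.
- exact: measurableT_comp.
- by move=> t; rewrite /= in_itv/= => /andP[t0 _]; exact: rstar_ge0.
- by rewrite mu_I1 lebesgue_measure_itv/= lte_fin ifT -?EFinB ?subr0.
- by rewrite lebesgue_measure_itv/= lte_fin ifT -?EFinB ?ltry.
- move=> l l0; rewrite rstar_level//.
  set d := mu (I1 `&` _).
  have dfin : d \is a fin_num by exact: level_fin_num.
  rewrite lebesgue_measure_itv/= lte_fin; case: ifPn => h; first by rewrite -EFinB subr0 fineK.
  have d0 : 0 <= fine d by apply: fine_ge0; exact: measure_ge0.
  rewrite -(fineK dfin); congr _%:E; apply/eqP; rewrite eq_sym eq_le d0 andbT leNgt//.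
Qed.

Definition Llog (R : realType) (t : R) : R := ln (2 * expR 1 / t).

Lemma Llog_eq (R : realType) (t : R) : 0 < t -> Llog t = 1 + ln (2 / t).
Proof.
move=> t0; have e0 := expR_gt0 (1 : R).
have -> : Llog t = ln (expR 1 * (2 / t)) by rewrite /Llog; congr ln; ring.
by rewrite lnM ?posrE ?divr_gt0// expRK.
Qed.

Lemma Llog_ge1 (R : realType) (t : R) : 0 < t -> t < 2 -> 1 <= Llog t.
Proof.
move=> t0 t2; rewrite Llog_eq// lerDl ln_ge0// ler_pdivlMr// mul1r; exact: ltW.
Qed.

Lemma Llog_measurable (R : realType) : measurable_fun (I02 : set (measurableTypeR R)) (@Llog R).
Proof.
apply: (measurableT_comp (@measurable_ln R)).
apply: measurable_funM; first exact: measurable_cst.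
exact: measurable_funTS (@measurable_inv R).
Qed.

Lemma rstar_mono (R : realType) (v : R -> R) (s t : R) : measurable_fun I1 v -> 0 < s -> s <= t ->
  rstar v t <= rstar v s.
Proof.
move=> mv s0 st; have r0 := rstar_ge0 mv s0.
rewrite rstar_le//; last exact: lt_le_trans st.
apply: (@le_trans _ _ s%:E); last by rewrite lee_fin.
by rewrite -rstar_le.
Qed.

Lemma LlogL_norm_rstar (R : realType) (n : nat) (f : R -> R[i]) (v : R -> R) : measurable_fun I1 v ->
  {ae (@lebesgue_measure R), forall x : R, I1 x -> Normc.normc (f x) = `|v x|} ->
  LlogL_norm n%:R f = (\int[mu]_(t in I02) (rstar v t * Llog t ^+ n)%:E)%E.
Proof.
move=> mv fv; rewrite -leb_integral; last 2 first.
- exact: measurable_itv.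
- apply/measurable_EFinP; apply: measurable_funM; first exact: rstar_measurable.
  by apply: measurable_funX; exact: Llog_measurable.
apply: eq_integral => t /set_mem; rewrite /= in_itv/= => /andP[t0 t2].
rewrite (rearrangement_rstar t fv) powR_mulrn//.
by have := Llog_ge1 t0 t2; rewrite /Llog; lra.
Qed.

(** One family for both spaces: n = 1 is [Phi 1 1] and n = 2 is [Phi2]. *)
Definition psin (R : realType) (n : nat) (s : R) : R := `|s| * (1 + ln (1 + `|s|)) ^+ n.

Lemma psin_ge0 (R : realType) (n : nat) (s : R) : 0 <= psin n s.
Proof. by rewrite mulr_ge0// exprn_ge0// addr_ge0// ln1p_ge0. Qed.

Lemma psin_measurable (R : realType) (n : nat) :
  measurable_fun (setT : set (measurableTypeR R)) (@psin R n).
Proof.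
have mn : measurable_fun (setT : set (measurableTypeR R)) (fun x : R => `|x|).
  exact: measurableT_comp.
apply: measurable_funM => //; apply: measurable_funX; apply: measurable_funD; first exact: measurable_cst.
apply: (measurableT_comp (@measurable_ln R)); apply: measurable_funD => //; exact: measurable_cst.
Qed.

Lemma psin_norm (R : realType) (n : nat) (s : R) : psin n `|s| = psin n s.
Proof. by rewrite /psin normr_id. Qed.

(** Monotonicity of [rstar v] and [Llog] >= 1 bound t [rstar v t] by the norm r. Hence ln (1 +
    [rstar v t]) is at most ln (1 + r / 2) + ln (2 / t), a multiple of [Llog t], and
    equimeasurability carries the estimate to v. *)
Lemma rstar_norm_L1 (R : realType) (n : nat) (v : R -> R) : measurable_fun I1 v ->
  (\int[mu]_(t in I02) (rstar v t * Llog t ^+ n)%:E < +oo)%E -> L1 (fun x => psin n (v x)).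
Proof.
move=> mv; set N := (\int[mu]_(t in _) _)%E => Noo.
have I02P (t : R) : I02 t -> 0 < t /\ t < 2 by rewrite /= in_itv/= => /andP[].
have mI2 : measurable (I02 : set (measurableTypeR R)) by exact: measurable_itv.
have i0 (t : R) : I02 t -> 0 <= rstar v t * Llog t ^+ n.
  move=> /I02P[t0 t2]; rewrite mulr_ge0 ?rstar_ge0// exprn_ge0//.
  by have := Llog_ge1 t0 t2; lra.
have mi : measurable_fun (I02 : set (measurableTypeR R)) (fun t => rstar v t * Llog t ^+ n).
  apply: measurable_funM; first exact: rstar_measurable.
  by apply: measurable_funX; exact: Llog_measurable.
have N0 : (0 <= N)%E by apply: integral_ge0 => t It; rewrite lee_fin i0.
have Nfin : N \is a fin_num by rewrite ge0_fin_numE.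
pose r := fine N; have r0 : 0 <= r by exact: fine_ge0.
have bound (t : R) : I02 t -> t * rstar v t <= r.
  move=> It; have [t0 t2] := I02P t It.
  pose J := `]0%R, t[%classic : set (measurableTypeR R).
  have mJ : measurable J by exact: measurable_itv.
  have JI (s : R) : J s -> [/\ 0 < s, s <= t & I02 s].
    rewrite /J /= !in_itv/= => /andP[s0 st]; split => //; first exact: ltW.
    by rewrite s0/=; exact: lt_trans t2.
  rewrite -lee_fin fineK//.
  apply: (@le_trans _ _ (\int[mu]_(s in J) (rstar v s * Llog s ^+ n)%:E)%E); last first.
    apply: ge0_subset_integral => //.
    - exact/measurable_EFinP.
    - by move=> s /JI[].
  apply: (@le_trans _ _ (\int[mu]_(s in J) (cst (rstar v t)%:E s))%E).
    have muJ : mu J = t%:E by rewrite /J lebesgue_measure_itv/= lte_fin t0 -EFinD subr0.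
    rewrite integral_cst// [X in (_ * X)%E]muJ -EFinM lee_fin.
    by rewrite mulrC.
  apply: ge0_le_integral => //.
  - by move=> s _; rewrite lee_fin rstar_ge0.
  - apply/measurable_EFinP; apply: measurable_funS mi => //.
    by move=> s /JI[].
  - move=> s Js; have [s0 st Is] := JI s Js; rewrite lee_fin.
    have [_ s2] := I02P s Is.
    apply: (le_trans (rstar_mono mv s0 st)).
    by rewrite ler_peMr ?rstar_ge0// exprn_ege1// Llog_ge1.
pose c := 1 + ln (1 + r / 2).
have c1 : 1 <= c by rewrite lerDl ln1p_ge0// divr_ge0.
have le (t : R) : I02 t -> psin n (rstar v t) <= c ^+ n * (rstar v t * Llog t ^+ n).
  move=> It; have [t0 t2] := I02P t It; have s0 := rstar_ge0 mv t0.
  rewrite /psin ger0_norm// mulrCA; apply: ler_wpM2l => //; rewrite -exprMn.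
  have h : 1 + ln (1 + rstar v t) <= c * Llog t.
    have b := bound t It; have L1t := Llog_ge1 t0 t2.
    have h1 : ln (1 + rstar v t) <= ln (1 + r / 2) + ln (2 / t).
      have p1 : 0 < 1 + r / 2 by have := divr_ge0 r0 (ler0n R 2); lra.
      have p2 : 0 < 2 / t by rewrite divr_gt0.
      have p3 : 0 < 1 + rstar v t by lra.
      rewrite -lnM ?posrE// ler_ln ?posrE//; last exact: mulr_gt0.
      have -> : (1 + r / 2) * (2 / t) = (2 + r) / t by field; rewrite gt_eqF.
      by rewrite ler_pdivlMr//; lra.
    have h2 := Llog_eq t0.
    have h3 : 0 <= (c - 1) * (Llog t - 1) by rewrite mulr_ge0//; lra.
    have fin (A B C d M : R) : d = 1 + A -> M = 1 + B -> C <= A + B -> 0 <= (d - 1) * (M - 1) -> 1 + C <= d * M.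
      by move=> -> -> h5 h6; lra.
    exact: fin (erefl _) h2 h1 h3.
  apply: lerXn2r => //; rewrite nnegrE; last by apply: le_trans h; rewrite addr_ge0// ln1p_ge0.
  by rewrite addr_ge0// ln1p_ge0.
apply/integrableP; split.
  by apply/measurable_EFinP; apply: (measurableT_comp (@psin_measurable R n)).
rewrite (_ : (\int[mu]_(x in I1) _ = \int[mu]_(x in I1) (psin n `|v x|)%:E)%E); last first.
  by apply: eq_integral => x _ /=; rewrite ger0_norm ?psin_ge0// psin_norm.
rewrite -(rstar_equimeasurable mv (@psin_measurable R n) (@psin_ge0 R n)).
apply: (@le_lt_trans _ _ (\int[mu]_(t in I02) ((c ^+ n)%:E * (rstar v t * Llog t ^+ n)%:E))%E).
  apply: ge0_le_integral => //.
  - by move=> t _; rewrite lee_fin psin_ge0.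
  - by apply/measurable_EFinP; apply: (measurableT_comp (@psin_measurable R n)); exact: rstar_measurable.
  - by apply: emeasurable_funM; [exact: measurable_cst|exact/measurable_EFinP].
have cn0 : 0 <= c ^+ n by rewrite exprn_ge0//; lra.
rewrite ge0_integralZl_EFin//; last exact/measurable_EFinP.
by rewrite -/N -(fineK Nfin) -EFinM ltry.
Qed.

Lemma powR_integral02 (R : realType) : (\int[mu]_(t in I02) (t `^ (- (3 / 4)) : R)%:E < +oo)%E.
Proof.
have h2 : 0 < 2 :> R by [].
pose F (t : R) := 4 * t `^ (4^-1).
have [||||_ ->] := @FTC_open_ge0 R (fun t => t `^ (- (3 / 4))) F 0 2 (4 * 0) (4 * 2 `^ (4^-1)) h2
   (fun t _ => powR_ge0 _ _).
- move=> t /andP[t0 _]; have d := is_deriveZ (4 : R) (is_derive1_powR (4^-1) t0).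
  apply: (is_derive_eq d); rewrite /GRing.scale /= (_ : 4^-1 - 1 = - (3 / 4)); last by field.
  by field.
- by move=> t /andP[t0 _]; exact: is_derive_continuous (is_derive1_powR _ t0).
- by apply: cvgM; [exact: cvg_cst|apply: powR_cvg0].
- apply: cvg_at_left_filter; apply: cvgM; first exact: cvg_cst.
  exact: is_derive_continuous (is_derive1_powR _ h2).
by rewrite ltry.
Qed.

(** Where [rstar v t] >= t^(-1/2) the logarithm of 1/t is controlled by that of [rstar v t];
    elsewhere the integrand is at most 8 t^(-3/4), which is integrable. The power 1 suffices because
    solutions are only claimed to lie in L log L. *)
Lemma Phi_rstar_norm (R : realType) (v : R -> R) : measurable_fun I1 v ->
  L1 (fun x => psin 1 (v x)) -> (\int[mu]_(t in I02) (rstar v t * Llog t ^+ 1)%:E < +oo)%E.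
Proof.
move=> mv iP.
have I02P (t : R) : I02 t -> 0 < t /\ t < 2 by rewrite /= in_itv/= => /andP[].
have mI2 : measurable (I02 : set (measurableTypeR R)) by exact: measurable_itv.
have ln2 : ln 2 <= 1 :> R by have := @le_ln1Dx R 1; rewrite (_ : 1 + 1 = 2)//; apply; lra.
have le (t : R) : I02 t -> rstar v t * Llog t ^+ 1 <= 2 * psin 1 (rstar v t) + 8 * t `^ (- (3 / 4)).
  move=> It; have [t0 t2] := I02P t It; have s0 := rstar_ge0 mv t0.
  have z0 : 0 < t `^ (- 2^-1) by exact: powR_gt0.
  have Lt : Llog t <= 2 - ln t.
    by rewrite Llog_eq// ln_div ?posrE//; lra.
  have p0 := psin_ge0 1 (rstar v t); have q0 := powR_ge0 t (- (3 / 4)).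
  rewrite expr1; have [zs|zs] := lerP (t `^ (- 2^-1)) (rstar v t).
    have h : Llog t <= 2 * (1 + ln (1 + rstar v t)).
      have : ln (t `^ (- 2^-1)) <= ln (1 + rstar v t) by rewrite ler_ln ?posrE; lra.
      by rewrite ln_powR; lra.
    apply: (@le_trans _ _ (2 * psin 1 (rstar v t))); last by rewrite lerDl mulr_ge0.
    by rewrite /psin expr1 ger0_norm// mulrCA; exact: ler_wpM2l.
  have y0 : 2^-1 <= t `^ (- 4^-1).
    rewrite powRN lef_pV2 ?posrE ?powR_gt0//.
    apply: (@le_trans _ _ (2 `^ (4^-1))); first by apply: ge0_ler_powR; rewrite ?nnegrE ?ltW.
    by rewrite -[leRHS]powRr1//; apply: ler_powR; lra.
  have h : Llog t <= 8 * t `^ (- 4^-1).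
    have := @le_ln1Dx R (t `^ (- 4^-1) - 1); rewrite (_ : 1 + (t `^ (- 4^-1) - 1) = t `^ (- 4^-1)); last by ring.
    by rewrite ln_powR => hh; have := hh (_ : -1 < t `^ (- 4^-1) - 1); lra.
  apply: (@le_trans _ _ (8 * t `^ (- (3 / 4)))); last by rewrite lerDr mulr_ge0.
  have -> : t `^ (- (3 / 4)) = t `^ (- 2^-1) * t `^ (- 4^-1).
    by rewrite -powRD; [congr (_ `^ _); field|rewrite (gt_eqF t0) implybT].
  rewrite mulrCA; apply: ler_pM => //; [|exact: ltW].
  by have := Llog_ge1 t0 t2; lra.
have m1 : measurable_fun (I02 : set (measurableTypeR R)) (fun t => (psin 1 (rstar v t))%:E).
  by apply/measurable_EFinP; apply: (measurableT_comp (@psin_measurable R 1)); exact: rstar_measurable.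
have m2 : measurable_fun (I02 : set (measurableTypeR R)) (fun t : R => (t `^ (- (3 / 4)))%:E).
  by apply/measurable_EFinP; apply: measurable_funTS; exact: measurable_powR.
apply: (@le_lt_trans _ _ (\int[mu]_(t in I02) (2%:E * (psin 1 (rstar v t))%:E + 8%:E * (t `^ (- (3 / 4)))%:E))%E).
  apply: ge0_le_integral => //.
  - move=> t /I02P[t0 t2]; rewrite lee_fin mulr_ge0 ?rstar_ge0// expr1.
    by have := Llog_ge1 t0 t2; lra.
  - apply/measurable_EFinP; apply: measurable_funM; first exact: rstar_measurable.
    by apply: measurable_funX; exact: Llog_measurable.
  - by apply: emeasurable_funD; apply: emeasurable_funM => //; exact: measurable_cst.
rewrite ge0_integralD//; last 4 first.
- by move=> t _; rewrite mule_ge0// lee_fin psin_ge0.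
- by apply: emeasurable_funM => //; exact: measurable_cst.
- by move=> t _; rewrite mule_ge0// lee_fin powR_ge0.
- by apply: emeasurable_funM => //; exact: measurable_cst.
rewrite !ge0_integralZl_EFin//; [|by move=> t _; rewrite lee_fin ?powR_ge0 ?psin_ge0..].
apply: lte_add_pinfty; apply: lte_mul_pinfty => //; last exact: powR_integral02.
rewrite (rstar_equimeasurable mv (@psin_measurable R 1) (@psin_ge0 R 1)).
rewrite (_ : (\int[mu]_(x in I1) _ = \int[mu]_(x in I1) (psin 1 (v x))%:E)%E); last first.
  by apply: eq_integral => x _; rewrite psin_norm.
by rewrite Rintegral_lee ?ltry//; exact: mI1.
Qed.

(** * Complex functions and the airfoil equation *)

Local Open Scope complex_scope.

Lemma complex_divR (R : realType) (z : R[i]) (r : R) :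
  z / r%:C = (complex.Re z / r) +i* (complex.Im z / r).
Proof.
have -> : (r%:C)^-1 = (r^-1)%:C :> R[i] by rewrite fmorphV.
by case: z => a b /=; simpc.
Qed.

Lemma sqrt_sqrD_le (R : realType) (u v : R) : Num.sqrt (u ^+ 2 + v ^+ 2) <= `|u| + `|v|.
Proof.
rewrite -[leRHS]ger0_norm ?addr_ge0// -sqrtr_sqr ler_wsqrtr//.
rewrite sqrrD !real_normK ?num_real// -addrA (addrC (_ *+ 2)) addrA lerDl.
by rewrite mulrn_wge0// mulr_ge0.
Qed.

Lemma cvg_complex (R : realType) (T : Type) (F : set_system T) (a b : T -> R) (la lb : R) :
  Filter F -> a @ F --> la -> b @ F --> lb ->
  ((fun x => a x +i* b x) : T -> R[i]^o) @ F --> ((la +i* lb) : R[i]^o).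
Proof.
move=> FF ha hb; apply/cvgrPdist_lt => e e0.
have [r r0 eE] : exists2 r : R, 0 < r & e = r%:C.
  case: e e0 => x y; rewrite ltcE/= => /andP[/eqP y0 x0]; exists x => //.
  by rewrite y0.
have r20 : 0 < r / 2 by rewrite divr_gt0.
have Ha := (cvgrPdist_lt _ _).1 ha _ r20; have Hb := (cvgrPdist_lt _ _).1 hb _ r20.
apply: filterS2 (Ha FF) (Hb FF) => x hx hy.
rewrite eE (_ : _ - _ = (la - a x) +i* (lb - b x)); last by [].
rewrite normc_def/= ltcR.
set u := la - a x in hx *; set v := lb - b x in hy *.
have h : Num.sqrt (u ^+ 2 + v ^+ 2) <= `|u| + `|v| by exact: sqrt_sqrD_le.
by apply: (le_lt_trans h); lra.
Qed.

Lemma ae_leb (R : realType) (P : R -> Prop) :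
  {ae (@lebesgue_measure R), forall x, P x} -> {ae (lebR R), forall x, P x}.
Proof. exact: negligible_leb. Qed.

Lemma leb_ae (R : realType) (P : R -> Prop) :
  {ae (lebR R), forall x, P x} -> {ae (@lebesgue_measure R), forall x, P x}.
Proof. exact: leb_negligible. Qed.

(** Borel real and imaginary parts up to a null set: the interface through which the real results
    reach Lebesgue measurable complex functions. *)
Definition rep (R : realType) (f : R -> R[i]) (f1 f2 : R -> R) : Prop :=
  [/\ measurable_fun I1 f1, measurable_fun I1 f2 &
   {ae (@lebesgue_measure R), forall x : R, I1 x -> f x = f1 x +i* f2 x}].

Lemma rep_exists (R : realType) (f : R -> R[i]) : measurable_on11 f ->
  exists f1 f2, rep f f1 f2.
Proof.
move=> [m1 m2]; have [f1 [mf1 h1]] := borel_version m1; have [f2 [mf2 h2]] := borel_version m2.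
exists f1, f2; split => //; apply: aeS2 h1 h2 => x h1 h2 Ix.
by rewrite -h1// -h2//; case: (f x).
Qed.

Lemma ae_version_measurable (R : realType) (f f' : R -> R) (D : set (measurableTypeR R)) : measurable D ->
  measurable_fun D f' -> {ae (@lebesgue_measure R), forall x : R, D x -> f x = f' x} ->
  measurable_fun (D : set (lebesgueR R)) f.
Proof.
move=> mD mf' ff'; apply/measurable_EFinP.
apply: (@ae_measurable_fun _ _ _ (lebR R) (@completed_lebesgue_measure_is_complete R) _ (EFin \o f')).
  by apply: ae_leb; apply: aeS ff' => x h Dx /=; rewrite h.
by apply/measurable_EFinP; exact: borel_leb_fun.
Qed.

Lemma rep_measurable (R : realType) (f : R -> R[i]) (f1 f2 : R -> R) : rep f f1 f2 ->
  measurable_on11 f.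
Proof.
move=> [m1 m2 h]; split.
- by apply: (ae_version_measurable (@mI1 R) m1); apply: aeS h => x h Ix; rewrite h.
- by apply: (ae_version_measurable (@mI1 R) m2); apply: aeS h => x h Ix; rewrite h.
Qed.

Definition vmod (R : realType) (f1 f2 : R -> R) (x : R) : R := Num.sqrt (f1 x ^+ 2 + f2 x ^+ 2).

Lemma vmod_measurable (R : realType) (f1 f2 : R -> R) :
  measurable_fun I1 f1 -> measurable_fun I1 f2 -> measurable_fun I1 (vmod f1 f2).
Proof.
move=> m1 m2; apply: (@measurableT_comp _ _ _ _ _ _ (@Num.sqrt R)).
  by apply: continuous_measurable_fun; exact: sqrt_continuous.
by apply: measurable_funD; exact: measurable_funX.
Qed.

Lemma vmod_ge (R : realType) (f1 f2 : R -> R) (x : R) :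
  `|f1 x| <= `|vmod f1 f2 x| /\ `|f2 x| <= `|vmod f1 f2 x|.
Proof.
rewrite [`|vmod _ _ _|]ger0_norm ?sqrtr_ge0// -!sqrtr_sqr /vmod.
by split; apply: ler_wsqrtr; rewrite ?lerDl ?lerDr sqr_ge0.
Qed.

Lemma vmod_le (R : realType) (f1 f2 : R -> R) (x : R) : `|vmod f1 f2 x| <= `|f1 x| + `|f2 x|.
Proof.
by rewrite ger0_norm ?sqrtr_ge0//; exact: sqrt_sqrD_le.
Qed.

Lemma rep_vmod (R : realType) (f : R -> R[i]) (f1 f2 : R -> R) : rep f f1 f2 ->
  {ae (@lebesgue_measure R), forall x : R, I1 x -> Normc.normc (f x) = `|vmod f1 f2 x|}.
Proof.
move=> [_ _ h]; apply: aeS h => x h Ix; rewrite h//= ger0_norm//; exact: sqrtr_ge0.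
Qed.

Lemma psin_mono (R : realType) (n : nat) (s t : R) : `|s| <= `|t| -> psin n s <= psin n t.
Proof.
move=> st; rewrite /psin; have h1 := ln1p_ge0 (normr_ge0 s); apply: ler_pM => //.
  by rewrite exprn_ge0// addr_ge0.
have h := ln1p_mono (normr_ge0 s) st.
by apply: lerXn2r; rewrite ?nnegrE; lra.
Qed.

Lemma Phi_psin (R : realType) (s : R) : Phi 1 1 s = psin 1 s.
Proof. by rewrite /Phi /psin expr1 mul1r divr1. Qed.

Lemma rep_LlogL_L1 (R : realType) (n : nat) (f : R -> R[i]) (f1 f2 : R -> R) : LlogL n%:R f ->
  rep f f1 f2 -> L1 (fun x => psin n (f1 x)) /\ L1 (fun x => psin n (f2 x)).
Proof.
move=> [_ Nf] rf; have [m1 m2 _] := rf; have mv := vmod_measurable m1 m2.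
rewrite (LlogL_norm_rstar n mv (rep_vmod rf)) in Nf.
have iv := rstar_norm_L1 mv Nf.
split; apply: (L1_le _ iv).
- exact: (measurableT_comp (@psin_measurable R n)).
- by move=> x _; rewrite ger0_norm ?psin_ge0// psin_mono//; have [] := vmod_ge f1 f2 x.
- exact: (measurableT_comp (@psin_measurable R n)).
- by move=> x _; rewrite ger0_norm ?psin_ge0// psin_mono//; have [] := vmod_ge f1 f2 x.
Qed.

Lemma rep_LlogL (R : realType) (f : R -> R[i]) (f1 f2 : R -> R) : rep f f1 f2 ->
  L1 (fun x => Phi 1 1 (f1 x)) -> L1 (fun x => Phi 1 1 (f2 x)) -> LlogL 1 f.
Proof.
move=> rf i1 i2; split; first exact: rep_measurable rf.
have [m1 m2 _] := rf; have mv := vmod_measurable m1 m2.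
rewrite (_ : 1 = 1%:R)// (LlogL_norm_rstar 1 mv (rep_vmod rf)).
apply: (Phi_rstar_norm mv); apply: (L1_le _ (L1D (L1Z 4 i1) (L1Z 4 i2))).
  exact: (measurableT_comp (@psin_measurable R 1)).
move=> x _; rewrite ger0_norm ?psin_ge0//.
have E (s : R) : Phi 1 1 s = Phi 1 1 `|s| by rewrite /Phi normr_id.
rewrite (E (f1 x)) (E (f2 x)) -Phi_psin.
apply: le_trans (Phi_add ler01 ltr01 _ _); apply: Phi_mono => //.
by rewrite [leRHS]ger0_norm ?addr_ge0//; exact: vmod_le.
Qed.

Lemma cintegral_rep (R : realType) (f : R -> R[i]) (f1 f2 : R -> R) (t : R) (D : set R) :
  rep f f1 f2 -> measurable (D : set (measurableTypeR R)) -> D `<=` I1 ->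
  cintegral D (fun x => f x / (x - t)%:C) =
    (\int[mu]_(x in (D : set (measurableTypeR R))) (f1 x / (x - t))) +i*
    (\int[mu]_(x in (D : set (measurableTypeR R))) (f2 x / (x - t))).
Proof.
move=> rf mD DI; have [m1 m2 h] := rf.
have H (u u' : R -> R) : measurable_fun I1 u' ->
    {ae (@lebesgue_measure R), forall x : R, I1 x -> u x = u' x} ->
    \int[lebR R]_(x in (D : set (lebesgueR R))) (u x / (x - t)) =
    \int[mu]_(x in (D : set (measurableTypeR R))) (u' x / (x - t)).
  move=> mu' uu'; rewrite /Rintegral; congr fine.
  have m' : measurable_fun (D : set (measurableTypeR R)) (fun x => u' x / (x - t)).
    apply: measurable_funM; first exact: measurable_funS mu'.
    apply: (@measurableT_comp _ _ _ _ _ _ (@GRing.inv R)); first exact: measurable_inv.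
    by apply: measurable_funTS; exact: shift_measurable.
  have uD : {ae (@lebesgue_measure R), forall x : R, D x -> u x / (x - t) = u' x / (x - t)}.
    by apply: aeS uu' => x uu' Dx; rewrite uu'//; exact: DI.
  transitivity (\int[lebR R]_(x in (D : set (lebesgueR R))) (u' x / (x - t))%:E)%E.
    apply: ae_eq_integral; first exact: borel_leb.
    - by apply/measurable_EFinP; exact: (ae_version_measurable mD m' uD).
    - by apply/measurable_EFinP; exact: borel_leb_fun.
    - by apply: ae_leb; apply: aeS uD => x uD Dx; rewrite uD.
  by apply: leb_integral => //; exact/measurable_EFinP.
rewrite /cintegral; congr (_ +i* _).
- rewrite -(H (fun x => complex.Re (f x)) f1 m1); last by apply: aeS h => x h Ix; rewrite h.
  by apply: eq_Rintegral => x _; rewrite complex_divR.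
- rewrite -(H (fun x => complex.Im (f x)) f2 m2); last by apply: aeS h => x h Ix; rewrite h.
  by apply: eq_Rintegral => x _; rewrite complex_divR.
Qed.

Lemma fht_rep (R : realType) (f : R -> R[i]) (f1 f2 g1 g2 : R -> R) : rep f f1 f2 ->
  L1 f1 -> L1 f2 -> isT f1 g1 -> isT f2 g2 ->
  {ae (@lebesgue_measure R), forall t : R, I1 t -> fht f t = (pi^-1 * g1 t) +i* (pi^-1 * g2 t)}.
Proof.
move=> rf i1 i2 [_ h1] [_ h2]; apply: aeS2 h1 h2 => t h1 h2 It.
rewrite /fht; apply: (@cvg_lim R[i]^o (@norm_hausdorff _ R[i]^o)).
have lim : ((fun e => (pi^-1 * tr f1 t e) +i* (pi^-1 * tr f2 t e)) : R -> R[i]^o)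
    @ (0 : R)^'+ --> (((pi^-1 * g1 t) +i* (pi^-1 * g2 t)) : R[i]^o).
  by apply: cvg_complex; apply: cvgM; [exact: cvg_cst|exact: h1|exact: cvg_cst|exact: h2].
apply: cvg_trans lim; apply: near_eq_cvg; near=> e.
have e0 : 0 < e by near: e; exact: nbhs_right_gt.
move: (It); rewrite /= in_itv/= => /andP[t1 t2].
have DI1 : `]-1, t - e[%classic `<=` (I1 : set R).
  by move=> x /=; rewrite !in_itv/= => /andP[? ?]; apply/andP; split; lra.
have DI2 : `]t + e, 1[%classic `<=` (I1 : set R).
  by move=> x /=; rewrite !in_itv/= => /andP[? ?]; apply/andP; split; lra.
rewrite (cintegral_rep t rf (measurable_itv _) DI1) (cintegral_rep t rf (measurable_itv _) DI2).
rewrite (tr_split i1 It e0) (tr_split i2 It e0).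
by simpc.
Unshelve. all: by end_near. Qed.

Lemma LlogL_L1 (R : realType) (f : R -> R[i]) (f1 f2 : R -> R) : LlogL 1 f -> rep f f1 f2 ->
  [/\ L1 (fun x => Phi 1 1 (f1 x)), L1 (fun x => Phi 1 1 (f2 x)), L1 f1 & L1 f2].
Proof.
move=> Lf rf; have [m1 m2 _] := rf.
have [] := @rep_LlogL_L1 R 1 f f1 f2 Lf rf.
have E (u : R -> R) : (fun x => psin 1 (u x)) = (fun x => Phi 1 1 (u x)).
  by apply/funext => x; rewrite Phi_psin.
rewrite !E => i1 i2; split => //.
- exact: Phi_L1 ler01 ltr01 m1 i1.
- exact: Phi_L1 ler01 ltr01 m2 i2.
Qed.

Definition wtC (R : realType) (g : R -> R[i]) : R -> R[i] :=
  fun t => (Num.sqrt (1 - t ^+ 2))%:C * g t.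

Definition airfoil_formula (R : realType) (g : R -> R[i]) (c : R[i]) : R -> R[i] :=
  fun x => - 1 / (Num.sqrt (1 - x ^+ 2))%:C * fht (wtC g) x + c / (Num.sqrt (1 - x ^+ 2))%:C.

Lemma rep_wtC (R : realType) (g : R -> R[i]) (g1 g2 : R -> R) : rep g g1 g2 ->
  rep (wtC g) (fun t => wt t * g1 t) (fun t => wt t * g2 t).
Proof.
move=> [m1 m2 h]; split; try by apply: measurable_funM => //; exact: wt_measurable.
by apply: aeS h => x h Ix; rewrite /wtC h//; simpc.
Qed.

Lemma airfoil_solution (R : realType) (f g : R -> R[i]) : LlogL 1 f -> fht f = g %[ae leb in I11] ->
  exists c : R[i], f = airfoil_formula g c %[ae leb in I11].
Proof.
move=> Lf fg; have [f1 [f2 rf]] := rep_exists Lf.1.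
have [m1 m2 hf] := rf; have [P1 P2 i1 i2] := LlogL_L1 Lf rf.
have [g1 T1] := isT_exists i1; have [g2 T2] := isT_exists i2.
have [mg1 _] := T1; have [mg2 _] := T2.
have [ig1 _] := norm_log_bound i1 T1 ltr01 P1.
have [ig2 _] := norm_log_bound i2 T2 ltr01 P2.
have hT := fht_rep rf i1 i2 T1 T2.
have rg : rep g (fun t => pi^-1 * g1 t) (fun t => pi^-1 * g2 t).
  split; try by apply: measurable_funM => //; exact: measurable_cst.
  by apply: aeS2 hT (leb_ae fg) => t h1 h2 It; rewrite -h2// h1.
have rw := rep_wtC rg.
have inv (u v : R -> R) : measurable_fun I1 u -> L1 (fun x => Phi 1 1 (u x)) -> isT u v -> L1 v ->
    isT (fun t => wt t * (pi^-1 * v t))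
      (fun t => pi^-1 * (- pi ^+ 2 * (wt t * u t) + pi * \int[mu]_(x in I1) u x)).
  move=> mu' iP Tuv iv; have := isTZ pi^-1 (L1_wt iv) (inversion mu' iP Tuv).
  by apply: isT_eq_arg => t _; ring.
have hw := fht_rep rw (L1_wt (L1Z pi^-1 ig1)) (L1_wt (L1Z pi^-1 ig2))
  (inv _ _ m1 P1 T1 ig1) (inv _ _ m2 P2 T2 ig2).
(* [inversion] has the constant pi times the integral of f; the two transforms, each normalized by
   1/pi, divide it by pi^2. *)
exists ((pi^-1 * \int[mu]_(x in I1) f1 x) +i* (pi^-1 * \int[mu]_(x in I1) f2 x)).
apply: ae_leb; apply: aeS2 hf hw => t hf hw It.
have w0 : wt t != 0 by rewrite gt_eqF// I1_wt_gt0.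
have p0 : pi != 0 :> R by rewrite gt_eqF// pi_gt0.
have fin (p w u I : R) : p != 0 -> w != 0 ->
    u = (p^-1 * I - p^-1 * (p^-1 * (- p ^+ 2 * (w * u) + p * I))) / w.
  by move=> hp hw'; field; rewrite hp hw'.
rewrite /airfoil_formula -/(wt t); set c := (_ +i* _).
have -> : - 1 / (wt t)%:C * fht (wtC g) t + c / (wt t)%:C = (c - fht (wtC g) t) / (wt t)%:C by ring.
by rewrite hw// hf// complex_divR /c /=; congr (_ +i* _); exact: fin.
Qed.

Lemma wtV_Phi (R : realType) (c : R) : L1 (fun x : R => Phi 1 1 (c * (wt x)^-1)).
Proof.
have h := L1Z `|c| (wtV_log_integrable ler01 ltr01 (normr_ge0 c)).
apply: (L1_le _ h).
  by apply: Phi_measurable; apply: measurable_funM; [exact: measurable_cst|exact: wtV_measurable].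
move=> x Ix; rewrite ger0_norm ?Phi_ge0// /Phi normrM (gtr0_norm (wtV_gt0 Ix)).
by rewrite addr0 mulrA.
Qed.

Lemma Phi_addL1 (R : realType) (u v : R -> R) : measurable_fun I1 u -> measurable_fun I1 v ->
  L1 (fun x => Phi 1 1 (u x)) -> L1 (fun x => Phi 1 1 (v x)) ->
  L1 (fun x => Phi 1 1 (u x + v x)).
Proof.
move=> mu' mv iu iv; apply: (L1_le _ (L1D (L1Z 4 iu) (L1Z 4 iv))).
  by apply: Phi_measurable; exact: measurable_funD.
by move=> x _; rewrite ger0_norm ?Phi_ge0//; exact: Phi_add.
Qed.

Lemma isT_add_wtV (R : realType) (u v : R -> R) (c : R) : L1 u -> isT u v ->
  isT (fun x => u x + c * (wt x)^-1) v.
Proof.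
move=> iu Tu; have T0 := isTZ (- c) (pw_integrable 1) (isT_pvp (@pvp1 R)).
have := isTB iu (L1Z (- c) (pw_integrable 1)) Tu T0.
rewrite (_ : (fun x => v x - _) = v); last by apply/funext => x; rewrite hornerC mulr0 subr0.
by apply: isT_eq_arg => x _; rewrite /pw hornerC mul1r mulNr opprK.
Qed.

(** 1 / [wt] has finite modular ([wtV_Phi]) and its principal value vanishes on all of (-1,1), so
    adding a multiple of it changes neither membership nor transform. *)
Lemma fht_homogeneous (R : realType) (f f0 : R -> R[i]) (c : R[i]) : LlogL 1 f0 ->
  f = (fun x => f0 x + c / (Num.sqrt (1 - x ^+ 2))%:C) %[ae leb in I11] ->
  LlogL 1 f /\ fht f = fht f0 %[ae leb in I11].
Proof.
move=> Lf ff0; have [f1 [f2 rf]] := rep_exists Lf.1.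
have [m1 m2 hf] := rf; have [P1 P2 i1 i2] := LlogL_L1 Lf rf.
have mV (d : R) : measurable_fun I1 (fun x => d * (@wt R x)^-1).
  by apply: measurable_funM; [exact: measurable_cst|exact: wtV_measurable].
have rf' : rep f (fun x => f1 x + complex.Re c * (wt x)^-1) (fun x => f2 x + complex.Im c * (wt x)^-1).
  split; try exact: measurable_funD.
  apply: aeS2 hf (leb_ae ff0) => x h1 h2 Ix; rewrite h2// h1// complex_divR.
  by simpc.
have Q1 := Phi_addL1 m1 (mV (complex.Re c)) P1 (wtV_Phi _).
have Q2 := Phi_addL1 m2 (mV (complex.Im c)) P2 (wtV_Phi _).
have [g1 T1] := isT_exists i1; have [g2 T2] := isT_exists i2.
have Lf' := rep_LlogL rf' Q1 Q2.
have [_ _ j1 j2] := LlogL_L1 Lf' rf'.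
have h := fht_rep rf i1 i2 T1 T2.
have h' := fht_rep rf' j1 j2 (isT_add_wtV (complex.Re c) i1 T1) (isT_add_wtV (complex.Im c) i2 T2).
split; first exact: Lf'.
by apply: ae_leb; apply: aeS2 h h' => x h h' Ix; rewrite h// h'.
Qed.

Lemma LlogL2_range (R : realType) (g : R -> R[i]) : LlogL 2 g -> fht_range g.
Proof.
move=> Lg; have [g1 [g2 rg]] := rep_exists Lg.1; have [m1 m2 hg] := rg.
have [P1 P2] := @rep_LlogL_L1 R 2 g g1 g2 Lg rg.
have iL (u : R -> R) : measurable_fun I1 u -> L1 (fun x => psin 2 (u x)) -> L1 u.
  move=> mu' iP; apply: (L1_le mu' iP) => x _; rewrite /psin ler_peMr// exprn_ege1//.
  by rewrite lerDl ln1p_ge0.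
have sol (u : R -> R) : measurable_fun I1 u -> L1 (fun x => psin 2 (u x)) ->
    exists v : R -> R, [/\ measurable_fun I1 v, L1 v, L1 (fun x => Phi 1 1 (v x)) &
      isT v (fun x => pi * u x)].
  move=> mu' iP; have iu := iL u mu' iP.
  have [h Th] := isT_exists (L1_wt iu); have [mh _] := Th.
  have iW := W_LlogL mu' iP Th; have TW := W_solves mu' iP Th.
  have mW : measurable_fun I1 (fun x => h x / wt x).
    by apply: measurable_funM => //; exact: wtV_measurable.
  have i1 := Phi_L1 ler01 ltr01 mW iW.
  have mv : measurable_fun I1 (fun x => - pi^-1 * (h x / wt x)).
    by apply: measurable_funM => //; exact: measurable_cst.
  have p0 := pi_gt0 R; have p2 := pi_ge2 R.
  (* The transform without 1/pi sends h / [wt] to - pi^2 u, so this multiple is sent to pi u, and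
     [fht] restores u. As 1/pi <= 1, the modular does not increase. *)
  exists (fun x => - pi^-1 * (h x / wt x)); split => //.
  - exact: L1Z.
  - apply: (L1_le (Phi_measurable 1 1 mv) iW) => x _; rewrite ger0_norm ?Phi_ge0//.
    have pV : 0 <= pi^-1 :> R by rewrite invr_ge0 ltW.
    apply: Phi_mono => //; rewrite normrM normrN (ger0_norm pV) ler_piMl//.
    by rewrite invf_le1//; lra.
  - have := isTZ (- pi^-1) i1 TW; congr (isT _ _); apply/funext => x.
    have pn : pi != 0 :> R by rewrite gt_eqF.
    have fin (p w : R) : p != 0 -> - p^-1 * (- p ^+ 2 * w) = p * w by move=> hp; field.
    exact: fin.
have [f1 [mf1 i1 Q1 T1]] := sol g1 m1 P1.
have [f2 [mf2 i2 Q2 T2]] := sol g2 m2 P2.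
have rf : rep (fun x => f1 x +i* f2 x) f1 f2 by split => //; apply: aeW.
exists (fun x => f1 x +i* f2 x); first exact: rep_LlogL rf Q1 Q2.
have h := fht_rep rf i1 i2 T1 T2.
apply: ae_leb; apply: aeS2 h hg => x h hg Ix; rewrite h// hg//.
by rewrite !mulrA !mulVf ?mul1r// gt_eqF// pi_gt0.
Qed.

(** For sufficiency the transform of the formula is never computed: g being in the range, some
    solution f0 exists and already has the form with a constant c0, so f differs from it by a
    multiple of 1 / [wt]. *)
Lemma airfoil_iff (R : realType) (g : R -> R[i]) : fht_range g -> forall f : R -> R[i],
  (LlogL 1 f /\ fht f = g %[ae leb in I11]) <->
  exists c : R[i], f = airfoil_formula g c %[ae leb in I11].
Proof.
move=> [f0 L0 hf0] f; split=> [[Lf fg]|[c fc]]; first exact: airfoil_solution.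
have [c0 hc0] := airfoil_solution L0 hf0.
have [|Lf ff0] := @fht_homogeneous R f f0 (c - c0) L0.
  apply: ae_leb; apply: aeS2 (leb_ae fc) (leb_ae hc0) => x h1 h2 Ix.
  by rewrite h1// h2// /airfoil_formula; ring.
split; first exact: Lf.
apply: ae_leb; apply: aeS2 (leb_ae ff0) (leb_ae hf0) => x h1 h2 Ix.
by rewrite (h1 Ix); exact: h2.
Qed.

Theorem theorem4p14 (R : realType) :
  (forall g : R -> R[i], fht_range g ->
    forall f : R -> R[i],
      (LlogL 1 f /\ fht f = g %[ae leb in I11]) <->
      exists c : R[i],
        f = (fun x : R =>
               - 1 / (Num.sqrt (1 - x ^+ 2))%:C *
                 fht (fun t : R => (Num.sqrt (1 - t ^+ 2))%:C * g t) x
               + c / (Num.sqrt (1 - x ^+ 2))%:C) %[ae leb in I11]) /\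
  (forall g : R -> R[i], LlogL 2 g ->
    fht_range g /\
    forall f : R -> R[i],
      (LlogL 1 f /\ fht f = g %[ae leb in I11]) <->
      exists c : R[i],
        f = (fun x : R =>
               - 1 / (Num.sqrt (1 - x ^+ 2))%:C *
                 fht (fun t : R => (Num.sqrt (1 - t ^+ 2))%:C * g t) x
               + c / (Num.sqrt (1 - x ^+ 2))%:C) %[ae leb in I11]).
Proof.
split=> [g gr|g Lg]; first exact: airfoil_iff.
by have gr := LlogL2_range Lg; split; [exact: gr|exact: airfoil_iff].
Qed.
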